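(* Let $1<\alpha\le2$. Consider the system of particles in $\mathbb R$ whose initial positions form a Poisson random measure with intensity the Lebesgue measure $\lambda$, and which move independently according to the standard symmetric $\alpha$-stable Lévy process, without branching. Let $N=(N_t)_{t\ge0}$ be its empirical process and, with $F_T=\sqrt T$, let $$Y_T(1)=\frac1{F_T}\left(\int_0^{T}N_s\,ds-\int_0^{T}EN_s\,ds\right).$$ Let $\psi_t=1_{[0,t]}-1_{[-t,0]}$, $t\ge0$. Then, as $T\to\infty$, the processes $(\langle Y_T(1),\psi_t\rangle)_{t\ge0}$ converge, in the sense of weak convergence of finite dimensional distributions, to $K\zeta^H$, where $K$ is a constant and $H=\frac{1+\alpha}2\in(1,\frac32]$.
   Context: The standard symmetric $\alpha$-stable Lévy process has characteristic function $e^{-t|z|^\alpha}$ at time $t$; the motions are independent of each other and of the initial configuration. $N_t(A)$ is the number of particles in $A\subset\mathbb R$ at time $t$; $\langle\mu,f\rangle=\int f\,d\mu$; $\langle EN_s,f\rangle=E\langle N_s,f\rangle$; $\langle\int_0^TN_s\,ds,f\rangle=\int_0^T\langle N_s,f\rangle\,ds$. $1_A$ is the indicator of $A$. $\zeta^H$ (negative sub-fractional Brownian motion when $H\in(1,2)$) is the continuous centered Gaussian process indexed by $t\ge0$ with covariance, for $0\le s\le t$, $$E\zeta^H_s\zeta^H_t=(1-H)\left(s^{2H}+t^{2H}-\tfrac12\left((s+t)^{2H}+|t-s|^{2H}\right)\right).$$ The constant $K$ depends only on $\alpha$. *)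

(* Defs.v *)
From HB Require Import structures.
From mathcomp Require Import all_boot all_order all_algebra finmap.
From mathcomp Require Import all_classical all_reals all_analysis.
From mathcomp Require Import measurable_realfun complex.

Set Implicit Arguments.
Unset Strict Implicit.
Unset Printing Implicit Defensive.

Import Order.TTheory GRing.Theory Num.Theory.
Import numFieldNormedType.Exports.

Local Open Scope classical_set_scope.
Local Open Scope ring_scope.

Section independence.
Context d (Omega : measurableType d) (R : realType) (P : probability Omega R).

Definition mutually_independent (I : choiceType)
    (F : I -> set (set Omega)) : Prop :=
  forall (J : {fset I}) (B : I -> set Omega),
    (forall i, i \in J -> F i (B i)) ->
    P (\bigcap_(i in [set` J]) B i) = (\prod_(i <- J) P (B i))%E.

Definition sigma_gen (I : Type) d' (E : measurableType d')
    (D : set I) (X : I -> Omega -> E) : set (set Omega) :=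
  <<s \bigcup_(i in D) preimage_set_system setT (X i) measurable >>.

Definition independent_family (I : choiceType) d' (E : measurableType d')
    (X : I -> Omega -> E) : Prop :=
  mutually_independent (fun i => sigma_gen [set: unit] (fun=> X i)).

End independence.

Section processes.
Context d (Omega : measurableType d) (R : realType) (P : probability Omega R).

Definition characteristic_function (X : Omega -> R) (z : R) : R[i] :=
  Complex (fine 'E_P[fun w => cos (z * X w)%R]%E)
          (fine 'E_P[fun w => sin (z * X w)%R]%E).

Definition cadlag (f : R -> R) : Prop :=
  forall t : R, 0 <= t ->
    f u @[u --> t^'+] --> f t /\ (0 < t -> cvg (f u @[u --> t^'-])).

(* Processes on the half-line are indexed by all of R; only the values at
   nonnegative times are constrained or used. *)
Definition levy_process (X : R -> {RV P >-> R}) : Prop :=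
  [/\ {ae P, forall w, X 0 w = 0},
      forall (n : nat) (t : nat -> R), 0 <= t 0%N ->
        {homo t : i j / (i <= j)%N >-> i <= j} ->
        independent_family P
          (fun (i : 'I_n) (w : Omega) => X (t i.+1) w - X (t i) w),
      forall s t : R, 0 <= s -> s <= t -> forall A : set R, measurable A ->
        P [set w | A (X t w - X s w)] = P [set w | A (X (t - s) w)] &
      forall w, cadlag (fun t => X t w)].

Definition std_symmetric_stable_levy (alpha : R)
    (X : R -> {RV P >-> R}) : Prop :=
  levy_process X /\
  forall t z : R, 0 <= t ->
    characteristic_function (X t) z = (expR (- (t * `|z| `^ alpha)))%:C%C.

(* The degenerate laws are Gaussian too; they are singled out because
   [normal_prob m 0] is a uniform law in the library. *)
Definition gaussian_law (m s : R) : set R -> \bar R :=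
  if s == 0 then \d_m else normal_prob m s.

Definition gaussian_process (X : R -> {RV P >-> R}) : Prop :=
  forall (n : nat) (t a : 'I_n -> R), (forall i, 0 <= t i) ->
    exists m s : R, forall A : set R, measurable A ->
      P [set w | A (\sum_(i < n) a i * X (t i) w)] = gaussian_law m s A.

Definition sub_fbm_cov (H s t : R) : R :=
  (1 - H) * (s `^ (2 * H) + t `^ (2 * H)
             - 2^-1 * ((s + t) `^ (2 * H) + `|t - s| `^ (2 * H))).

Definition negative_sub_fbm (H : R) (zeta : R -> {RV P >-> R}) : Prop :=
  [/\ gaussian_process zeta,
      forall t : R, 0 <= t -> ('E_P[zeta t] = 0)%E,
      forall s t : R, 0 <= s -> s <= t ->
        'E_P[fun w => (zeta s w * zeta t w)%R]%E = (sub_fbm_cov H s t)%:E &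
      {ae P, forall w, {within `[0, +oo[, continuous (fun t : R => zeta t w)}}].

End processes.

Section particle_system.
Context d (Omega : measurableType d) (R : realType) (P : probability Omega R).

(* The Poisson mass function is written out because [poisson_pmf] is not a
   mass function at rate 0. *)
Definition poisson_random_measure (mu : set R -> \bar R)
    (M : Omega -> {measure set R -> \bar R}) : Prop :=
  [/\ forall A : set R, measurable A -> measurable_fun setT (fun w => M w A),
      forall A : set R, measurable A -> (mu A < +oo)%E -> forall k : nat,
        P [set w | M w A = k%:R%:E] =
          (expR (- fine (mu A)) * fine (mu A) ^+ k / k`!%:R)%:E,
      forall A : set R, measurable A -> mu A = +oo%E ->
        {ae P, forall w, M w A = +oo%E} &
      forall (n : nat) (A : 'I_n -> set R), (forall i, measurable (A i)) ->
        trivIset setT A -> independent_family P (fun i w => M w (A i))].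

(* Particle [i] starts at [x i] and is at [x i + xi i t] at time [t]; the
   empirical process is the sum of the Dirac masses at the particles. *)
Definition empirical_process (x : nat -> {RV P >-> R})
    (xi : nat -> R -> {RV P >-> R}) (t : R) (w : Omega) :
    {measure set R -> \bar R} :=
  mseries (fun i => \d_(x i w + xi i t w)) 0.

(* The index [None] stands for the initial configuration and [Some i] for the
   whole trajectory of particle [i]. As the intensity is infinite, there are
   almost surely infinitely many particles and they can be enumerated by
   [nat]. *)
Definition stable_particle_system (alpha : R) (x : nat -> {RV P >-> R})
    (xi : nat -> R -> {RV P >-> R}) : Prop :=
  [/\ poisson_random_measure lebesgue_measure
        (fun w => mseries (fun i => \d_(x i w)) 0),
      forall i, std_symmetric_stable_levy alpha (xi i) &
      mutually_independent P (fun o : option nat =>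
        match o with
        | None => sigma_gen setT (fun i => x i : Omega -> R)
        | Some i => sigma_gen [set t : R | 0 <= t]
                              (fun t => xi i t : Omega -> R)
        end)].

Definition bracket (mu : {measure set R -> \bar R}) (f : R -> R) : R :=
  \int[mu]_y f y.

(* <Y_T(1), f> for F_T = sqrt T *)
Definition occupation_fluctuation
    (N : R -> Omega -> {measure set R -> \bar R})
    (T : R) (f : R -> R) (w : Omega) : R :=
  (Num.sqrt T)^-1 *
  (\int[lebesgue_measure]_(s in `[0, T]) bracket (N s w) f -
   \int[lebesgue_measure]_(s in `[0, T])
      fine 'E_P[fun w' => bracket (N s w') f]%E).

Definition psi (t y : R) : R := \1_`[0, t] y - \1_`[- t, 0] y.

End particle_system.

(* Convergence as T -> +oo of the laws of (Y T t_1, ..., Y T t_n), tested on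
   bounded continuous functions. *)
Definition fdd_cvg (R : realType)
    d (Omega : measurableType d) (P : probability Omega R)
    d' (Omega' : measurableType d') (P' : probability Omega' R)
    (Y : R -> R -> Omega -> R) (Z : R -> Omega' -> R) : Prop :=
  forall (n : nat) (t : 'I_n -> R), (forall i, 0 <= t i) ->
  forall f : 'rV[R]_n -> R, continuous f ->
    (exists M : R, forall v, `|f v| <= M) ->
    ('E_P[fun w => f (\row_i Y T (t i) w)] @[T --> +oo%R]
       --> 'E_P'[fun w => f (\row_i Z (t i) w)])%E.

(* Main.v *)
(* Fix the times t_i and weights b_i, and let phi = sum_i b_i psi_{t_i}. Up to centring,
   sum_i b_i <Y_T(1), psi_{t_i}> is the sum over the particles j of
   h_j(x_j) = T^(-1/2) int_0^T phi(x_j + xi_j(s)) ds. Given the Poisson points these are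
   independent, so Lindeberg's exchange replaces E cos(th + sum_j h_j(x_j)) by
   E[cos(th + sum_j m(x_j)) exp(- sum_j v(x_j) / 2)], where m(y) and v(y) are the first two
   moments of h_j(y), at a cost controlled by the integrals of m^2, of v and of the fourth
   moment. By Campbell's formulas sum_j m(x_j) has variance int m^2 -> 0, and sum_j v(x_j)
   concentrates at int v, as v^2 is dominated by the fourth moment, whose integral tends
   to 0.

   All the moments are computed with cosine transforms: tent functions are positive
   combinations of cosines, and E cos(z xi(s)) = exp(- s |z|^alpha). In particular int v
   tends to a constant times int |phi^(z)|^2 / |z|^alpha dz, which by scaling is K^2 times
   the variance of sum_i b_i zeta_{t_i}. Integrating tent functions also shows that
   convergence of the expectations E cos(th + sum_i b_i Y_i) implies convergence in law. *)
Require Import Defs.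
From HB Require Import structures.
From mathcomp Require Import all_boot all_order all_algebra finmap.
From mathcomp Require Import all_classical all_reals all_analysis measurable_realfun.
From mathcomp Require Import complex ring lra.

Set Implicit Arguments.
Unset Strict Implicit.
Unset Printing Implicit Defensive.

Import Order.TTheory GRing.Theory Num.Theory.
Import numFieldNormedType.Exports.

Local Open Scope classical_set_scope.
Local Open Scope ring_scope.

(** * Integrals of bounded measurable functions *)

(** For 1 < alpha the motion is recurrent and 1/|z|^alpha is not integrable at 0, so a compactly
    supported function has in general no finite potential. What saves the fourth moment is that
    [psi] is odd: its transform vanishes at 0 and its potential is bounded. For ordered times s <= a
    <= b <= r, the symmetry of the motion with respect to Lebesgue measure reverses the gap a - s;
    both outer gaps then give potentials of [phi], each of order 1/T after normalisation, and the
    gap b - a leaves an average that tends to 0.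

    The transform of [psi] decays only like 1/z and cannot be inverted absolutely. Tents, with
    transforms (1 - cos(tz))/z^2, can: [psi] enters through its correlations, which are combinations
    of tents, or as a limit of difference quotients of tents.

    Time is averaged over a uniform probability on [0, T], so that [occT] is the occupation integral
    divided by T and a particle contributes [sqrt T * occT]. Exchanges of integrals over times and
    paths then involve only bounded functions and finite measures. Real cosines with a free phase
    [th] stand for complex characteristic functions. *)

Section integ.
Context d (T : measurableType d) (R : realType).
Variable mu : {measure set T -> \bar R}.
Implicit Types f g : T -> R.

Definition integ f := mu.-integrable setT (EFin \o f).

Lemma integ_meas f : integ f -> measurable_fun setT f.
Proof. by move=> /measurable_int/measurable_EFinP. Qed.

Lemma integ_le f g : measurable_fun setT f -> integ g ->
  (forall x, `|f x| <= g x) -> integ f.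
Proof.
move=> mf ig fg; apply: (le_integrable measurableT _ _ ig) => //.
  exact/measurable_EFinP.
move=> x _ /=; rewrite lee_fin (le_trans (fg x))// ler_norm//.
Qed.

Lemma integD f g : integ f -> integ g -> integ (fun x => f x + g x).
Proof. by move=> if_ ig; apply: (integrableD measurableT if_ ig). Qed.

Lemma integB f g : integ f -> integ g -> integ (fun x => f x - g x).
Proof. by move=> if_ ig; apply: (integrableB measurableT if_ ig). Qed.

Lemma integZ k f : integ f -> integ (fun x => k * f x).
Proof. by move=> if_; apply: (integrableZl measurableT k if_). Qed.

Lemma integ_abs f : integ f -> integ (fun x => `|f x|).
Proof. by move=> if_; exact: integrable_norm. Qed.

Lemma integ0 : integ (fun=> 0).
Proof. exact: integrable0. Qed.

Lemma integ_sum (I : Type) (s : seq I) (F : I -> T -> R) :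
  (forall i, integ (F i)) -> integ (fun x => \sum_(i <- s) F i x).
Proof.
move=> iF; elim: s => [|a s IH].
  by under [X in integ X]funext do rewrite big_nil; exact: integ0.
under [X in integ X]funext do rewrite big_cons.
exact: integD.
Qed.

Lemma integM f g M : measurable_fun setT f -> (forall x, `|f x| <= M) ->
  integ g -> integ (fun x => f x * g x).
Proof.
move=> mf fM ig; apply: (@integ_le _ (fun x => M * `|g x|)).
- by apply: measurable_funM => //; exact: integ_meas.
- by apply: integZ; exact: integ_abs.
- by move=> x; rewrite normrM ler_wpM2r.
Qed.

Lemma eq_Rint g f : (forall x, f x = g x) ->
  \int[mu]_x f x = \int[mu]_x g x.
Proof. by move=> fg; apply: eq_Rintegral => x _. Qed.

Lemma Rint0 : \int[mu]_x (0 : R) = 0.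
Proof. by rewrite /Rintegral integral0. Qed.

Lemma RintD f g : integ f -> integ g ->
  \int[mu]_x (f x + g x) = \int[mu]_x f x + \int[mu]_x g x.
Proof. by move=> ? ?; rewrite RintegralD. Qed.

Lemma RintB f g : integ f -> integ g ->
  \int[mu]_x (f x - g x) = \int[mu]_x f x - \int[mu]_x g x.
Proof. by move=> ? ?; rewrite RintegralB. Qed.

Lemma RintZ k f : integ f ->
  \int[mu]_x (k * f x) = k * \int[mu]_x f x.
Proof. by move=> ?; rewrite RintegralZl. Qed.

Lemma RintZr k f : integ f ->
  \int[mu]_x (f x * k) = \int[mu]_x f x * k.
Proof. by move=> ?; rewrite RintegralZr. Qed.

Lemma RintN f : integ f -> \int[mu]_x (- f x) = - \int[mu]_x f x.
Proof.
move=> if_; rewrite -mulN1r -RintZ//.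
by apply: eq_Rintegral => x _; rewrite mulN1r.
Qed.

Lemma le_Rint f g : integ f -> integ g -> (forall x, f x <= g x) ->
  \int[mu]_x f x <= \int[mu]_x g x.
Proof. by move=> ? ? ?; apply: le_Rintegral. Qed.

Lemma Rint_abs_le f g : integ f -> integ g -> (forall x, `|f x| <= g x) ->
  `|\int[mu]_x f x| <= \int[mu]_x g x.
Proof.
move=> if_ ig fg; apply: le_trans (le_normr_Rintegral measurableT if_) _.
by apply: le_Rint => //; exact: integ_abs.
Qed.

Lemma Rint_sum (I : Type) (s : seq I) (F : I -> T -> R) :
  (forall i, integ (F i)) ->
  \int[mu]_x (\sum_(i <- s) F i x) = \sum_(i <- s) \int[mu]_x F i x.
Proof.
move=> iF; elim: s => [|a s IH].
  rewrite big_nil; under eq_Rintegral do rewrite big_nil.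
  by rewrite /Rintegral integral0.
rewrite big_cons -IH -RintD//; last exact: integ_sum.
by apply: eq_Rintegral => x _; rewrite big_cons.
Qed.

Lemma Rint_EFin f : integ f ->
  (\int[mu]_x (f x)%:E = (\int[mu]_x f x)%:E)%E.
Proof. by move=> if_; rewrite /Rintegral fineK//; exact: integrable_fin_num. Qed.

Lemma integ_ge0P f : measurable_fun setT f -> (forall x, 0 <= f x) ->
  (\int[mu]_x (f x)%:E < +oo)%E -> integ f.
Proof.
move=> mf f0 fi; apply/integrableP; split; first exact/measurable_EFinP.
rewrite (eq_integral (fun x => (f x)%:E))// => x _ /=.
by rewrite ger0_norm.
Qed.

Lemma dct (f_ : nat -> T -> R) f g :
  (forall n, measurable_fun setT (f_ n)) -> measurable_fun setT f ->
  {ae mu, forall x, f_ ^~ x @ \oo --> f x} -> integ g ->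
  (forall n x, `|f_ n x| <= g x) ->
  \int[mu]_x f_ n x @[n --> \oo] --> \int[mu]_x f x.
Proof.
move=> mf_ mf ff ig fg.
have [|||||i1 _ i2] := @dominated_convergence _ _ _ mu setT measurableT
  (fun n => EFin \o f_ n) (EFin \o f) (EFin \o g).
- by move=> n; exact/measurable_EFinP.
- exact/measurable_EFinP.
- by apply: filterS ff => x fx _; apply: cvg_EFin; [exact: nearW|exact: fx].
- exact: ig.
- by apply: aeW => x n _ /=; rewrite lee_fin.
apply: fine_cvg; rewrite /Rintegral fineK//; exact: integrable_fin_num.
Qed.

Lemma dct_pt (f_ : nat -> T -> R) f g :
  (forall n, measurable_fun setT (f_ n)) ->
  (forall x, f_ ^~ x @ \oo --> f x) -> integ g ->
  (forall n x, `|f_ n x| <= g x) ->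
  \int[mu]_x f_ n x @[n --> \oo] --> \int[mu]_x f x.
Proof.
move=> mf_ ff ig fg; apply: (dct mf_ _ _ ig fg).
- by apply: (@measurable_fun_cvg _ _ _ setT f_ f) => // x _.
- exact: aeW.
Qed.

End integ.

Arguments eq_Rint {d T R} mu g {f}.

Section bounded_measurable.
Context d (T : measurableType d) (R : realType).
Implicit Types f g : T -> R.

(** Products, compositions and partial integrals against finite measures stay in this class, so that
    exchanges of integrals over probability spaces carry no integrability condition. *)
Definition bdm f := measurable_fun setT f /\ exists M, forall x, `|f x| <= M.

Lemma bdm_meas f : bdm f -> measurable_fun setT f. Proof. by case. Qed.

Lemma bdm_cst k : bdm (fun=> k).
Proof. by split => //; exists `|k|. Qed.

Lemma bdmD f g : bdm f -> bdm g -> bdm (fun x => f x + g x).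
Proof.
move=> [mf [M fM]] [mg [N gN]]; split; first exact: measurable_funD.
by exists (M + N) => x; rewrite (le_trans (ler_normD _ _))// lerD.
Qed.

Lemma bdmN f : bdm f -> bdm (fun x => - f x).
Proof.
move=> [mf [M fM]]; split; first exact: measurable_funN.
by exists M => x; rewrite normrN.
Qed.

Lemma bdmB f g : bdm f -> bdm g -> bdm (fun x => f x - g x).
Proof. by move=> bf bg; apply: bdmD => //; exact: bdmN. Qed.

Lemma bdmM f g : bdm f -> bdm g -> bdm (fun x => f x * g x).
Proof.
move=> [mf [M fM]] [mg [N gN]]; split; first exact: measurable_funM.
by exists (M * N) => x; rewrite normrM ler_pM.
Qed.

Lemma bdmX f n : bdm f -> bdm (fun x => f x ^+ n).
Proof.
move=> [mf [M fM]]; split; first exact: measurable_funX.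
by exists (M ^+ n) => x; rewrite normrX lerXn2r// nnegrE// (le_trans _ (fM x)).
Qed.

Lemma bdm_norm f : bdm f -> bdm (fun x => `|f x|).
Proof.
move=> [mf [M fM]]; split; last by exists M => x; rewrite normr_id.
exact: measurableT_comp.
Qed.

Lemma bdm_sum (I : Type) (s : seq I) (F : I -> T -> R) :
  (forall i, bdm (F i)) -> bdm (fun x => \sum_(i <- s) F i x).
Proof.
move=> iF; elim: s => [|a s IH].
  by under [X in bdm X]funext do rewrite big_nil; exact: bdm_cst.
under [X in bdm X]funext do rewrite big_cons.
exact: bdmD.
Qed.

Lemma bdm_prod (I : Type) (s : seq I) (P : pred I) (F : I -> T -> R) :
  (forall i, bdm (F i)) -> bdm (fun x => \prod_(i <- s | P i) F i x).
Proof.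
move=> iF; elim: s => [|a s IH].
  by under [X in bdm X]funext do rewrite big_nil; exact: bdm_cst.
under [X in bdm X]funext do rewrite big_cons.
by case: (P a) => //; exact: bdmM.
Qed.

Lemma bdm_cos f : measurable_fun setT f -> bdm (fun x => cos (f x)).
Proof.
move=> mf; split; last by exists 1 => x; exact: cos_max.
apply: measurableT_comp => //; apply: continuous_measurable_fun.
exact: continuous_cos.
Qed.

Lemma bdm_sin f : measurable_fun setT f -> bdm (fun x => sin (f x)).
Proof.
move=> mf; split; last by exists 1 => x; exact: sin_max.
apply: measurableT_comp => //; apply: continuous_measurable_fun.
exact: continuous_sin.
Qed.

Lemma bdm_indic (A : set T) : measurable A -> bdm (\1_A : T -> R).
Proof.
move=> mA; split => //; exists 1 => x.
by rewrite indicE ger0_norm// lern1 leq_b1.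
Qed.

Lemma bdm_integ (mu : {finite_measure set T -> \bar R}) f :
  bdm f -> integ mu f.
Proof.
move=> [mf [M fM]]; apply: (@integ_le _ _ _ mu f (fun=> M)) => //.
exact: finite_measure_integrable_cst.
Qed.

End bounded_measurable.

Lemma bdm_comp d d' (T : measurableType d) (U : measurableType d')
  (R : realType) (f : U -> R) (g : T -> U) :
  bdm f -> measurable_fun setT g -> bdm (fun x => f (g x)).
Proof.
move=> [mf [M fM]] mg; split; last by exists M => x; exact: fM.
exact: (measurableT_comp mf mg).
Qed.

(** * Fubini's theorem for real-valued integrals *)

Section fubini.
Context d1 d2 (T1 : measurableType d1) (T2 : measurableType d2) (R : realType).
Variable m1 : {sigma_finite_measure set T1 -> \bar R}.
Variable m2 : {sigma_finite_measure set T2 -> \bar R}.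

Lemma meas_sec1 (f : T1 * T2 -> R) x : measurable_fun setT f ->
  measurable_fun setT (fun y => f (x, y)).
Proof. by move=> mf; apply: (measurableT_comp mf). Qed.

Lemma meas_sec2 (f : T1 * T2 -> R) y : measurable_fun setT f ->
  measurable_fun setT (fun x => f (x, y)).
Proof. by move=> mf; apply: (measurableT_comp mf). Qed.

(** A real inner integral is [fine] of an extended one, a default value where the section is not
    integrable; such sections form a null set, so the extended Fubini theorem transfers. *)
Lemma Rfubini (f : T1 * T2 -> R) : integ (m1 \x m2)%E f ->
  \int[m1]_x \int[m2]_y f (x, y) = \int[m2]_y \int[m1]_x f (x, y).
Proof.
move=> if_; have mf := integ_meas if_.
have F := @Fubini _ _ _ _ _ m1 m2 _ if_.
rewrite /Rintegral; congr fine.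
transitivity (\int[m1]_x \int[m2]_y (f (x, y))%:E)%E.
  apply: ae_eq_integral => //.
  - apply/measurable_EFinP/measurableT_comp => //.
    exact: (measurable_fubini_F if_).
  - exact: (measurable_fubini_F if_).
  - have := ae_integrable1 if_.
    by apply: filterS => x ix _; rewrite fineK//; exact: integrable_fin_num.
rewrite F; apply: ae_eq_integral => //.
- exact: (measurable_fubini_G if_).
- apply/measurable_EFinP/measurableT_comp => //.
  exact: (measurable_fubini_G if_).
- have := ae_integrable2 if_.
  by apply: filterS => x ix _; rewrite fineK//; exact: integrable_fin_num.
Qed.

Lemma Rfubini1 (f : T1 * T2 -> R) : integ (m1 \x m2)%E f ->
  \int[m1]_x \int[m2]_y f (x, y) = \int[(m1 \x m2)%E]_p f p.
Proof.
move=> if_; have mf := integ_meas if_.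
have F := @integral12_prod_meas1 _ _ _ _ _ m1 m2 _ if_.
rewrite /Rintegral; congr fine; rewrite -F.
apply: ae_eq_integral => //.
- apply/measurable_EFinP/measurableT_comp => //.
  exact: (measurable_fubini_F if_).
- exact: (measurable_fubini_F if_).
- have := ae_integrable1 if_.
  by apply: filterS => x ix _; rewrite fineK//; exact: integrable_fin_num.
Qed.

Lemma integ_prod_le (f : T1 * T2 -> R) (g1 : T1 -> R) (g2 : T2 -> R) :
  measurable_fun setT f -> integ m1 g1 -> integ m2 g2 ->
  (forall x y, `|f (x, y)| <= g1 x * g2 y) -> integ (m1 \x m2)%E f.
Proof.
move=> mf i1 i2 fg; apply/(@integrable12ltyP _ _ _ _ _ m1 m2).
  exact/measurable_EFinP.
have g10 x : `|g1 x| = `|g1 x| by [].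
apply: (@le_lt_trans _ _ (\int[m1]_x ((\int[m2]_y `|g2 y|) * `|g1 x|)%:E)%E).
  apply: ge0_le_integral => //.
  - by move=> x _; apply: integral_ge0 => y _; exact: abse_ge0.
  - apply: (@measurable_fun_fubini_tonelli_F _ _ _ _ _ m2 (fun p => `|(f p)%:E|%E)) => //.
    by apply: measurableT_comp => //; exact/measurable_EFinP.
  - apply/measurable_EFinP; apply: measurable_funM => //.
    by apply: measurableT_comp => //; exact: integ_meas i1.
  - move=> x _.
    apply: (@le_trans _ _ (\int[m2]_y (`|g1 x| * `|g2 y|)%:E)%E).
      apply: ge0_le_integral => //.
      + apply: measurableT_comp => //; apply/measurable_EFinP.
        exact: (measurableT_comp mf).
      + apply/measurable_EFinP; apply: measurable_funM => //.
        by apply: measurableT_comp => //; exact: integ_meas i2.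
      + move=> y _ /=; rewrite lee_fin (le_trans (fg x y))//.
        by rewrite -normrM ler_norm.
    rewrite (@Rint_EFin _ _ _ _ (fun y => `|g1 x| * `|g2 y|)); last first.
      by apply: integZ; exact: integ_abs.
    by rewrite RintZ; [rewrite mulrC|exact: integ_abs].
rewrite (@Rint_EFin _ _ _ _ (fun x => (\int[m2]_y `|g2 y|) * `|g1 x|)) ?ltry//.
by apply: integZ; exact: integ_abs.
Qed.

End fubini.

Section fubini_bounded.
Context d1 d2 (T1 : measurableType d1) (T2 : measurableType d2) (R : realType).
Variable m1 : {finite_measure set T1 -> \bar R}.
Variable m2 : {finite_measure set T2 -> \bar R}.

Lemma bdm_integ_prod (f : T1 * T2 -> R) : bdm f -> integ (m1 \x m2)%E f.
Proof.
move=> [mf [M fM]].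
apply: (@integ_prod_le _ _ _ _ _ m1 m2 f (fun=> M) (fun=> 1)) => //.
- exact: finite_measure_integrable_cst.
- exact: finite_measure_integrable_cst.
- by move=> x y; rewrite mulr1.
Qed.

Lemma bdm_fubini (f : T1 * T2 -> R) : bdm f ->
  \int[m1]_x \int[m2]_y f (x, y) = \int[m2]_y \int[m1]_x f (x, y).
Proof. by move=> bf; apply: Rfubini; exact: bdm_integ_prod. Qed.

End fubini_bounded.

Lemma bdm_Rint2 d1 d2 (T1 : measurableType d1) (T2 : measurableType d2)
  (R : realType) (m2 : {finite_measure set T2 -> \bar R}) (f : T1 * T2 -> R) :
  bdm f -> bdm (fun x => \int[m2]_y f (x, y)).
Proof.
move=> bf; have [mf [M fM]] := bf.
have i1 x : integ m2 (fun y => f (x, y)).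
  by apply: bdm_integ; split; [exact: meas_sec1|exists M => y].
have iM : integ m2 (fun=> M) by exact: finite_measure_integrable_cst.
split; last first.
  exists (\int[m2]_y M) => x.
  by apply: Rint_abs_le.
(* Tonelli's measurability statement concerns nonnegative integrands: the bound [M] is added, and
   its integral subtracted. *)
have -> : (fun x => \int[m2]_y f (x, y)) =
  (fun x => fine (\int[m2]_y ((f (x, y) + M)%:E))%E - \int[m2]_y M).
  apply/funext => x; rewrite -/(\int[m2]_y (f (x, y) + M)) RintD// addrK//.
apply: measurable_funB => //; apply: measurableT_comp => //.
apply: (@measurable_fun_fubini_tonelli_F _ _ _ _ _ m2 (fun p => (f p + M)%:E)).
  by apply/measurable_EFinP; exact: measurable_funD.
move=> [x y] /=; rewrite lee_fin -lerBlDr sub0r.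
by have := fM (x, y); rewrite ler_norml => /andP[].
Qed.

(** * Laws and independence *)

Section mkmfun.
Context d d' (T : measurableType d) (U : measurableType d').
Definition mkmfun (X : T -> U) (mX : measurable_fun setT X) : {mfun T >-> U} :=
  HB.pack X (isMeasurableFun.Build _ _ _ _ X mX).
End mkmfun.

Section int_law.
Context d (Om : measurableType d) (R : realType) (P : probability Om R).
Context d' (E : measurableType d') (X : Om -> E) (mX : measurable_fun setT X).

Lemma ge0_int_law (f : E -> \bar R) : measurable_fun setT f ->
  (forall x, 0 <= f x)%E ->
  (\int[distribution P (mkmfun mX)]_x f x = \int[P]_w f (X w))%E.
Proof.
by move=> mf f0; exact: (@ge0_integral_distribution _ _ _ _ _ P (mkmfun mX) f mf f0).
Qed.

Lemma int_law (f : E -> R) : bdm f ->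
  \int[distribution P (mkmfun mX)]_x f x = \int[P]_w f (X w).
Proof.
move=> bf; rewrite /Rintegral; congr fine.
apply: (@integral_distribution _ _ _ _ _ P (mkmfun mX) (EFin \o f)).
  by apply/measurable_EFinP; case: bf.
by apply: (@bdm_integ _ _ _ P); exact: bdm_comp.
Qed.
End int_law.

Section laws.
Context d (Om : measurableType d) (R : realType) (P : probability Om R).

Definition same_law d1 (Om1 : measurableType d1) (P1 : probability Om1 R)
    d' (E : measurableType d') (X : Om -> E) (Y : Om1 -> E) :=
  forall A, measurable A -> P (X @^-1` A) = P1 (Y @^-1` A).

Section same_law.
Context d1 (Om1 : measurableType d1) (P1 : probability Om1 R).
Context d' (E : measurableType d') (X : Om -> E) (Y : Om1 -> E).
Hypotheses (mX : measurable_fun setT X) (mY : measurable_fun setT Y).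
Hypothesis XY : same_law P1 X Y.

Lemma same_law_ge0 (f : E -> \bar R) : measurable_fun setT f ->
  (forall x, 0 <= f x)%E -> (\int[P]_w f (X w) = \int[P1]_w f (Y w))%E.
Proof.
move=> mf f0.
rewrite -(ge0_int_law P mX mf f0) -(ge0_int_law P1 mY mf f0); apply: eq_measure_integral => A mA _; exact: XY.
Qed.

Lemma same_law_bdm (f : E -> R) : bdm f ->
  \int[P]_w f (X w) = \int[P1]_w f (Y w).
Proof.
move=> bf.
rewrite -(int_law P mX bf) -(int_law P1 mY bf) /Rintegral; congr fine.
apply: eq_measure_integral => A mA _; exact: XY.
Qed.
End same_law.

Definition indep2 d1 d2 (E1 : measurableType d1) (E2 : measurableType d2)
    (X1 : Om -> E1) (X2 : Om -> E2) :=
  forall A B, measurable A -> measurable B ->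
    P (X1 @^-1` A `&` X2 @^-1` B) = (P (X1 @^-1` A) * P (X2 @^-1` B))%E.

Section indep2.
Context d1 d2 (E1 : measurableType d1) (E2 : measurableType d2).
Variables (X1 : Om -> E1) (X2 : Om -> E2).
Hypotheses (m1 : measurable_fun setT X1) (m2 : measurable_fun setT X2).
Hypothesis ind : indep2 X1 X2.

Let D1 : probability E1 R := distribution P (mkmfun m1).
Let D2 : probability E2 R := distribution P (mkmfun m2).
Let m12 : measurable_fun setT (fun w => (X1 w, X2 w)).
Proof. exact: measurable_fun_pair. Qed.

Let prodE A : measurable A -> (D1 \x D2)%E A = distribution P (mkmfun m12) A.
Proof.
apply: product_measure_unique => B C mB mC.
by rewrite -ind.
Qed.

Lemma indep2_ge0 (F : E1 * E2 -> \bar R) : measurable_fun setT F ->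
  (forall p, 0 <= F p)%E ->
  (\int[P]_w F (X1 w, X2 w) = \int[P]_w1 \int[P]_w2 F (X1 w1, X2 w2))%E.
Proof.
move=> mF F0.
rewrite -(ge0_int_law P m12 mF F0).
transitivity (\int[(D1 \x D2)]_p F p)%E.
  by apply/esym/eq_measure_integral => A mA _; exact: prodE.
rewrite fubini_tonelli1//.
rewrite [LHS](ge0_int_law P m1)//=; last 2 first.
- exact: measurable_fun_fubini_tonelli_F.
- by move=> y; apply: integral_ge0.
apply: eq_integral => w _; rewrite /fubini_F.
rewrite [LHS](ge0_int_law P m2)//=.
exact: (measurableT_comp mF).
Qed.

Lemma indep2_bdm (F : E1 * E2 -> R) : bdm F ->
  \int[P]_w F (X1 w, X2 w) = \int[P]_w1 \int[P]_w2 F (X1 w1, X2 w2).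
Proof.
move=> bF.
rewrite -(int_law P m12 bF).
have -> : \int[distribution P (mkmfun m12)]_p F p = \int[(D1 \x D2)%E]_p F p.
  rewrite /Rintegral; congr fine.
  by apply/esym/eq_measure_integral => A mA _; exact: prodE.
rewrite -Rfubini1; last exact: bdm_integ_prod.
have bG : bdm (fun x => \int[D2]_y F (x, y)) by exact: bdm_Rint2.
rewrite (int_law P m1 bG) /Rintegral; congr fine; apply: eq_integral => w _.
congr EFin.
have bb : bdm (fun y : E2 => F (X1 w, y)).
  by apply: (bdm_comp bF); exact: measurable_fun_pair.
exact: (int_law P m2 bb).
Qed.
End indep2.

End laws.

(** * From independent families to independent sigma-algebras *)

Section mutual_independence.
Context d (Om : measurableType d) (R : realType) (P : probability Om R).
Context (I : choiceType) (F : I -> set (set Om)).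
Hypothesis mF : forall i, F i `<=` measurable.
Hypothesis FT : forall i, F i setT.
Hypothesis FI : forall i, setI_closed (F i).
Hypothesis ind : mutually_independent P F.

Let pisys (J : set I) : set (set Om) := [set A | exists S : {fset I},
  (forall i, i \in S -> J i) /\ exists B : I -> set Om,
  (forall i, F i (B i)) /\ A = \bigcap_(i in [set` S]) B i].

(** For fixed [B], the probability of the intersection of A with B and the product P(A) P(B) are
    finite measures in A. They agree on [pisys J], a pi-system generating the joint sigma-algebra of
    the [F i], i in J. *)
Lemma mutual_indep_sigma (J : set I) k A B : ~ J k ->
  <<s \bigcup_(i in J) F i >> A -> F k B -> P (A `&` B) = (P A * P B)%E.
Proof.
move=> Jk sA FB; have mB := mF FB.
have piI : setI_closed (pisys J).
  move=> _ _ [S1 [S1J [B1 [FB1 ->]]]] [S2 [S2J [B2 [FB2 ->]]]].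
  exists (S1 `|` S2)%fset; split.
    by move=> i; rewrite inE => /orP[/S1J|/S2J].
  exists (fun i => (if i \in S1 then B1 i else setT) `&`
                   (if i \in S2 then B2 i else setT)); split.
    by move=> i; apply: FI; case: ifP.
  apply/seteqP; split => [x [h1 h2] i /= iS|x h].
    split; case: ifPn => // ii; [exact: h1|exact: h2].
  split => i /= iS.
    by have /= := h i; rewrite inE iS => /(_ isT)[].
  by have /= := h i; rewrite inE iS orbT => /(_ isT)[].
have pim : pisys J `<=` measurable.
  move=> _ [S [SJ [C [FC ->]]]]; apply: fin_bigcap_measurable => // i _.
  exact: mF.
have sub : <<s \bigcup_(i in J) F i >> `<=` <<s pisys J >>.
  apply: sub_sigma_algebra2 => C [i Ji FC].
  exists [fset i]%fset; split; first by move=> j; rewrite inE => /eqP ->.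
  exists (fun j => if j == i then C else setT); split.
    by move=> j; case: ifPn => // /eqP ->.
  apply/seteqP; split => [x Cx j /=|x /(_ i)/=].
    by rewrite inE => /eqP ->; rewrite eqxx.
  by rewrite inE eqxx; apply.
pose r : {nonneg R} := NngNum (fine_ge0 (measure_ge0 P B)).
have rE : (r%:num%:E = P B)%E by rewrite /= fineK// fin_num_measure.
suff : mrestr P mB A = mscale r P A.
  by move=> h; rewrite muleC -rE; exact: h.
have H := @g_sigma_algebra_measure_unique _ R Om (pisys J) pim (fun=> setT) _ _
  (mrestr P mB) (mscale r P) piI.
apply: H => [i|||//|]; last exact: sub.
- exists fset0; split => //; exists (fun=> setT); split => //.
  by apply/seteqP; split => x // _ i; rewrite /= inE.
- by apply/seteqP; split => // x _; exists 0%N.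
- move=> _ [S [SJ [C [FC ->]]]].
  change (P (\bigcap_(i in [set` S]) C i `&` B) = (r%:num)%:E * P (\bigcap_(i in [set` S]) C i))%E.
  have kS : k \notin S by apply/negP => /SJ.
  (* The family extended by [B] at the new index [k], to which mutual independence applies. *)
  pose C' i := if i == k then B else C i.
  have := ind (J := (k |` S)%fset) (B := C') _.
  rewrite (_ : \bigcap_(i in _) C' i = \bigcap_(i in [set` S]) C i `&` B); last first.
    apply/seteqP; split => [x h|x [h Bx] i /=].
      split; last by have /= := h k; rewrite /C' !inE eqxx; apply.
      move=> i /= iS; have /= := h i; rewrite /C' !inE iS orbT => /(_ isT).
      by case: eqP => // ik; move: kS; rewrite -ik iS.
    by rewrite !inE /C'; case: eqP => //= _; exact: h.
  move=> ->; last by move=> i _; rewrite /C'; case: eqP => [->|].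
  rewrite big_fsetU1//= {1}/C' eqxx rE; congr (_ * _)%E.
  rewrite (ind (J := S) (B := C)); last by move=> i _; exact: FC.
  rewrite big_seq [RHS]big_seq; apply: eq_bigr => i iS; rewrite /C'.
  by case: eqP => // ik; move: kS; rewrite -ik iS.
- move=> _; change (P (setT `&` B) < +oo)%E; rewrite setTI.
  by rewrite (le_lt_trans (probability_le1 _ mB))// ltry.
Qed.

End mutual_independence.

Section sigma_gen.
Context d (Om : measurableType d) (I : Type) d' (E : measurableType d').
Variables (D : set I) (X : I -> Om -> E).

Lemma sigma_gen_sigma_algebra : sigma_algebra setT (sigma_gen D X).
Proof. exact: smallest_sigma_algebra. Qed.

Lemma sigma_genT : sigma_gen D X setT.
Proof.
have [h0 hC _] := sigma_gen_sigma_algebra.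
by have := hC _ h0; rewrite setD0.
Qed.

Lemma sigma_genI : setI_closed (sigma_gen D X).
Proof. exact: (@measurableI _ (g_sigma_algebraType (\bigcup_(i in D) preimage_set_system setT (X i) measurable))). Qed.

Lemma sigma_gen_meas : (forall i, D i -> measurable_fun setT (X i)) ->
  sigma_gen D X `<=` measurable.
Proof.
move=> mX; apply: smallest_sub; first exact: sigma_algebra_measurable.
by move=> _ [i Di [B mB <-]]; apply: mX.
Qed.

Lemma sigma_gen_measurable_fun i : D i ->
  measurable_fun setT (X i : g_sigma_algebraType (\bigcup_(i in D) preimage_set_system setT (X i) measurable) -> E).
Proof.
by move=> Di _ B mB; apply: sub_sigma_algebra; exists i => //; exists B.
Qed.

End sigma_gen.

Lemma measurable_fun_coarser d (Om : measurableType d) d' (E : measurableType d')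
    (G1 G2 : set (set Om)) (f : Om -> E) : G1 `<=` <<s G2 >> ->
  measurable_fun setT (f : g_sigma_algebraType G1 -> E) ->
  measurable_fun setT (f : g_sigma_algebraType G2 -> E).
Proof.
move=> G12 mf _ B mB; have sub : <<s G1 >> `<=` <<s G2 >>.
  by apply: (smallest_sub (smallest_sigma_algebra _ _)).
exact: sub (mf measurableT B mB).
Qed.

(** The identity into the same set with a smaller sigma-algebra is a random variable; [indep2] of
    two such identities is independence of the two sigma-algebras. *)
Lemma measurable_fun_gen_id d (Om : measurableType d) (G : set (set Om)) :
  G `<=` measurable ->
  measurable_fun setT (id : Om -> g_sigma_algebraType G).
Proof.
move=> mG _ B mB; rewrite setTI preimage_id.
have sub : <<s G >> `<=` (measurable : set (set Om)).
  by apply: smallest_sub => //; exact: sigma_algebra_measurable.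
exact: sub.
Qed.

(** * Cosines, sines and affine substitutions *)

Section trig_bounds.
Context {R : realType}.
Implicit Types x y z h : R.

Lemma lip_of_derive (f f' : R -> R) (M : R) :
  (forall x : R, is_derive x 1 f (f' x)) -> (forall x, `|f' x| <= M) ->
  forall a b, `|f a - f b| <= M * `|a - b|.
Proof.
move=> df fM.
have H (a b : R) : a <= b -> `|f b - f a| <= M * `|b - a|.
  move=> ab.
  have cf : {within `[a, b], continuous f}.
    apply: derivable_within_continuous => x _.
    by apply: ex_derive.
  have [c _ ->] := @MVT_segment R f f' a b ab (fun x _ => df x) cf.
  by rewrite normrM ler_wpM2r.
move=> a b; have [ab|/ltW ba] := leP a b; last exact: H.
by rewrite distrC (distrC a); exact: H.
Qed.

Lemma sqn x : `|x| ^+ 2 = x ^+ 2.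
Proof. by rewrite real_normK// num_real. Qed.

Lemma sin_le_norm x : `|sin x| <= `|x|.
Proof.
have := @lip_of_derive sin cos 1 _ (@cos_max R) x 0.
by rewrite sin0 !subr0 mul1r; apply.
Qed.

Lemma cos_lip x y : `|cos x - cos y| <= `|x - y|.
Proof.
have := @lip_of_derive cos (fun x => - sin x) 1 _ _ x y.
by rewrite mul1r; apply => u; rewrite normrN; exact: sin_max.
Qed.

Lemma one_cos x : 1 - cos x = 2 * sin (x / 2) ^+ 2.
Proof.
have -> : cos x = cos (x / 2 + x / 2) by congr cos; lra.
rewrite cosD; have := @cos2Dsin2 R (x / 2); nra.
Qed.

Lemma one_cos_ge0 x : 0 <= 1 - cos x.
Proof. by rewrite subr_ge0 cos_le1. Qed.

Lemma one_cos_le2 x : 1 - cos x <= 2.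
Proof. have := @cos_geN1 R x; lra. Qed.

Lemma one_cos_le x : 1 - cos x <= x ^+ 2 / 2.
Proof.
rewrite one_cos; have := sin_le_norm (x / 2).
rewrite -ler_sqr ?nnegrE// !sqn => h; nra.
Qed.

(** Mean value theorem for x - sin x, whose derivative 1 - cos is at most x^2/2; the constant is not
    sharp. *)
Lemma sin_sub_le x : `|x - sin x| <= `|x| ^+ 3 / 2.
Proof.
have H (a : R) : 0 <= a -> `|a - sin a| <= a ^+ 3 / 2.
  move=> a0; have [->|an0] := eqVneq a 0; first by rewrite sin0 subrr normr0 expr0n/= mul0r.
  have a0' : 0 < a by rewrite lt_neqAle eq_sym an0.
  pose f (x : R) : R := x - sin x; pose f' (x : R) : R := 1 - cos x.
  have df (x0 : R) : is_derive x0 1 f (f' x0).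
    by rewrite /f /f'; apply: is_deriveB.
  have cf : {within `[0, a], continuous f}.
    by apply: derivable_within_continuous => z _; apply: ex_derive.
  have [c + E] := @MVT_segment R f f' 0 a a0 (fun x _ => df x) cf.
  rewrite in_itv/= => /andP[c0 ca].
  have -> : a - sin a = (1 - cos c) * a by move: E; rewrite /f /f' sin0 !subr0.
  rewrite ger0_norm ?mulr_ge0 ?one_cos_ge0//.
  have := one_cos_le c; have : c ^+ 2 <= a ^+ 2 by rewrite ler_sqr ?nnegrE.
  nra.
have [x0|/ltW x0] := leP 0 x; first by rewrite (ger0_norm x0) H.
have -> : x - sin x = - ((- x) - sin (- x)) by rewrite sinN; ring.
by rewrite normrN (ler0_norm x0); apply: H; rewrite oppr_ge0.
Qed.

Lemma cos_taylor_ge0 x : 0 <= cos x - 1 + x ^+ 2 / 2.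
Proof. have := one_cos_le x; lra. Qed.

Lemma cos_taylor_le4 x : cos x - 1 + x ^+ 2 / 2 <= x ^+ 4 / 8.
Proof.
set u := x / 2.
have -> : x ^+ 4 / 8 = 2 * `|u| ^+ 4 by rewrite -[4%N]/(2 * 2)%N !exprM sqn /u; field.
(* With u = x/2 the left side is 2 (u^2 - sin(u)^2), factored as a difference of squares. *)
have E : cos x - 1 + x ^+ 2 / 2 = 2 * ((u - sin u) * (u + sin u)).
  have := one_cos x; rewrite -/u => h; have -> : cos x = 1 - 2 * sin u ^+ 2 by lra.
  by rewrite /u; field.
rewrite E ler_pM2l//; apply: le_trans (ler_norm _) _; rewrite normrM.
have h1 := sin_sub_le u.
have h2 : `|u + sin u| <= 2 * `|u|.
  by apply: le_trans (ler_normD _ _) _; have := sin_le_norm u; lra.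
have := ler_pM (normr_ge0 _) (normr_ge0 _) h1 h2.
by congr (_ <= _); field.
Qed.

Lemma cos_taylor_le2 x : cos x - 1 + x ^+ 2 / 2 <= x ^+ 2 / 2.
Proof. have := @cos_le1 R x; lra. Qed.

(** The two Taylor remainders are kept apart: the cube comes from the sine and is later absorbed by
    [norm_cube_le]. *)
Lemma cos_expand x h :
  `|cos (x + h) - (cos x * (1 - h ^+ 2 / 2) - sin x * h)|
    <= h ^+ 4 / 8 + `|h| ^+ 3 / 2.
Proof.
rewrite cosD (_ : _ - _ = cos x * (cos h - 1 + h ^+ 2 / 2) + sin x * (h - sin h)); last by ring.
apply: le_trans (ler_normD _ _) _; rewrite !normrM; apply: lerD.
  rewrite (ger0_norm (cos_taylor_ge0 h)).
  apply: le_trans _ (cos_taylor_le4 h).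
  by rewrite ler_piMl ?cos_taylor_ge0// cos_max.
apply: le_trans _ (sin_sub_le h).
by rewrite ler_piMl// sin_max.
Qed.

End trig_bounds.

Section image_measure.
Context d d' (T : measurableType d) (U : measurableType d') (R : realType).
Variables (mu : {measure set T -> \bar R}) (X : {mfun T >-> U}).

Definition image_measure := pushforward mu X.

Let image0 : image_measure set0 = 0%E.
Proof. exact: measure0. Qed.

Let image_ge0 A : (0 <= image_measure A)%E.
Proof. exact: measure_ge0. Qed.

Let image_sigma_additive : semi_sigma_additive image_measure.
Proof. exact: measure_semi_sigma_additive. Qed.

HB.instance Definition _ := isMeasure.Build _ _ _ image_measure
  image0 image_ge0 image_sigma_additive.

Lemma ge0_integral_image (f : U -> \bar R) : measurable_fun setT f ->
  (forall x, 0 <= f x)%E -> (\int[image_measure]_x f x = \int[mu]_x f (X x))%E.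
Proof. by move=> mf f0; rewrite ge0_integral_pushforward. Qed.
End image_measure.

(** * Affine changes of variable for Lebesgue measure *)

Section lebesgue_affine.
Context {R : realType}.
Local Notation leb := (@lebesgue_measure R).

Lemma meas_affine (a b : R) : measurable_fun setT (fun x : R => a * x + b).
Proof. by apply: measurable_funD => //; apply: measurable_funM. Qed.

Let aff (a b : R) : {mfun measurableTypeR R >-> measurableTypeR R} :=
  @mkmfun _ _ (measurableTypeR R) (measurableTypeR R) (fun x : R => a * x + b) (meas_affine a b).

Let leb_pushforward (a b : R) (A : set R) : a != 0 -> measurable A ->
  (`|a|%:E * leb ((fun x => (a * x + b)%R) @^-1` A))%E = leb A.
Proof.
move=> a0 mA.
pose r : {nonneg R} := NngNum (normr_ge0 a).
pose mu : {measure set (measurableTypeR R) -> \bar R} := mscale r (image_measure leb (aff a b)).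
suff : leb A = mu A by move=> ->.
apply: lebesgue_measure_unique => // _ [[l u] _ <-] /=.
change (leb `]l, u] = `|a|%:E * leb ((fun x => (a * x + b)%R) @^-1` `]l, u]))%E.
rewrite lebesgue_measure_itv/=.
have [apos|aneg] := ltP 0 a.
  rewrite (_ : _ @^-1` _ = `](l - b) / a, (u - b) / a]%classic); last first.
    apply/seteqP; split => x /=; rewrite !in_itv/= ltr_pdivrMr// ler_pdivlMr// (mulrC x) ltrBlDr lerBrDr//.
  rewrite lebesgue_measure_itv/= !lte_fin ltr_pM2r ?invr_gt0// ltrD2r gtr0_norm//.
  case: ltP => // _; last by rewrite mule0.
  by rewrite -!EFinB -EFinM; congr EFin; field.
(* A negative slope exchanges the open and the closed end of the interval, which does not affect its
   length. *)
have {}aneg : a < 0 by rewrite lt_neqAle a0.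
rewrite (_ : _ @^-1` _ = `[(u - b) / a, (l - b) / a[%classic); last first.
  apply/seteqP; split => x /=; rewrite !in_itv/= ler_ndivrMr// ltr_ndivlMr// (mulrC x) ltrBlDr lerBrDr// => /andP[-> ->]//.
rewrite lebesgue_measure_itv/= !lte_fin ltr_nM2r ?invr_lt0// ltrD2r ltr0_norm//.
case: ltP => // _; last by rewrite mule0.
by rewrite -!EFinB -EFinM; congr EFin; field.
Qed.

Lemma ge0_leb_affine (a b : R) (f : R -> \bar R) : a != 0 ->
  measurable_fun setT f -> (forall x, 0 <= f x)%E ->
  (\int[leb]_x f (a * x + b)%R = `|a|^-1%:E * \int[leb]_x f x)%E.
Proof.
move=> a0 mf f0.
pose r : {nonneg R} := NngNum (normr_ge0 a).
have -> : (\int[leb]_x f x = \int[mscale r (image_measure leb (aff a b))]_x f x)%E.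
  apply: eq_measure_integral => A mA _.
  exact: (esym (leb_pushforward b a0 mA)).
rewrite ge0_integral_mscale// ge0_integral_image//.
by rewrite muleA -EFinM mulVf ?mul1e// normr_eq0.
Qed.

Lemma integ_affine (a b : R) (f : R -> R) : a != 0 -> integ leb f ->
  integ leb (fun x => f (a * x + b)).
Proof.
move=> a0 /integrableP[mf fi]; apply/integrableP; split.
  by apply: measurableT_comp mf (meas_affine a b).
rewrite (ge0_leb_affine b (f := fun x => `|(f x)%:E|%E) a0)//; last first.
  exact: measurableT_comp.
by apply: lte_mul_pinfty; rewrite ?lee_fin ?invr_ge0.
Qed.

Lemma Rint_affine (a b : R) (f : R -> R) : a != 0 -> integ leb f ->
  \int[leb]_x f (a * x + b) = `|a|^-1 * \int[leb]_x f x.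
Proof.
move=> a0 if_.
have ip := integrable_funepos measurableT if_.
have in_ := integrable_funeneg measurableT if_.
rewrite /Rintegral.
have mf : measurable_fun setT (EFin \o f) by case/integrableP: if_.
have Ep := ge0_leb_affine b a0 (measurable_funepos mf) (fun x => funepos_ge0 (EFin \o f) x).
have En := ge0_leb_affine b a0 (measurable_funeneg mf) (fun x => funeneg_ge0 (EFin \o f) x).
rewrite integralE [in RHS]integralE.
transitivity (fine (`|a|^-1%:E * (\int[leb]_x (EFin \o f)^\+%E x)
   - `|a|^-1%:E * (\int[leb]_x (EFin \o f)^\-%E x))%E).
  congr fine; congr (_ - _)%E; [rewrite -Ep|rewrite -En]; apply: eq_integral => x _; by rewrite ?funeposE ?funenegE.
have fp := integrable_fin_num measurableT ip.
have fn := integrable_fin_num measurableT in_.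
by rewrite fineB ?fin_numM// fineB// !fineM// mulrBr.
Qed.

Lemma Rint_odd (f : R -> R) : integ leb f -> (forall y, f (- y) = - f y) -> \int[leb]_y f y = 0.
Proof.
move=> if_ fN.
have := Rint_affine 0 (_ : -1 != 0 :> R) if_.
rewrite oppr_eq0 oner_eq0 normrN normr1 invr1 mul1r => /(_ isT).
rewrite (eq_Rint leb (fun x => - f x)); last by move=> x; rewrite addr0 mulN1r fN.
by rewrite RintN// => h; lra.
Qed.

End lebesgue_affine.

(** * Fourier multipliers and tent functions *)

Section lam.
Context {R : realType} (alpha : R) (alpha_gt1 : 1 < alpha) (alpha_le2 : alpha <= 2).
Local Notation leb := (@lebesgue_measure R).

(** The exponent of the motion: E cos(z X_t) = exp(-t [lam z]). *)
Definition lam (z : R) : R := `|z| `^ alpha.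

Lemma lam_ge0 z : 0 <= lam z. Proof. exact: powR_ge0. Qed.

Lemma lam_gt0 z : z != 0 -> 0 < lam z.
Proof. by move=> z0; rewrite powR_gt0// normr_gt0. Qed.

Lemma lam_small z : `|z| <= 1 -> z ^+ 2 <= lam z.
Proof.
move=> z1; have [->|z0] := eqVneq z 0; first by rewrite expr0n lam_ge0.
rewrite -sqn -powR_mulrn// /lam; apply: ger_powR => //.
by rewrite normr_gt0 z0.
Qed.

Lemma lam_big z : 1 <= `|z| -> lam z <= z ^+ 2.
Proof. by move=> z1; rewrite -sqn -powR_mulrn// /lam; apply: ler_powR. Qed.

Lemma lamM a z : lam (a * z) = lam a * lam z.
Proof. by rewrite /lam normrM powRM. Qed.

Lemma meas_lam : measurable_fun setT lam.
Proof.
by apply: (measurableT_comp (measurable_powR alpha)); exact: normr_measurable.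
Qed.

(** The primitive x^(1 - alpha) / (1 - alpha) vanishes at infinity because alpha > 1. *)
Lemma integ_powR_tail : integ leb (fun z : R => (z `^ (- alpha)) * \1_(`[1%R, +oo[%classic : set R) z).
Proof.
apply: integ_ge0P.
- apply: measurable_funM; first exact: measurable_powR.
  exact: measurable_indic.
- by move=> z; rewrite mulr_ge0// powR_ge0.
rewrite (_ : (\int[_]_x _)%E = (\int[leb]_(x in `[1%R, +oo[) (x `^ (- alpha))%:E)%E); last first.
  rewrite [RHS]integral_mkcond; apply: eq_integral => z _.
  by rewrite patchE indicE; case: ifPn => _; rewrite ?mulr1 ?mulr0.
rewrite (@ge0_continuous_FTC2y _ _ (fun x => (1 - alpha)^-1 * x `^ (1 - alpha)) _ 0) ?ltry//.
- by move=> x _; exact: powR_ge0.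
- apply: derivable_within_continuous => x; rewrite in_itv/= andbT => x1.
  by apply: ex_derive; apply: is_derive1_powR; apply: lt_le_trans x1.
- rewrite -[0](mulr0 (1 - alpha)^-1); apply: cvgMr.
  have -> : 1 - alpha = - (alpha - 1) by rewrite opprB.
  under eq_fun do rewrite powRN.
  apply/gtr0_cvgV0.
    near=> x; apply: powR_gt0; near: x; exact: nbhs_pinfty_gt.
  apply/cvgryPge => A; near=> x.
  have x0 : 0 < x by near: x; exact: nbhs_pinfty_gt.
  have H : `|A| `^ (alpha - 1)^-1 <= x by near: x; exact: nbhs_pinfty_ge.
  apply: le_trans (ler_norm A) _.
  have -> : `|A| = (`|A| `^ (alpha - 1)^-1) `^ (alpha - 1).
    by rewrite -powRrM mulVf ?powRr1// subr_eq0 gt_eqF.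
  apply: ge0_ler_powR => //; rewrite ?nnegrE ?powR_ge0 ?subr_ge0 ?ltW//.
- move=> x x1; apply: derivableM => //; apply: ex_derive.
  by apply: is_derive1_powR; exact: lt_trans x1.
- apply: cvg_at_right_filter; apply: cvgMr.
  have /derivable1_diffP/differentiable_continuous h :=
    @ex_derive _ _ _ _ _ _ _ (is_derive1_powR (1 - alpha) (@ltr01 R)).
  exact: h.
- move=> x; rewrite in_itv/= andbT => x1.
  have x0 : 0 < x by exact: lt_trans x1.
  rewrite derive1E; apply: derive_val.
  have h := is_derive1_powR (1 - alpha) x0.
  have := is_deriveZ (1 - alpha)^-1 h.
  rewrite /GRing.scale/= mulrA mulVf ?mul1r; last by rewrite subr_eq0 lt_eqF.
  by rewrite (_ : 1 - alpha - 1 = - alpha); [exact|lra].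
Unshelve. all: by end_near. Qed.

(** Common criterion for the integrals over frequencies: bounded near 0, of order 1/|z|^alpha at
    infinity. The point 0 is set apart since the integrands are quotients, with a default value
    there. *)
Lemma integ_dom (f : R -> R) A : measurable_fun setT f ->
  (forall z, z != 0 -> `|z| <= 1 -> `|f z| <= A) ->
  (forall z, 1 < `|z| -> `|f z| <= A / lam z) -> integ leb f.
Proof.
move=> mf f1 f2.
pose V z : R := (z `^ (- alpha)) * \1_(`[1%R, +oo[%classic : set R) z.
(* The value at 0 is not controlled by the two bounds, hence the second term. *)
pose A' := `|A| + `|f 0|.
have iV' : integ leb (fun z => V ((-1) * z + 0)).
  by apply: integ_affine; [rewrite oppr_eq0 oner_eq0|exact: integ_powR_tail].
have i1 : integ leb (fun z => \1_(`[-1, 1]%classic) z : R).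
  exact: integrable_indic_itv.
apply: (@integ_le _ _ _ leb f (fun z => A' * (\1_(`[-1, 1]%classic) z + V z + V ((-1) * z + 0)))) => //.
  by apply: integZ; apply: integD => //; apply: integD => //; exact: integ_powR_tail.
have V0 z : 0 <= V z by rewrite mulr_ge0// powR_ge0.
have A'0 : 0 <= A' by rewrite addr_ge0.
have AA : A <= A' by rewrite (le_trans (ler_norm A))// lerDl.
move=> z; have [z1|z1] := leP `|z| 1.
  have : `|f z| <= A' * 1.
    rewrite mulr1; have [->|z0] := eqVneq z 0; first by rewrite lerDr.
    exact: le_trans (f1 _ z0 z1) AA.
  move/le_trans; apply; apply: ler_wpM2l => //.
  have -> : \1_(`[-1, 1]%classic) z = 1 :> R.
    by rewrite indicE mem_set//= in_itv/= -ler_norml.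
  by rewrite -addrA lerDl addr_ge0.
have : `|f z| <= A' * `|z| `^ (- alpha).
  rewrite powRN; apply: le_trans (f2 _ z1) _.
  by apply: ler_wpM2r => //; rewrite invr_ge0 powR_ge0.
move/le_trans; apply; apply: ler_wpM2l => //.
have [z0|z0] := leP 0 z.
  rewrite -[leLHS]add0r -[leLHS]addr0; apply: lerD; last exact: V0.
  apply: lerD; first by rewrite indicE.
  rewrite /V (ger0_norm z0) indicE mem_set ?mulr1//= in_itv/= andbT ltW//.
  by rewrite -(ger0_norm z0).
rewrite -[leLHS]add0r; apply: lerD.
  by apply: addr_ge0 => //; rewrite indicE.
rewrite /V mulN1r addr0 (ltr0_norm z0) indicE mem_set ?mulr1//= in_itv/= andbT ltW//.
by rewrite -(ltr0_norm z0).
Qed.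

Lemma meas_cosM (a : R) : measurable_fun setT (fun z => cos (a * z)).
Proof. by apply: bdm_meas; apply: bdm_cos; exact: measurable_funM. Qed.

Lemma meas_inv : measurable_fun setT (fun z : R => z^-1).
Proof.
rewrite (_ : setT = [set 0] `|` ~` [set 0 : R]); last by rewrite setUv.
apply/measurable_funU => //; first exact: measurableC.
split; first exact: measurable_fun_set1.
apply: open_continuous_measurable_fun.
  by apply: closed_openC; exact: accessible_closed_set1 (hausdorff_accessible (@Rhausdorff R)) _.
by move=> z; rewrite inE/= => /eqP z0; exact: inv_continuous.
Qed.

Lemma meas_sqV : measurable_fun setT (fun z : R => (z ^+ 2)^-1).
Proof. by apply: (measurableT_comp meas_inv); exact: exprn_measurable. Qed.

Lemma meas_lamV : measurable_fun setT (fun z : R => (lam z)^-1).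
Proof. by apply: (measurableT_comp meas_inv); exact: meas_lam. Qed.

(* decay required of a Fourier multiplier p for p^2/z^2 and p^2/(z^2 |z|^alpha) to be integrable *)
Definition mult2 (p : R -> R) := measurable_fun setT p /\
  exists2 C : R, 0 <= C & forall z, `|p z| <= C /\ `|p z| <= C * z ^+ 2.

Lemma mult2_one_cos t : mult2 (fun z => 1 - cos (t * z)).
Proof.
split; first by apply: measurable_funB => //; exact: meas_cosM.
exists (2 + t ^+ 2); first by rewrite addr_ge0// sqr_ge0.
move=> z; rewrite ger0_norm ?one_cos_ge0//; split.
  by apply: le_trans (one_cos_le2 _) _; rewrite lerDl sqr_ge0.
apply: le_trans (one_cos_le _) _; have := sqr_ge0 z; have := sqr_ge0 (t * z).
rewrite exprMn; nra.
Qed.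

Lemma mult2D p1 p2 : mult2 p1 -> mult2 p2 -> mult2 (fun z => p1 z + p2 z).
Proof.
move=> [m1 [C1 C10 H1]] [m2 [C2 C20 H2]]; split; first exact: measurable_funD.
exists (C1 + C2); first exact: addr_ge0.
move=> z; have [a1 b1] := H1 z; have [a2 b2] := H2 z.
by split; apply: le_trans (ler_normD _ _) _; rewrite ?mulrDl lerD.
Qed.

Lemma mult2Z k p : mult2 p -> mult2 (fun z => k * p z).
Proof.
move=> [m1 [C1 C10 H1]]; split; first exact: measurable_funM.
exists (`|k| * C1); first exact: mulr_ge0.
move=> z; have [a1 b1] := H1 z; rewrite normrM -mulrA.
by split; rewrite ler_wpM2l.
Qed.

Lemma mult2_sum (I : Type) (s : seq I) (p : I -> R -> R) :
  (forall i, mult2 (p i)) -> mult2 (fun z => \sum_(i <- s) p i z).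
Proof.
move=> H; elim: s => [|a s IH].
  under [X in mult2 X]funext do rewrite big_nil.
  by split => //; exists 0 => // z; rewrite normr0 mul0r.
under [X in mult2 X]funext do rewrite big_cons.
exact: mult2D.
Qed.

Lemma mult2_integ p : mult2 p -> integ leb (fun z => p z / z ^+ 2).
Proof.
move=> [mp [C C0 H]]; apply: (@integ_dom _ C).
- by apply: measurable_funM => //; exact: meas_sqV.
- move=> z z0 _; have [_ h] := H z.
  rewrite normrM normfV (ger0_norm (sqr_ge0 z)) ler_pdivrMr//.
  by rewrite exprn_even_gt0.
- move=> z z1; have [h _] := H z.
  have z0 : z != 0 by rewrite -normr_gt0 (lt_trans _ z1).
  rewrite normrM normfV (ger0_norm (sqr_ge0 z)).
  apply: ler_pM => //; first by rewrite invr_ge0 sqr_ge0.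
  by rewrite lef_pV2 ?posrE ?lam_gt0 ?exprn_even_gt0// lam_big// ltW.
Qed.

Lemma mult2M p1 p2 : mult2 p1 -> mult2 p2 -> mult2 (fun z => p1 z * p2 z).
Proof.
move=> [m1 [C1 C10 H1]] [m2 [C2 C20 H2]]; split; first exact: measurable_funM.
exists (C1 * C2); first exact: mulr_ge0.
move=> z; have [a1 b1] := H1 z; have [a2 b2] := H2 z.
rewrite normrM; split; first exact: ler_pM.
by rewrite -mulrA; exact: ler_pM.
Qed.

(** Near 0 the product is of order z^4, while z^2 |z|^alpha is at least z^4 there since alpha <=
    2. *)
Lemma mult2_lam_integ p1 p2 : mult2 p1 -> mult2 p2 ->
  integ leb (fun z => p1 z * p2 z / z ^+ 2 / lam z).
Proof.
move=> [m1 [C1 C10 H1]] [m2 [C2 C20 H2]]; apply: (@integ_dom _ (C1 * C2)).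
- apply: measurable_funM; last exact: meas_lamV.
  by apply: measurable_funM; [exact: measurable_funM|exact: meas_sqV].
- move=> z z0 z1; have [_ b1] := H1 z; have [_ b2] := H2 z.
  rewrite !normrM !normfV (ger0_norm (sqr_ge0 z)) (ger0_norm (lam_ge0 z)).
  rewrite ler_pdivrMr ?lam_gt0// ler_pdivrMr ?exprn_even_gt0//.
  apply: le_trans (ler_pM _ _ b1 b2) _ => //.
  have -> : C1 * z ^+ 2 * (C2 * z ^+ 2) = C1 * C2 * z ^+ 2 * z ^+ 2 by ring.
  apply: ler_wpM2r; first exact: sqr_ge0.
  by apply: ler_wpM2l; [exact: mulr_ge0|exact: lam_small].
- move=> z z1; have [a1 _] := H1 z; have [a2 _] := H2 z.
  rewrite !normrM !normfV (ger0_norm (sqr_ge0 z)) (ger0_norm (lam_ge0 z)).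
  rewrite ler_wpM2r ?invr_ge0 ?lam_ge0//.
  rewrite -[leRHS]mulr1; apply: ler_pM; rewrite ?mulr_ge0 ?invr_ge0 ?sqr_ge0//.
    exact: ler_pM.
  rewrite invf_le1; last by rewrite exprn_even_gt0//= -normr_gt0 (lt_trans _ z1).
  by rewrite -sqn expr_ge1// ltW.
Qed.

(** The numerator is of order z^4 near 0, against z^2 |z|^alpha >= z^4, and of order z^2 at
    infinity, which leaves 1/|z|^alpha. Subtracting the quadratic term from 1 - cos is what makes
    the quotient integrable at 0. *)
Lemma cos_taylor_integ a :
  integ leb (fun z => (cos (a * z) - 1 + (a * z) ^+ 2 / 2) / z ^+ 2 / lam z).
Proof.
apply: (@integ_dom _ (a ^+ 4 + a ^+ 2)).
- apply: measurable_funM; last exact: meas_lamV.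
  apply: measurable_funM; last exact: meas_sqV.
  apply: measurable_funD; first by apply: measurable_funB => //; exact: meas_cosM.
  by apply: measurable_funM => //; apply: measurable_funX; exact: measurable_funM.
- move=> z z0 z1.
  rewrite !normrM !normfV (ger0_norm (sqr_ge0 z)) (ger0_norm (lam_ge0 z)).
  rewrite (ger0_norm (cos_taylor_ge0 _)).
  rewrite ler_pdivrMr ?lam_gt0// ler_pdivrMr ?exprn_even_gt0//.
  apply: le_trans (cos_taylor_le4 _) _.
  have h := lam_small z1; have := sqr_ge0 (a ^+ 2); have := sqr_ge0 z.
  have -> : (a * z) ^+ 4 = (a ^+ 2) ^+ 2 * (z ^+ 2) * (z ^+ 2) by ring.
  have -> : a ^+ 4 = (a ^+ 2) ^+ 2 by ring.
  move=> h2 h3; have := sqr_ge0 a.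
  set b := a ^+ 2 in h3 *; set y := z ^+ 2 in h h2 *; move=> b0.
  have h4 : (b ^+ 2 + b) * y * y <= (b ^+ 2 + b) * lam z * y.
    by rewrite ler_wpM2r// ler_wpM2l// addr_ge0.
  apply: le_trans h4; have := mulr_ge0 (mulr_ge0 h3 h2) h2.
  have := mulr_ge0 (mulr_ge0 b0 h2) h2; lra.
- move=> z z1; have z0 : z != 0 by rewrite -normr_gt0 (lt_trans _ z1).
  rewrite !normrM !normfV (ger0_norm (sqr_ge0 z)) (ger0_norm (lam_ge0 z)).
  rewrite (ger0_norm (cos_taylor_ge0 _)).
  rewrite ler_wpM2r ?invr_ge0 ?lam_ge0// ler_pdivrMr ?exprn_even_gt0//.
  apply: le_trans (cos_taylor_le2 _) _; rewrite exprMn.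
  have := sqr_ge0 a; have := sqr_ge0 z; have : 0 <= a ^+ 4 by rewrite exprn_even_ge0.
  nra.
Qed.

(** Integrand of the bound [psi_potential]. Near 0 the factor |z| min(1, |z| D) is of order z^2 and
    offsets the singularity of 1/|z|^alpha; at infinity p is bounded and |z|/z^2 is at most 1. *)
Lemma pot_integ p D : mult2 p -> 0 <= D ->
  integ leb (fun z => `|p z| / z ^+ 2 * `|z| * Num.min 1 (`|z| * D) / lam z).
Proof.
move=> [mp [C C0 H]] D0; apply: (@integ_dom _ (C * (1 + D))).
- apply: measurable_funM; last exact: meas_lamV.
  apply: measurable_funM.
    apply: measurable_funM => //; apply: measurable_funM; last exact: meas_sqV.
    exact: measurableT_comp.
  by apply: measurable_minr => //; apply: measurable_funM.
- move=> z z0 z1; have [_ h] := H z.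
  rewrite !normrM !normfV (ger0_norm (sqr_ge0 z)) (ger0_norm (lam_ge0 z)) !normr_id.
  have m0 : 0 <= Num.min 1 (`|z| * D) by rewrite le_min ler01 mulr_ge0.
  rewrite (ger0_norm m0) ler_pdivrMr ?lam_gt0//.
  have h' : `|p z| / z ^+ 2 <= C by rewrite ler_pdivrMr ?exprn_even_gt0.
  have h3 : Num.min 1 (`|z| * D) <= `|z| * (1 + D).
    by rewrite ge_min; apply/orP; right; rewrite ler_wpM2l// lerDr.
  rewrite -[leRHS]mulrA -[leLHS]mulrA; apply: ler_pM => //.
  - by rewrite mulr_ge0// invr_ge0 sqr_ge0.
  - by rewrite mulr_ge0.
  apply: le_trans (ler_wpM2l _ h3) _ => //.
  by rewrite mulrA -expr2 sqn mulrC ler_wpM2l ?addr_ge0// lam_small.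
- move=> z z1; have [h _] := H z; have z0 : z != 0 by rewrite -normr_gt0 (lt_trans _ z1).
  rewrite !normrM !normfV (ger0_norm (sqr_ge0 z)) (ger0_norm (lam_ge0 z)) !normr_id.
  have m0 : 0 <= Num.min 1 (`|z| * D) by rewrite le_min ler01 mulr_ge0.
  rewrite (ger0_norm m0) ler_wpM2r ?invr_ge0 ?lam_ge0//.
  have h3 : Num.min 1 (`|z| * D) <= 1 by rewrite ge_min lexx.
  apply: ler_pM; rewrite ?mulr_ge0 ?invr_ge0 ?sqr_ge0//; last first.
    by apply: le_trans h3 _; rewrite lerDl.
  rewrite -mulrA -[leRHS]mulr1; apply: ler_pM; rewrite ?mulr_ge0 ?invr_ge0 ?sqr_ge0//.
  rewrite mulrC -sqn expr2 invfM mulrA mulfV ?normr_eq0// mul1r.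
  by rewrite invf_le1 ?ltW// (lt_trans _ z1).
Qed.

(** Equal to pi; the value enters nowhere, only the sign. *)
Definition c1 : R := \int[leb]_z ((1 - cos (1 * z)) / z ^+ 2).

Lemma c1_gt0 : 0 < c1.
Proof.
have i1 := mult2_integ (mult2_one_cos 1).
have f0 z : 0 <= (1 - cos (1 * z)) / z ^+ 2 :> R.
  by rewrite mulr_ge0 ?one_cos_ge0// invr_ge0 sqr_ge0.
rewrite lt_neqAle Rintegral_ge0// andbT; apply/negP => /eqP c0.
have mf : measurable_fun setT (fun z : R => ((1 - cos (1 * z)) / z ^+ 2)%:E).
  by apply/measurable_EFinP; exact: integ_meas i1.
have : (\int[leb]_z `|((1 - cos (1 * z)) / z ^+ 2)%:E| = 0)%E.
  under eq_integral do rewrite gee0_abs ?lee_fin//.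
  by rewrite (Rint_EFin i1) -/c1 -c0.
move/(ae_eq_integral_abs leb measurableT mf).1 => [N [mN N0 sN]].
have : (leb `]0%R, 1%R[ <= 0)%E.
  rewrite -N0; apply: le_measure; rewrite ?inE//.
  move=> z /=; rewrite in_itv/= => /andP[z0 z1]; apply: sN => /= /(_ I)/eqP.
  rewrite eqe mulf_eq0 invr_eq0 expf_eq0/= (gt_eqF z0) orbF mul1r subr_eq0 => /eqP h.
  have : cos z < cos 0.
    rewrite ltr_cos// ?in_itv/= ?lexx ?pi_ge0//.
    by rewrite ltW//=; apply: le_trans (ltW z1) _; apply: le_trans (@pi_ge2 R); lra.
  by rewrite cos0 -h ltxx.
rewrite lebesgue_measure_itv/= lte_fin ltr01 -EFinB lee_fin; lra.
Qed.

(** Substitution z -> a z. It exhibits |a| as a mixture of the functions 1 - cos(a z), from which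
    the tents inherit their cosine transforms. *)
Lemma cosrep a : \int[leb]_z ((1 - cos (a * z)) / z ^+ 2) = c1 * `|a|.
Proof.
have [->|a0] := eqVneq a 0.
  rewrite normr0 mulr0 (eq_Rint leb (fun=> 0)) ?Rint0// => z.
  by rewrite mul0r cos0 subrr mul0r.
have i1 := mult2_integ (mult2_one_cos 1).
rewrite (eq_Rint leb (fun z => a ^+ 2 * ((1 - cos (1 * (a * z + 0))) / (a * z + 0) ^+ 2))); last first.
  move=> z; rewrite addr0 mul1r exprMn (invfM (a ^+ 2) (z ^+ 2)).
  set X := 1 - _.
  have -> : a ^+ 2 * (X * ((a ^+ 2)^-1 * (z ^+ 2)^-1)) = (a ^+ 2 / a ^+ 2) * (X / z ^+ 2) by ring.
  by rewrite mulfV ?mul1r// expf_neq0.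
rewrite RintZ; last exact: (integ_affine 0 a0 i1).
rewrite (Rint_affine 0 a0 i1) -/c1 -sqn expr2 mulrA mulfK ?normr_eq0// mulrC//.
Qed.

Definition Calpha : R := \int[leb]_z ((cos (1 * z) - 1 + (1 * z) ^+ 2 / 2) / z ^+ 2 / lam z).

Lemma Calpha_ge0 : 0 <= Calpha.
Proof.
by apply: Rintegral_ge0 => z _; rewrite !mulr_ge0 ?cos_taylor_ge0// invr_ge0 ?sqr_ge0 ?lam_ge0.
Qed.

(** Substitution z -> a z: the weight 1/(z^2 |z|^alpha) produces |a|^(2 + alpha), and dz removes one
    power. With 1 + alpha = 2H these are the powers in [sub_fbm_cov]. *)
Lemma Calpha_rep a :
  \int[leb]_z ((cos (a * z) - 1 + (a * z) ^+ 2 / 2) / z ^+ 2 / lam z)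
  = Calpha * `|a| `^ (1 + alpha).
Proof.
have [->|a0] := eqVneq a 0.
  rewrite normr0 powR0 ?mulr0; last by rewrite gt_eqF// addr_gt0// (lt_trans _ alpha_gt1).
  rewrite (eq_Rint leb (fun=> 0)) ?Rint0// => z.
  by rewrite !mul0r cos0 subrr expr0n/= mul0r addr0 !mul0r.
have i1 := cos_taylor_integ 1.
rewrite (eq_Rint leb (fun z => (a ^+ 2 * lam a) *
   ((cos (1 * (a * z + 0)) - 1 + (1 * (a * z + 0)) ^+ 2 / 2) / (a * z + 0) ^+ 2 / lam (a * z + 0)))); last first.
  move=> z; rewrite addr0 !mul1r lamM; set X := cos _ - 1 + _.
  rewrite exprMn (invfM (a ^+ 2) (z ^+ 2)) (invfM (lam a) (lam z)).
  have la : lam a != 0 by rewrite gt_eqF// lam_gt0.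
  have -> : a ^+ 2 * lam a * (X * ((a ^+ 2)^-1 * (z ^+ 2)^-1) * ((lam a)^-1 * (lam z)^-1)) =
    (a ^+ 2 / a ^+ 2) * (lam a / lam a) * (X / z ^+ 2 / lam z) by ring.
  by rewrite !mulfV ?expf_neq0// !mul1r.
rewrite RintZ; last exact: (integ_affine 0 a0 i1).
rewrite (Rint_affine 0 a0 i1) -/Calpha mulrA [LHS]mulrC; congr (_ * _).
rewrite powRD; last by rewrite normr_eq0 a0 implybT.
rewrite powRr1// -sqn expr2 mulrAC mulfK ?normr_eq0//.
Qed.

Definition tent (t y : R) : R := Num.max 0 (t - `|y|).

(** A tent is half a second difference of the absolute value. *)
Lemma tentE t y : 0 <= t -> tent t y = (`|y + t| + `|y - t|) / 2 - `|y|.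
Proof.
move=> t0; rewrite /tent.
have [y0|y0] := leP 0 y.
  rewrite (ger0_norm y0) (@ger0_norm _ (y + t)) ?addr_ge0//.
  have [yt|yt] := leP t y.
    by rewrite ger0_norm ?subr_ge0//; rewrite max_l; lra.
  by rewrite ltr0_norm ?subr_lt0//; rewrite max_r; lra.
rewrite (ltr0_norm y0) (@ler0_norm _ (y - t)); last by lra.
have [yt|yt] := leP 0 (y + t).
  by rewrite ger0_norm//; rewrite max_r; lra.
by rewrite ltr0_norm//; rewrite max_l; lra.
Qed.

Lemma tent_ge0 t y : 0 <= tent t y. Proof. by rewrite le_max lexx. Qed.

Lemma tent_le t y : 0 <= t -> tent t y <= t.
Proof. by move=> t0; rewrite ge_max t0/= gerBl. Qed.

Lemma integ_cosM f y : integ leb f -> integ leb (fun z => cos (z * y) * f z).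
Proof.
move=> if_; apply: (@integM _ _ _ _ _ _ 1) => //; last by move=> z; exact: cos_max.
by apply: bdm_meas; apply: bdm_cos; exact: measurable_funM.
Qed.

Lemma tent_rep t y : 0 <= t ->
  c1 * tent t y = \int[leb]_z (cos (z * y) * ((1 - cos (t * z)) / z ^+ 2)).
Proof.
move=> t0; rewrite tentE//.
have i a : integ leb (fun z => (1 - cos (a * z)) / z ^+ 2).
  exact: mult2_integ (mult2_one_cos a).
rewrite mulrBr mulrA mulrDr -!cosrep.
rewrite -RintD// -RintZr; last exact: integD.
rewrite -RintB//; last first.
  have := integZ (2^-1) (integD (i (y + t)) (i (y - t))).
  by congr (integrable _ _ _); apply/funext => z /=; rewrite mulrC.
apply: eq_Rintegral => z _; rewrite (mulrDl y t z) (mulrBl z y t) cosD cosB (mulrC z y).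
by set i2 := (z ^+ 2)^-1; field.
Qed.

End lam.

Section tent_prob.
Context {R : realType}.
Local Notation leb := (@lebesgue_measure R).
Local Notation q t := (fun z : R => (1 - cos (t * z)) / z ^+ 2).

(** The integrals of this section do not involve alpha; the lemmas proved for a given exponent are
    instantiated at 2. *)
Let alpha2 : (1 : R) < 2. Proof. by rewrite ltr1n. Qed.

Lemma c1_neq0 : @c1 R != 0.
Proof. by rewrite gt_eqF// (@c1_gt0 R 2)// ltr1n. Qed.

Lemma integ_q t : integ leb (q t).
Proof. exact: (mult2_integ alpha2 (lexx _) (mult2_one_cos t)). Qed.

Lemma q_ge0 t z : 0 <= q t z.
Proof. by rewrite mulr_ge0 ?one_cos_ge0// invr_ge0 sqr_ge0. Qed.

Lemma meas_tent t : measurable_fun setT (tent t : R -> R).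
Proof. by apply: measurable_maxr => //; apply: measurable_funB. Qed.

Lemma bdm_tent d (T : measurableType d) t (f : T -> R) : 0 <= t ->
  measurable_fun setT f -> bdm (fun x => tent t (f x)).
Proof.
move=> t0 mf; split; first exact: (measurableT_comp (meas_tent t)).
by exists t => x; rewrite ger0_norm ?tent_ge0// tent_le.
Qed.

Context d (Om : measurableType d) (P : probability Om R).

(** Passage from cosines of [X] to tents of [X]. The weight [Phi] allows it to be repeated, one
    coordinate at a time, in [Phi_cons]. *)
Lemma tent_fubini (Phi X : Om -> R) t : 0 <= t -> bdm Phi ->
  measurable_fun setT X ->
  c1 * \int[P]_w (Phi w * tent t (X w)) =
  \int[leb]_z ((\int[P]_w (Phi w * cos (z * X w))) * q t z).
Proof.
move=> t0 bP mX; have [mP [M PM]] := bP.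
have bt : bdm (fun w => Phi w * tent t (X w)) by apply: bdmM => //; exact: bdm_tent.
rewrite -RintZ; last exact: bdm_integ.
pose F (p : Om * R) := Phi p.1 * cos (p.2 * X p.1) * q t p.2.
have iF : integ (P \x leb)%E F.
  apply: (@integ_prod_le _ _ _ _ _ P leb F (fun=> M) (fun z => `|q t z|)).
  - have mX1 : measurable_fun setT (fun p : Om * R => X p.1) by exact: measurableT_comp.
    have mP1 : measurable_fun setT (fun p : Om * R => Phi p.1) by exact: measurableT_comp.
    apply: measurable_funM; first apply: measurable_funM => //.
      by apply: bdm_meas; apply: bdm_cos; exact: measurable_funM.
    by apply: (measurableT_comp (integ_meas (integ_q t))).
  - exact: finite_measure_integrable_cst.
  - by apply: integ_abs; exact: integ_q.
  - move=> w z; rewrite /F/= normrM ler_wpM2r// normrM -[leRHS]mulr1.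
    by apply: ler_pM => //; exact: cos_max.
transitivity (\int[P]_w \int[leb]_z F (w, z)).
  apply: eq_Rint => w; rewrite mulrCA (tent_rep alpha2 (lexx _))// -RintZ; last first.
    by apply: integ_cosM; exact: integ_q.
  by apply: eq_Rint => z; rewrite /F/= mulrA (mulrC z).
rewrite Rfubini//; apply: eq_Rint => z; rewrite -RintZr//.
by apply: bdm_integ; apply: bdmM => //; apply: bdm_cos; exact: measurable_funM.
Qed.

End tent_prob.

(** * Uniqueness of a law with given cosine transforms *)

Section law_unique.
Context {R : realType}.
Local Notation leb := (@lebesgue_measure R).
Context d (Om : measurableType d) (P : probability Om R).
Context d1 (Om1 : measurableType d1) (P1 : probability Om1 R).
Context (X : Om -> R) (Y : Om1 -> R).
Hypotheses (mX : measurable_fun setT X) (mY : measurable_fun setT Y).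
Hypothesis XY : forall z th,
  \int[P]_w cos (z * X w + th) = \int[P1]_w cos (z * Y w + th).

Lemma same_tent t c : 0 <= t ->
  \int[P]_w tent t (X w - c) = \int[P1]_w tent t (Y w - c).
Proof.
move=> t0; apply: (mulfI c1_neq0).
have := @tent_fubini R _ _ P (fun=> 1) (fun w => X w - c) t t0 (bdm_cst _ _).
have := @tent_fubini R _ _ P1 (fun=> 1) (fun w => Y w - c) t t0 (bdm_cst _ _).
under eq_Rintegral do rewrite mul1r.
move=> ->; last exact: measurable_funB.
under eq_Rintegral do rewrite mul1r.
move=> ->; last exact: measurable_funB.
apply: eq_Rint => z; congr (_ * _).
rewrite (eq_Rint P (fun w => cos (z * X w + - (z * c)))); last first.
  by move=> w; rewrite mul1r mulrBr.
by rewrite XY; apply: eq_Rint => w; rewrite mul1r mulrBr.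
Qed.

(** Trapezoid of height 1, a difference of concentric tents: with e = 1/(n+1) it rises on [a, a + e]
    and falls on [b, b + e]. The shift to the right makes the limit the indicator of ]a, b], with
    the correct value at both ends. *)
Let step (a b : R) n (x : R) : R :=
  n.+1%:R * (tent ((b - a + n.+1%:R^-1) / 2) (x - (a + b + n.+1%:R^-1) / 2) -
   tent ((b - a - n.+1%:R^-1) / 2) (x - (a + b + n.+1%:R^-1) / 2)).

Let step_val (a b e x : R) : 0 < e -> e <= b - a ->
  tent ((b - a + e) / 2) (x - (a + b + e) / 2) -
   tent ((b - a - e) / 2) (x - (a + b + e) / 2) =
  if x <= a then 0 else if x < a + e then x - a else if x <= b then e else
  if x < b + e then b + e - x else 0.
Proof.
move=> e0 eba; rewrite /tent; have [x0|x0] := ltP (x - (a + b + e) / 2) 0.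
- rewrite ltr0_norm//.
  case: ifPn => [xa|]; first by rewrite !max_l; lra.
  rewrite -ltNge => ax; case: ifPn => [xae|].
    by rewrite max_r ?max_l; lra.
  rewrite -leNgt => aex; case: ifPn => [xb|].
    by rewrite !max_r; lra.
  by rewrite -ltNge => bx; exfalso; lra.
- rewrite ger0_norm//.
  rewrite ifF; last by apply/negbTE; rewrite -ltNge; lra.
  rewrite ifF; last by apply/negbTE; rewrite -leNgt; lra.
  case: ifPn => [xb|]; first by rewrite !max_r; lra.
  rewrite -ltNge => bx; case: ifPn => [xbe|].
    by rewrite max_r ?max_l; lra.
  by rewrite -leNgt => bex; rewrite !max_l; lra.
Qed.

Let step_bnd a b n x : a < b -> n.+1%:R^-1 <= b - a -> `|step a b n x| <= 1.
Proof.
move=> ab nb; have n0 : 0 < n.+1%:R^-1 :> R by rewrite invr_gt0.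
have H : `|tent ((b - a + n.+1%:R^-1) / 2) (x - (a + b + n.+1%:R^-1) / 2) -
   tent ((b - a - n.+1%:R^-1) / 2) (x - (a + b + n.+1%:R^-1) / 2)| <= n.+1%:R^-1.
  rewrite step_val//; set e := _^-1 in n0 nb *.
  case: ifPn => [_|]; first by rewrite normr0 ltW.
  rewrite -ltNge => ax; case: ifPn => xae; first by rewrite ger0_norm; lra.
  case: ifPn => [_|]; first by rewrite ger0_norm// ltW.
  rewrite -ltNge => bx; case: ifPn => xbe; last by rewrite normr0 ltW.
  by rewrite ger0_norm; lra.
rewrite /step normrM ger0_norm//; apply: le_trans (ler_wpM2l _ H) _ => //.
by rewrite mulfV.
Qed.

Let step_cvg a b x : a < b -> step a b n x @[n --> \oo] --> (\1_(`]a, b]%classic) x : R).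
Proof.
move=> ab; apply: cvg_near_cst.
have small (e : R) : 0 < e -> \forall n \near \oo, n.+1%:R^-1 < e.
  by move=> e0; exact: near_infty_natSinv_lt (PosNum e0).
have ba0 : 0 < b - a by rewrite subr_gt0.
rewrite indicE.
have [xa|ax] := leP x a.
  near=> n; have n0 : 0 < n.+1%:R^-1 :> R by rewrite invr_gt0.
  have nb : n.+1%:R^-1 < b - a by near: n; exact: small.
  rewrite /step step_val ?(ltW nb)// xa mulr0.
  by rewrite memNset//= in_itv/= (le_gtF xa).
have [xb|bx] := leP x b.
  have xa0 : 0 < x - a by rewrite subr_gt0.
  near=> n; have n0 : 0 < n.+1%:R^-1 :> R by rewrite invr_gt0.
  have nb : n.+1%:R^-1 < b - a by near: n; exact: small.
  have nx : n.+1%:R^-1 < x - a by near: n; exact: small.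
  rewrite /step step_val ?(ltW nb)// (lt_geF ax)/= xb ifF; last first.
    by apply/negbTE; rewrite -leNgt; move: nx; set e := n.+1%:R^-1 => nx; lra.
  by rewrite mulfV// mem_set//= in_itv/= ax.
have xb0 : 0 < x - b by rewrite subr_gt0.
near=> n; have n0 : 0 < n.+1%:R^-1 :> R by rewrite invr_gt0.
have nb : n.+1%:R^-1 < b - a by near: n; exact: small.
have nx : n.+1%:R^-1 < x - b by near: n; exact: small.
rewrite /step step_val ?(ltW nb)// (lt_geF ax)/= (lt_geF bx)/= ifF; last first.
  by apply/negbTE; rewrite -leNgt; move: nx; set e := n.+1%:R^-1 => nx; lra.
rewrite /= ifF ?mulr0; last first.
  by apply/negbTE; rewrite -leNgt; move: nx; set e := n.+1%:R^-1 => nx; lra.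
by rewrite memNset//= in_itv/= (lt_geF bx) andbF.
Unshelve. all: by end_near. Qed.

Let meas_step a b n : measurable_fun setT (step a b n).
Proof.
by apply: measurable_funM => //; apply: measurable_funB;
  apply: (measurableT_comp (meas_tent _)); exact: measurable_funB.
Qed.

Let step_law dd (O : measurableType dd) (Q : probability O R) (V : O -> R) a b :
  a < b -> measurable_fun setT V ->
  \int[Q]_w step a b n (V w) @[n --> \oo] --> fine (Q (V @^-1` `]a, b])).
Proof.
move=> ab mV.
have mA : measurable (V @^-1` `]a, b]) by rewrite -[X in measurable X]setTI; exact: mV.
have -> : fine (Q (V @^-1` `]a, b])) = \int[Q]_w (\1_(`]a, b]%classic) (V w) : R).
  rewrite /Rintegral (eq_integral (fun w => (\1_(V @^-1` `]a, b]) w)%:E))//.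
  by rewrite integral_indic// setIT.
have ba0 : 0 < b - a by rewrite subr_gt0.
(* The trapezoid has its shape only when 1/(n+1) <= b - a; the first terms are dropped. *)
have [N _ HN] := near_infty_natSinv_lt (PosNum ba0).
rewrite -(cvg_shiftn N).
apply: (@dct_pt _ _ _ Q (fun n w => step a b (n + N) (V w)) _ (fun=> 1)).
- by move=> n; exact: (measurableT_comp (@meas_step a b _)).
- by move=> w; have := @step_cvg a b (V w) ab; rewrite -(cvg_shiftn N).
- exact: finite_measure_integrable_cst.
- move=> n w; apply: step_bnd => //; apply: ltW; apply: HN => /=.
  exact: leq_addl.
Qed.

(** The cosines determine the expectations of tents, hence of trapezoids, hence the masses of
    half-open intervals, which form a pi-system. *)
Lemma law_unique : same_law P P1 X Y.
Proof.
move=> A mA.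
change (distribution P (mkmfun mX) A = distribution P1 (mkmfun mY) A).
apply: (@measure_unique _ R _ (@ocitv R) (fun n => `](- n%:R), n%:R]%classic)) => //.
- exact: ocitvI.
- by move=> i; exact: is_ocitv.
- apply/seteqP; split => // x _; exists (Num.bound `|x|) => //=.
  have := archi_boundP (normr_ge0 x); rewrite ltr_norml in_itv/= => /andP[-> /ltW ->].
  by [].
- move=> _ [[a b] _ <-] /=.
  have [ab|ba] := ltP a b; last first.
    by rewrite set_itv_ge ?bnd_simp -?leNgt// !measure0.
  change (P (X @^-1` `]a, b]) = P1 (Y @^-1` `]a, b])).
  have mI : measurable (`]a, b]%classic : set R) by [].
  rewrite -[LHS]fineK; last first.
    by rewrite fin_num_measure// -[X in measurable X]setTI; exact: mX.
  rewrite -[RHS]fineK; last first.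
    by rewrite fin_num_measure// -[X in measurable X]setTI; exact: mY.
  congr EFin.
  have ba0 : 0 < b - a by rewrite subr_gt0.
  have [N _ HN] := near_infty_natSinv_lt (PosNum ba0).
  suff H2 : \int[P]_w step a b n (X w) @[n --> \oo] --> fine (P1 (Y @^-1` `]a, b])).
    have H1 := @step_law _ _ P _ _ _ ab mX.
    by rewrite -(cvg_lim (@Rhausdorff R) H2) (cvg_lim (@Rhausdorff R) H1).
  have H3 := @step_law _ _ P1 _ _ _ ab mY; apply: cvg_trans H3; apply: near_eq_cvg.
  exists N => // n /= /HN /= /ltW nb.
  have i1 dd (O : measurableType dd) (Q : probability O R) (V : O -> R) (t c : R) :
      measurable_fun setT V -> 0 <= t -> integ Q (fun w => tent t (V w - c)).
    by move=> mV t0; apply: bdm_integ; apply: bdm_tent => //; exact: measurable_funB.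
  have n0 : 0 <= n.+1%:R^-1 :> R by rewrite invr_ge0.
  have t1 : 0 <= (b - a + n.+1%:R^-1) / 2 by rewrite divr_ge0// addr_ge0// ltW.
  have t2 : 0 <= (b - a - n.+1%:R^-1) / 2 by rewrite divr_ge0// subr_ge0.
  rewrite /step RintZ; last by apply: integB; exact: i1.
  rewrite RintZ; last by apply: integB; exact: i1.
  congr (_ * _); rewrite RintB; [|exact: i1..]; rewrite RintB; [|exact: i1..].
  by rewrite !same_tent.
- by move=> k; rewrite (le_lt_trans (probability_le1 _ _))// ltry.
Qed.

End law_unique.

(** * Convergence in law from cosine transforms *)

Section tent_partition.
Context {R : realType}.

Let clamp (x : R) : R := Num.min 1 (Num.max 0 x).

Let tent1E x : tent 1 x = clamp (x + 1) - clamp x.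
Proof.
rewrite /tent /clamp; have [x0|x0] := leP 0 x.
  rewrite (ger0_norm x0) [Num.max 0 (x + 1)]max_r; last by lra.
  rewrite [Num.min 1 (x + 1)]min_l; last by lra.
  rewrite ?[Num.max 0 x]max_r//.
  by have [x1|x1] := leP 1 x; [rewrite max_l; lra|rewrite max_r; lra].
rewrite (ltr0_norm x0) [Num.min 1 0]min_r//.
have [x1|x1] := leP 0 (x + 1).
  by rewrite min_r; [rewrite max_r; lra|lra].
by rewrite min_r// max_l; lra.
Qed.

(** By [tent1E] the tents are increments of [clamp], and the sum telescopes. *)
Lemma sum_tent (N : nat) (x : R) :
  \sum_(k < N.+1) tent 1 (x - k%:R) = clamp (x + 1) - clamp (x - N%:R).
Proof.
elim: N => [|N IH]; first by rewrite big_ord_recl big_ord0 tent1E subr0 addr0.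
rewrite big_ord_recr/= IH tent1E -[in X in _ + X]natr1.
rewrite (_ : x - (N%:R + 1) + 1 = x - N%:R); last by ring.
by rewrite -natr1; lra.
Qed.

Lemma sum_tent_le1 (N : nat) (x : R) : \sum_(k < N.+1) tent 1 (x - k%:R) <= 1.
Proof.
rewrite sum_tent; have : clamp (x + 1) <= 1 by rewrite /clamp ge_min lexx.
have : 0 <= clamp (x - N%:R) by rewrite /clamp le_min ler01 le_max lexx.
lra.
Qed.

Lemma sum_tent_eq1 (N : nat) (x : R) : 0 <= x -> x <= N%:R ->
  \sum_(k < N.+1) tent 1 (x - k%:R) = 1.
Proof.
move=> x0 xN; rewrite sum_tent /clamp [Num.max 0 (x + 1)]max_r; last by lra.
rewrite min_l; last by lra.
by rewrite max_l ?subr_le0// min_r// subr0.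
Qed.

Variable n : nat.
Local Notation grid m := {ffun 'I_n -> 'I_(2 * m * m).+1}.

(* multilinear tent functions centred at the points (k_i - m^2) / m *)
Definition hat (m : nat) (k : grid m) (y : 'I_n -> R) : R :=
  \prod_(i < n) tent 1 (m%:R * y i - ((k i)%:R - (m * m)%:R)).

Lemma hat_ge0 m k y : 0 <= @hat m k y.
Proof. by apply: prodr_ge0 => i _; exact: tent_ge0. Qed.

Let hatE m (k : grid m) y : hat k y =
  \prod_(i < n) tent 1 (m%:R * y i + (m * m)%:R - (k i)%:R).
Proof. by apply: eq_bigr => i _; congr tent; ring. Qed.

Lemma sum_hat_le1 m y : \sum_(k : grid m) hat k y <= 1.
Proof.
under eq_bigr do rewrite hatE.
rewrite -(bigA_distr_bigA (fun i (j : 'I_(2 * m * m).+1) => tent 1 (m%:R * y i + (m * m)%:R - j%:R))).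
apply: prodr_ile1 => i _; rewrite sum_tent_le1 andbT.
by apply: sumr_ge0 => j _; exact: tent_ge0.
Qed.

Lemma sum_hat_eq1 m y : (forall i, `|y i| <= m%:R) ->
  \sum_(k : grid m) hat k y = 1.
Proof.
move=> ym; under eq_bigr do rewrite hatE.
rewrite -(bigA_distr_bigA (fun i (j : 'I_(2 * m * m).+1) => tent 1 (m%:R * y i + (m * m)%:R - j%:R))).
apply: big1 => i _; have := ym i; rewrite ler_norml => /andP[h1 h2].
have m0 : 0 <= m%:R :> R by [].
apply: sum_tent_eq1; rewrite !natrM; nra.
Qed.

Lemma hat_neq0 m (k : grid m) y : hat k y != 0 ->
  forall i, `|m%:R * y i - ((k i)%:R - (m * m)%:R)| < 1.
Proof.
move=> h i; rewrite ltNge; apply: contra h => h.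
apply/prodf_eq0; exists i => //.
by rewrite /tent max_l// subr_le0.
Qed.

Variable f : 'rV[R]_n -> R.
Hypothesis cf : continuous f.
Hypothesis f0 : forall y, 0 <= f y.

Let cell m (k : grid m) := [set f y | y in
  [set y : 'rV[R]_n | forall i, `|m%:R * y 0 i - ((k i)%:R - (m * m)%:R)| <= 1]].

(** A nonnegative combination of products of tents lying below [f]: each hat is weighted by the
    infimum of [f] over its support. *)
Definition lower m (y : 'I_n -> R) : R := \sum_(k : grid m) inf (cell k) * hat k y.

Let cell_lb m (k : grid m) : has_lbound (cell k).
Proof. by exists 0 => _ [y _ <-]. Qed.

Let inf_cell_ge0 m (k : grid m) : 0 <= inf (cell k).
Proof.
have [->|ne] := eqVneq (cell k) set0; first by rewrite inf0.
by apply: lb_le_inf; [exact/set0P|move=> _ [y _ <-]].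
Qed.

Lemma lower_ge0 m y : 0 <= lower m y.
Proof. by apply: sumr_ge0 => k _; rewrite mulr_ge0// hat_ge0. Qed.

Lemma lower_le m (y : 'I_n -> R) : lower m y <= f (\row_i y i).
Proof.
apply: (@le_trans _ _ (\sum_(k : grid m) f (\row_i y i) * hat k y)); last first.
  by rewrite -mulr_sumr ler_piMr// sum_hat_le1.
apply: ler_sum => k _; have [->|h] := eqVneq (hat k y) 0; first by rewrite !mulr0.
apply: ler_wpM2r; first exact: hat_ge0.
apply: ge_inf => //; exists (\row_i y i) => //= i; rewrite mxE ltW//.
exact: hat_neq0.
Qed.

Lemma lower_cvg (y : 'I_n -> R) : lower m y @[m --> \oo] --> f (\row_i y i).
Proof.
apply/cvgrPdist_le => e e0.
have := @cf (\row_i y i) => /cvgrPdist_le /(_ _ e0)/nbhs_ballP[d /= d0 Hd].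
near=> m.
have m0 : (0 : R) < m%:R by near: m; exact: nbhs_infty_gtr.
have ym i : `|y i| <= m%:R.
  have : \sum_(j < n) `|y j| <= m%:R by near: m; exact: nbhs_infty_ger.
  by apply: le_trans; rewrite (bigD1 i)//= lerDl sumr_ge0.
have md : 2 / d < m%:R by near: m; exact: nbhs_infty_gtr.
rewrite ger0_norm ?subr_ge0 ?lower_le//.
rewrite lerBlDr -lerBlDl.
have -> : f (\row_i y i) - e = \sum_(k : grid m) (f (\row_i y i) - e) * hat k y.
  by rewrite -mulr_sumr sum_hat_eq1// mulr1.
apply: ler_sum => k _; have [->|h] := eqVneq (hat k y) 0; first by rewrite !mulr0.
apply: ler_wpM2r; first exact: hat_ge0.
apply: lb_le_inf.
  exists (f (\row_i y i)); exists (\row_i y i) => //= i; rewrite mxE ltW//.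
  exact: hat_neq0.
move=> _ [x /= hx <-].
suff : `|f (\row_i y i) - f x| <= e by rewrite ler_norml => /andP[_]; lra.
apply: Hd; split => // i j; rewrite mxE ord1 /ball/=.
have h1 := hx j; have h2 := hat_neq0 h j.
(* [x] lies in the cell of a hat that does not vanish at [y], so each coordinate of [x] is within
   2/m of that of [y]. *)
have h3 : `|m%:R * (y j - x 0 j)| < 2.
  rewrite (_ : m%:R * (y j - x 0 j) = (m%:R * y j - ((k j)%:R - (m * m)%:R))
    - (m%:R * x 0 j - ((k j)%:R - (m * m)%:R))); last by ring.
  by apply: le_lt_trans (ler_normB _ _) _; lra.
rewrite normrM (ger0_norm (ltW m0)) mulrC -ltr_pdivlMr// in h3.
apply: lt_trans h3 _; rewrite ltr_pdivrMr// mulrC.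
by rewrite ltr_pdivrMr in md.
Unshelve. all: by end_near. Qed.

End tent_partition.

Lemma continuous_addc {R : realType} (T : topologicalType) (f : T -> R) (M : R) :
  continuous f -> continuous (fun y => f y + M).
Proof. by move=> cf y; apply: cvgD; [exact: cf|exact: cvg_cst]. Qed.

Lemma continuous_opp_fun {R : realType} (T : topologicalType) (f : T -> R) :
  continuous f -> continuous (fun y => - f y).
Proof. by move=> cf y; apply: cvgN; exact: cf. Qed.

Section weak.
Context {R : realType}.
Local Notation leb := (@lebesgue_measure R).
Context d (Om : measurableType d) (P : probability Om R).
Context d' (Om' : measurableType d') (P' : probability Om' R).
Variables (n : nat) (Y : nat -> 'I_n -> Om -> R) (Z : 'I_n -> Om' -> R).
Hypotheses (mY : forall k i, measurable_fun setT (Y k i)).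
Hypotheses (mZ : forall i, measurable_fun setT (Z i)).
Hypothesis YZ : forall (b : 'I_n -> R) th,
  \int[P]_w cos (\sum_(i < n) b i * Y k i w + th) @[k --> \oo] -->
  \int[P']_w cos (\sum_(i < n) b i * Z i w + th).

Let Phi dd (O : measurableType dd) (V : 'I_n -> O -> R) (M : R) (c : 'I_n -> R)
  (s : seq 'I_n) (w : O) := \prod_(i <- s) tent 1 (M * V i w - c i).

Let bdm_Phi dd (O : measurableType dd) (V : 'I_n -> O -> R) M c s :
  (forall i, measurable_fun setT (V i)) -> bdm (Phi V M c s).
Proof.
move=> mV; apply: bdm_prod => i; apply: bdm_tent => //.
by apply: measurable_funB => //; exact: measurable_funM.
Qed.

Let meas_lin dd (O : measurableType dd) (V : 'I_n -> O -> R) (b : 'I_n -> R) th :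
  (forall i, measurable_fun setT (V i)) ->
  measurable_fun setT (fun w => \sum_(i < n) b i * V i w + th).
Proof.
move=> mV; apply: measurable_funD => //; apply: measurable_sum => i.
exact: measurable_funM.
Qed.

(* one more tent factor, opened by its cosine transform *)
Let Phi_cons dd (O : measurableType dd) (Q : probability O R) (V : 'I_n -> O -> R)
    M c i s (b : 'I_n -> R) th : (forall i, measurable_fun setT (V i)) ->
  c1 * \int[Q]_w (Phi V M c (i :: s) w * cos (\sum_(i < n) b i * V i w + th)) =
  \int[leb]_z ((2^-1 * (\int[Q]_w (Phi V M c s w *
        cos (\sum_(j < n) (b j + (if j == i then z * M else 0)) * V j w + (th - z * c i))) +
      \int[Q]_w (Phi V M c s w *
        cos (\sum_(j < n) (b j - (if j == i then z * M else 0)) * V j w + (th + z * c i)))))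
   * ((1 - cos (1 * z)) / z ^+ 2)).
Proof.
move=> mV.
have bP := bdm_Phi M c s mV.
have bc b' th' : bdm (fun w => cos (\sum_(i < n) b' i * V i w + th')).
  by apply: bdm_cos; exact: meas_lin.
have := @tent_fubini R _ _ Q (fun w => Phi V M c s w * cos (\sum_(i < n) b i * V i w + th))
  (fun w => M * V i w - c i) 1 ler01 _ _.
rewrite (eq_Rint Q (fun w => Phi V M c (i :: s) w * cos (\sum_(i < n) b i * V i w + th))); last first.
  by move=> w; rewrite /Phi big_cons; ring.
move=> ->; last 2 first.
- by apply: bdmM => //; exact: bc.
- by apply: measurable_funB => //; exact: measurable_funM.
apply: eq_Rint => z; congr (_ * _).
rewrite -RintD; last 2 first.
- by apply: bdm_integ; apply: bdmM.
- by apply: bdm_integ; apply: bdmM.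
rewrite -RintZ; last first.
  by apply: integD; apply: bdm_integ; apply: bdmM.
apply: eq_Rint => w; rewrite -mulrDr.
have S sg : \sum_(j < n) (b j + sg * (if j == i then z * M else 0)) * V j w =
    \sum_(j < n) b j * V j w + sg * (z * M * V i w).
  under eq_bigr do rewrite mulrDl.
  rewrite big_split/=; congr (_ + _); rewrite (bigD1 i)//= eqxx big1 ?addr0 ?mulrA//.
  by move=> j /negbTE ->; rewrite mulr0 mul0r.
have S1 : \sum_(j < n) (b j + (if j == i then z * M else 0)) * V j w =
    \sum_(j < n) b j * V j w + 1 * (z * M * V i w).
  by rewrite -S; apply: eq_bigr => j _; rewrite mul1r.
have S2 : \sum_(j < n) (b j - (if j == i then z * M else 0)) * V j w =
    \sum_(j < n) b j * V j w + -1 * (z * M * V i w).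
  by rewrite -S; apply: eq_bigr => j _; rewrite mulN1r.
rewrite S1 S2; set X := \sum_(_ < _) _.
rewrite (_ : X + 1 * (z * M * V i w) + (th - z * c i) = (X + th) + z * (M * V i w - c i)); last by ring.
rewrite (_ : X + -1 * (z * M * V i w) + (th + z * c i) = (X + th) - z * (M * V i w - c i)); last by ring.
rewrite (cosD (X + th)) (cosB (X + th)); by field.
Qed.

(** Induction on the number of tent factors. Opening one alters the frequencies [b] and the phase
    [th], hence both are general; the limit passes under the integral in z by domination. *)
Let Phi_cvg M c s b th :
  \int[P]_w (Phi (Y k) M c s w * cos (\sum_(i < n) b i * Y k i w + th)) @[k --> \oo] -->
  \int[P']_w (Phi Z M c s w * cos (\sum_(i < n) b i * Z i w + th)).
Proof.
elim: s b th => [|i s IH] b th.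
  rewrite (eq_Rint P' (fun w => cos (\sum_(i < n) b i * Z i w + th))); last first.
    by move=> w; rewrite /Phi big_nil mul1r.
  under eq_fun do under eq_Rintegral do rewrite /Phi big_nil mul1r.
  exact: YZ.
have H : c1 * \int[P]_w (Phi (Y k) M c (i :: s) w * cos (\sum_(i < n) b i * Y k i w + th)) @[k --> \oo] -->
  c1 * \int[P']_w (Phi Z M c (i :: s) w * cos (\sum_(i < n) b i * Z i w + th)).
  rewrite Phi_cons//.
  rewrite (_ : (fun k => _) = (fun k => \int[leb]_z ((2^-1 * (\int[P]_w (Phi (Y k) M c s w *
        cos (\sum_(j < n) (b j + (if j == i then z * M else 0)) * Y k j w + (th - z * c i))) +
      \int[P]_w (Phi (Y k) M c s w *
        cos (\sum_(j < n) (b j - (if j == i then z * M else 0)) * Y k j w + (th + z * c i)))))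
   * ((1 - cos (1 * z)) / z ^+ 2)))); last by apply/funext => k; exact: Phi_cons.
  have bnd dd (O : measurableType dd) (Q : probability O R) (V : 'I_n -> O -> R) b' th' :
      (forall i, measurable_fun setT (V i)) ->
      `|\int[Q]_w (Phi V M c s w * cos (\sum_(i < n) b' i * V i w + th'))| <= 1.
    move=> mV.
    have -> : 1 = \int[Q]_w (1 : R) by rewrite Rintegral_cst// mul1r [X in fine X](probability_setT Q).
    apply: Rint_abs_le.
    - by apply: bdm_integ; apply: bdmM; [exact: bdm_Phi|apply: bdm_cos; exact: meas_lin].
    - exact: finite_measure_integrable_cst.
    - move=> w; rewrite normrM -[leRHS]mulr1; apply: ler_pM => //; last exact: cos_max.
      rewrite /Phi normr_prod; apply: prodr_ile1 => j _.
      by rewrite normr_ge0/= ger0_norm ?tent_ge0// tent_le.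
  apply: (@dct_pt _ _ _ leb _ _ (fun z => (1 - cos (1 * z)) / z ^+ 2)).
  - move=> k; apply: measurable_funM; last exact: (integ_meas (integ_q 1)).
    apply: measurable_funM => //; apply: measurable_funD.
      apply: bdm_meas; apply: (@bdm_Rint2 _ _ R Om R P (fun p : R * Om => Phi (Y k) M c s p.2 * cos (\sum_(j < n) (b j + (if j == i then p.1 * M else 0)) * Y k j p.2 + (th - p.1 * c i)))).
      apply: bdmM; first exact: (bdm_comp (bdm_Phi M c s (mY k)) measurable_snd).
      apply: bdm_cos; apply: measurable_funD; last by apply: measurable_funB => //; apply: measurable_funM.
      apply: measurable_sum => j; apply: measurable_funM; last exact: (measurableT_comp (mY k j)).
      by apply: measurable_funD => //; case: (j == i) => //; apply: measurable_funM.
    apply: bdm_meas; apply: (@bdm_Rint2 _ _ R Om R P (fun p : R * Om => Phi (Y k) M c s p.2 * cos (\sum_(j < n) (b j - (if j == i then p.1 * M else 0)) * Y k j p.2 + (th + p.1 * c i)))).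
    apply: bdmM; first exact: (bdm_comp (bdm_Phi M c s (mY k)) measurable_snd).
    apply: bdm_cos; apply: measurable_funD; last by apply: measurable_funD => //; apply: measurable_funM.
    apply: measurable_sum => j; apply: measurable_funM; last exact: (measurableT_comp (mY k j)).
    by apply: measurable_funB => //; case: (j == i) => //; apply: measurable_funM.
  - by move=> z; apply: cvgMl; apply: cvgMr; apply: cvgD; exact: IH.
  - exact: integ_q.
  - move=> k z; rewrite normrM [X in _ * X]ger0_norm ?q_ge0// ler_piMl ?q_ge0//.
    rewrite normrM ger0_norm ?invr_ge0//.
    apply: le_trans (ler_wpM2l _ (ler_normD _ _)) _; first by rewrite invr_ge0.
    have := bnd _ _ P (Y k) (fun j => b j + (if j == i then z * M else 0)) (th - z * c i) (mY k).
    have := bnd _ _ P (Y k) (fun j => b j - (if j == i then z * M else 0)) (th + z * c i) (mY k).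
    lra.
have E (x : R) : x = c1^-1 * (c1 * x) by rewrite mulKf// c1_neq0.
rewrite [X in _ --> X]E [X in X @ _ --> _](_ : _ = (fun k => c1^-1 * (c1 *
  \int[P]_w (Phi (Y k) M c (i :: s) w * cos (\sum_(i < n) b i * Y k i w + th))))).
  exact: cvgMr.
by apply/funext => k; exact: E.
Qed.

Let lower_bdm dd (O : measurableType dd) (V : 'I_n -> O -> R) (f : 'rV[R]_n -> R) m :
  (forall i, measurable_fun setT (V i)) -> bdm (fun w => lower f m (fun i => V i w)).
Proof.
move=> mV; apply: bdm_sum => k; apply: bdmM; first exact: bdm_cst.
exact: (bdm_Phi m%:R _ (index_enum 'I_n) mV).
Qed.

Let lower_cvgE (f : 'rV[R]_n -> R) m :
  \int[P]_w lower f m (fun i => Y k i w) @[k --> \oo] -->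
  \int[P']_w lower f m (fun i => Z i w).
Proof.
(* The cosine with zero frequencies and zero phase is 1; it only puts the terms in the form of
   [Phi_cvg]. *)
have E dd (O : measurableType dd) (Q : probability O R) (V : 'I_n -> O -> R) :
    (forall i, measurable_fun setT (V i)) ->
    \int[Q]_w lower f m (fun i => V i w) = \sum_(k : {ffun 'I_n -> 'I_(2 * m * m).+1})
    (inf [set f y | y in [set y : 'rV[R]_n | forall i, `|m%:R * y 0 i - ((k i)%:R - (m * m)%:R)| <= 1]] *
    \int[Q]_w (Phi V m%:R (fun i => (k i)%:R - (m * m)%:R) (index_enum 'I_n) w
      * cos (\sum_(i < n) 0 * V i w + 0))).
  move=> mV; rewrite /lower Rint_sum.
    apply: eq_bigr => k _; rewrite RintZ; last by apply: bdm_integ; exact: (bdm_Phi m%:R _ (index_enum 'I_n) mV).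
    congr (_ * _); apply: eq_Rint => w; rewrite big1 ?addr0 ?cos0 ?mulr1//.
    by move=> i _; rewrite mul0r.
  by move=> k; apply: integZ; apply: bdm_integ; exact: (bdm_Phi m%:R _ (index_enum 'I_n) mV).
rewrite E//.
rewrite (_ : (fun k => _) = (fun k => \sum_(j : {ffun 'I_n -> 'I_(2 * m * m).+1})
    (inf [set f y | y in [set y : 'rV[R]_n | forall i, `|m%:R * y 0 i - ((j i)%:R - (m * m)%:R)| <= 1]] *
    \int[P]_w (Phi (Y k) m%:R (fun i => (j i)%:R - (m * m)%:R) (index_enum 'I_n) w
      * cos (\sum_(i < n) 0 * Y k i w + 0))))); last by apply/funext => k; exact: E.
apply: cvg_big => [|k _]; first exact: add_continuous.
apply: cvgMr; exact: Phi_cvg.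
Qed.

(** Obtained as a limit of the functions [lower], which are explicitly measurable in the
    coordinates, so that no sigma-algebra on row vectors is invoked. [f] is shifted by its bound
    because [lower] approximates nonnegative functions. *)
Lemma meas_row_comp dd (O : measurableType dd) (V : 'I_n -> O -> R) (f : 'rV[R]_n -> R) :
  (forall i, measurable_fun setT (V i)) -> continuous f ->
  (exists M : R, forall y, `|f y| <= M) ->
  measurable_fun setT (fun w => f (\row_i V i w)).
Proof.
move=> mV cf [M fM]; pose g y := f y + M.
have g0 y : 0 <= g y.
  by rewrite /g -lerBlDr sub0r; have := fM y; rewrite ler_norml => /andP[].
have cg : continuous g by exact: continuous_addc.
have mg : measurable_fun setT (fun w => g (\row_i V i w)).
  apply: (@measurable_fun_cvg _ _ _ setT (fun m w => lower g m (fun i => V i w))) => //.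
    by move=> m; apply: bdm_meas; exact: lower_bdm.
  by move=> w _; exact: lower_cvg.
rewrite (_ : (fun w => _) = (fun w => g (\row_i V i w) - M)).
  exact: measurable_funB.
by apply/funext => w; rewrite /g addrK.
Qed.

(** A lower bound asks for no control of the mass far away, since [lower g m] stays below [g]
    everywhere. Applied to -f it gives the upper bound, as both measures have total mass 1; this
    takes the place of a tightness argument. *)
Let weak_lower (f : 'rV[R]_n -> R) : continuous f ->
  (exists M : R, forall y, `|f y| <= M) -> forall e, 0 < e ->
  \forall k \near \oo, \int[P']_w f (\row_i Z i w) - e <= \int[P]_w f (\row_i Y k i w).
Proof.
move=> cf [M fM] e e0; pose g y := f y + M.
have g0 y : 0 <= g y.
  by rewrite /g -lerBlDr sub0r; have := fM y; rewrite ler_norml => /andP[].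
have cg : continuous g by exact: continuous_addc.
have ib dd (O : measurableType dd) (Q : probability O R) (V : 'I_n -> O -> R) :
    (forall i, measurable_fun setT (V i)) -> integ Q (fun w => f (\row_i V i w)).
  move=> mV; apply: bdm_integ; split; last by exists M => w.
  by apply: meas_row_comp => //; exists M.
have fg dd (O : measurableType dd) (Q : probability O R) (V : 'I_n -> O -> R) :
    (forall i, measurable_fun setT (V i)) ->
    \int[Q]_w g (\row_i V i w) = \int[Q]_w f (\row_i V i w) + M.
  move=> mV; rewrite RintD//; last 2 first.
  - exact: ib.
  - exact: finite_measure_integrable_cst.
  by rewrite Rintegral_cst// [X in fine X](probability_setT Q)/= mulr1.
have c1_ : \int[P']_w lower g m (fun i => Z i w) @[m --> \oo] --> \int[P']_w g (\row_i Z i w).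
  apply: (@dct_pt _ _ _ P' (fun m w => lower g m (fun i => Z i w)) _ (fun=> M + M)).
  - by move=> m; apply: bdm_meas; exact: lower_bdm.
  - by move=> w; exact: lower_cvg.
  - exact: finite_measure_integrable_cst.
  - move=> m w; rewrite ger0_norm ?lower_ge0//.
    apply: le_trans (lower_le g0 _ _) _; rewrite /g lerD2r.
    by apply: le_trans (ler_norm _) _.
have e2 : 0 < e / 2 by rewrite divr_gt0.
move/cvgrPdist_le : c1_ => /(_ _ e2)[m _ /(_ m (leqnn m))/=].
rewrite fg// => hm.
have := @lower_cvgE g m => /cvgrPdist_le /(_ _ e2).
apply: filterS => k hk.
have : \int[P]_w lower g m (fun i => Y k i w) <= \int[P]_w g (\row_i Y k i w).
  apply: le_Rint.
  - by apply: bdm_integ; exact: lower_bdm.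
  - apply: integD; first exact: ib.
    exact: finite_measure_integrable_cst.
  - by move=> w; exact: lower_le.
rewrite fg//; move: hm hk; rewrite !ler_norml => /andP[_ h1] /andP[_ h2] h3; lra.
Qed.

Lemma weak_cvg (f : 'rV[R]_n -> R) : continuous f ->
  (exists M : R, forall y, `|f y| <= M) ->
  \int[P]_w f (\row_i Y k i w) @[k --> \oo] --> \int[P']_w f (\row_i Z i w).
Proof.
move=> cf [M fM]; apply/cvgrPdist_le => e e0.
have h1 : \forall k \near \oo, \int[P']_w f (\row_i Z i w) - e <= \int[P]_w f (\row_i Y k i w).
  by apply: weak_lower => //; exists M.
have ib dd (O : measurableType dd) (Q : probability O R) (V : 'I_n -> O -> R) :
    (forall i, measurable_fun setT (V i)) -> integ Q (fun w => f (\row_i V i w)).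
  move=> mV; apply: bdm_integ; split; last by exists M => w.
  by apply: meas_row_comp => //; exists M.
have h2 : \forall k \near \oo, \int[P']_w (- f (\row_i Z i w)) - e <= \int[P]_w (- f (\row_i Y k i w)).
  apply: (weak_lower (f := fun y => - f y)) => //.
    exact: continuous_opp_fun.
  by exists M => y; rewrite normrN.
near=> k.
have a1 : \int[P']_w f (\row_i Z i w) - e <= \int[P]_w f (\row_i Y k i w) by near: k.
have : \int[P']_w (- f (\row_i Z i w)) - e <= \int[P]_w (- f (\row_i Y k i w)) by near: k.
rewrite !RintN; [|exact: ib..] => a2.
by rewrite ler_norml; apply/andP; split; lra.
Unshelve. all: by end_near. Qed.

End weak.

(** * Campbell's formulas *)

Section double_series.
Context {R : realType}.
Local Open Scope ereal_scope.

Lemma nneseries_cvg (a : nat -> \bar R) : (forall i, 0 <= a i) ->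
  \sum_(i < n) a i @[n --> \oo] --> \sum_(i <oo) a i.
Proof.
move=> a0.
have := @is_cvg_nneseries R a xpredT 0 (fun n _ _ => a0 n).
by under eq_fun do rewrite big_mkord.
Qed.

Lemma sum_le_nneseries (a : nat -> \bar R) n : (forall i, 0 <= a i) ->
  \sum_(i < n) a i <= \sum_(i <oo) a i.
Proof.
by move=> a0; have := @nneseries_lim_ge R a xpredT 0 n (fun k _ _ => a0 k); rewrite big_mkord.
Qed.

(** Squares are used since the square of an n-th partial sum is a sum over an n by n array. *)
Lemma square_sums_cvg (a : nat -> nat -> \bar R) : (forall i j, 0 <= a i j) ->
  \sum_(i < n) \sum_(j < n) a i j @[n --> \oo] --> \sum_(i <oo) \sum_(j <oo) a i j.
Proof.
move=> a0.
have s0 i : 0 <= \sum_(j <oo) a i j by apply: nneseries_ge0.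
have nd : {homo (fun n => \sum_(i < n) \sum_(j < n) a i j) : n m / (n <= m)%N >-> n <= m}.
  move=> n m nm.
  apply: (@le_trans _ _ (\sum_(i < n) \sum_(j < m) a i j)).
    apply: lee_sum => i _; rewrite -!(big_mkord xpredT (fun j => a i j)).
    by apply: lee_sum_nneg_natr.
  rewrite -!(big_mkord xpredT (fun i => \sum_(j < m) a i j)).
  by apply: lee_sum_nneg_natr => // i _ _; apply: sume_ge0.
have C := ereal_nondecreasing_is_cvgn nd.
suff <- : limn (fun n => \sum_(i < n) \sum_(j < n) a i j) = \sum_(i <oo) \sum_(j <oo) a i j.
  exact: C.
apply/eqP; rewrite eq_le; apply/andP; split.
  apply: lime_le => //; apply: nearW => n.
  apply: le_trans (sum_le_nneseries n s0); apply: lee_sum => i _.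
  exact: sum_le_nneseries.
apply: lime_le; first exact: is_cvg_nneseries.
apply: nearW => m; rewrite big_mkord.
have C2 : \sum_(i < m) \sum_(j < n) a i j @[n --> \oo] --> \sum_(i < m) \sum_(j <oo) a i j.
  apply: cvg_nnesum => [i _|i _].
    by apply: nearW => n; apply: sume_ge0.
  exact: nneseries_cvg.
rewrite -(cvg_lim _ C2)//; apply: lee_lim.
- by apply/cvg_ex; eexists; exact: C2.
- exact: C.
near=> n.
rewrite -!(big_mkord xpredT (fun i => \sum_(j < n) a i j)).
apply: lee_sum_nneg_natr => //; last by near: n; exact: nbhs_infty_ge.
by move=> i _ _; apply: sume_ge0.
Unshelve. all: by end_near. Qed.

End double_series.

(** * First two moments of Poisson variables *)

Section poisson_moments.
Context {R : realType} (l : R).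
Hypothesis l0 : 0 <= l.
Local Open Scope ereal_scope.

Definition ppmf (k : nat) : R := (expR (- l) * l ^+ k / k`!%:R)%R.

Lemma ppmf_ge0 k : (0 <= ppmf k)%R.
Proof. by rewrite /ppmf divr_ge0// mulr_ge0 ?expR_ge0// exprn_ge0. Qed.

Lemma ppmf_sum : \sum_(k <oo) (ppmf k)%:E = 1.
Proof.
have -> : 1 = (expR (- l) * expR l)%:E by rewrite -expRD addNr expR0.
rewrite /ppmf; under eq_eseriesr do rewrite -mulrA EFinM.
rewrite nneseriesZl; last by move=> k _; rewrite lee_fin divr_ge0// exprn_ge0.
rewrite EFinM; congr (_ * _).
rewrite /expR -EFin_lim; last exact: is_cvg_series_exp_coeff.
by apply/congr_lim/funext => n; rewrite /series/= -sumEFin.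
Qed.

(** Both moments follow from this recurrence by shifting the summation index. *)
Lemma ppmfS k : (k.+1%:R * ppmf k.+1 = l * ppmf k)%R.
Proof.
rewrite /ppmf factS natrM exprS invfM.
set F := (k`!%:R^-1)%R; set E := expR _.
have k0 : (k.+1%:R : R) != 0%R by rewrite pnatr_eq0.
by field.
Qed.

Lemma ppmf_mean : \sum_(k <oo) (k%:R * ppmf k)%:E = l%:E.
Proof.
rewrite nneseries_recl//; last by move=> k _; rewrite lee_fin mulr_ge0// ppmf_ge0.
rewrite mul0r add0e -(@nneseries_addn R _ 1)//; last first.
  by move=> k; rewrite lee_fin mulr_ge0// ppmf_ge0.
under eq_eseriesr do rewrite addn1 ppmfS EFinM.
by rewrite nneseriesZl ?ppmf_sum ?mule1// => k _; rewrite lee_fin ppmf_ge0.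
Qed.

Lemma ppmf_sqr : \sum_(k <oo) (k%:R ^+ 2 * ppmf k)%:E = (l * l + l)%:E.
Proof.
rewrite nneseries_recl//; last by move=> k _; rewrite lee_fin mulr_ge0 ?sqr_ge0// ppmf_ge0.
rewrite expr0n mul0r add0e -(@nneseries_addn R _ 1)//; last first.
  by move=> k; rewrite lee_fin mulr_ge0 ?sqr_ge0// ppmf_ge0.
have E k : ((k + 1)%:R ^+ 2 * ppmf (k + 1))%:E = l%:E * ((k%:R * ppmf k)%:E + (ppmf k)%:E).
  by rewrite addn1 expr2 -mulrA ppmfS -EFinD -EFinM -natr1; congr EFin; ring.
rewrite (eq_eseriesr (g := fun k => l%:E * ((k%:R * ppmf k)%:E + (ppmf k)%:E))) => [|k _]; last exact: E.
rewrite nneseriesZl; last first.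
  by move=> k _; rewrite -EFinD lee_fin addr_ge0 ?ppmf_ge0// mulr_ge0// ppmf_ge0.
rewrite nneseriesD; last 2 first.
- by move=> k _ _; rewrite lee_fin mulr_ge0// ppmf_ge0.
- by move=> k _ _; rewrite lee_fin ppmf_ge0.
by rewrite ppmf_mean ppmf_sum -EFinD -EFinM; congr EFin; ring.
Qed.

Context d (Om : measurableType d) (P : probability Om R) (N : Om -> \bar R).
Hypothesis mN : measurable_fun setT N.
Hypothesis N0 : forall w, 0 <= N w.
Hypothesis NP : forall k : nat, P [set w | N w = k%:R%:E] = (ppmf k)%:E.

Lemma poisson_expect (phi : \bar R -> \bar R) : measurable_fun setT phi ->
  (forall x, 0 <= phi x) ->
  \int[P]_w phi (N w) = \sum_(k <oo) phi k%:R%:E * (ppmf k)%:E.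
Proof.
move=> mphi phi0.
pose S k := [set w | N w = k%:R%:E].
have mS k : measurable (S k).
  rewrite (_ : S k = setT `&` N @^-1` [set k%:R%:E]); last by rewrite setTI.
  by apply: mN => //; exact: emeasurable_set1.
have tS : trivIset setT S.
  apply/trivIsetP => i j _ _ ij; rewrite -subset0 => w [h1 h2].
  have h1' : N w = i%:R%:E := h1. have {}h2 : N w = j%:R%:E := h2.
  by move: ij; rewrite h1' in h2; case: h2 => /eqP; rewrite eqr_nat => ->.
have mU : measurable (\bigcup_k S k) by exact: bigcup_measurable.
have mf : measurable_fun setT (fun w => phi (N w)) by exact: measurableT_comp.
(* The natural values already carry total mass 1, so [N] is almost surely a natural number. *)
have PU : P (~` \bigcup_k S k) = 0.
  rewrite probability_setC// measure_bigcup//.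
  rewrite (eq_eseriesr (g := fun k => (ppmf k)%:E)) => [|k _]; last by rewrite -NP.
  rewrite (_ : \sum_(i <oo | i \in [set: nat]) (ppmf i)%:E = 1) ?subee//.
  by rewrite -[RHS]ppmf_sum; apply: eq_eseriesl => i; rewrite mem_set.
rewrite -(setUv (\bigcup_k S k)) ge0_integral_setU//; last 3 first.
- exact: measurableC.
- by rewrite setUv.
- exact/disj_setPCl.
rewrite [X in _ + X](_ : _ = 0); last first.
  by apply: (@null_set_integral _ _ _ P _ _ (measurableC mU)) => //; exact: measurable_funTS.
rewrite adde0 ge0_integral_bigcup//; last exact: measurable_funTS.
apply: eq_eseriesr => k _.
rewrite (eq_integral (fun=> phi k%:R%:E)); last by move=> w; rewrite inE => ->.
by rewrite integral_cst// -NP.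
Qed.

Lemma poisson_E1 : \int[P]_w N w = l%:E.
Proof.
(* [poisson_expect] is stated for functions nonnegative on all extended reals, hence the truncation
   at 0. *)
rewrite (eq_integral (fun w => maxe 0 (N w))); last by move=> w _; rewrite max_r.
rewrite (@poisson_expect (fun x => maxe 0 x)); last 2 first.
- by apply: measurable_maxe.
- by move=> x; rewrite le_max lexx.
rewrite -ppmf_mean; apply: eq_eseriesr => k _.
by rewrite max_r ?lee_fin// EFinM.
Qed.

Lemma poisson_E2 : \int[P]_w (N w * N w) = (l * l + l)%:E.
Proof.
rewrite (eq_integral (fun w => maxe 0 (N w) * maxe 0 (N w))); last by move=> w _; rewrite max_r.
rewrite (@poisson_expect (fun x => maxe 0 x * maxe 0 x)); last 2 first.
- by apply: emeasurable_funM; apply: measurable_maxe.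
- by move=> x; rewrite mule_ge0// le_max lexx.
rewrite -ppmf_sqr; apply: eq_eseriesr => k _.
by rewrite max_r ?lee_fin// -EFinM -EFinM expr2.
Qed.

End poisson_moments.

Section campbell.
Context {R : realType}.
Local Notation leb := (@lebesgue_measure R).
Context d (Om : measurableType d) (P : probability Om R).
Variable x : nat -> Om -> R.
Hypothesis mx : forall i, measurable_fun setT (x i).
Hypothesis prm : poisson_random_measure P leb (fun w => mseries (fun i => \d_(x i w)) 0).
Local Open Scope ereal_scope.

Let M (A : set R) (w : Om) : \bar R := mseries (fun i => \d_(x i w)) 0 A.

Let mM A : measurable A -> measurable_fun setT (M A).
Proof. by case: prm => + _ _ _; exact. Qed.

Let M0 A w : 0 <= M A w.
Proof. exact: measure_ge0. Qed.

Let M1 A : measurable A -> leb A < +oo -> \int[P]_w M A w = leb A.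
Proof.
move=> mA Afin; have [_ + _ _] := prm => /(_ _ mA Afin) h.
rewrite (@poisson_E1 R (fine (leb A)) _ _ _ P (M A))//.
- by rewrite fineK// ge0_fin_numE.
- exact: fine_ge0.
- exact: mM.
Qed.

Let M2 A : measurable A -> leb A < +oo ->
  \int[P]_w (M A w * M A w) = leb A * leb A + leb A.
Proof.
move=> mA Afin; have [_ + _ _] := prm => /(_ _ mA Afin) h.
rewrite (@poisson_E2 R (fine (leb A)) _ _ _ P (M A))//.
- by rewrite EFinD EFinM fineK// ge0_fin_numE.
- exact: fine_ge0.
- exact: mM.
Qed.

Let M1oo A : measurable A -> leb A = +oo -> \int[P]_w M A w = +oo.
Proof.
move=> mA Aoo; have [_ _ + _] := prm => /(_ _ mA Aoo) h.
transitivity (\int[P]_w (+oo : \bar R)).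
  apply: ae_eq_integral => //; first exact: mM.
  by apply: filterS h => w h _.
by rewrite integral_cst// [X in _ * X](probability_setT P) mule1.
Qed.

Let M12 A B : measurable A -> measurable B -> A `&` B = set0 ->
  leb A < +oo -> leb B < +oo ->
  \int[P]_w (M A w * M B w) = leb A * leb B.
Proof.
move=> mA mB AB Afin Bfin; have [_ _ _ ind] := prm.
pose C (i : 'I_2) := if i == 0%N :> nat then A else B.
have mC i : measurable (C i) by rewrite /C; case: ifP.
have tC : trivIset setT C.
  apply/trivIsetP => -[[|[|//]] hi] [[|[|//]] hj] _ _ //= _; rewrite /C/=;
    first [by rewrite AB|by rewrite setIC AB].
have {}ind := ind 2%N C mC tC.
have i2 : indep2 P (M A) (M B).
  move=> U V mU mV.
  pose o0 : 'I_2 := ord0; pose o1 : 'I_2 := lift ord0 ord0.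
  pose D (i : 'I_2) := if i == o0 then M A @^-1` U else M B @^-1` V.
  have := ind [fset o0; o1]%fset D _.
  rewrite (_ : \bigcap_(i in _) D i = M A @^-1` U `&` M B @^-1` V); last first.
    apply/seteqP; split => [w h|w [h1 h2] i /=].
      by split; [have := h o0|have := h o1]; rewrite /= !inE eqxx ?orbT; apply.
    by rewrite !inE /D => /orP[] /eqP ->.
  move=> ->; last first.
    move=> i; rewrite !inE => /orP[] /eqP -> /=; apply: sub_sigma_algebra; exists tt => //.
      by exists U => //; rewrite setTI.
    by exists V => //; rewrite setTI.
  by rewrite big_fsetU1 ?inE//= big_seq_fset1.
have H := @indep2_ge0 _ _ _ P _ _ _ _ (M A) (M B) (mM mA) (mM mB) i2
  (fun p => maxe 0 p.1 * maxe 0 p.2).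
rewrite (eq_integral (fun w => maxe 0 (M A w) * maxe 0 (M B w))); last first.
  by move=> w _; rewrite !max_r.
rewrite H; last 2 first.
- by apply: emeasurable_funM; apply: measurable_maxe => //; exact: measurableT_comp.
- by move=> p; rewrite mule_ge0// le_max lexx.
rewrite (eq_integral (fun w1 => M A w1 * leb B)); last first.
  move=> w1 _ /=; rewrite max_r//.
  rewrite (eq_integral (fun w2 => M A w1 * M B w2)); last by move=> w2 _; rewrite max_r.
  by rewrite ge0_integralZl// ?M1//; exact: mM.
by rewrite ge0_integralZr// ?M1//; exact: mM.
Qed.

(** Split along the intersection: products over disjoint pieces are handled by independence, and
    only the square of the count of the intersection adds its measure. *)
Let MM A B : measurable A -> measurable B -> leb A < +oo -> leb B < +oo ->
  \int[P]_w (M A w * M B w) = leb A * leb B + leb (A `&` B).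
Proof.
move=> mA mB Af Bf.
pose C := A `&` B; pose D1 := A `\` B; pose D2 := B `\` A.
have mC : measurable C by exact: measurableI.
have mD1 : measurable D1 by exact: measurableD.
have mD2 : measurable D2 by exact: measurableD.
have lef E F : measurable E -> measurable F -> E `<=` F -> leb F < +oo -> leb E < +oo.
  by move=> mE mF EF; apply: le_lt_trans; apply: le_measure; rewrite ?inE.
have Cf : leb C < +oo by apply: lef Af => //; exact: subIsetl.
have D1f : leb D1 < +oo by apply: lef Af => //; exact: subDsetl.
have D2f : leb D2 < +oo by apply: lef Bf => //; exact: subDsetl.
have splitA (m : {measure set R -> \bar R}) : m A = m D1 + m C.
  exact: measureDI.
have splitB (m : {measure set R -> \bar R}) : m B = m D2 + m C.
  by rewrite /C setIC; exact: measureDI.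
rewrite (eq_integral (fun w => (M D1 w * M D2 w + M D1 w * M C w) + (M C w * M D2 w + M C w * M C w))); last first.
  move=> w _; rewrite {1}/M splitA {1}/M splitB -/(M D1 w) -/(M D2 w) -/(M C w).
  by rewrite ge0_muleDl ?adde_ge0// !ge0_muleDr.
have mMM E F : measurable E -> measurable F -> measurable_fun setT (fun w => M E w * M F w).
  by move=> mE mF; apply: emeasurable_funM; exact: mM.
have MM0 E F w : 0 <= M E w * M F w by exact: mule_ge0.
rewrite ge0_integralD//; last 4 first.
- by move=> w _; exact: adde_ge0.
- by apply: emeasurable_funD; exact: mMM.
- by move=> w _; exact: adde_ge0.
- by apply: emeasurable_funD; exact: mMM.
rewrite ge0_integralD//; [|exact: mMM..]; rewrite ge0_integralD//; [|exact: mMM..].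
rewrite M12//; last by apply/seteqP; split=> // y [[_ nB] [By _]].
rewrite M12//; last by apply/seteqP; split=> // y [[_ nB] [_ By]].
rewrite M12//; last by apply/seteqP; split=> // y [[Ay _] [_ nA]].
rewrite M2// -/C.
have -> : leb A = leb D1 + leb C by exact: measureDI.
have -> : leb B = leb D2 + leb C by rewrite /C setIC; exact: measureDI.
have D1n : leb D1 \is a fin_num by rewrite ge0_fin_numE.
have D2n : leb D2 \is a fin_num by rewrite ge0_fin_numE.
have Cn : leb C \is a fin_num by rewrite ge0_fin_numE.
rewrite -(fineK D1n) -(fineK D2n) -(fineK Cn) -!EFinD -?EFinM -?EFinD -?EFinM -?EFinD; congr EFin; ring.
Qed.

Let sumdirac A w : M A w = \sum_(i <oo) (\1_A (x i w))%:E.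
Proof. by apply: eq_eseriesr => i _; rewrite /dirac. Qed.

Let mxA i A : measurable A -> measurable (x i @^-1` A).
Proof. by move=> mA; rewrite -[X in measurable X]setTI; exact: mx. Qed.

(** The sum of the laws of the points is a measure whose value on a set is the expected count; hence
    it is Lebesgue measure. *)
Lemma campbell1 (f : R -> \bar R) : measurable_fun setT f -> (forall y, 0 <= f y) ->
  \sum_(i <oo) \int[P]_w f (x i w) = \int[leb]_y f y.
Proof.
move=> mf f0.
pose kap := mseries (fun i => image_measure P (@mkmfun _ _ Om (measurableTypeR R) (x i) (mx i))) 0.
have E : \int[kap]_y f y = \sum_(i <oo) \int[P]_w f (x i w).
  rewrite ge0_integral_measure_series//; apply: eq_eseriesr => i _.
  by rewrite ge0_integral_image.
rewrite -E; apply: eq_measure_integral => A mA _.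
transitivity (\int[P]_w M A w).
  rewrite (eq_integral (fun w => \sum_(i <oo) (\1_A (x i w))%:E)); last by move=> w _; rewrite sumdirac.
  rewrite integral_nneseries//; last first.
    by move=> i; apply/measurable_EFinP; exact: measurableT_comp.
  apply: eq_eseriesr => i _.
  rewrite (eq_integral (fun w => (\1_(x i @^-1` A) w)%:E))//.
  by rewrite integral_indic ?setIT//; exact: mxA.
have [Af|] := ltP (leb A) +oo; first exact: M1.
by rewrite leye_eq => /eqP Aoo; rewrite M1oo.
Qed.

Let pair_meas i j : measurable_fun setT (fun w => (x i w, x j w)).
Proof. exact: measurable_fun_pair. Qed.

Let diag_meas : measurable_fun setT (fun y : R => (y, y)).
Proof. exact: measurable_fun_pair. Qed.

(** Second moment measure of the points, pairs (i, i) included; these account for the diagonal part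
    of [kap2]. *)
Let kap1 : {measure set (measurableTypeR R * measurableTypeR R) -> \bar R} :=
  mseries (fun i => mseries (fun j => image_measure P (@mkmfun _ _ Om (measurableTypeR R * measurableTypeR R)%type (fun w => (x i w, x j w)) (pair_meas i j))) 0) 0.

Let kap2 : {measure set (measurableTypeR R * measurableTypeR R) -> \bar R} :=
  measure_add (leb \x leb) (image_measure leb (@mkmfun _ _ (measurableTypeR R) (measurableTypeR R * measurableTypeR R)%type (fun y => (y, y)) diag_meas)).

Let kap_rect A B : measurable A -> measurable B -> leb A < +oo -> leb B < +oo ->
  kap1 (A `*` B) = kap2 (A `*` B).
Proof.
move=> mA mB Af Bf.
have -> : kap2 (A `*` B) = leb A * leb B + leb (A `&` B).
  transitivity ((leb \x leb) (A `*` B) + leb (A `&` B)); last by rewrite product_measure1E.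
  exact: measure_addE.
rewrite -MM//.
have -> : kap1 (A `*` B) = \sum_(i <oo) \sum_(j <oo) \int[P]_w ((\1_A (x i w))%:E * (\1_B (x j w))%:E).
  apply: eq_eseriesr => i _; apply: eq_eseriesr => j _.
  rewrite (eq_integral (fun w => (\1_(x i @^-1` A `&` x j @^-1` B) w)%:E)); last first.
    by move=> w _; rewrite -EFinM !indicE in_setI -natrM mulnb.
  by rewrite integral_indic ?setIT//; apply: measurableI; exact: mxA.
have m1 C i : measurable C -> measurable_fun setT (fun w => (\1_C (x i w))%:E : \bar R).
  by move=> mC; apply/measurable_EFinP; exact: measurableT_comp.
rewrite (eq_integral (fun w => \sum_(i <oo) (\1_A (x i w))%:E * M B w)); last first.
  move=> w _; rewrite sumdirac.
  (* A finite factor is moved through the series; if [M B w] is infinite, both sides are +oo or 0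
     according to whether some point falls in [A]. *)
  have [h|h] := ltP (M B w) +oo.
    have <- : (fine (M B w))%:E = M B w by rewrite fineK// ge0_fin_numE.
    under [RHS]eq_eseriesr do rewrite muleC.
    by rewrite nneseriesZl// muleC.
  have -> : M B w = +oo by apply/eqP; rewrite -leye_eq.
  have [/existsNP[i /eqP Ai]|Ai] := pselect (~ forall i, \1_A (x i w) = 0%R :> R).
    have Ai1 : \1_A (x i w) = 1%R :> R by move: Ai; rewrite indicE; case: (_ \in _) => //=; rewrite eqxx.
    have pos : 0 < \sum_(j <oo) (\1_A (x j w))%:E :> \bar R.
      apply: (@lt_le_trans _ _ (\sum_(j < i.+1) (\1_A (x j w))%:E)); last exact: sum_le_nneseries.
      rewrite big_ord_recr/= Ai1; apply: (@lt_le_trans _ _ 1) => //.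
      by rewrite leeDr// sume_ge0.
    rewrite gt0_muley//; apply/esym/eqP; rewrite -leye_eq.
    apply: le_trans (sum_le_nneseries i.+1 _); last by move=> j; rewrite mule_ge0// lee_fin.
    rewrite big_ord_recr/= Ai1 mul1e addeC addye// -ltNye.
    by apply: (@lt_le_trans _ _ 0) => //; apply: sume_ge0 => j _; rewrite mule_ge0// lee_fin.
  have {}Ai i : \1_A (x i w) = 0%R :> R by move: i; exact: contrapT Ai.
  rewrite eseries0; last by move=> i _ _; rewrite Ai.
  by rewrite mul0e eseries0// => i _ _; rewrite Ai mul0e.
rewrite integral_nneseries//; last 2 first.
- by move=> i; apply: emeasurable_funM; [exact: m1|exact: mM].
- by move=> i w _; rewrite mule_ge0// lee_fin.
apply: eq_eseriesr => i _.
rewrite [RHS](eq_integral (fun w => \sum_(j <oo) ((\1_A (x i w))%:E * (\1_B (x j w))%:E))); last first.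
  by move=> w _; rewrite sumdirac nneseriesZl.
rewrite integral_nneseries//.
by move=> j; apply: emeasurable_funM; exact: m1.
Qed.

(** Uniqueness of measures on rectangles with sides of finite measure, exhausted by the squares of
    the [I n]; rectangles of infinite mass are thereby avoided. *)
Let kap_eq C : measurable C -> kap1 C = kap2 C.
Proof.
move=> mC.
pose G : set (set (measurableTypeR R * measurableTypeR R)) := [set C | exists A B, [/\ measurable A, measurable B,
  leb A < +oo, leb B < +oo & C = A `*` B]].
pose I (n : nat) : set R := `](- n%:R)%R, n%:R%R]%classic.
have mI n : measurable (I n) by exact: measurable_itv.
have If n : leb (I n) < +oo.
  by rewrite lebesgue_measure_itv/=; case: ifP => _; rewrite -?EFinB ltry.
have Imon n m : (n <= m)%N -> I n `<=` I m.
  move=> nm y; rewrite /I /= !in_itv/= => /andP[h1 h2]; apply/andP; split.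
    by apply: le_lt_trans h1; rewrite lerN2 ler_nat.
  by apply: le_trans h2 _; rewrite ler_nat.
have IT y : exists n, I n y.
  exists (Num.bound `|y|%R); have := archi_boundP (normr_ge0 y).
  by rewrite ltr_norml /I/= in_itv/= => /andP[-> /ltW ->].
have Gm : G `<=` @measurable _ (measurableTypeR R * measurableTypeR R)%type by move=> _ [A [B [mA mB _ _ ->]]]; exact: measurableX.
have GI : setI_closed G.
  move=> _ _ [A [B [mA mB Af Bf ->]]] [A' [B' [mA' mB' Af' Bf' ->]]].
  exists (A `&` A'), (B `&` B'); split.
  - exact: measurableI.
  - exact: measurableI.
  - by apply: le_lt_trans Af; apply: le_measure; rewrite ?inE//; exact: measurableI.
  - by apply: le_lt_trans Bf; apply: le_measure; rewrite ?inE//; exact: measurableI.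
  - by rewrite setXI.
have lef (E : set (measurableTypeR R)) n : measurable E -> leb (I n) < +oo -> leb (E `&` I n) < +oo.
  move=> mE; apply: le_lt_trans; apply: (le_measure leb); rewrite ?inE//; last exact: mI.
  by apply: (@measurableI _ (measurableTypeR R)) => //; exact: mI.
have sub : @measurable _ (measurableTypeR R * measurableTypeR R)%type `<=` <<s G >>.
  rewrite measurable_prod_measurableType; apply: smallest_sub; first exact: smallest_sigma_algebra.
  move=> _ [A mA [B mB <-]].
  have -> : A `*` B = \bigcup_n ((A `&` I n) `*` (B `&` I n)).
    apply/seteqP; split => [[u v] /= [Au Bv]|[u v] [n _ [/= [Au _] [Bv _]]]] //.
    have [n In] := IT u; have [m Im] := IT v.
    exists (maxn n m) => //; split => /=; split => //.
      by apply: Imon In; exact: leq_maxl.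
    by apply: Imon Im; exact: leq_maxr.
  apply: sigma_algebra_bigcup => n; apply: sub_sigma_algebra.
  exists (A `&` I n), (B `&` I n); split => //; try by apply: (@measurableI _ (measurableTypeR R)) => //; exact: mI.
    by apply: lef (If n).
  by apply: lef (If n).
apply: (@g_sigma_algebra_measure_unique _ R _ G Gm (fun n => I n `*` I n)) => //.
- by move=> n; exists (I n), (I n); split=> //; first [exact: mI|exact: If].
- apply/seteqP; split => // -[u v] _.
  have [n In] := IT u; have [m Im] := IT v.
  exists (maxn n m) => //; split => /=.
    by apply: Imon In; exact: leq_maxl.
  by apply: Imon Im; exact: leq_maxr.
- by move=> _ [A [B [mA mB Af Bf ->]]]; exact: kap_rect.
- move=> n; rewrite kap_rect; [|exact: mI|exact: mI|exact: If|exact: If].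
  have -> : kap2 (I n `*` I n) = leb (I n) * leb (I n) + leb (I n `&` I n).
    by transitivity ((leb \x leb) (I n `*` I n) + leb (I n `&` I n)); [exact: measure_addE|rewrite product_measure1E//; exact: mI].
  by rewrite setIid lte_add_pinfty// lte_mul_pinfty// ge0_fin_numE.
- exact: sub.
Qed.

Lemma campbell2 (F : R * R -> \bar R) : measurable_fun setT F -> (forall p, 0 <= F p) ->
  \sum_(i <oo) \sum_(j <oo) \int[P]_w F (x i w, x j w) =
  \int[leb]_u \int[leb]_v F (u, v) + \int[leb]_u F (u, u).
Proof.
move=> mF F0.
have E1 : \int[kap1]_p F p = \sum_(i <oo) \sum_(j <oo) \int[P]_w F (x i w, x j w).
  rewrite ge0_integral_measure_series//; apply: eq_eseriesr => i _.
  rewrite ge0_integral_measure_series//; apply: eq_eseriesr => j _.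
  by rewrite ge0_integral_image.
rewrite -E1 (eq_measure_integral kap2); last by move=> C mC _; exact: kap_eq.
rewrite ge0_integral_measure_add// fubini_tonelli1// ge0_integral_image//.
Qed.

End campbell.

Section campbell_real.
Context {R : realType}.
Local Notation leb := (@lebesgue_measure R).
Context d (Om : measurableType d) (P : probability Om R).
Variable x : nat -> Om -> R.
Hypothesis mx : forall i, measurable_fun setT (x i).
Hypothesis prm : poisson_random_measure P leb (fun w => mseries (fun i => \d_(x i w)) 0).

Lemma campbell_ge0_cvg (f : R -> R) : integ leb f -> (forall y, 0 <= f y) ->
  (forall i, integ P (fun w => f (x i w))) /\
  \sum_(i < n) \int[P]_w f (x i w) @[n --> \oo] --> \int[leb]_y f y.
Proof.
move=> if_ f0.
have mf : measurable_fun setT (EFin \o f) by apply/measurable_EFinP; exact: integ_meas if_.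
have C := campbell1 mx prm mf (fun y => f0 y).
rewrite [RHS](Rint_EFin if_) in C.
have h0 i : (0 <= \int[P]_w (f (x i w))%:E)%E by apply: integral_ge0 => w _; rewrite lee_fin.
have ii i : integ P (fun w => f (x i w)).
  apply: integ_ge0P => //.
    have mf' : measurable_fun setT f := integ_meas if_.
    exact: (measurableT_comp mf' (mx i)).
  apply: (@le_lt_trans _ _ (\sum_(j < i.+1) \int[P]_w (f (x j w))%:E)%E).
    by rewrite big_ord_recr/= leeDr// sume_ge0.
  apply: le_lt_trans (sum_le_nneseries i.+1 h0) _.
  by rewrite [X in (X < _)%E]C ltry.
split; first exact: ii.
suff H : (\sum_(i < n) \int[P]_w f (x i w))%:E @[n --> \oo] --> (\int[leb]_y f y)%:E by exact: (fine_cvg H).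
rewrite -C; apply: cvg_trans (nneseries_cvg h0); apply: near_eq_cvg; apply: nearW => n.
by rewrite -sumEFin; apply: eq_bigr => i _; rewrite (Rint_EFin (ii i)).
Qed.

(** A signed [f] is the difference of the nonnegative functions |f| + f and |f|. *)
Lemma campbell_cvg (f : R -> R) : integ leb f ->
  (forall i, integ P (fun w => f (x i w))) /\
  \sum_(i < n) \int[P]_w f (x i w) @[n --> \oo] --> \int[leb]_y f y.
Proof.
move=> if_.
have ia := integ_abs if_.
have i1 : integ leb (fun y => `|f y| + f y) by apply: integD.
have [ja ca] := campbell_ge0_cvg ia (fun y => normr_ge0 _).
have h0 y : 0 <= `|f y| + f y by rewrite -lerBlDr sub0r -normrN ler_norm.
have [j1 c1] := campbell_ge0_cvg i1 h0.
have E i : (fun w => f (x i w)) = (fun w => (`|f (x i w)| + f (x i w)) - `|f (x i w)|).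
  by apply/funext => w; rewrite addrAC subrr add0r.
have ii i : integ P (fun w => f (x i w)) by rewrite E; apply: integB.
split=> //.
rewrite (_ : (fun n => _) = (fun n => \sum_(i < n) \int[P]_w (`|f (x i w)| + f (x i w))
  - \sum_(i < n) \int[P]_w `|f (x i w)|)); last first.
  apply/funext => n; rewrite -sumrB; apply: eq_bigr => i _.
  by rewrite -RintB//; congr (Rintegral _ _ _); exact: E.
have -> : \int[leb]_y f y = \int[leb]_y (`|f y| + f y) - \int[leb]_y `|f y|.
  by rewrite -RintB//; apply: eq_Rint => y; rewrite addrAC subrr add0r.
exact: cvgB.
Qed.

Lemma campbell2_ge0_cvg (F : R * R -> R) : measurable_fun setT F -> (forall p, 0 <= F p) ->
  (\int[leb]_u \int[leb]_v (F (u, v))%:E < +oo)%E ->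
  (\int[leb]_u (F (u, u))%:E < +oo)%E ->
  (forall i j, integ P (fun w => F (x i w, x j w))) /\
  \sum_(i < n) \sum_(j < n) \int[P]_w F (x i w, x j w) @[n --> \oo] -->
  fine (\int[leb]_u \int[leb]_v (F (u, v))%:E)%E + \int[leb]_u F (u, u).
Proof.
move=> mF F0 I1 I2.
have mF' : measurable_fun setT (EFin \o F) by exact/measurable_EFinP.
have C := campbell2 mx prm mF' (fun y => F0 y).
have J1 : (0 <= \int[leb]_u \int[leb]_v (F (u, v))%:E)%E.
  by apply: integral_ge0 => u _; apply: integral_ge0 => v _; rewrite lee_fin.
have J2 : (0 <= \int[leb]_u (F (u, u))%:E)%E by apply: integral_ge0 => u _; rewrite lee_fin.
have h0 i j : (0 <= \int[P]_w (F (x i w, x j w))%:E)%E by apply: integral_ge0 => w _; rewrite lee_fin.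
have tot : (\sum_(i <oo) \sum_(j <oo) \int[P]_w (F (x i w, x j w))%:E < +oo)%E.
  by rewrite [X in (X < _)%E]C lte_add_pinfty.
have ii i j : integ P (fun w => F (x i w, x j w)).
  apply: integ_ge0P => //.
    by apply: (measurableT_comp mF); exact: measurable_fun_pair.
  apply: le_lt_trans tot.
  apply: le_trans (sum_le_nneseries i.+1 _); last by move=> k; exact: nneseries_ge0.
  rewrite big_ord_recr/=.
  apply: (@le_trans _ _ (\sum_(k <oo) \int[P]_w (F (x i w, x k w))%:E)%E); last first.
    by rewrite leeDr// sume_ge0// => k _; exact: nneseries_ge0.
  apply: le_trans (sum_le_nneseries j.+1 _) => //.
  by rewrite big_ord_recr/= leeDr// sume_ge0.
split; first exact: ii.
suff H : (\sum_(i < n) \sum_(j < n) \int[P]_w F (x i w, x j w))%:E @[n --> \oo] -->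
  (fine (\int[leb]_u \int[leb]_v (F (u, v))%:E)%E + \int[leb]_u F (u, u))%:E.
  exact: (fine_cvg H).
have -> : (fine (\int[leb]_u \int[leb]_v (F (u, v))%:E)%E + \int[leb]_u F (u, u))%:E =
  (\sum_(i <oo) \sum_(j <oo) \int[P]_w (F (x i w, x j w))%:E)%E.
  rewrite [RHS]C EFinD; congr (_ + _)%E.
    by rewrite fineK// ge0_fin_numE.
  by rewrite /Rintegral fineK// ge0_fin_numE.
apply: cvg_trans (square_sums_cvg h0); apply: near_eq_cvg; apply: nearW => n.
rewrite -sumEFin; apply: eq_bigr => i _.
by rewrite -sumEFin; apply: eq_bigr => j _; rewrite (Rint_EFin (ii i j)).
Qed.

(** In the second moment measure the product part gives the square of the mean, which cancels, and
    the diagonal part the integral of f^2. For signed [f] the product is expanded into four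
    nonnegative ones, built from [fp] and [fa]. *)
Lemma campbell_var (f : R -> R) : integ leb f -> integ leb (fun y => f y ^+ 2) ->
  (forall n, integ P (fun w => (\sum_(i < n) f (x i w) - \int[leb]_y f y) ^+ 2)) /\
  \int[P]_w (\sum_(i < n) f (x i w) - \int[leb]_y f y) ^+ 2 @[n --> \oo] -->
  \int[leb]_y f y ^+ 2.
Proof.
move=> if_ if2.
have mf := integ_meas if_.
have ia := integ_abs if_.
have [jf cf] := campbell_cvg if_.
have D (g h : R -> R) : integ leb g -> integ leb h -> (forall y, 0 <= g y) -> (forall y, 0 <= h y) ->
   (\int[leb]_u \int[leb]_v (g u * h v)%:E = (\int[leb]_y g y * \int[leb]_y h y)%:E)%E.
  move=> ig ih g0 h0.
  transitivity (\int[leb]_u (g u * \int[leb]_y h y)%:E)%E.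
    apply: eq_integral => u _.
    by rewrite -RintZ// -Rint_EFin//; exact: integZ.
  rewrite -RintZr// -Rint_EFin//.
  have := integZ (\int[leb]_y h y) ig; congr (integrable _ _ _).
  by apply/funext => u /=; rewrite mulrC.
pose fa y := `|f y|; pose fp y := `|f y| + f y.
have fp0 y : 0 <= fp y by rewrite /fp -lerBlDr sub0r -normrN ler_norm.
have fa0 y : 0 <= fa y by exact: normr_ge0.
have ip : integ leb fp by apply: integD.
have mfa : measurable_fun setT fa by exact: integ_meas ia.
have mfp : measurable_fun setT fp by exact: integ_meas ip.
have i2 (g h : R -> R) : measurable_fun setT g -> measurable_fun setT h ->
    (forall y, `|g y| <= 2 * `|f y|) -> (forall y, `|h y| <= 2 * `|f y|) ->
    integ leb (fun y => g y * h y).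
  move=> mg mh gf hf; apply: (@integ_le _ _ _ leb _ (fun y => 4 * f y ^+ 2)).
  - exact: measurable_funM.
  - exact: integZ.
  - move=> y; rewrite normrM; apply: le_trans (ler_pM _ _ (gf y) (hf y)) _ => //.
    by rewrite mulrACA -(sqn (f y)) expr2 -natrM.
have ba y : `|fa y| <= 2 * `|f y| by rewrite /fa normr_id ler_peMl// ler1n.
have bp y : `|fp y| <= 2 * `|f y|.
  by rewrite (ger0_norm (fp0 y)) /fp mulrDl mul1r lerD2l ler_norm.
have mixed (g h : R -> R) : integ leb g -> integ leb h -> (forall y, 0 <= g y) -> (forall y, 0 <= h y) ->
    (forall y, `|g y| <= 2 * `|f y|) -> (forall y, `|h y| <= 2 * `|f y|) ->
    (forall i j, integ P (fun w => g (x i w) * h (x j w))) /\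
    \sum_(i < n) \sum_(j < n) \int[P]_w (g (x i w) * h (x j w)) @[n --> \oo] -->
    (\int[leb]_y g y * \int[leb]_y h y) + \int[leb]_y (g y * h y).
  move=> ig ih g0 h0 bg bh.
  have mg := integ_meas ig; have mh := integ_meas ih.
  have Dgh := D g h ig ih g0 h0.
  have -> : \int[leb]_y g y * \int[leb]_y h y =
    fine (\int[leb]_u \int[leb]_v ((fun p : R * R => g p.1 * h p.2) (u, v))%:E)%E.
    exact: (esym (congr1 fine Dgh)).
  apply: (@campbell2_ge0_cvg (fun p => g p.1 * h p.2)).
  - by apply: measurable_funM; exact: measurableT_comp.
  - by move=> p; rewrite mulr_ge0.
  - by apply: (@le_lt_trans _ _ (\int[leb]_y g y * \int[leb]_y h y)%:E); rewrite ?ltry// -Dgh lexx.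
  - have igh : integ leb (fun y => g y * h y) by apply: i2.
    by apply: (@le_lt_trans _ _ (\int[leb]_y (g y * h y))%:E); rewrite ?ltry// -(Rint_EFin igh) lexx.
have [jpp cpp] := mixed _ _ ip ip fp0 fp0 bp bp.
have [jpa cpa] := mixed _ _ ip ia fp0 fa0 bp ba.
have [jap cap] := mixed _ _ ia ip fa0 fp0 ba bp.
have [jaa caa] := mixed _ _ ia ia fa0 fa0 ba ba.
have fE y : f y = fp y - fa y by rewrite /fp addrAC subrr add0r.
have jff i j : integ P (fun w => f (x i w) * f (x j w)).
  rewrite (_ : (fun w => _) = (fun w => fp (x i w) * fp (x j w) - fp (x i w) * fa (x j w)
     - (fa (x i w) * fp (x j w) - fa (x i w) * fa (x j w)))).
    exact: (integB (integB (jpp i j) (jpa i j)) (integB (jap i j) (jaa i j))).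
  by apply/funext => w; rewrite !fE; ring.
set c := \int[leb]_y f y.
have sq n w : (\sum_(i < n) f (x i w) - c) ^+ 2 =
   \sum_(i < n) \sum_(j < n) f (x i w) * f (x j w) - (2 * c) * (\sum_(i < n) f (x i w)) + c ^+ 2.
  rewrite (_ : \sum_(i < n) \sum_(j < n) _ = (\sum_(i < n) f (x i w)) ^+ 2); first by ring.
  by rewrite expr2 mulr_suml; apply: eq_bigr => i _; rewrite mulr_sumr.
have k1 n : integ P (fun w => \sum_(i < n) \sum_(j < n) f (x i w) * f (x j w)).
  by apply: integ_sum => i; apply: integ_sum => j.
have k2 n : integ P (fun w => (2 * c) * (\sum_(i < n) f (x i w))).
  by apply: integZ; apply: integ_sum => i.
have k3 : integ P (fun=> c ^+ 2) by exact: finite_measure_integrable_cst.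
have SE n : (fun w => (\sum_(i < n) f (x i w) - c) ^+ 2) = (fun w =>
   \sum_(i < n) \sum_(j < n) f (x i w) * f (x j w) - (2 * c) * (\sum_(i < n) f (x i w)) + c ^+ 2).
  by apply/funext => w; exact: sq.
split.
  by move=> n; rewrite SE; apply: integD => //; apply: integB.
rewrite (_ : (fun n => _) = (fun n => (\sum_(i < n) \sum_(j < n) \int[P]_w (f (x i w) * f (x j w)))
   - (2 * c) * (\sum_(i < n) \int[P]_w f (x i w)) + c ^+ 2)); last first.
  apply/funext => n; rewrite SE RintD//; last by apply: integB.
  rewrite RintB// RintZ; last by apply: integ_sum.
  rewrite Rint_sum; last by move=> i; apply: integ_sum.
  rewrite Rint_sum// Rintegral_cst// [X in fine X](probability_setT P) mulr1.
  by congr (_ - _ + _); apply: eq_bigr => i _; rewrite Rint_sum.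
have -> : \int[leb]_y f y ^+ 2 = (c * c + \int[leb]_y (f y * f y)) - (2 * c) * c + c ^+ 2.
  rewrite (eq_Rint leb (fun y => f y * f y)); first by ring.
  by move=> y; rewrite expr2.
apply: cvgD; last exact: cvg_cst.
apply: cvgB; last by apply: cvgMr; exact: cf.
rewrite (_ : (fun n => _) = (fun n => \sum_(i < n) \sum_(j < n) \int[P]_w (fp (x i w) * fp (x j w))
   - \sum_(i < n) \sum_(j < n) \int[P]_w (fp (x i w) * fa (x j w))
   - (\sum_(i < n) \sum_(j < n) \int[P]_w (fa (x i w) * fp (x j w))
   - \sum_(i < n) \sum_(j < n) \int[P]_w (fa (x i w) * fa (x j w))))); last first.
  apply/funext => n; rewrite -!sumrB; apply: eq_bigr => i _.
  rewrite -!sumrB; apply: eq_bigr => j _.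
  have q1 := integB (jpp i j) (jpa i j); have q2 := integB (jap i j) (jaa i j).
  rewrite -(RintB (jpp i j) (jpa i j)) -(RintB (jap i j) (jaa i j)) -(RintB q1 q2).
  by apply: eq_Rint => w; rewrite /fp; ring.
have -> : c * c + \int[leb]_y (f y * f y) =
  (\int[leb]_y fp y * \int[leb]_y fp y + \int[leb]_y (fp y * fp y))
  - (\int[leb]_y fp y * \int[leb]_y fa y + \int[leb]_y (fp y * fa y))
  - ((\int[leb]_y fa y * \int[leb]_y fp y + \int[leb]_y (fa y * fp y))
  - (\int[leb]_y fa y * \int[leb]_y fa y + \int[leb]_y (fa y * fa y))).
  have -> : c = \int[leb]_y fp y - \int[leb]_y fa y.
    by rewrite /c -RintB//; apply: eq_Rint => y; exact: fE.
  have -> : \int[leb]_y (f y * f y) = \int[leb]_y (fp y * fp y) - \int[leb]_y (fp y * fa y)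
     - (\int[leb]_y (fa y * fp y) - \int[leb]_y (fa y * fa y)).
    rewrite -RintB; [|exact: i2..]; rewrite -RintB; [|exact: i2..].
    rewrite -RintB; [|by apply: integB; exact: i2..].
    by apply: eq_Rint => y; rewrite !fE; ring.
  by ring.
by apply: cvgB; apply: cvgB.
Qed.

End campbell_real.

(** * Levy processes *)

Section joint_measurability.
Context {R : realType} d (Om : measurableType d) (X : R -> Om -> R).
Hypothesis mX : forall t, 0 <= t -> measurable_fun setT (X t).
Hypothesis rX : forall w t, 0 <= t -> X u w @[u --> t^'+] --> X t w.

(** Grid point strictly to the right of |s|, at distance at most 1/(n+1): right-continuity alone
    then approximates a path by paths that are constant in time on each cell. *)
Let stp (n : nat) (s : R) : R := (Num.truncn (n.+1%:R * `|s|)).+1%:R / n.+1%:R.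

Let stp_gt n s : `|s| < stp n s.
Proof.
rewrite /stp ltr_pdivlMr ?ltr0n// mulrC.
by apply: truncnS_gt; rewrite num_real.
Qed.

Let stp_le n s : stp n s <= `|s| + n.+1%:R^-1.
Proof.
rewrite /stp -natr1 mulrDl mul1r lerD2r ler_pdivrMr ?ltr0n// mulrC.
by rewrite truncn_le mulr_ge0.
Qed.

Let stp_cvg w s : X (stp n s) w @[n --> \oo] --> X `|s| w.
Proof.
have s0 : 0 <= `|s| by [].
have /cvg_at_rightP h := @rX w _ s0.
apply: (h (fun n => stp n s)); split => //.
apply: (@squeeze_cvgr _ _ _ _ (fun=> `|s|) (fun n => `|s| + n.+1%:R^-1)).
- by apply: nearW => n; rewrite ltW//= stp_le.
- exact: cvg_cst.
- rewrite -[X in _ --> X]addr0; apply: cvgD; first exact: cvg_cst.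
  exact: cvg_harmonic.
Qed.

Lemma joint_meas : measurable_fun setT (fun p : R * Om => X `|p.1| p.2).
Proof.
apply: (measurable_fun_cvg (h := fun n p => X (stp n p.1) p.2)) => [n|p _]; last first.
  exact: stp_cvg.
move=> _ A mA; rewrite setTI [X in measurable X](_ : _ =
   \bigcup_k ([set s : R | Num.truncn (n.+1%:R * `|s|) = k] `*` (X (k.+1%:R / n.+1%:R) @^-1` A))); last first.
  apply/seteqP; split=> [[s w] /= h|[s w] [k _ [/= sk h]]].
    by exists (Num.truncn (n.+1%:R * `|s|)).
  by rewrite /stp sk.
apply: bigcupT_measurable => k; apply: measurableX; last first.
  by rewrite -[X in measurable X]setTI; apply: mX => //; rewrite divr_ge0.
have -> : [set s : R | Num.truncn (n.+1%:R * `|s|) = k] =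
   (fun s : R => n.+1%:R * `|s|) @^-1` `[k%:R, k.+1%:R[.
  apply/seteqP; split=> s /=; rewrite in_itv/=.
    by move=> <-; apply/truncn_itv; rewrite mulr_ge0.
  by move=> h; apply: truncn_def.
rewrite -[X in measurable X]setTI; apply: (_ : measurable_fun setT _) => //.
by apply: measurable_funM => //; exact: measurableT_comp.
Qed.

End joint_measurability.

Section indep_sigma.
Context d (Om : measurableType d) (R : realType) (P : probability Om R).
Context (I : choiceType) (F : I -> set (set Om)).
Hypothesis mF : forall i, F i `<=` measurable.
Hypothesis FT : forall i, F i setT.
Hypothesis FI : forall i, setI_closed (F i).
Hypothesis ind : mutually_independent P F.

Lemma indep2_sigma (J : set I) k d1 d2 (E1 : measurableType d1) (E2 : measurableType d2)
  (U : Om -> E1) (V : Om -> E2) : ~ J k ->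
  measurable_fun setT (U : g_sigma_algebraType (\bigcup_(i in J) F i) -> E1) ->
  (forall B, measurable B -> F k (V @^-1` B)) -> indep2 P U V.
Proof.
move=> Jk mU mV A B mA mB; apply: (mutual_indep_sigma mF FT FI ind Jk); last exact: mV.
by have := mU measurableT A mA; rewrite setTI.
Qed.

End indep_sigma.

Section indep4.
Context d (Om : measurableType d) (R : realType) (P : probability Om R).

(** Integral against the product of the four laws, iterated so that the laws can be replaced one at
    a time. *)
Definition Eiter4 (A B C D : Om -> R) (F : R * R * R * R -> R) : R :=
  \int[P]_w1 \int[P]_w2 \int[P]_w3 \int[P]_w4 F (A w1, B w2, C w3, D w4).

Lemma Eiter4_same_law (A B C D A' B' C' D' : Om -> R) F : bdm F ->
  measurable_fun setT A -> measurable_fun setT B -> measurable_fun setT C -> measurable_fun setT D ->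
  measurable_fun setT A' -> measurable_fun setT B' -> measurable_fun setT C' -> measurable_fun setT D' ->
  same_law P P A A' -> same_law P P B B' -> same_law P P C C' -> same_law P P D D' ->
  Eiter4 A B C D F = Eiter4 A' B' C' D' F.
Proof.
move=> bF mA mB mC mD mA' mB' mC' mD' hA hB hC hD.
pose G3 (D : Om -> R) p := \int[P]_w4 F (p, D w4).
pose G2 (C D : Om -> R) p := \int[P]_w3 G3 D (p, C w3).
pose G1 (B C D : Om -> R) p := \int[P]_w2 G2 C D (p, B w2).
have b3 H : measurable_fun setT H -> bdm (G3 H).
  move=> mH; apply: (@bdm_Rint2 _ _ _ _ _ P (fun q : (R * R * R) * Om => F (q.1, H q.2))).
  by apply: (bdm_comp bF); apply: measurable_fun_pair => //; exact: measurableT_comp.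
have b2 K H : measurable_fun setT K -> measurable_fun setT H -> bdm (G2 K H).
  move=> mK mH; apply: (@bdm_Rint2 _ _ _ _ _ P (fun q : (R * R) * Om => G3 H (q.1, K q.2))).
  by apply: (bdm_comp (b3 _ mH)); apply: measurable_fun_pair => //; exact: measurableT_comp.
have b1 L K H : measurable_fun setT L -> measurable_fun setT K -> measurable_fun setT H -> bdm (G1 L K H).
  move=> mL mK mH; apply: (@bdm_Rint2 _ _ _ _ _ P (fun q : R * Om => G2 K H (q.1, L q.2))).
  by apply: (bdm_comp (b2 _ _ mK mH)); apply: measurable_fun_pair => //; exact: measurableT_comp.
have e3 p : G3 D p = G3 D' p.
  by apply: (same_law_bdm mD mD' hD (f := fun x => F (p, x))); apply: (bdm_comp bF); exact: measurable_fun_pair.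
have e2 p : G2 C D p = G2 C' D' p.
  transitivity (\int[P]_w G3 D (p, C' w)); last by apply: eq_Rint => w; exact: e3.
  by apply: (same_law_bdm mC mC' hC (f := fun x => G3 D (p, x))); apply: (bdm_comp (b3 _ mD)); exact: measurable_fun_pair.
have e1 p : G1 B C D p = G1 B' C' D' p.
  transitivity (\int[P]_w G2 C D (p, B' w)); last by apply: eq_Rint => w; exact: e2.
  by apply: (same_law_bdm mB mB' hB (f := fun x => G2 C D (p, x))); apply: (bdm_comp (b2 _ _ mC mD)); exact: measurable_fun_pair.
rewrite -[LHS]/(\int[P]_w G1 B C D (A w)) -[RHS]/(\int[P]_w G1 B' C' D' (A' w)).
transitivity (\int[P]_w G1 B C D (A' w)); last by apply: eq_Rint => w; exact: e1.
by apply: (same_law_bdm mA mA' hA); exact: b1.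
Qed.

(** The variables are split off one at a time, the last against the joint vector of the preceding
    ones. *)
Lemma indep4 (Y : 'I_4 -> Om -> R) (F : R * R * R * R -> R) :
  (forall i, measurable_fun setT (Y i)) -> independent_family P Y -> bdm F ->
  \int[P]_w F (Y (inord 0) w, Y (inord 1) w, Y (inord 2) w, Y (inord 3) w) =
  Eiter4 (Y (inord 0)) (Y (inord 1)) (Y (inord 2)) (Y (inord 3)) F.
Proof.
move=> mY ind bF.
pose S (i : 'I_4) := sigma_gen [set: unit] (fun=> Y i).
have mS i : S i `<=` measurable by apply: sigma_gen_meas => _ _; exact: mY.
have ST i : S i setT by exact: sigma_genT.
have SI i : setI_closed (S i) by exact: sigma_genI.
have SY i B : measurable B -> S i (Y i @^-1` B).
  by move=> mB; apply: sub_sigma_algebra; exists tt => //; exists B => //; rewrite setTI.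
have mJ (J : set 'I_4) i : J i ->
    measurable_fun setT (Y i : g_sigma_algebraType (\bigcup_(i in J) S i) -> R).
  by move=> Ji _ B mB; rewrite setTI; apply: sub_sigma_algebra; exists i => //; exact: SY.
set y0 := inord 0; set y1 := inord 1; set y2 := inord 2; set y3 := inord 3.
have v (k : nat) : (k < 4)%N -> (inord k : 'I_4) = k :> nat by move=> h; rewrite inordK.
have I3 : indep2 P (fun w => (Y y0 w, Y y1 w, Y y2 w)) (Y y3).
  apply: (@indep2_sigma _ _ _ P _ S mS ST SI ind [set i : 'I_4 | (i < 3)%N] y3).
  - by rewrite /= v.
  - by apply: measurable_fun_pair; [apply: measurable_fun_pair|]; apply: mJ; rewrite /= v.
  - by move=> B; exact: SY.
have I2 : indep2 P (fun w => (Y y0 w, Y y1 w)) (Y y2).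
  apply: (@indep2_sigma _ _ _ P _ S mS ST SI ind [set i : 'I_4 | (i < 2)%N] y2).
  - by rewrite /= v.
  - by apply: measurable_fun_pair; apply: mJ; rewrite /= v.
  - by move=> B; exact: SY.
have I1 : indep2 P (Y y0) (Y y1).
  apply: (@indep2_sigma _ _ _ P _ S mS ST SI ind [set i : 'I_4 | (i < 1)%N] y1).
  - by rewrite /= v.
  - by apply: mJ; rewrite /= v.
  - by move=> B; exact: SY.
have m2 : measurable_fun setT (fun w => (Y y0 w, Y y1 w)) by exact: measurable_fun_pair.
have m3 : measurable_fun setT (fun w => (Y y0 w, Y y1 w, Y y2 w)) by exact: measurable_fun_pair.
pose G3 p := \int[P]_w4 F (p, Y y3 w4).
pose G2 p := \int[P]_w3 G3 (p, Y y2 w3).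
have b3 : bdm G3.
  apply: (@bdm_Rint2 _ _ _ _ _ P (fun q : (R * R * R) * Om => F (q.1, Y y3 q.2))).
  by apply: (bdm_comp bF); apply: measurable_fun_pair => //; exact: measurableT_comp.
have b2 : bdm G2.
  apply: (@bdm_Rint2 _ _ _ _ _ P (fun q : (R * R) * Om => G3 (q.1, Y y2 q.2))).
  by apply: (bdm_comp b3); apply: measurable_fun_pair => //; exact: measurableT_comp.
transitivity (\int[P]_w1 \int[P]_w2 F (Y y0 w1, Y y1 w1, Y y2 w1, Y y3 w2)).
  exact: (indep2_bdm m3 (mY y3) I3 bF).
rewrite -[LHS]/(\int[P]_w G3 (Y y0 w, Y y1 w, Y y2 w)).
transitivity (\int[P]_w1 \int[P]_w2 G3 (Y y0 w1, Y y1 w1, Y y2 w2)).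
  exact: (indep2_bdm m2 (mY y2) I2 b3).
rewrite -[LHS]/(\int[P]_w G2 (Y y0 w, Y y1 w)).
exact: (indep2_bdm (mY y0) (mY y1) I1 b2).
Qed.

End indep4.

Section levy.
Context d (Om : measurableType d) (R : realType) (P : probability Om R).
Variables (alpha : R).

Lemma stable_cos (X : R -> {RV P >-> R}) t z th : std_symmetric_stable_levy alpha X ->
  0 <= t -> \int[P]_w cos (z * X t w + th) = cos th * expR (- (t * `|z| `^ alpha)).
Proof.
move=> [_ cf] t0; have := cf t z t0; rewrite /characteristic_function.
have mz : measurable_fun setT (fun w => z * X t w) by exact: measurable_funM.
have e1 : fine 'E_P[fun w => cos (z * X t w)%R] = \int[P]_w cos (z * X t w) by rewrite unlock.
have e2 : fine 'E_P[fun w => sin (z * X t w)%R] = \int[P]_w sin (z * X t w) by rewrite unlock.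
rewrite e1 e2 => -[h1 h2].
have ic := bdm_integ P (bdm_cos mz); have is_ := bdm_integ P (bdm_sin mz).
transitivity (\int[P]_w (cos th * cos (z * X t w) - sin th * sin (z * X t w))).
  by apply: eq_Rint => w; rewrite cosD; ring.
by rewrite RintB ?RintZ//; [rewrite h1 h2; ring|exact: integZ..].
Qed.

Lemma stable_same_law (X Z : R -> {RV P >-> R}) t :
  std_symmetric_stable_levy alpha X -> std_symmetric_stable_levy alpha Z ->
  0 <= t -> same_law P P (X t) (Z t).
Proof.
move=> hX hZ t0; apply: law_unique => // z th.
by rewrite !stable_cos.
Qed.

(** The right side involves only the one-time laws of a reference process [Z]: moments up to order
    four therefore agree for all particles. *)
Lemma levy_incr4 (X Z : R -> {RV P >-> R}) (s1 s2 s3 s4 : R) F :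
  std_symmetric_stable_levy alpha X -> std_symmetric_stable_levy alpha Z ->
  0 <= s1 -> s1 <= s2 -> s2 <= s3 -> s3 <= s4 -> bdm F ->
  \int[P]_w F (X s1 w, X s2 w - X s1 w, X s3 w - X s2 w, X s4 w - X s3 w) =
  Eiter4 P (Z s1) (Z (s2 - s1)) (Z (s3 - s2)) (Z (s4 - s3)) F.
Proof.
move=> hX hZ h1 h2 h3 h4 bF.
have [[X0 indX stX _] _] := hX.
(* The times 0, s1, s2, s3, s4, so that the first increment starts at 0. *)
pose t (n : nat) : R := if n is n'.+1 then if n' is n''.+1 then if n'' is n3.+1 then if n3 is _.+1 then s4 else s3 else s2 else s1 else 0.
have tm : {homo t : i j / (i <= j)%N >-> i <= j}.
  apply: homo_leq => [x|y x z|n]; first exact: lexx; first exact: le_trans.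
  by case: n => [|[|[|[|n]]]] //=.
pose Y (i : 'I_4) (w : Om) := X (t i.+1) w - X (t i) w.
have mY i : measurable_fun setT (Y i) by exact: measurable_funB.
have ind : independent_family P Y by apply: indX.
have v (k : nat) : (k < 4)%N -> (inord k : 'I_4) = k :> nat by move=> h; rewrite inordK.
have lawY (i : 'I_4) : same_law P P (Y i) (Z (t i.+1 - t i)).
  have ti : 0 <= t i by apply: (@tm 0%N).
  have tii : t i <= t i.+1 by exact: tm.
  move=> A mA; rewrite [LHS](stX (t i) (t i.+1) ti tii A mA).
  by apply: (stable_same_law hX hZ) => //; rewrite subr_ge0.
have mX u : measurable_fun setT (X u) by [].
transitivity (\int[P]_w F (Y (inord 0) w, Y (inord 1) w, Y (inord 2) w, Y (inord 3) w)).
  have bX : bdm (fun w => F (X s1 w, X s2 w - X s1 w, X s3 w - X s2 w, X s4 w - X s3 w)).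
    apply: (bdm_comp bF).
    by do 3 (apply: measurable_fun_pair; last exact: measurable_funB).
  have bY : bdm (fun w => F (Y (inord 0) w, Y (inord 1) w, Y (inord 2) w, Y (inord 3) w)).
    apply: (bdm_comp bF).
    by do 3 (apply: measurable_fun_pair; last exact: mY).
  (* [X 0] vanishes only almost surely, so the first increment equals [X s1] up to a null set. *)
  rewrite /Rintegral; congr fine; apply: ae_eq_integral => //.
  - by apply/measurable_EFinP; case: bX.
  - by apply/measurable_EFinP; case: bY.
  - by apply: filterS X0 => w X0w _; rewrite /Y !v//= X0w subr0.
rewrite (indep4 mY ind bF); apply: Eiter4_same_law => //.
- by have := lawY (inord 0); rewrite v//= subr0.
- by have := lawY (inord 1); rewrite v.
- by have := lawY (inord 2); rewrite v.
- by have := lawY (inord 3); rewrite v.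
Qed.

End levy.

Lemma bdm_le {R : realType} d (T : measurableType d) (f g : T -> R) :
  measurable_fun setT f -> measurable_fun setT g -> bdm (fun x => (f x <= g x)%R%:R : R).
Proof.
move=> mf mg; split; last by exists 1 => x; rewrite ger0_norm// lern1 leq_b1.
have mb : measurable_fun setT (fun x => f x <= g x) by exact: measurable_fun_ler.
rewrite (_ : (fun x => _) = (fun x => if f x <= g x then 1 else 0)); last by apply/funext => x; case: ifP.
exact: measurable_fun_ifT.
Qed.

(** * Powers of an integral as integrals over ordered times *)

Section ordered.
Context {R : realType} (U : probability (measurableTypeR R) R).
Hypothesis atomless : forall a, U [set a] = 0%E.
Implicit Types p q g : R -> R.

Definition run p (b : R) : R := \int[U]_a ((a <= b)%R%:R * p a).

Lemma bdm_run p : bdm p -> bdm (run p).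
Proof.
move=> bp; apply: (@bdm_Rint2 _ _ _ _ _ U (fun z : R * measurableTypeR R => (z.2 <= z.1)%R%:R * p z.2)).
apply: bdmM; first by apply: bdm_le.
by apply: (bdm_comp bp).
Qed.

Let atom_lt p c : bdm p -> \int[U]_a ((a < c)%R%:R * p a) = run p c.
Proof.
move=> bp; rewrite /run /Rintegral; congr fine; apply: ae_eq_integral => //.
- apply/measurable_EFinP; apply: measurable_funM; last exact: bdm_meas bp.
  rewrite (_ : (fun x => _) = (fun x => 1 - (c <= x)%R%:R)); last first.
    by apply/funext => x; case: leP => _; rewrite ?subrr ?subr0.
  by apply: measurable_funB => //; apply: bdm_meas; exact: bdm_le.
- apply/measurable_EFinP; apply: measurable_funM; last exact: bdm_meas bp.
  by apply: bdm_meas; exact: bdm_le.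
- exists [set c]; split; [exact: measurable_set1|exact: atomless|].
  move=> a /=; apply: contra_notP => /eqP ac _.
  by rewrite le_eqVlt (negbTE ac).
Qed.

(** Integration by parts: pairs of times are split by their order, and ties are negligible because
    [U] has no atom. *)
Lemma run_total p q : bdm p -> bdm q ->
  (\int[U]_a p a) * (\int[U]_a q a) = \int[U]_a (p a * run q a + run p a * q a).
Proof.
move=> bp bq; have br := bdm_run bp; have bs := bdm_run bq.
have ip := bdm_integ U bp; have iq := bdm_integ U bq.
have blt : bdm (fun z : measurableTypeR R * measurableTypeR R => (z.1 < z.2)%R%:R : R).
  rewrite (_ : (fun x => _) = (fun z : measurableTypeR R * measurableTypeR R => 1 - (z.2 <= z.1)%R%:R)); last first.
    by apply/funext => x; case: leP => _; rewrite ?subrr ?subr0.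
  by apply: bdmB; [exact: bdm_cst|exact: bdm_le].
have bpq : bdm (fun z : measurableTypeR R * measurableTypeR R => p z.1 * ((z.1 < z.2)%R%:R * q z.2)).
  by apply: bdmM; [exact: (bdm_comp bp)|apply: bdmM => //; exact: (bdm_comp bq)].
have E a : p a * \int[U]_c q c = p a * run q a + \int[U]_c (p a * ((a < c)%R%:R * q c)).
  have bl : bdm (fun c : measurableTypeR R => (c <= a)%R%:R : R) by exact: bdm_le.
  have bl' : bdm (fun c : measurableTypeR R => (a < c)%R%:R : R).
    by apply: (bdm_comp blt (g := fun c => (a, c))); exact: measurable_fun_pair.
  have b1 := bdm_integ U (bdmM bl bq); have b2 := bdm_integ U (bdmM bl' bq).
  rewrite RintZ// -mulrDr; congr (_ * _).
  rewrite /run -RintD//; apply: eq_Rint => c.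
  by case: leP => _; rewrite mul1r mul0r ?addr0 ?add0r.
rewrite -RintZr//.
rewrite (eq_Rint U (fun a => p a * run q a + \int[U]_c (p a * ((a < c)%R%:R * q c))))//.
rewrite RintD; last 2 first.
- by apply: bdm_integ; exact: bdmM.
- apply: bdm_integ; exact: (@bdm_Rint2 _ _ _ _ _ U _ bpq).
rewrite RintD; [|by apply: bdm_integ; exact: bdmM..].
congr (_ + _).
rewrite (@bdm_fubini _ _ _ _ _ U U (fun z => p z.1 * ((z.1 < z.2)%R%:R * q z.2)))//.
apply: eq_Rint => c /=.
rewrite -atom_lt// -RintZr; last first.
  apply: bdm_integ; apply: bdmM => //.
  by apply: (bdm_comp blt (g := fun a => (a, c))); exact: measurable_fun_pair.
by apply: eq_Rint => a; ring.
Qed.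

Lemma runM p q b : bdm p -> bdm q ->
  run p b * run q b = run (fun a => p a * run q a + run p a * q a) b.
Proof.
move=> bp bq; have bl : bdm (fun c : measurableTypeR R => (c <= b)%R%:R : R) by exact: bdm_le.
rewrite {1 2}/run (run_total (bdmM bl bp) (bdmM bl bq)) /run; apply: eq_Rint => a.
have [ab|_] := leP a b; last by rewrite !mul0r mulr0 addr0.
rewrite !mul1r; congr (_ * _ + _ * _); apply: eq_Rint => c;
  by have [ca|_] := leP c a; rewrite ?mul0r// (le_trans ca ab) !mul1r.
Qed.

Lemma run_pow2 g b : bdm g -> run g b ^+ 2 = 2 * run (fun a => g a * run g a) b.
Proof.
move=> bg; rewrite expr2 runM// /run -RintZ.
  by apply: eq_Rint => a; rewrite /run; ring.
by apply: bdm_integ; apply: bdmM; [exact: bdm_le|apply: bdmM => //; exact: bdm_run].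
Qed.

(** The 4! orderings of four times have equal integrals. The extreme times are kept in separate
    factors, as they are the ones integrated out first in the moment bound. *)
Lemma int_pow4 g : bdm g -> (\int[U]_a g a) ^+ 4 =
  24 * \int[U]_b (g b * run (fun a => g a * run g a) b * \int[U]_r ((b <= r)%R%:R * g r)).
Proof.
move=> bg; have bG := bdm_run bg.
pose p a := g a * run g a; have bp : bdm p by exact: bdmM.
have bP := bdm_run bp.
have e2 : (\int[U]_a g a) ^+ 2 = 2 * \int[U]_a p a.
  rewrite expr2 run_total// -RintZ; last exact: bdm_integ.
  by apply: eq_Rint => a; rewrite /p; ring.
have e3 b : run g b * run p b = 3 * run (fun a => g a * run p a) b.
  rewrite runM// /run -RintZ; last by apply: bdm_integ; apply: bdmM; [exact: bdm_le|exact: bdmM].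
  apply: eq_Rint => a; rewrite -/(run p a) -/(run g a).
  (* By [run_pow2] the square of [run g] is twice [run p], so the two terms of the product rule add
     up to three times the first. *)
  have e' : run g a * p a = g a * run g a ^+ 2 by rewrite /p; ring.
  by rewrite e' (run_pow2 a bg : _ = 2 * run p a); ring.
have bgP : bdm (fun b => g b * run p b) by exact: bdmM.
have -> : (\int[U]_a g a) ^+ 4 = 24 * \int[U]_r (g r * run (fun b => g b * run p b) r).
  rewrite -[4%N]/(2 * 2)%N exprM e2 exprMn [(\int[U]_a p a) ^+ 2]expr2 run_total//.
  rewrite -!RintZ; last 2 first.
  - by apply: bdm_integ; apply: bdmM => //; exact: bdm_run.
  - by apply: bdm_integ; apply: bdmD; exact: bdmM.
  apply: eq_Rint => a; move: (run p a) (run (fun b => g b * run p b) a) (e3 a) => P Q e.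
  by transitivity (8 * (g a * (run g a * P))); [rewrite /p; ring|rewrite e; ring].
congr (_ * _).
have bF : bdm (fun z : measurableTypeR R * measurableTypeR R =>
   g z.1 * ((z.2 <= z.1)%R%:R * (g z.2 * run p z.2))).
  apply: bdmM; first exact: (bdm_comp bg).
  by apply: bdmM; [exact: bdm_le|exact: (bdm_comp bgP)].
transitivity (\int[U]_r \int[U]_b (g r * ((b <= r)%R%:R * (g b * run p b)))).
  apply: eq_Rint => r; rewrite -RintZ//; apply: bdm_integ; apply: bdmM => //; exact: bdm_le.
rewrite (bdm_fubini U U bF); apply: eq_Rint => b.
transitivity (\int[U]_r (g r * ((b <= r)%R%:R * (g b * run p b)))); first by [].
rewrite -/(run p b).
transitivity (\int[U]_r ((g b * run p b) * ((b <= r)%R%:R * g r))).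
  by apply: eq_Rint => r; ring.
by rewrite RintZ//; apply: bdm_integ; apply: bdmM => //; exact: bdm_le.
Qed.

Definition U4 : probability _ R := (U \x U \x U \x U)%E.

Lemma int_U4 F : bdm F ->
  \int[U4]_q F q = \int[U]_b \int[U]_a \int[U]_s \int[U]_r F (b, a, s, r).
Proof.
move=> bF.
pose F3 x := \int[U]_r F (x, r); pose F2 x := \int[U]_s F3 (x, s).
have b3 : bdm F3 by exact: (bdm_Rint2 U bF).
have b2 : bdm F2 by exact: (bdm_Rint2 U b3).
pose V2 : probability _ R := (U \x U)%E; pose V3 : probability _ R := (V2 \x U)%E.
have e1 := Rfubini1 (bdm_integ_prod V3 U bF).
have e2 := Rfubini1 (bdm_integ_prod V2 U b3).
have e3 := Rfubini1 (bdm_integ_prod U U b2).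
exact: (etrans (esym e1) (etrans (esym e2) (esym e3))).
Qed.

(** The times are listed as (b, a, s, r) for s <= a <= b <= r: the middle ones, to be integrated
    last, come first. *)
Definition ord4 (b a s r : R) : R := (a <= b)%R%:R * (s <= a)%R%:R * (b <= r)%R%:R.

Lemma int_pow4_U4 g : bdm g -> (\int[U]_a g a) ^+ 4 =
  24 * \int[U4]_q (ord4 q.1.1.1 q.1.1.2 q.1.2 q.2 * (g q.1.1.1 * g q.1.1.2 * g q.1.2 * g q.2)).
Proof.
move=> bg; rewrite int_pow4//; congr (_ * _); rewrite int_U4; last first.
  have m2 := @measurable_fst _ _ (measurableTypeR R * measurableTypeR R * measurableTypeR R)%type (measurableTypeR R).
  have m3 := measurableT_comp (@measurable_fst _ _ (measurableTypeR R * measurableTypeR R)%type (measurableTypeR R)) m2.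
  have p1 := measurableT_comp (@measurable_fst _ _ (measurableTypeR R) (measurableTypeR R)) m3.
  have p2 := measurableT_comp (@measurable_snd _ _ (measurableTypeR R) (measurableTypeR R)) m3.
  have p3 := measurableT_comp (@measurable_snd _ _ (measurableTypeR R * measurableTypeR R)%type (measurableTypeR R)) m2.
  have p4 := @measurable_snd _ _ (measurableTypeR R * measurableTypeR R * measurableTypeR R)%type (measurableTypeR R).
  apply: bdmM; last by do !apply: bdmM; first [exact: (bdm_comp bg p1)|exact: (bdm_comp bg p2)|exact: (bdm_comp bg p3)|exact: (bdm_comp bg p4)].
  apply: bdmM; last exact: (bdm_le p1 p4).
  by apply: bdmM; [exact: (bdm_le p2 p1)|exact: (bdm_le p3 p2)].
apply: eq_Rint => b /=.
have br : bdm (fun r : measurableTypeR R => (b <= r)%R%:R * g r) by apply: bdmM => //; exact: bdm_le.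
have bs a : bdm (fun s : measurableTypeR R => (s <= a)%R%:R * g s) by apply: bdmM => //; exact: bdm_le.
have ba : bdm (fun a : measurableTypeR R => (a <= b)%R%:R * (g a * run g a)).
  by apply: bdmM; [exact: bdm_le|apply: bdmM => //; exact: bdm_run].
rewrite -mulrA {1}/run -RintZr; last exact: bdm_integ.
rewrite -RintZ; last first.
  apply: bdm_integ; exact: (bdmM ba (bdm_cst _ _)).
apply: eq_Rint => a.
rewrite {1}/run.
transitivity (\int[U]_s ((g b * (a <= b)%R%:R * g a) * (((s <= a)%R%:R * g s) * \int[U]_r ((b <= r)%R%:R * g r)))).
  rewrite RintZ; last by apply: bdm_integ; exact: (bdmM (bs a) (bdm_cst _ _)).
  by rewrite RintZr; [ring|exact: bdm_integ].
apply: eq_Rint => s.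
rewrite mulrA -RintZ; last exact: bdm_integ.
by apply: eq_Rint => r; rewrite /ord4; ring.
Qed.

End ordered.

(** * Translation invariance and duality for Lebesgue measure *)

Section shift.
Context {R : realType}.
Local Notation leb := (@lebesgue_measure R).

Definition bint (k : R -> R) := bdm k /\ integ leb k.

Lemma Rint_shift (k : R -> R) b : integ leb k -> \int[leb]_x k (x + b) = \int[leb]_x k x.
Proof.
move=> ik; have := Rint_affine b (oner_neq0 R) ik; rewrite normr1 invr1 mul1r => <-.
by apply: eq_Rint => x; rewrite mul1r.
Qed.

Lemma integ_shift (k : R -> R) b : integ leb k -> integ leb (fun x => k (x + b)).
Proof.
move=> ik; have := integ_affine b (oner_neq0 R) ik; congr (integrable _ _ _).
by apply/funext => x /=; rewrite mul1r.
Qed.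

Context d (W : measurableType d) (Q : probability W R) (V : W -> R).
Hypothesis mV : measurable_fun setT V.

Lemma integ_shift_prod (k : R -> R) : integ leb k ->
  integ (leb \x Q)%E (fun p : measurableTypeR R * W => k (p.1 + V p.2)).
Proof.
move=> ik; have mk := integ_meas ik.
have mkV : measurable_fun setT (fun p : measurableTypeR R * W => k (p.1 + V p.2)).
  by apply: (measurableT_comp mk); apply: measurable_funD => //; exact: measurableT_comp.
apply/integrableP; split; first exact/measurable_EFinP.
rewrite (@fubini_tonelli2 _ _ _ _ _ leb Q)//=; last first.
  by apply/measurable_EFinP; apply: measurableT_comp mkV.
rewrite (eq_integral (fun=> (\int[leb]_x `|k x|)%:E)); last first.
  move=> w _; rewrite /fubini_G/= -(Rint_shift (V w) (integ_abs ik)) Rint_EFin//.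
  exact: (integ_shift (V w) (integ_abs ik)).
by rewrite integral_cst// [X in (_ * X)%E](probability_setT Q) mule1 ltry.
Qed.

(** Lebesgue measure is invariant under an independent displacement: the piece of a path before its
    first observed time disappears from the moments. *)
Lemma int_E_shift (k : R -> R) : integ leb k ->
  \int[leb]_y \int[Q]_w k (y + V w) = \int[leb]_x k x.
Proof.
move=> ik; rewrite (@Rfubini _ _ _ _ _ leb Q (fun p => k (p.1 + V p.2)))//=; last exact: integ_shift_prod.
rewrite (eq_Rint Q (fun=> \int[leb]_x k x)) ?Rintegral_cst//; last by move=> w; exact: Rint_shift.
by rewrite [X in fine X](probability_setT Q) mulr1.
Qed.

Lemma integ_E_shift (k : R -> R) : bint k -> integ leb (fun y => \int[Q]_w k (y + V w)).
Proof.
move=> [bk ik].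
have H := integ_shift_prod ik.
have := integrable_fubini_F H.
congr (integrable _ _ _); apply/funext => y /=.
rewrite /fubini_F/= Rint_EFin//; apply: bdm_integ; apply: (bdm_comp bk).
exact: measurable_funD.
Qed.

(** With respect to Lebesgue measure, the adjoint of averaging over [V] is averaging over -V; for
    symmetric laws this reverses time. *)
Lemma int_shift_sym (k1 k2 : R -> R) : bint k1 -> bint k2 ->
  \int[leb]_x (k1 x * \int[Q]_w k2 (x + V w)) = \int[leb]_x (k2 x * \int[Q]_w k1 (x - V w)).
Proof.
move=> [b1 i1] [b2 i2]; have [_ [M1 H1]] := b1; have [_ [M2 H2]] := b2.
have bV (k : R -> R) (s : bool) x : bdm k -> bdm (fun w => k (x + (-1) ^+ s * V w)).
  by move=> bk; apply: (bdm_comp bk); apply: measurable_funD => //; exact: measurable_funM.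
have bV2 x : bdm (fun w => k2 (x + V w)).
  by have := bV k2 false x b2; congr bdm; apply/funext => w; rewrite expr0 mul1r.
have bV1 x : bdm (fun w => k1 (x - V w)).
  by have := bV k1 true x b1; congr bdm; apply/funext => w; rewrite expr1 mulN1r.
transitivity (\int[leb]_x \int[Q]_w (k1 x * k2 (x + V w))).
  by apply: eq_Rint => x; rewrite RintZ//; exact: bdm_integ.
transitivity (\int[leb]_x \int[Q]_w (k2 x * k1 (x - V w))); last first.
  by apply: eq_Rint => x; rewrite RintZ//; exact: bdm_integ.
have mk1 := integ_meas i1; have mk2 := integ_meas i2.
have q1 : integ Q (fun=> M1) by exact: bdm_integ (bdm_cst _ _).
have q2 : integ Q (fun=> M2) by exact: bdm_integ (bdm_cst _ _).
rewrite (@Rfubini _ _ _ _ _ leb Q (fun p => k1 p.1 * k2 (p.1 + V p.2)))/=; last first.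
  apply: (integ_prod_le _ (integ_abs i1) q2).
    apply: measurable_funM; first exact: measurableT_comp.
    by apply: (measurableT_comp mk2); apply: measurable_funD => //; exact: measurableT_comp.
  by move=> x w /=; rewrite normrM ler_wpM2l.
rewrite (@Rfubini _ _ _ _ _ leb Q (fun p => k2 p.1 * k1 (p.1 - V p.2)))/=; last first.
  apply: (integ_prod_le _ (integ_abs i2) q1).
    apply: measurable_funM; first exact: measurableT_comp.
    by apply: (measurableT_comp mk1); apply: measurable_funB => //; exact: measurableT_comp.
  by move=> x w /=; rewrite normrM ler_wpM2l.
apply: eq_Rint => w.
have ii : integ leb (fun x => k2 x * k1 (x - V w)).
  apply: (integ_le _ (integZ M1 (integ_abs i2))).
    apply: measurable_funM => //; apply: (measurableT_comp mk1); exact: measurable_funB.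
  by move=> x; rewrite normrM mulrC ler_wpM2r.
rewrite -(Rint_shift (V w) ii); apply: eq_Rint => x.
by rewrite addrK mulrC.
Qed.

End shift.

(** * Two-time and four-time correlations along a path *)

Section correlations.
Context {R : realType} (alpha : R).
Local Notation leb := (@lebesgue_measure R).
Context d (Om : measurableType d) (P : probability Om R).
Variable Z : R -> {RV P >-> R}.
Hypothesis hZ : std_symmetric_stable_levy alpha Z.
Implicit Types (phi psi : R -> R) (X : R -> {RV P >-> R}).

(** The semigroup of the motion at time |u|. The absolute value makes it measurable in every real
    [u] and symmetric in a difference of times. *)
Definition pt phi (u x : R) : R := \int[P]_w phi (x + Z `|u| w).

Let mZ u : measurable_fun setT (fun w => Z u w). Proof. by []. Qed.

Let mZx u x : measurable_fun setT (fun w => x + Z u w).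
Proof. exact: measurable_funD. Qed.

Lemma jmZ d' (W : measurableType d') (f g : W -> R) (h : W -> Om) :
  measurable_fun setT f -> measurable_fun setT g -> measurable_fun setT h ->
  measurable_fun setT (fun p => f p + Z `|g p| (h p)).
Proof.
move=> mf mg mh; apply: measurable_funD => //.
have rX w t : 0 <= t -> Z u w @[u --> t^'+] --> Z t w.
  by move=> t0; have [[_ _ _ cl] _] := hZ; have [] := cl w t t0.
have := joint_meas (fun t _ => mZ t) rX.
move=> mj; exact: (measurableT_comp mj (measurable_fun_pair mg mh)).
Qed.

Lemma bdm_pt phi d' (W : measurableType d') (f g : W -> R) : bdm phi ->
  measurable_fun setT f -> measurable_fun setT g -> bdm (fun p => pt phi (f p) (g p)).
Proof.
move=> bphi mf mg.
apply: (@bdm_Rint2 _ _ _ _ _ P (fun q : W * Om => phi (g q.1 + Z `|f q.1| q.2))).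
apply: (bdm_comp bphi); apply: jmZ => //.
- exact: measurableT_comp.
- exact: measurableT_comp.
Qed.

Lemma pt_sym phi u x : bdm phi -> \int[P]_w phi (x - Z `|u| w) = pt phi u x.
Proof.
move=> bphi; rewrite /pt.
have u0 : 0 <= `|u| by [].
have sl : same_law P P (fun w => - Z `|u| w) (fun w => Z `|u| w).
  apply: law_unique => // [|z th]; first exact: measurable_funN.
  rewrite (stable_cos z th hZ u0).
  rewrite (eq_Rint P (fun w => cos ((- z) * Z `|u| w + th))); last by move=> w; rewrite mulrN mulNr.
  by rewrite (stable_cos (- z) th hZ u0) normrN.
have mN : measurable_fun setT (fun w => - Z `|u| w) by exact: measurable_funN.
apply: (same_law_bdm mN (mZ _) sl (f := fun v => phi (x + v))).
by apply: (bdm_comp bphi); exact: measurable_funD.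
Qed.

Lemma pt_le phi M u x : bdm phi -> (forall y, `|phi y| <= M) -> `|pt phi u x| <= M.
Proof.
move=> bphi hM.
have -> : M = \int[P]_w M by rewrite Rintegral_cst// [X in fine X](probability_setT P) mulr1.
apply: Rint_abs_le => //.
- by apply: bdm_integ; apply: (bdm_comp bphi).
- exact: bdm_integ (bdm_cst _ _).
Qed.

Let EcP (c : R) : \int[P]_w c = c.
Proof. by rewrite Rintegral_cst// [X in fine X](probability_setT P) mulr1. Qed.

Lemma corr2 phi X s r y : std_symmetric_stable_levy alpha X -> bdm phi -> 0 <= s -> s <= r ->
  \int[P]_w (phi (y + X s w) * phi (y + X r w)) =
  \int[P]_w (phi (y + Z s w) * pt phi (r - s) (y + Z s w)).
Proof.
move=> hX bphi s0 sr.
pose F (q : R * R * R * R) := phi (y + q.1.1.1) * phi (y + q.1.1.1 + q.1.1.2).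
have bF : bdm F.
  have m2 := @measurable_fst _ _ (R * R * R)%type R.
  have m3 := measurableT_comp (@measurable_fst _ _ (R * R)%type R) m2.
  have p1 := measurableT_comp (@measurable_fst _ _ R R) m3.
  have p2 := measurableT_comp (@measurable_snd _ _ R R) m3.
  have p1' : measurable_fun setT (fun q : R * R * R * R => y + q.1.1.1) by exact: measurable_funD.
  by apply: bdmM; apply: (bdm_comp bphi) => //; exact: measurable_funD.
have := levy_incr4 hX hZ s0 sr (lexx _) (lexx _) bF.
rewrite (eq_Rint P (fun w => phi (y + X s w) * phi (y + X r w))); last first.
  by move=> w; rewrite /F/=; congr (_ * phi _); ring.
move=> ->; rewrite /Eiter4 /F/=; apply: eq_Rint => w1.
rewrite /pt ger0_norm ?subr_ge0// -RintZ; last by apply: bdm_integ; apply: (bdm_comp bphi).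
by apply: eq_Rint => w2; rewrite (eq_Rint P (fun=> phi (y + Z s w1) * phi (y + Z s w1 + Z (r - s) w2))) ?EcP// => w3; rewrite EcP.
Qed.

(** In terms of the semigroup, phi P_u (phi P_v (phi P_t phi)): the four-time correlation as seen
    from the position at the earliest time. *)
Definition ker4 phi u v t (x : R) : R :=
  phi x * \int[P]_w2 (phi (x + Z u w2) * \int[P]_w3 (phi (x + Z u w2 + Z v w3) *
     pt phi t (x + Z u w2 + Z v w3))).

Lemma corr4 phi X s a b r y : std_symmetric_stable_levy alpha X -> bdm phi ->
  0 <= s -> s <= a -> a <= b -> b <= r ->
  \int[P]_w (phi (y + X b w) * phi (y + X a w) * phi (y + X s w) * phi (y + X r w)) =
  \int[P]_w ker4 phi (a - s) (b - a) (r - b) (y + Z s w).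
Proof.
move=> hX bphi s0 sa ab br.
pose F (q : R * R * R * R) := phi (y + q.1.1.1) * (phi (y + q.1.1.1 + q.1.1.2) *
  (phi (y + q.1.1.1 + q.1.1.2 + q.1.2) * phi (y + q.1.1.1 + q.1.1.2 + q.1.2 + q.2))).
have bF : bdm F.
  have p4 := @measurable_snd _ _ (R * R * R)%type R.
  have m2 := @measurable_fst _ _ (R * R * R)%type R.
  have p3 := measurableT_comp (@measurable_snd _ _ (R * R)%type R) m2.
  have m3 := measurableT_comp (@measurable_fst _ _ (R * R)%type R) m2.
  have p1 := measurableT_comp (@measurable_fst _ _ R R) m3.
  have p2 := measurableT_comp (@measurable_snd _ _ R R) m3.
  have q1 : measurable_fun setT (fun q : R * R * R * R => y + q.1.1.1) by exact: measurable_funD.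
  have q2 := measurable_funD q1 p2.
  have q3 := measurable_funD q2 p3.
  have q4 := measurable_funD q3 p4.
  apply: bdmM; first exact: (bdm_comp bphi q1).
  apply: bdmM; first exact: (bdm_comp bphi q2).
  apply: bdmM; first exact: (bdm_comp bphi q3).
  exact: (bdm_comp bphi q4).
have := levy_incr4 hX hZ s0 sa ab br bF.
rewrite (eq_Rint P (fun w => phi (y + X b w) * phi (y + X a w) * phi (y + X s w) * phi (y + X r w))); last first.
  move=> w; rewrite /F/=.
  have -> : y + X s w + (X a w - X s w) = y + X a w by ring.
  have -> : y + X a w + (X b w - X a w) = y + X b w by ring.
  have -> : y + X b w + (X r w - X b w) = y + X r w by ring.
  by ring.
move=> ->; rewrite /Eiter4 /F/=; apply: eq_Rint => w1.
have b4 x : bdm (fun w => phi (x + Z (r - b) w)) by apply: (bdm_comp bphi).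
have b3 x : bdm (fun w => phi (x + Z (b - a) w) * pt phi (r - b) (x + Z (b - a) w)).
  by apply: bdmM; [apply: (bdm_comp bphi)|apply: bdm_pt].
have b2 x : bdm (fun w2 => phi (x + Z (a - s) w2) * \int[P]_w3 (phi (x + Z (a - s) w2 + Z (b - a) w3) *
     pt phi (r - b) (x + Z (a - s) w2 + Z (b - a) w3))).
  apply: bdmM; first exact: (bdm_comp bphi).
  have mm : measurable_fun setT (fun q : Om * Om => x + Z (a - s) q.1 + Z (b - a) q.2).
    apply: measurable_funD; first apply: measurable_funD => //; exact: measurableT_comp.
  apply: (@bdm_Rint2 _ _ _ _ _ P (fun q : Om * Om => phi (x + Z (a - s) q.1 + Z (b - a) q.2) * pt phi (r - b) (x + Z (a - s) q.1 + Z (b - a) q.2))).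
  by apply: bdmM; [exact: (bdm_comp bphi mm)|exact: bdm_pt].
rewrite /ker4 -RintZ; last exact: bdm_integ.
apply: eq_Rint => w2; rewrite mulrA -RintZ; last exact: bdm_integ.
apply: eq_Rint => w3; rewrite /pt ger0_norm ?subr_ge0// !mulrA -RintZ; last exact: bdm_integ.
by apply: eq_Rint => w4; rewrite !mulrA.
Qed.

Variable phi : R -> R.
Hypothesis bphi : bint phi.

Let bi_mul psi : bdm psi -> bint (fun x => phi x * psi x).
Proof.
move=> bp; have [b i] := bphi; split; first exact: bdmM.
have [M hM] : exists M, forall x, `|psi x| <= M by case: bp.
apply: (integ_le _ (integZ M (integ_abs i))); first exact: bdm_meas (bdmM b bp).
by move=> x; rewrite normrM mulrC ler_wpM2r.
Qed.

Lemma int_corr2 X s r : std_symmetric_stable_levy alpha X -> 0 <= s -> 0 <= r ->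
  \int[leb]_y \int[P]_w (phi (y + X s w) * phi (y + X r w)) = \int[leb]_x (phi x * pt phi (r - s) x).
Proof.
move=> hX.
wlog sr : s r / s <= r => [W s0 r0|s0 r0].
  have [sr|/ltW rs] := leP s r; first exact: W.
  rewrite (eq_Rint leb (fun y => \int[P]_w (phi (y + X r w) * phi (y + X s w)))); last first.
    by move=> y; apply: eq_Rint => w; rewrite mulrC.
  by rewrite W//; apply: eq_Rint => x; rewrite /pt distrC.
have [bp ip] := bphi.
rewrite (eq_Rint leb (fun y => \int[P]_w (phi (y + Z s w) * pt phi (r - s) (y + Z s w)))); last first.
  by move=> y; exact: corr2.
rewrite (@int_E_shift _ _ _ P _ (mZ s) (fun x => phi x * pt phi (r - s) x))//.
by case: (bi_mul (bdm_pt bp (@measurable_cst _ _ R R setT (r - s)) (@measurable_id _ R setT))).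
Qed.

Lemma bint_ker4 u v t : bint (ker4 phi u v t).
Proof.
have [bp _] := bphi.
apply: bi_mul.
apply: (@bdm_Rint2 _ _ _ _ _ P (fun q : R * Om => phi (q.1 + Z u q.2) * \int[P]_w3 (phi (q.1 + Z u q.2 + Z v w3) *
     pt phi t (q.1 + Z u q.2 + Z v w3)))).
have m1 : measurable_fun setT (fun q : R * Om => q.1 + Z u q.2).
  by apply: measurable_funD => //; exact: measurableT_comp.
apply: bdmM; first exact: (bdm_comp bp m1).
apply: (@bdm_Rint2 _ _ _ _ _ P (fun q : (R * Om) * Om => phi (q.1.1 + Z u q.1.2 + Z v q.2) * pt phi t (q.1.1 + Z u q.1.2 + Z v q.2))).
have m2 : measurable_fun setT (fun q : (R * Om) * Om => q.1.1 + Z u q.1.2 + Z v q.2).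
  apply: measurable_funD; last exact: measurableT_comp.
  exact: (measurableT_comp m1 measurable_fst).
by apply: bdmM; [exact: (bdm_comp bp m2)|exact: bdm_pt].
Qed.

(** The first gap is reversed by duality. The outer gaps [u] and [t] become the factors [pt phi u]
    and [pt phi t] on either side of the middle gap [v], and can be integrated in time
    separately. *)
Lemma int_corr4 u v t : 0 <= u -> 0 <= v ->
  \int[leb]_x ker4 phi u v t x =
  \int[leb]_x (phi x * pt phi u x * \int[P]_w (phi (x + Z v w) * pt phi t (x + Z v w))).
Proof.
move=> u0 v0; have [bp ip] := bphi.
pose kap x := \int[P]_w (phi (x + Z v w) * pt phi t (x + Z v w)).
have bk : bdm kap.
  have m1 : measurable_fun setT (fun q : R * Om => q.1 + Z v q.2).
    by apply: measurable_funD => //; exact: measurableT_comp.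
  apply: (@bdm_Rint2 _ _ _ _ _ P (fun q : R * Om => phi (q.1 + Z v q.2) * pt phi t (q.1 + Z v q.2))).
  by apply: bdmM; [exact: (bdm_comp bp m1)|exact: bdm_pt].
have := int_shift_sym P (mZ u) bphi (bi_mul bk).
rewrite -/(kap _) /ker4 => ->; apply: eq_Rint => x.
have := pt_sym u x bp; rewrite (ger0_norm u0) => ->.
by rewrite mulrAC -mulrA.
Qed.

End correlations.

(** * Moments of occupation integrals *)

Section swap_leb.
Context {R : realType}.
Local Notation leb := (@lebesgue_measure R).
Context d (W : measurableType d) (Q : probability W R).

Lemma integ_sections (G : measurableTypeR R * W -> R) c : measurable_fun setT G ->
  (forall w, integ leb (fun y => G (y, w))) ->
  (forall w, \int[leb]_y `|G (y, w)| <= c) -> integ (leb \x Q)%E G.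
Proof.
move=> mG iG hc; apply/integrableP; split; first exact/measurable_EFinP.
rewrite (@fubini_tonelli2 _ _ _ _ _ leb Q)//=; last first.
  by apply/measurable_EFinP; apply: measurableT_comp mG.
apply: (@le_lt_trans _ _ (\int[Q]_w c%:E)%E).
  apply: ge0_le_integral => //.
  - by move=> w _; apply: integral_ge0 => y _.
  - apply: (@measurable_fun_fubini_tonelli_G _ _ _ _ _ leb (fun p => `|(G p)%:E|%E)) => //.
    by apply/measurable_EFinP; apply: measurableT_comp mG.
  - move=> w _; rewrite /fubini_G/= Rint_EFin ?lee_fin//.
    exact: integ_abs (iG w).
by rewrite integral_cst// [X in (_ * X)%E](probability_setT Q) mule1 ltry.
Qed.

Lemma int_weight_swap (phi : R -> R) (F : measurableTypeR R * W -> R) : integ leb phi -> bdm F ->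
  \int[Q]_w \int[leb]_x (phi x * F (x, w)) = \int[leb]_x (phi x * \int[Q]_w F (x, w)).
Proof.
move=> ip bF; have [mF [M hM]] := bF.
have mp := integ_meas ip.
have iF x : integ Q (fun w => F (x, w)).
  by apply: bdm_integ; apply: (bdm_comp bF); exact: measurable_fun_pair.
rewrite -(@Rfubini _ _ _ _ _ leb Q (fun p => phi p.1 * F p))/=; last first.
  apply: (integ_prod_le _ (integ_abs ip) (bdm_integ Q (bdm_cst _ M))).
    by apply: measurable_funM => //; exact: measurableT_comp.
  by move=> x w; rewrite normrM ler_wpM2l.
by apply: eq_Rint => x; rewrite RintZ.
Qed.

End swap_leb.

Section occupation.
Context {R : realType} (alpha : R).
Local Notation leb := (@lebesgue_measure R).
Context d (Om : measurableType d) (P : probability Om R).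
Variables X Z : R -> {RV P >-> R}.
Hypotheses (hX : std_symmetric_stable_levy alpha X) (hZ : std_symmetric_stable_levy alpha Z).
Variable U : probability (measurableTypeR R) R.
Hypothesis atomless : forall a, U [set a] = 0%E.
Variable phi : R -> R.
Hypothesis bphi : bint phi.

Local Notation nn s := ((0 <= s)%R%:R : R).

(* A Levy process is constrained at nonnegative times only: the path is read at
   |s| and negative times are cut off. *)
Definition occ (Y : R -> {RV P >-> R}) (y : R) (w : Om) : R :=
  \int[U]_s (nn s * phi (y + Y `|s| w)).

Let bp : bdm phi. Proof. by case: bphi. Qed.
Let ip : integ leb phi. Proof. by case: bphi. Qed.

Let bnn d' (W : measurableType d') (f : W -> R) : measurable_fun setT f -> bdm (fun p => nn (f p)).
Proof. by move=> mf; exact: bdm_le. Qed.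

Let bphiX (Y : R -> {RV P >-> R}) (hY : std_symmetric_stable_levy alpha Y) d' (W : measurableType d') (f g : W -> R) (h : W -> Om) :
  measurable_fun setT f -> measurable_fun setT g -> measurable_fun setT h ->
  bdm (fun p => nn (g p) * phi (f p + Y `|g p| (h p))).
Proof. by move=> mf mg mh; apply: bdmM; [exact: bnn|apply: (bdm_comp bp); exact: (jmZ hY)]. Qed.

Lemma occ_mean y : \int[P]_w occ X y w = \int[U]_s (nn s * pt Z phi s y).
Proof.
have b : bdm (fun q : Om * measurableTypeR R => nn q.2 * phi (y + X `|q.2| q.1)).
  by apply: (bphiX hX).
rewrite (bdm_fubini P U b); apply: eq_Rint => s /=.
rewrite RintZ; last by apply: bdm_integ; apply: (bdm_comp bp); exact: measurable_funD.
congr (_ * _); apply: (same_law_bdm _ _ _ (f := fun v => phi (y + v))) => //.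
- by apply: (stable_same_law hX hZ).
- by apply: (bdm_comp bp); exact: measurable_funD.
Qed.

Definition c2 (Y : R -> {RV P >-> R}) y (q : measurableTypeR R * measurableTypeR R) : R :=
  \int[P]_w ((nn q.1 * phi (y + Y `|q.1| w)) * (nn q.2 * phi (y + Y `|q.2| w))).

Let bc2_in (Y : R -> {RV P >-> R}) (hY : std_symmetric_stable_levy alpha Y) d' (W : measurableType d') (f : W -> R) (g : W -> measurableTypeR R * measurableTypeR R) (h : W -> Om) :
  measurable_fun setT f -> measurable_fun setT g -> measurable_fun setT h ->
  bdm (fun p => (nn (g p).1 * phi (f p + Y `|(g p).1| (h p))) * (nn (g p).2 * phi (f p + Y `|(g p).2| (h p)))).
Proof.
move=> mf mg mh; apply: bdmM; apply: (bphiX hY) => //.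
- exact: (measurableT_comp measurable_fst mg).
- exact: (measurableT_comp measurable_snd mg).
Qed.

Lemma occ_sqr y : \int[P]_w occ X y w ^+ 2 = \int[(U \x U)%E]_q c2 X y q.
Proof.
have b1 w : bdm (fun s : measurableTypeR R => nn s * phi (y + X `|s| w)) by apply: (bphiX hX).
have bw w : bdm (fun q : measurableTypeR R * measurableTypeR R =>
   (nn q.1 * phi (y + X `|q.1| w)) * (nn q.2 * phi (y + X `|q.2| w))) by apply: (bc2_in hX).
have -> : \int[P]_w occ X y w ^+ 2 = \int[P]_w \int[(U \x U)%E]_q
   ((nn q.1 * phi (y + X `|q.1| w)) * (nn q.2 * phi (y + X `|q.2| w))).
  apply: eq_Rint => w; have /= <- := Rfubini1 (bdm_integ_prod U U (bw w)).
  rewrite /occ expr2 -RintZr; last exact: bdm_integ.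
  by apply: eq_Rint => s; rewrite RintZ//; exact: bdm_integ.
pose V2 : probability _ R := (U \x U)%E.
apply: (bdm_fubini P V2 (f := fun p => (nn p.2.1 * phi (y + X `|p.2.1| p.1)) * (nn p.2.2 * phi (y + X `|p.2.2| p.1)))).
exact: (bc2_in hX).
Qed.

Lemma c2_law y q : c2 X y q = c2 Z y q.
Proof.
case: q => s r; rewrite /c2/=.
have [s0|s0] := leP 0 s; last by apply: eq_Rint => w; rewrite !mul0r.
have [r0|r0] := leP 0 r; last by apply: eq_Rint => w; rewrite !mul0r !mulr0.
rewrite (ger0_norm s0) (ger0_norm r0).
wlog sr : s r s0 r0 / s <= r => [H|].
  have [sr|/ltW rs] := leP s r; first exact: H.
  have := H r s r0 s0 rs => h.
  rewrite (eq_Rint P (fun w => 1 * phi (y + X r w) * (1 * phi (y + X s w)))); last by move=> w; rewrite mulrC.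
  by rewrite h; apply: eq_Rint => w; rewrite mulrC.
transitivity (\int[P]_w (phi (y + X s w) * phi (y + X r w))); first by apply: eq_Rint => w; rewrite !mul1r.
transitivity (\int[P]_w (phi (y + Z s w) * phi (y + Z r w))); last by apply: eq_Rint => w; rewrite !mul1r.
by rewrite (corr2 hZ _ hX)// (corr2 hZ _ hZ).
Qed.

Lemma occ_sqr_law y : \int[P]_w occ X y w ^+ 2 = \int[(U \x U)%E]_q c2 Z y q.
Proof. by rewrite occ_sqr; apply: eq_Rint => q; exact: c2_law. Qed.

Let M : R := xget 0 [set M | forall x, `|phi x| <= M].
Let hM x : `|phi x| <= M.
Proof.
have [_ ex] := bp; have : [set M | forall x, `|phi x| <= M] M by exact: xgetPex.
exact.
Qed.
Let M0 : 0 <= M. Proof. exact: le_trans (hM 0). Qed.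

Let aphi x := `|phi x|.
Let baphi : bint aphi.
Proof. by split; [exact: bdm_norm|exact: integ_abs]. Qed.

Let nn1 (s : R) : `|nn s| <= 1. Proof. by rewrite normr_nat lern1 leq_b1. Qed.

Let bptZ f d' (W : measurableType d') (g h : W -> R) : bdm f -> measurable_fun setT g ->
  measurable_fun setT h -> bdm (fun p => pt Z f (g p) (h p)).
Proof. exact: (bdm_pt hZ). Qed.

(** One factor |phi| suffices for integrability in the starting point: the integral over [y] of its
    semigroup does not depend on the time. *)
Lemma integ_pt_dom d' (W : measurableType d') (Q : probability W R)
    (G : measurableTypeR R * W -> R) (s : W -> R) K :
  measurable_fun setT G -> measurable_fun setT s -> 0 <= K ->
  (forall y w, `|G (y, w)| <= K * pt Z aphi (s w) y) -> integ (leb \x Q)%E G.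
Proof.
move=> mG ms K0 h; have [ba ia] := baphi.
have iw w : integ leb (fun y => K * pt Z aphi (s w) y).
  by apply: integZ; apply: (@integ_E_shift _ _ _ P _ _ aphi).
have jw w : integ leb (fun y => G (y, w)).
  apply: (integ_le _ (iw w)); last by move=> y; exact: h.
  exact: meas_sec2.
apply: (@integ_sections _ _ _ _ _ (K * \int[leb]_x aphi x)) => // w.
rewrite -(@int_E_shift _ _ _ P (fun w' => Z `|s w| w') _ aphi)//.
rewrite -RintZ; last by apply: (@integ_E_shift _ _ _ P _ _ aphi).
apply: le_Rint; [exact: integ_abs|exact: iw|by move=> y; exact: h].
Qed.

Lemma c2_le y q : `|c2 Z y q| <= M * pt Z aphi q.1 y.
Proof.
rewrite /pt -RintZ; last by apply: bdm_integ; apply: (bdm_comp (proj1 baphi)); exact: measurable_funD.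
apply: Rint_abs_le.
- apply: bdm_integ; apply: (bc2_in hZ (f := fun _ => y) (g := fun _ => q)) => //.
- by apply: bdm_integ; apply: bdmM; [exact: bdm_cst|apply: (bdm_comp (proj1 baphi)); exact: measurable_funD].
move=> w; rewrite !normrM mulrC; apply: ler_pM; try by rewrite mulr_ge0.
- by rewrite -[leRHS]mul1r; apply: ler_pM.
- by rewrite -[leRHS]mul1r; apply: ler_pM.
Qed.

Lemma bdm_c2 : bdm (fun p : measurableTypeR R * (measurableTypeR R * measurableTypeR R) => c2 Z p.1 p.2).
Proof.
apply: (@bdm_Rint2 _ _ _ _ _ P (fun q : (measurableTypeR R * (measurableTypeR R * measurableTypeR R)) * Om =>
   (nn q.1.2.1 * phi (q.1.1 + Z `|q.1.2.1| q.2)) * (nn q.1.2.2 * phi (q.1.1 + Z `|q.1.2.2| q.2)))).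
apply: (bc2_in hZ) => //.
- exact: (measurableT_comp measurable_fst measurable_fst).
- exact: (measurableT_comp measurable_snd measurable_fst).
Qed.

Lemma int_occ_sqr : integ leb (fun y => \int[P]_w occ X y w ^+ 2) /\
  \int[leb]_y \int[P]_w occ X y w ^+ 2 =
  \int[(U \x U)%E]_q (nn q.1 * nn q.2 * \int[leb]_x (phi x * pt Z phi (q.2 - q.1) x)).
Proof.
pose V2 : probability _ R := (U \x U)%E.
have iG : integ (leb \x V2)%E (fun p => c2 Z p.1 p.2).
  apply: (@integ_pt_dom _ _ V2 _ (fun q => q.1) M) => //.
  - exact: bdm_meas bdm_c2.
  - exact: measurable_fst.
  - by move=> y w; exact: c2_le.
have E : (fun y => \int[P]_w occ X y w ^+ 2) = (fun y => \int[V2]_q c2 Z y q).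
  by apply/funext => y; exact: occ_sqr_law.
rewrite E; split.
  have := integrable_fubini_F iG; congr (integrable _ _ _); apply/funext => y /=.
  have H : bdm (fun q => c2 Z y q).
    by apply: (bdm_comp bdm_c2 (g := fun q => (y, q))); exact: measurable_fun_pair.
  exact: (Rint_EFin (bdm_integ V2 H)).
rewrite (Rfubini iG)/=; apply: eq_Rint => -[s r] /=.
have [s0|s0] := leP 0 s; last first.
  by rewrite !mul0r (eq_Rint leb (fun=> 0)) ?Rint0// => y; rewrite /c2/= (lt_geF s0) (eq_Rint P (fun=> 0)) ?Rint0// => w; rewrite !mul0r.
have [r0|r0] := leP 0 r; last first.
  by rewrite mulr0 !mul0r (eq_Rint leb (fun=> 0)) ?Rint0// => y; rewrite /c2/= (lt_geF r0) (eq_Rint P (fun=> 0)) ?Rint0// => w; rewrite !mul0r mulr0.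
rewrite !mul1r -(int_corr2 hZ bphi hZ s0 r0); apply: eq_Rint => y; apply: eq_Rint => w /=.
by rewrite s0 r0 !mul1r !ger0_norm.
Qed.

Local Notation T4 := (measurableTypeR R * measurableTypeR R * measurableTypeR R * measurableTypeR R)%type.
Local Notation o4 q := (ord4 q.1.1.1 q.1.1.2 q.1.2 q.2).

Definition c4 (Y : R -> {RV P >-> R}) y (q : T4) : R :=
  \int[P]_w ((nn q.1.1.1 * phi (y + Y `|q.1.1.1| w)) * (nn q.1.1.2 * phi (y + Y `|q.1.1.2| w)) *
   (nn q.1.2 * phi (y + Y `|q.1.2| w)) * (nn q.2 * phi (y + Y `|q.2| w))).

Let pr1 : measurable_fun setT (fun q : T4 => q.1.1.1).
Proof. exact: (measurableT_comp measurable_fst (measurableT_comp measurable_fst measurable_fst)). Qed.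
Let pr2 : measurable_fun setT (fun q : T4 => q.1.1.2).
Proof. exact: (measurableT_comp measurable_snd (measurableT_comp measurable_fst measurable_fst)). Qed.
Let pr3 : measurable_fun setT (fun q : T4 => q.1.2).
Proof. exact: (measurableT_comp measurable_snd measurable_fst). Qed.

Let bc4_in (Y : R -> {RV P >-> R}) (hY : std_symmetric_stable_levy alpha Y) d' (W : measurableType d') (f : W -> R) (g : W -> T4) (h : W -> Om) :
  measurable_fun setT f -> measurable_fun setT g -> measurable_fun setT h ->
  bdm (fun p => (nn (g p).1.1.1 * phi (f p + Y `|(g p).1.1.1| (h p))) * (nn (g p).1.1.2 * phi (f p + Y `|(g p).1.1.2| (h p))) *
   (nn (g p).1.2 * phi (f p + Y `|(g p).1.2| (h p))) * (nn (g p).2 * phi (f p + Y `|(g p).2| (h p)))).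
Proof.
move=> mf mg mh; do !apply: bdmM; try apply: bnn; try (apply: (bdm_comp bp); apply: (jmZ hY) => //).
all: first [exact: (measurableT_comp pr1 mg)|exact: (measurableT_comp pr2 mg)|exact: (measurableT_comp pr3 mg)|exact: (measurableT_comp measurable_snd mg)].
Qed.

Lemma bdm_o4 : bdm (fun q : T4 => o4 q).
Proof.
by apply: bdmM; [apply: bdmM|]; apply: bdm_le => //; first [exact: pr1|exact: pr2|exact: pr3].
Qed.

Lemma occ_pow4 y : \int[P]_w occ X y w ^+ 4 = 24 * \int[U4 U]_q (o4 q * c4 X y q).
Proof.
have b1 w : bdm (fun s : measurableTypeR R => nn s * phi (y + X `|s| w)) by apply: (bphiX hX).
pose G (p : Om * T4) := o4 p.2 * ((nn p.2.1.1.1 * phi (y + X `|p.2.1.1.1| p.1)) * (nn p.2.1.1.2 * phi (y + X `|p.2.1.1.2| p.1)) *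
   (nn p.2.1.2 * phi (y + X `|p.2.1.2| p.1)) * (nn p.2.2 * phi (y + X `|p.2.2| p.1))).
have bG : bdm G.
  by apply: bdmM; [exact: (bdm_comp bdm_o4)|apply: (bc4_in hX)].
rewrite (eq_Rint P (fun w => 24 * \int[U4 U]_q G (w, q))); last first.
  by move=> w; rewrite /occ (int_pow4_U4 atomless (b1 w)).
rewrite RintZ; last by apply: bdm_integ; exact: (bdm_Rint2 (U4 U) bG).
congr (_ * _); rewrite (bdm_fubini P (U4 U) bG); apply: eq_Rint => q.
rewrite /G/= RintZ//; apply: bdm_integ.
by apply: (bc4_in hX (f := fun=> y) (g := fun=> q)).
Qed.

Lemma o4_c4 y b a s r : o4 (b, a, s, r) * c4 X y (b, a, s, r) =
  o4 (b, a, s, r) * nn s * \int[P]_w ker4 Z phi (a - s) (b - a) (r - b) (y + Z s w).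
Proof.
rewrite /ord4/=.
have [ab|_] := leP a b; last by rewrite !mul0r.
have [sa|_] := leP s a; last by rewrite !(mulr0, mul0r).
have [br|_] := leP b r; last by rewrite !(mulr0, mul0r).
have [s0|s0] := leP 0 s; last first.
  by rewrite mulr0 mul0r /c4/= (eq_Rint P (fun=> 0)) ?Rint0 ?mulr0// => w; rewrite (lt_geF s0) !(mulr0, mul0r).
have a0 := le_trans s0 sa; have b0 := le_trans a0 ab; have r0 := le_trans b0 br.
rewrite -(corr4 hZ _ hX)// !mul1r /c4/= a0 b0 r0 s0; apply: eq_Rint => w.
by rewrite !ger0_norm// !mul1r.
Qed.

Lemma occ_pow4_law y : \int[P]_w occ X y w ^+ 4 = 24 * \int[U4 U]_q
  (o4 q * nn q.1.2 * \int[P]_w ker4 Z phi (q.1.1.2 - q.1.2) (q.1.1.1 - q.1.1.2) (q.2 - q.1.1.1) (y + Z q.1.2 w)).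
Proof.
by rewrite occ_pow4; congr (_ * _); apply: eq_Rint => -[[[b a] s] r]; exact: o4_c4.
Qed.

Lemma c4_le y q : `|o4 q * c4 X y q| <= M ^+ 3 * pt Z aphi q.1.2 y.
Proof.
have [mo [Mo _]] := bdm_o4.
have o1 : `|o4 q| <= 1.
  by rewrite /ord4 !normrM !normr_nat -!natrM lern1; do 3 case: (_ <= _).
apply: (@le_trans _ _ `|c4 X y q|).
  by rewrite normrM ler_piMl.
have -> : pt Z aphi q.1.2 y = pt X aphi q.1.2 y.
  apply: (same_law_bdm _ _ _ (f := fun v => aphi (y + v))) => //.
  - by apply: (stable_same_law hZ hX).
  - by apply: (bdm_comp (proj1 baphi)); exact: measurable_funD.
rewrite /pt -RintZ; last by apply: bdm_integ; apply: (bdm_comp (proj1 baphi)); exact: measurable_funD.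
apply: Rint_abs_le.
- by apply: bdm_integ; apply: (bc4_in hX (f := fun _ => y) (g := fun _ => q)).
- by apply: bdm_integ; apply: bdmM; [exact: bdm_cst|apply: (bdm_comp (proj1 baphi)); exact: measurable_funD].
(* Three factors are bounded by [M]; the one at the earliest time [q.1.2] is kept. *)
move=> w; rewrite mulrAC !normrM (_ : M ^+ 3 = M * M * M); last by ring.
have H s : `|nn s| * `|phi (y + X `|s| w)| <= M by rewrite -[leRHS]mul1r; apply: ler_pM.
have H' s : `|nn s| * `|phi (y + X `|s| w)| <= aphi (y + X `|s| w) by rewrite -[leRHS]mul1r; apply: ler_pM.
by repeat (apply: ler_pM => //; try by rewrite !mulr_ge0).
Qed.

(** P_v (phi P_t phi): the middle gap followed by the last one. *)
Let kap (v t x : R) : R := \int[P]_w (phi (x + Z `|v| w) * pt Z phi t (x + Z `|v| w)).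

Let bkap d' (W : measurableType d') (v t x : W -> R) : measurable_fun setT v ->
  measurable_fun setT t -> measurable_fun setT x -> bdm (fun p => kap (v p) (t p) (x p)).
Proof.
move=> mv mt mx.
have m1 : measurable_fun setT (fun q : W * Om => x q.1 + Z `|v q.1| q.2).
  by apply: (jmZ hZ) => //; exact: (measurableT_comp _ measurable_fst).
apply: (@bdm_Rint2 _ _ _ _ _ P (fun q : W * Om => phi (x q.1 + Z `|v q.1| q.2) * pt Z phi (t q.1) (x q.1 + Z `|v q.1| q.2))).
apply: bdmM; first exact: (bdm_comp bp m1).
by apply: bptZ => //; exact: (measurableT_comp mt measurable_fst).
Qed.

(** For fixed [a] and [b] the integrals over [s] and [r] separate, and each is a potential of [phi]
    bounded by [D]. The bound is asked only where [phi] does not vanish, because each potential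
    comes multiplied by [phi] at the same point. There remains the mean over a and b of |phi|
    P_|b-a| |phi|. *)
Lemma int_occ_pow4 D : 0 <= D ->
  (forall a x, phi x != 0 -> `|\int[U]_s ((s <= a)%R%:R * (nn s * pt Z phi (a - s) x))| <= D) ->
  (forall b x, phi x != 0 -> `|\int[U]_r ((b <= r)%R%:R * pt Z phi (r - b) x)| <= D) ->
  integ leb (fun y => \int[P]_w occ X y w ^+ 4) /\
  \int[leb]_y \int[P]_w occ X y w ^+ 4 <=
  24 * (D ^+ 2 * \int[leb]_x (aphi x * \int[(U \x U)%E]_q pt Z aphi (q.1 - q.2) x)).
Proof.
move=> D0 HA HB.
have bG : bdm (fun p : measurableTypeR R * T4 => o4 p.2 * c4 X p.1 p.2).
  apply: bdmM; first exact: (bdm_comp bdm_o4).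
  apply: (@bdm_Rint2 _ _ _ _ _ P (fun q : (measurableTypeR R * T4) * Om =>
   (nn q.1.2.1.1.1 * phi (q.1.1 + X `|q.1.2.1.1.1| q.2)) * (nn q.1.2.1.1.2 * phi (q.1.1 + X `|q.1.2.1.1.2| q.2)) *
   (nn q.1.2.1.2 * phi (q.1.1 + X `|q.1.2.1.2| q.2)) * (nn q.1.2.2 * phi (q.1.1 + X `|q.1.2.2| q.2)))).
  apply: (bc4_in hX) => //.
  - exact: (measurableT_comp measurable_fst measurable_fst).
  - exact: (measurableT_comp measurable_snd measurable_fst).
have iG : integ (leb \x U4 U)%E (fun p => o4 p.2 * c4 X p.1 p.2).
  apply: (@integ_pt_dom _ _ (U4 U) _ (fun q => q.1.2) (M ^+ 3)) => //.
  - exact: bdm_meas bG.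
  - exact: exprn_ge0.
  - by move=> y w; exact: c4_le.
have E : (fun y => \int[P]_w occ X y w ^+ 4) = (fun y => 24 * \int[U4 U]_q (o4 q * c4 X y q)).
  by apply/funext => y; exact: occ_pow4.
have i1 : integ leb (fun y => \int[U4 U]_q (o4 q * c4 X y q)).
  have := integrable_fubini_F iG; congr (integrable _ _ _); apply/funext => y /=.
  have H : bdm (fun q => o4 q * c4 X y q).
    by apply: (bdm_comp bG (g := fun q => (y, q))); exact: measurable_fun_pair.
  exact: (Rint_EFin (bdm_integ (U4 U) H)).
rewrite E; split; first exact: integZ.
rewrite RintZ//; apply: ler_wpM2l => //.
rewrite (Rfubini iG)/=.
pose F (p : measurableTypeR R * T4) := o4 p.2 * nn p.2.1.2 * (pt Z phi (p.2.1.1.2 - p.2.1.2) p.1 *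
  kap (p.2.1.1.1 - p.2.1.1.2) (p.2.2 - p.2.1.1.1) p.1).
have mq (k : T4 -> R) : measurable_fun setT k -> measurable_fun setT (fun p : measurableTypeR R * T4 => k p.2).
  by move=> mk; exact: (measurableT_comp mk measurable_snd).
have bF : bdm F.
  apply: bdmM; first apply: bdmM.
  - exact: (bdm_comp bdm_o4).
  - by apply: bnn; exact: (mq _ pr3).
  - apply: bdmM.
      apply: bptZ => //; apply: measurable_funB; [exact: (mq _ pr2)|exact: (mq _ pr3)].
    apply: bkap => //; apply: measurable_funB; try exact: (mq _ pr1); try exact: (mq _ pr2).
    exact: (mq _ measurable_snd).
(* At fixed times this is [int_corr4]; outside the ordered region both sides vanish. *)
have eF q : \int[leb]_y (o4 q * c4 X y q) = \int[leb]_x (phi x * F (x, q)).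
  case: q => -[[b a] s] r.
  rewrite (eq_Rint leb (fun y => o4 (b, a, s, r) * nn s * \int[P]_w ker4 Z phi (a - s) (b - a) (r - b) (y + Z s w))); last first.
    by move=> y; exact: o4_c4.
  have [bk ik] := bint_ker4 hZ bphi (a - s) (b - a) (r - b).
  rewrite RintZ; last by apply: (@integ_E_shift _ _ _ P _ _ (ker4 Z phi (a - s) (b - a) (r - b))).
  rewrite (@int_E_shift _ _ _ P _ _ (ker4 Z phi (a - s) (b - a) (r - b)))//.
  rewrite /F/= /ord4.
  have [ab|_] := leP a b; last by rewrite !mul0r (eq_Rint leb (fun=> 0)) ?Rint0// => x; rewrite !mul0r mulr0.
  have [sa|_] := leP s a; last by rewrite !(mulr0, mul0r) (eq_Rint leb (fun=> 0)) ?Rint0// => x; rewrite !(mulr0, mul0r).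
  have mi := @measurable_id _ R setT; have mc (c : R) := @measurable_cst _ _ R R setT c.
  rewrite (int_corr4 hZ bphi) ?subr_ge0//.
  rewrite (eq_Rint leb (fun x => phi x * (pt Z phi (a - s) x * kap (b - a) (r - b) x))); last first.
    by move=> x; rewrite /kap (@ger0_norm _ (b - a)) ?subr_ge0// mulrA.
  rewrite -RintZ; last first.
    have [mb [Mb hb]] : bdm (fun x : R => pt Z phi (a - s) x * kap (b - a) (r - b) x).
      by apply: bdmM; [exact: bptZ|exact: bkap].
    apply: (integ_le _ (integZ Mb (integ_abs ip))).
      by apply: measurable_funM => //; exact: integ_meas ip.
    by move=> x; rewrite normrM mulrC ler_wpM2r.
  by apply: eq_Rint => x; ring.
rewrite (eq_Rint (U4 U) (fun q => \int[leb]_x (phi x * F (x, q))))//.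
rewrite (int_weight_swap (U4 U) ip bF).
have ba := proj1 baphi; have ia := proj2 baphi.
pose V2 : probability _ R := (U \x U)%E.
have bpp : bdm (fun p : measurableTypeR R * (measurableTypeR R * measurableTypeR R) => pt Z aphi (p.2.1 - p.2.2) p.1).
  by apply: bptZ => //; apply: measurable_funB; [exact: (measurableT_comp measurable_fst measurable_snd)|exact: (measurableT_comp measurable_snd measurable_snd)].
have bP2 : bdm (fun x : measurableTypeR R => \int[V2]_q pt Z aphi (q.1 - q.2) x) by exact: (bdm_Rint2 V2 bpp).
have bF4 : bdm (fun x : measurableTypeR R => \int[U4 U]_q F (x, q)) by exact: (bdm_Rint2 (U4 U) bF).
have bint_mul (k : R -> R) (l : R -> R) : bint k -> bdm l -> integ leb (fun x => k x * l x).
  move=> [bk ik] [ml [K hK]].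
  apply: (integ_le _ (integZ K (integ_abs ik))).
    by apply: measurable_funM => //; exact: integ_meas ik.
  by move=> x; rewrite normrM mulrC ler_wpM2r.
rewrite -RintZ; last exact: (bint_mul _ _ baphi bP2).
apply: (le_trans (ler_norm _)); apply: Rint_abs_le.
- exact: (bint_mul _ _ bphi bF4).
- apply: integZ; exact: (bint_mul _ _ baphi bP2).
move=> x; have [->|px] := eqVneq (phi x) 0.
  rewrite mul0r normr0 mulr_ge0 ?sqr_ge0// mulr_ge0//; first exact: normr_ge0.
  apply: Rintegral_ge0 => q _; apply: Rintegral_ge0 => w _; exact: normr_ge0.
rewrite normrM mulrCA; apply: ler_wpM2l => //.
have bFx : bdm (fun q => F (x, q)) by apply: (bdm_comp bF); exact: measurable_fun_pair.
have bptba : bdm (fun q : measurableTypeR R * measurableTypeR R => pt Z aphi (q.1 - q.2) x).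
  by apply: (bdm_comp bpp (g := fun q => (x, q))); exact: measurable_fun_pair.
rewrite int_U4// [X in _ <= _ * X](_ : _ = \int[U]_b \int[U]_a pt Z aphi (b - a) x); last first.
  exact: (esym (Rfubini1 (bdm_integ_prod U U bptba))).
have bi (b a : R) : bdm (fun s : measurableTypeR R => (s <= a)%R%:R * (nn s * pt Z phi (a - s) x)).
  by apply: bdmM; [exact: bdm_le|apply: bdmM; [exact: bnn|apply: bptZ => //; exact: measurable_funB]].
have bj (b a : R) : bdm (fun r : measurableTypeR R => (b <= r)%R%:R * kap (b - a) (r - b) x).
  by apply: bdmM; [exact: bdm_le|apply: bkap => //; exact: measurable_funB].
have key b a : \int[U]_s \int[U]_r F (x, (b, a, s, r)) = (a <= b)%R%:R *
    (\int[U]_s ((s <= a)%R%:R * (nn s * pt Z phi (a - s) x))) * \int[U]_r ((b <= r)%R%:R * kap (b - a) (r - b) x).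
  pose J := \int[U]_r ((b <= r)%R%:R * kap (b - a) (r - b) x); rewrite -[X in _ = _ * X]/J.
  have ii : integ U (fun s => (s <= a)%R%:R * (nn s * pt Z phi (a - s) x)) := bdm_integ U (bi b a).
  transitivity (\int[U]_s ((a <= b)%R%:R * ((s <= a)%R%:R * (nn s * pt Z phi (a - s) x)) * J)); last first.
    by rewrite RintZr ?RintZ//; exact: integZ.
  apply: eq_Rint => s; rewrite -RintZ; last exact: bdm_integ.
  by apply: eq_Rint => r; rewrite /F/= /ord4; ring.
have bptx (b a : R) : bdm (fun w => aphi (x + Z `|b - a| w)) by apply: (bdm_comp ba); exact: measurable_funD.
(* The last potential is evaluated at the end of the middle gap, where the factor [phi] restricts it
   to the support; the absolute value of that factor is what remains. *)
have keyB b a : `|\int[U]_r ((b <= r)%R%:R * kap (b - a) (r - b) x)| <= D * pt Z aphi (b - a) x.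
  pose H (p : measurableTypeR R * Om) := phi (x + Z `|b - a| p.2) * ((b <= p.1)%R%:R * pt Z phi (p.1 - b) (x + Z `|b - a| p.2)).
  have mx : measurable_fun setT (fun p : measurableTypeR R * Om => x + Z `|b - a| p.2).
    by apply: measurable_funD => //; exact: measurableT_comp.
  have bH : bdm H.
    apply: bdmM; first exact: (bdm_comp bp mx).
    apply: bdmM; first by apply: bdm_le.
    by apply: bptZ => //; exact: measurable_funB.
  rewrite (eq_Rint U (fun r => \int[P]_w H (r, w))); last first.
    move=> r; rewrite /kap -RintZ.
      by apply: eq_Rint => w; rewrite /H/=; ring.
    apply: bdm_integ; apply: bdmM; first by apply: (bdm_comp bp); exact: measurable_funD.
    by apply: bptZ => //; exact: measurable_funD.
  rewrite (bdm_fubini U P bH) /pt -RintZ; last exact: bdm_integ.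
  apply: Rint_abs_le.
  - apply: bdm_integ.
    apply: (@bdm_Rint2 _ _ _ _ _ U (fun q => H (q.2, q.1))).
    by apply: (bdm_comp bH); exact: measurable_fun_pair.
  - by apply: bdm_integ; apply: bdmM; [exact: bdm_cst|].
  move=> w; rewrite /H/= RintZ; last first.
    by apply: bdm_integ; apply: bdmM; [exact: bdm_le|apply: bptZ => //; exact: measurable_funB].
  rewrite normrM mulrC; have [->|pw] := eqVneq (phi (x + Z `|b - a| w)) 0.
    by rewrite normr0 mulr0 mulr_ge0// /aphi.
  by apply: ler_wpM2r => //; exact: HB.
rewrite -RintZ; last by apply: bdm_integ; exact: (bdm_Rint2 U bptba).
have bF3 : bdm (fun q : measurableTypeR R * measurableTypeR R * measurableTypeR R => \int[U]_r F (x, (q, r))).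
  exact: (bdm_Rint2 U bFx).
have bF2 : bdm (fun q : measurableTypeR R * measurableTypeR R => \int[U]_s \int[U]_r F (x, (q, s, r))).
  exact: (bdm_Rint2 U bF3).
apply: Rint_abs_le.
- by apply: bdm_integ; exact: (bdm_Rint2 U bF2).
- by apply: bdm_integ; apply: bdmM; [exact: bdm_cst|exact: (bdm_Rint2 U bptba)].
move=> b.
have bb1 : bdm (fun a : measurableTypeR R => pt Z aphi (b - a) x).
  by apply: bptZ => //; exact: measurable_funB.
rewrite -RintZ; last exact: bdm_integ.
apply: Rint_abs_le.
- by apply: bdm_integ; apply: (bdm_comp bF2 (g := fun a => (b, a))); exact: measurable_fun_pair.
- by apply: bdm_integ; apply: bdmM => //; exact: bdm_cst.
move=> a; rewrite key !normrM normr_nat -mulrA expr2 -mulrA.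
apply: (@le_trans _ _ (1 * (D * (D * pt Z aphi (b - a) x)))); last by rewrite mul1r.
apply: ler_pM; [by []|exact: mulr_ge0|by rewrite lern1 leq_b1|].
by apply: ler_pM; [by []|by []|exact: HA|exact: keyB].
Qed.

End occupation.

(** * Correlations of the test functions and their cosine transforms *)

Section psi_correlation.
Context {R : realType}.
Local Notation leb := (@lebesgue_measure R).
Implicit Types a b c s t x y z : R.

Lemma integ_itv a b : integ leb (\1_(`[a, b]%classic) : R -> R).
Proof.
apply: integ_ge0P.
- by apply: measurable_indic; exact: measurable_itv.
- by move=> x; rewrite indicE.
- by rewrite integral_indic// setIT [X in (X < _)%E](lebesgue_measure_itv `[a, b])/=; case: ifP => _; rewrite -?EFinB ltry.
Qed.

Lemma bint_itv a b : bint (\1_(`[a, b]%classic) : R -> R).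
Proof. by split; [apply: bdm_indic; exact: measurable_itv|exact: integ_itv]. Qed.

Lemma Rint_itv a b : \int[leb]_x \1_(`[a, b]%classic) x = if a < b then b - a else 0.
Proof.
by rewrite /Rintegral integral_indic// setIT [X in fine X](lebesgue_measure_itv `[a, b])/= lte_fin; case: ifP.
Qed.

Ltac nrm u := first [rewrite (@ger0_norm _ u); [|lra] | rewrite (@ler0_norm _ u); [|lra]].

(** The length of the intersection of an interval with a translate of another, as a mixed second
    difference of the absolute value: no case distinction remains, and four of them combine into
    tents in [psi_corr]. *)
Lemma overlap a b c d y : a <= b -> c <= d ->
  \int[leb]_x (\1_(`[a, b]%classic) x * \1_(`[c, d]%classic) (x + y)) =
  (`|b - (c - y)| + `|(d - y) - a| - `|a - (c - y)| - `|b - (d - y)|) / 2 :> R.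
Proof.
move=> ab cd.
rewrite (eq_Rint leb (\1_(`[Num.max a (c - y), Num.min b (d - y)]%classic))); last first.
  move=> x; rewrite !indicE -natrM mulnb; congr (nat_of_bool _)%:R.
  apply/idP/idP.
    rewrite !mem_setE !in_itv/= => /andP[/andP[h1 h2] /andP[h3 h4]].
    by rewrite ge_max le_min h1 h2 lerBlDr h3 lerBrDr h4.
  rewrite !mem_setE !in_itv/= ge_max le_min => /andP[/andP[h1 h3] /andP[h2 h4]].
  by rewrite h1 h2 -lerBlDr h3 -lerBrDr h4.
rewrite Rint_itv; set c' := c - y; set d' := d - y.
have cd' : c' <= d' by rewrite /c' /d' lerB.
move: c' d' cd' => {cd}c' {}d' cd.
case: (leP a c') => h1; case: (leP b d') => h2; case: ltP => h3;
  nrm (b - c'); nrm (d' - a); nrm (a - c'); nrm (b - d'); lra.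
Qed.

Lemma psi_corr s t y : 0 <= s -> 0 <= t ->
  \int[leb]_x (psi s x * psi t (x + y)) =
  2 * tent s y + 2 * tent t y - tent (s + t) y - tent `|s - t| y.
Proof.
move=> s0 t0; have ms0 : - s <= 0 by rewrite oppr_le0.
have mt0 : - t <= 0 by rewrite oppr_le0.
pose I a b c d x := \1_(`[a, b]%classic) x * \1_(`[c, d]%classic) (x + y) : R.
have iI a b c d : integ leb (I a b c d).
  apply: (integ_le _ (integ_itv a b)).
    apply: measurable_funM; first by apply: measurable_indic; exact: measurable_itv.
    have mcd : measurable_fun setT (\1_(`[c, d]%classic) : R -> R) := bdm_meas (proj1 (bint_itv c d)).
    apply: (measurableT_comp mcd); exact: measurable_funD.
  move=> x; rewrite /I normrM !indicE !normr_nat.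
  by case: (_ \in _); case: (_ \in _); rewrite ?mulr1 ?mulr0 ?mul0r.
rewrite (eq_Rint leb (fun x => (I 0 s 0 t x - I 0 s (- t) 0 x) - (I (- s) 0 0 t x - I (- s) 0 (- t) 0 x))); last first.
  by move=> x; rewrite /I /psi; ring.
rewrite RintB; [|exact: integB..]; rewrite !RintB// !overlap//.
rewrite !tentE ?addr_ge0//.
have -> : `|y + `|s - t| | + `|y - `|s - t| | = `|y + (s - t)| + `|y - (s - t)|.
  have [h|h] := leP 0 (s - t); first by rewrite (ger0_norm h).
  by rewrite (ltr0_norm h) opprK addrC.
have N (u v : R) : u = - v -> `|u| = `|v| :> R by move=> ->; rewrite normrN.
have E (u v : R) : u = v -> `|u| = `|v| :> R by move=> ->.
rewrite (E (s - (0 - y)) (y + s)); last by ring.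
rewrite (N (t - y - 0) (y - t)); last by ring.
rewrite (E (0 - (0 - y)) y); last by ring.
rewrite (E (s - (t - y)) (y + (s - t))); last by ring.
rewrite (E (s - (- t - y)) (y + (s + t))); last by ring.
rewrite (N (0 - y - 0) y); last by ring.
rewrite (E (0 - (- t - y)) (y + t)); last by ring.
rewrite (E (0 - (t - y)) (y - t)); last by ring.
rewrite (N (t - y - - s) (y - (s + t))); last by ring.
rewrite (E (- s - (0 - y)) (y - s)); last by ring.
rewrite (N (0 - y - - s) (y - s)); last by ring.
rewrite (E (- s - (- t - y)) (y - (s - t))); last by ring.
by field.
Qed.

(** [tent_rep] term by term, and the identity 2(1 - cos S)(1 - cos T) = 2(1 - cos S) + 2(1 - cos T)
    - (1 - cos(S + T)) - (1 - cos(S - T)). *)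
Lemma psi_corr_rep s t y : 0 <= s -> 0 <= t ->
  c1 * \int[leb]_x (psi s x * psi t (x + y)) =
  \int[leb]_z (cos (z * y) * (2 * ((1 - cos (s * z)) * (1 - cos (t * z))) / z ^+ 2)).
Proof.
move=> s0 t0.
have rep u : 0 <= u -> c1 * tent u y = \int[leb]_z (cos (z * y) * ((1 - cos (u * z)) / z ^+ 2)).
  by apply: (@tent_rep R 2) => //; rewrite ltr1n.
rewrite psi_corr// !mulrBr mulrDr !(mulrCA c1) !rep ?addr_ge0//.
have i u : integ leb (fun z => cos (z * y) * ((1 - cos (u * z)) / z ^+ 2)).
  by apply: integ_cosM; exact: integ_q.
rewrite -!RintZ// -RintD; [|exact: integZ..].
rewrite -RintB//; last by apply: integD; exact: integZ.
rewrite -RintB//; last by apply: integB => //; apply: integD; exact: integZ.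
apply: eq_Rint => z.
have -> : cos (`|s - t| * z) = cos ((s - t) * z).
  have [h|h] := leP 0 (s - t); first by rewrite ger0_norm.
  by rewrite ltr0_norm// mulNr cosN.
have -> : cos ((s + t) * z) = cos (s * z) * cos (t * z) - sin (s * z) * sin (t * z).
  by rewrite mulrDl cosD.
have -> : cos ((s - t) * z) = cos (s * z) * cos (t * z) + sin (s * z) * sin (t * z).
  by rewrite mulrBl cosB.
by ring.
Qed.

Variables (n : nat) (t b : 'I_n -> R).
Hypothesis t0 : forall i, 0 <= t i.

Definition phis (y : R) : R := \sum_i b i * psi (t i) y.
Definition mulp (z : R) : R := \sum_i b i * (1 - cos (t i * z)).
(* As [psi u] has Fourier transform 2i (1 - cos (u z)) / z, this is half the squared
   modulus of the Fourier transform of [phis]. *)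
Definition gker (z : R) : R := 2 * (mulp z * mulp z) / z ^+ 2.

Lemma bint_psi u : bint (psi u : R -> R).
Proof.
have [b1 i1] := bint_itv 0 u; have [b2 i2] := bint_itv (- u) 0.
by split; [exact: bdmB|exact: integB].
Qed.

Lemma bint_phis : bint phis.
Proof.
split.
  by apply: bdm_sum => i; apply: bdmM; [exact: bdm_cst|exact: (proj1 (bint_psi _))].
by apply: integ_sum => i; apply: integZ; exact: (proj2 (bint_psi _)).
Qed.

Lemma psi_odd u y : psi u (- y) = - psi u y.
Proof.
rewrite /psi opprB !indicE !mem_setE !in_itv/= oppr_ge0 oppr_le0 lerN2 lerNl.
by rewrite (andbC (y <= 0)) (andbC (y <= u)).
Qed.

Lemma psi_le1 u y : `|psi u y| <= 1.
Proof.
rewrite /psi !indicE; case: (_ \in _); case: (_ \in _);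
  by rewrite /= ?subrr ?subr0 ?sub0r ?normrN ?normr0 ?normr1.
Qed.

Lemma psi_supp u y : u < `|y| -> psi u y = 0.
Proof.
move=> uy; rewrite /psi !indicE !mem_setE !in_itv/=.
have -> : (0 <= y <= u) = false.
  by apply/negbTE/negP => /andP[a1 a2]; move: uy; rewrite ger0_norm// ltNge a2.
have -> : (- u <= y <= 0) = false.
  by apply/negbTE/negP => /andP[a1 a2]; move: uy; rewrite ler0_norm// ltNge lerNl a1.
by rewrite subrr.
Qed.

(** A radius of the support of [phis]: the sum bounds each of the nonnegative [t i]. *)
Definition Lphi : R := \sum_i t i.
Definition Mphi : R := \sum_i `|b i|.

Lemma Lphi_ge0 : 0 <= Lphi. Proof. by apply: sumr_ge0. Qed.
Lemma Mphi_ge0 : 0 <= Mphi. Proof. by apply: sumr_ge0. Qed.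

Lemma phis_supp y : Lphi < `|y| -> phis y = 0.
Proof.
move=> Ly; apply: big1 => i _; rewrite psi_supp ?mulr0//.
apply: le_lt_trans Ly; rewrite /Lphi (bigD1 i)//= lerDl; exact: sumr_ge0.
Qed.

Lemma phis_le y : `|phis y| <= Mphi.
Proof.
apply: le_trans (ler_norm_sum _ _ _) _; apply: ler_sum => i _.
by rewrite normrM ler_piMr// psi_le1.
Qed.

Lemma mult2_mulp : mult2 mulp.
Proof. by apply: mult2_sum => i; apply: mult2Z; exact: mult2_one_cos. Qed.

Lemma gker_ge0 z : 0 <= gker z.
Proof. by rewrite divr_ge0 ?sqr_ge0// mulr_ge0// -expr2 sqr_ge0. Qed.

Lemma integ_gker : integ leb gker.
Proof.
have alpha2 : (1 : R) < 2 by rewrite ltr1n.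
apply: (@mult2_integ R 2 alpha2 (lexx _) (fun z => 2 * (mulp z * mulp z))).
by apply: mult2Z; apply: mult2M; exact: mult2_mulp.
Qed.

Lemma phis_corr_rep y : c1 * \int[leb]_x (phis x * phis (x + y)) =
  \int[leb]_z (gker z * cos (z * y)).
Proof.
have iij i j : integ leb (fun x => psi (t i) x * psi (t j) (x + y)).
  have [bi ii] := bint_psi (t i); have [bj _] := bint_psi (t j).
  apply: (integ_le _ (integ_abs ii)).
    apply: measurable_funM; first exact: integ_meas ii.
    by apply: (measurableT_comp (bdm_meas bj)); exact: measurable_funD.
  by move=> x; rewrite normrM ler_piMr// psi_le1.
have jij i j : integ leb (fun z => cos (z * y) * (2 * ((1 - cos (t i * z)) * (1 - cos (t j * z))) / z ^+ 2)).
  have alpha2 : (1 : R) < 2 by rewrite ltr1n.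
  apply: integ_cosM; apply: (@mult2_integ R 2 alpha2 (lexx _) (fun z => 2 * ((1 - cos (t i * z)) * (1 - cos (t j * z))))).
  by apply: mult2Z; apply: mult2M; exact: mult2_one_cos.
rewrite (eq_Rint leb (fun x => \sum_i \sum_j (b i * b j) * (psi (t i) x * psi (t j) (x + y)))); last first.
  move=> x; rewrite /phis mulr_suml; apply: eq_bigr => i _.
  by rewrite mulr_sumr; apply: eq_bigr => j _; ring.
rewrite Rint_sum; last by move=> i; apply: integ_sum => j; exact: integZ.
rewrite (eq_Rint leb (fun z => \sum_i \sum_j (b i * b j) * (cos (z * y) * (2 * ((1 - cos (t i * z)) * (1 - cos (t j * z))) / z ^+ 2)))); last first.
  move=> z; rewrite /gker /mulp mulr_suml mulr_sumr !mulr_suml; apply: eq_bigr => i _.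
  rewrite mulr_sumr mulr_sumr !mulr_suml; apply: eq_bigr => j _; ring.
rewrite Rint_sum; last by move=> i; apply: integ_sum => j; exact: integZ.
rewrite mulr_sumr; apply: eq_bigr => i _.
rewrite Rint_sum; last by move=> j; exact: integZ.
rewrite Rint_sum; last by move=> j; exact: integZ.
rewrite mulr_sumr; apply: eq_bigr => j _.
by rewrite RintZ// RintZ// mulrCA psi_corr_rep.
Qed.

(** Parseval's identity in the form used for all second-order quantities: [V] will be a displacement
    at random times, whose cosine transform is explicit. *)
Lemma phis_E_rep (d : measure_display) (W : measurableType d) (Q : probability W R) (V : W -> R) :
  measurable_fun setT V ->
  c1 * \int[leb]_x (phis x * \int[Q]_w phis (x + V w)) =
  \int[leb]_z (gker z * \int[Q]_w cos (z * V w)).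
Proof.
move=> mV; have [bp ip] := bint_phis.
have bF : bdm (fun p : measurableTypeR R * W => phis (p.1 + V p.2)).
  by apply: (bdm_comp bp); apply: measurable_funD => //; exact: measurableT_comp.
have bC : bdm (fun p : measurableTypeR R * W => cos (p.1 * V p.2)).
  by apply: bdm_cos; apply: measurable_funM => //; exact: measurableT_comp.
rewrite -(int_weight_swap Q ip bF) -(int_weight_swap Q integ_gker bC) -RintZ/=.
  by apply: eq_Rint => w; exact: phis_corr_rep.
apply: bdm_integ; have [Mb [K hK]] := bp.
have mF := bdm_meas bF.
have iP : integ (leb \x Q)%E (fun p => phis p.1 * phis (p.1 + V p.2)).
  apply: (integ_prod_le _ (integ_abs ip) (bdm_integ Q (bdm_cst _ K))).
    by apply: measurable_funM => //; exact: (measurableT_comp Mb measurable_fst).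
  by move=> x w /=; rewrite normrM ler_wpM2l.
split.
  have := measurable_fubini_G iP.
  rewrite /fubini_G/= => mG; apply/measurable_EFinP.
  move: mG; congr (measurable_fun _ _); apply/funext => w /=.
  rewrite Rint_EFin//.
  apply: (integ_le _ (integZ K (integ_abs ip))).
    by apply: measurable_funM => //; apply: (measurableT_comp Mb); exact: measurable_funD.
  by move=> x; rewrite normrM mulrC ler_wpM2r.
exists (\int[leb]_x (K * `|phis x|)) => w; apply: Rint_abs_le.
- apply: (integ_le _ (integZ K (integ_abs ip))).
    by apply: measurable_funM => //; apply: (measurableT_comp Mb); exact: measurable_funD.
  by move=> x; rewrite normrM mulrC ler_wpM2r.
- exact: integZ (integ_abs ip).
- by move=> x; rewrite normrM mulrC ler_wpM2r.
Qed.

End psi_correlation.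

(** * Potentials and uniform times *)

Lemma norm_lim_le {R : realType} (u : nat -> R) l B :
  u @ \oo --> l -> (forall n, `|u n| <= B) -> `|l| <= B.
Proof.
move=> ul h; have nl : (fun n => `|u n|) @ \oo --> `|l| by exact: cvg_norm.
rewrite -(cvg_lim _ nl)//; apply: limr_le; first by apply/cvg_ex; exists `|l|.
by apply: nearW => k; exact: h.
Qed.

Section potential.
Context {R : realType} (alpha : R).
Hypotheses (alpha_gt1 : 1 < alpha) (alpha_le2 : alpha <= 2).
Local Notation leb := (@lebesgue_measure R).
Local Notation lam := (lam alpha).
Local Notation q t := (fun z : R => (1 - cos (t * z)) / z ^+ 2).
Context d (Om : measurableType d) (P : probability Om R).
Variable Z : R -> {RV P >-> R}.
Hypothesis hZ : std_symmetric_stable_levy alpha Z.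

Lemma expR_le_inv (x : R) : 0 < x -> expR (- x) <= x^-1.
Proof.
move=> x0; rewrite expRN lef_pV2 ?posrE ?expR_gt0//.
by apply: le_trans (expR_ge1Dx x); rewrite lerDr.
Qed.

Lemma exp_lam_meas u : measurable_fun setT (fun z => expR (- (u * lam z))).
Proof.
apply: measurableT_comp => //; apply: measurable_funN.
by apply: measurable_funM => //; exact: meas_lam.
Qed.

Lemma exp_lam_le1 u z : 0 <= u -> expR (- (u * lam z)) <= 1.
Proof. by move=> u0; rewrite expR_le1 oppr_le0 mulr_ge0// lam_ge0. Qed.

Lemma exp_lam_integ u : 0 < u -> integ leb (fun z => expR (- (u * lam z))).
Proof.
move=> u0; apply: (integ_dom alpha_gt1 (A := 1 + u^-1)).
- exact: exp_lam_meas.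
- move=> z _ _; rewrite ger0_norm ?expR_ge0//.
  apply: le_trans (exp_lam_le1 z (ltW u0)) _.
  by rewrite lerDl invr_ge0 ltW.
- move=> z z1; have z0 : z != 0 by rewrite -normr_gt0; apply: lt_trans z1.
  have l0 := lam_gt0 alpha z0.
  rewrite ger0_norm ?expR_ge0//; apply: le_trans (expR_le_inv (mulr_gt0 u0 l0)) _.
  by rewrite invfM mulrDl lerDr mul1r invr_ge0 ltW.
Qed.

Lemma stable_tent (u x t : R) : 0 <= t ->
  c1 * \int[P]_w tent t (x + Z `|u| w) =
  \int[leb]_z (cos (z * x) * expR (- (`|u| * lam z)) * q t z).
Proof.
move=> t0; have mX : measurable_fun setT (fun w => x + Z `|u| w) by exact: measurable_funD.
have := @tent_fubini _ _ _ P (fun=> 1) _ _ t0 (bdm_cst _ 1) mX.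
rewrite (eq_Rint P (fun w => tent t (x + Z `|u| w))); last by move=> w; rewrite mul1r.
move=> ->; apply: eq_Rint => z; congr (_ * _).
rewrite -(stable_cos z (z * x) hZ (normr_ge0 u)); apply: eq_Rint => w.
by rewrite mul1r mulrDr addrC.
Qed.

(** A tent of height e at [c] dominates e times the indicator of the atom, while its expectation is
    of order e^2 because exp(-|u| [lam z]) is integrable in z; then e tends to 0. *)
Lemma no_atom (u c : R) : u != 0 -> P [set w | Z `|u| w = c] = 0%E.
Proof.
move=> u0; have au : 0 < `|u| by rewrite normr_gt0.
set A := [set w | _].
have mA : measurable A.
  rewrite (_ : A = setT `&` (Z `|u| @^-1` [set c])); last by rewrite setTI.
  by apply: (measurable_funPT (Z `|u|)) => //; exact: measurable_set1.
pose I := \int[leb]_z expR (- (`|u| * lam z)).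
have I0 : 0 <= I by apply: Rintegral_ge0 => z _; exact: expR_ge0.
have c10 : 0 < @c1 R by apply: (@c1_gt0 R 2); rewrite ?ltr1n.
have bnd e : 0 < e -> c1 * fine (P A) <= e * (I / 2).
  move=> e0; rewrite -(ler_pM2l e0) mulrCA.
  apply: (@le_trans _ _ (c1 * \int[P]_w tent e (- c + Z `|u| w))).
    rewrite ler_pM2l//.
    have -> : e * fine (P A) = \int[P]_w (e * \1_A w).
      rewrite RintZ; last by apply: bdm_integ; exact: bdm_indic.
      by rewrite /Rintegral integral_indic// setIT.
    apply: le_Rint.
    - by apply: bdm_integ; apply: bdmM; [exact: bdm_cst|exact: bdm_indic].
    - apply: bdm_integ; apply: bdm_tent; [exact: ltW|exact: measurable_funD].
    - move=> w; rewrite indicE; case: (boolP (w \in A)) => wA; last by rewrite mulr0 tent_ge0.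
      move: wA; rewrite inE /A/= => ->; rewrite addNr /tent normr0 subr0 mulr1.
      by rewrite le_max lexx orbT.
  rewrite stable_tent; last exact: ltW.
  have -> : e * (e * (I / 2)) = \int[leb]_z ((e ^+ 2 / 2) * expR (- (`|u| * lam z))).
    by rewrite RintZ; [rewrite /I; field|exact: exp_lam_integ].
  have iL : integ leb (fun z => cos (z * - c) * expR (- (`|u| * lam z)) * q e z).
    apply: (integ_le _ (integ_q e)).
      apply: measurable_funM; last exact: integ_meas (integ_q e).
      apply: measurable_funM; last exact: exp_lam_meas.
      by apply: bdm_meas; apply: bdm_cos; exact: measurable_funM.
    move=> z; rewrite normrM (ger0_norm (q_ge0 e z)) ler_piMl ?q_ge0//.
    rewrite normrM mulr_ile1// ?cos_max// ger0_norm ?expR_ge0//.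
    exact: exp_lam_le1.
  apply: le_Rint => //; first exact: integZ (exp_lam_integ au).
  move=> z; apply: le_trans (ler_norm _) _.
  rewrite normrM (ger0_norm (q_ge0 e z)) normrM (ger0_norm (expR_ge0 _)) mulrC.
  apply: ler_pM; rewrite ?q_ge0 ?mulr_ge0 ?expR_ge0//.
    have [->|z0] := eqVneq z 0; first by rewrite expr0n invr0 mulr0 divr_ge0 ?sqr_ge0.
    rewrite ler_pdivrMr ?exprn_even_gt0//; apply: le_trans (one_cos_le _) _.
    by rewrite exprMn; lra.
  by rewrite ler_piMl ?expR_ge0// cos_max.
suff : fine (P A) <= 0.
  move=> h; apply/eqP; rewrite eq_le measure_ge0 andbT.
  by rewrite -(fineK (fin_num_measure P _ mA)) lee_fin.
rewrite -(pmulr_rle0 _ c10); apply/ler_addgt0Pl => e e0; rewrite addr0.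
have I2 : 0 < I / 2 + 1 by rewrite ltr_wpDl// divr_ge0.
apply: le_trans (bnd (e / (I / 2 + 1)) _) _; first by rewrite divr_gt0.
by rewrite mulrAC ler_pdivrMr// ler_pM2l// lerDl.
Qed.

(** [psi t] is minus the derivative of [tent t]. Its own sine transform is not absolutely
    integrable; those of these quotients are. *)
Definition quot (t : R) (n : nat) (y : R) : R :=
  (tent t (y - n.+1%:R^-1) - tent t y) * n.+1%:R.

Lemma tent_lip (t x y : R) : `|tent t x - tent t y| <= `|x - y|.
Proof.
rewrite /tent; have h1 := ler_dist_dist x y; have := ler_norm (`|x| - `|y|); have := ler_norm (- (`|x| - `|y|)).
rewrite normrN => h2 h3.
by rewrite ler_norml; case: (leP 0 (t - `|x|)) => ?; case: (leP 0 (t - `|y|)) => ?; apply/andP; split; lra.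
Qed.

Lemma quot_le1 (t : R) n (y : R) : `|quot t n y| <= 1.
Proof.
rewrite /quot normrM (ger0_norm (ler0n _ _)).
apply: (@le_trans _ _ (n.+1%:R^-1 * n.+1%:R)); last by rewrite mulVf// pnatr_eq0.
apply: ler_wpM2r => //; apply: le_trans (tent_lip _ _ _) _.
by rewrite (_ : y - _ - y = - n.+1%:R^-1) ?normrN ?ger0_norm//; ring.
Qed.

Lemma bdm_quot d' (W : measurableType d') t n (f : W -> R) : 0 <= t ->
  measurable_fun setT f -> bdm (fun p => quot t n (f p)).
Proof.
move=> t0 mf; apply: bdmM; last exact: bdm_cst.
by apply: bdmB; apply: bdm_tent => //; exact: measurable_funB.
Qed.

Lemma quot_cvg (t y : R) : 0 <= t -> y != 0 -> y != t -> y != - t ->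
  quot t n y @[n --> \oo] --> psi t y.
Proof.
move=> t0 y0 yt yNt.
pose m := Num.min `|y| (Num.min `|y - t| `|y + t|).
have m0 : 0 < m by rewrite !lt_min !normr_gt0 y0 subr_eq0 yt addr_eq0 yNt.
apply: cvg_near_cst.
have [N _ HN] := near_infty_natSinv_lt (PosNum m0).
exists N => // n Nn /=; have /= := HN n Nn.
rewrite /quot /psi !indicE !mem_setE !in_itv/=.
have n0 : n.+1%:R != 0 :> R by rewrite pnatr_eq0.
have e0 : 0 < n.+1%:R^-1 :> R by rewrite invr_gt0.
rewrite -[X in _ * X]invrK.
move: (n.+1%:R^-1) e0 => e e0.
rewrite !lt_min => /andP[h1 /andP[h2 h3]].
have D u : tent t (y - e) - tent t y = u * e -> (tent t (y - e) - tent t y) / e = u.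
  by move=> ->; rewrite mulfK// gt_eqF.
rewrite /tent in D *.
have [yp|yn] := ltP 0 y.
  rewrite (gtr0_norm yp) in h1.
  rewrite andbF (ltW yp)/= subr0.
  have [yt'|ty'] := leP y t.
    have yt2 : y < t by rewrite lt_neqAle yt.
    rewrite ltr0_norm ?subr_lt0// in h2.
    apply: (D 1); rewrite (gtr0_norm yp) (@gtr0_norm _ (y - e)) ?subr_gt0//.
    by rewrite !max_r; lra.
  rewrite gtr0_norm ?subr_gt0// in h2.
  apply: (D 0); rewrite (gtr0_norm yp) (@gtr0_norm _ (y - e)) ?subr_gt0//.
  by rewrite !max_l; lra.
have yn' : y < 0 by rewrite lt_neqAle y0.
rewrite (ltr0_norm yn') in h1.
rewrite andbT (lt_geF yn')/=.
have [yt'|ty'] := leP (- t) y.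
  have yt2 : - t < y by rewrite lt_neqAle eq_sym yNt.
  have ypt : 0 < y + t by lra.
  rewrite gtr0_norm// in h3.
  apply: (D (0 - 1)); rewrite (ltr0_norm yn') (@ltr0_norm _ (y - e)) ?subr_lt0//; last by lra.
  by rewrite !max_r; lra.
have ypt : y + t < 0 by lra.
rewrite ltr0_norm// in h3.
apply: (D (0 - 0)); rewrite (ltr0_norm yn') (@ltr0_norm _ (y - e)) ?subr_lt0//; last by lra.
by rewrite !max_l; lra.
Qed.

Lemma pt_quot_cvg (t u x : R) : 0 <= t -> u != 0 ->
  pt Z (quot t n) u x @[n --> \oo] --> pt Z (psi t) u x.
Proof.
move=> t0 u0.
have mx : measurable_fun setT (fun w => x + Z `|u| w) by exact: measurable_funD.
apply: (@dct _ _ _ P (fun n w => quot t n (x + Z `|u| w)) _ (fun=> 1)).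
- by move=> n; apply: bdm_meas; exact: bdm_quot.
- by apply: bdm_meas; exact: (bdm_comp (proj1 (bint_psi t))).
(* At 0, t and -t the quotients need not converge to [psi t]; these positions have probability 0. *)
- pose B := [set w | Z `|u| w = - x] `|` ([set w | Z `|u| w = t - x] `|` [set w | Z `|u| w = - t - x]).
  have mB c : measurable [set w | Z `|u| w = c].
    rewrite (_ : [set w | _] = setT `&` (Z `|u| @^-1` [set c])); last by rewrite setTI.
    by apply: (measurable_funPT (Z `|u|)) => //; exact: measurable_set1.
  exists B; split.
  + by apply: measurableU => //; exact: measurableU.
  + have PU (A A' : set Om) : measurable A -> measurable A' -> P A = 0%E -> P A' = 0%E -> P (A `|` A') = 0%E.
      move=> mA mA' A0 A'0; apply/eqP; rewrite eq_le measure_ge0 andbT.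
      by apply: le_trans (measureU2 P mA mA') _; rewrite [X in (X + _)%E]A0 [X in (_ + X)%E]A'0 adde0.
    by apply: (PU) => //; [exact: measurableU|exact: no_atom|apply: (PU) => //; exact: no_atom].
  + move=> w /= H; apply: contrapT => nB; apply: H.
    apply: quot_cvg => //; apply/eqP => h; apply: nB.
    * by left; rewrite /= -[RHS]add0r -h addrAC subrr add0r.
    * by right; left; rewrite /= -h addrAC subrr add0r.
    * by right; right; rewrite /= -h addrAC subrr add0r.
- exact: bdm_integ (bdm_cst _ _).
- by move=> n w; exact: quot_le1.
Qed.

(** Difference quotient of cos(z x) in x, with limit z sin(z x). *)
Definition dq (n : nat) (x z : R) : R := (cos (z * (x - n.+1%:R^-1)) - cos (z * x)) * n.+1%:R.

(** The bound is uniform in [n] and of order z^2 near 0, a trace of the oddness of [psi]: this makes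
    its product with 1/|z|^alpha integrable although alpha > 1. *)
Lemma dq_le n (x L z : R) : `|x| <= L -> `|dq n x z| <= `|z| * Num.min 1 (`|z| * (L + 1)).
Proof.
move=> xL; rewrite /dq normrM (ger0_norm (ler0n _ _)).
have e0 : 0 < n.+1%:R^-1 :> R by rewrite invr_gt0.
have e1 : n.+1%:R^-1 <= 1 :> R by rewrite invf_le1// ler1n.
rewrite -[X in _ * X <= _]invrK.
move: (n.+1%:R^-1) e0 e1 => e e0 e1.
rewrite ler_pdivrMr//.
have -> : cos (z * (x - e)) - cos (z * x) = 2 * sin (z * (x - e / 2)) * sin (z * e / 2).
  have -> : z * (x - e) = z * (x - e / 2) - z * e / 2 by field.
  have -> : z * x = z * (x - e / 2) + z * e / 2 by field.
  by rewrite cosB cosD; ring.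
have s1 : `|sin (z * e / 2)| <= `|z| * e / 2.
  apply: le_trans (sin_le_norm _) _.
  by rewrite !normrM (gtr0_norm e0) (ger0_norm (_ : 0 <= 2^-1)).
have s2 : `|sin (z * (x - e / 2))| <= Num.min 1 (`|z| * (L + 1)).
  rewrite le_min sin_max/=; apply: le_trans (sin_le_norm _) _.
  rewrite normrM ler_wpM2l//; apply: le_trans (ler_normB _ _) _.
  by apply: lerD => //; rewrite gtr0_norm; lra.
rewrite !normrM (ger0_norm (ler0n _ 2)).
rewrite (_ : `|z| * _ * e = 2 * Num.min 1 (`|z| * (L + 1)) * (`|z| * e / 2)); last by field.
apply: ler_pM => //; by rewrite ler_pM2l.
Qed.

Lemma pt_quot_rep (t : R) n (u x : R) : 0 <= t ->
  c1 * pt Z (quot t n) u x = \int[leb]_z (q t z * dq n x z * expR (- (`|u| * lam z))).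
Proof.
move=> t0.
have bt y : bdm (fun w => tent t (y + Z `|u| w)) by apply: bdm_tent => //; exact: measurable_funD.
have i1 y : integ leb (fun z => cos (z * y) * expR (- (`|u| * lam z)) * q t z).
  apply: (integ_le _ (integ_q t)).
    apply: measurable_funM; last exact: integ_meas (integ_q t).
    apply: measurable_funM; last exact: exp_lam_meas.
    by apply: bdm_meas; apply: bdm_cos; exact: measurable_funM.
  move=> z; rewrite normrM (ger0_norm (q_ge0 t z)) ler_piMl ?q_ge0//.
  rewrite normrM mulr_ile1// ?cos_max// ger0_norm ?expR_ge0//.
  exact: exp_lam_le1.
rewrite /pt /quot RintZr; last by apply: bdm_integ; apply: bdmB => //; have := bt (x - n.+1%:R^-1); congr bdm; apply/funext => w; rewrite addrAC.
rewrite RintB; last 2 first.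
- by apply: bdm_integ; have := bt (x - n.+1%:R^-1); congr bdm; apply/funext => w; rewrite addrAC.
- exact: bdm_integ (bt x).
have E1 := stable_tent u (x - n.+1%:R^-1) t0; have E2 := stable_tent u x t0.
rewrite (eq_Rint P (fun w => tent t ((x - n.+1%:R^-1) + Z `|u| w))); last by move=> w; rewrite addrAC.
rewrite mulrA mulrBr E1 E2 -RintB// -RintZr; last exact: integB.
by apply: eq_Rint => z; rewrite /dq; ring.
Qed.

Definition Cpot (t L : R) : R :=
  c1^-1 * \int[leb]_z (`|1 - cos (t * z)| / z ^+ 2 * `|z| * Num.min 1 (`|z| * (L + 1)) / lam z).

Lemma Cpot_ge0 (t L : R) : 0 <= L -> 0 <= Cpot t L.
Proof.
move=> L0; rewrite /Cpot mulr_ge0 ?invr_ge0//; first by apply/ltW; apply: (@c1_gt0 R 2); rewrite ?ltr1n.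
apply: Rintegral_ge0 => z _; rewrite divr_ge0 ?lam_ge0// mulr_ge0//.
  by rewrite mulr_ge0// divr_ge0// sqr_ge0.
by rewrite le_min ler01 mulr_ge0// addr_ge0.
Qed.

Context (U : probability (measurableTypeR R) R).
Variables (chi c : R -> R) (B : R).
Hypotheses (bchi : bdm chi) (chi1 : forall s, `|chi s| <= 1) (mc : measurable_fun setT c).
Hypothesis c0 : U [set s | c s = 0] = 0%E.
Hypothesis B0 : 0 <= B.
Hypothesis cB : forall z, z != 0 -> \int[U]_s expR (- (`|c s| * lam z)) <= B / lam z.

(** [c s] is a time lag and [chi] a cut-off. Averaging exp(-|c s| [lam z]) over [s] yields
    1/|z|^alpha, integrable against the transforms of the quotients with a bound independent of [n];
    the limit in [n] gives [psi]. *)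
Lemma psi_potential (t L x : R) : 0 <= t -> `|x| <= L ->
  `|\int[U]_s (chi s * pt Z (psi t) (c s) x)| <= B * Cpot t L.
Proof.
move=> t0 xL; have L0 : 0 <= L by apply: le_trans xL.
have c10 : 0 < @c1 R by apply: (@c1_gt0 R 2); rewrite ?ltr1n.
have mc' : measurable_fun setT (c : measurableTypeR R -> R) := mc.
have bq n : bdm (fun s : measurableTypeR R => pt Z (quot t n) (c s) x).
  by apply: (bdm_pt hZ) => //; exact: bdm_quot.
(* At lag 0 the position is deterministic and may be a point where the quotients do not converge to
   [psi t]; such lags are negligible. *)
have Uc0 : {ae U, forall s, c s != 0}.
  exists [set s | c s = 0]; split => //.
    rewrite (_ : [set s | _] = setT `&` (c @^-1` [set 0])); last by rewrite setTI.
    by apply: mc' => //; exact: measurable_set1.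
  by move=> s /= /negP; rewrite negbK => /eqP.
have lim : \int[U]_s (chi s * pt Z (quot t n) (c s) x) @[n --> \oo] -->
    \int[U]_s (chi s * pt Z (psi t) (c s) x).
  apply: (@dct _ _ _ U (fun n s => chi s * pt Z (quot t n) (c s) x) _ (fun=> 1)).
  - by move=> n; apply: bdm_meas; exact: bdmM.
  - apply: bdm_meas; apply: bdmM => //; apply: (bdm_pt hZ) => //.
    exact: (proj1 (bint_psi t)).
  - have [N [mN N0 HN]] := Uc0; exists N; split => // s /= H; apply: HN => /= cs; apply: H.
    by apply: cvgMr; exact: pt_quot_cvg.
  - exact: bdm_integ (bdm_cst _ _).
  - move=> n s; rewrite normrM mulr_ile1//; apply: pt_le; first exact: bdm_quot.
    exact: quot_le1.
have bnd n : `|\int[U]_s (chi s * pt Z (quot t n) (c s) x)| <= B * Cpot t L.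
  rewrite -(ler_pM2l c10) -{1}(gtr0_norm c10) -normrM.
  pose F (p : measurableTypeR R * measurableTypeR R) := chi p.2 * expR (- (`|c p.2| * lam p.1)).
  have bF : bdm F.
    apply: bdmM; first exact: (bdm_comp bchi).
    split.
      apply: measurableT_comp => //; apply: measurable_funN; apply: measurable_funM.
        by apply: measurableT_comp => //; exact: (measurableT_comp mc' measurable_snd).
      by apply: (measurableT_comp (@meas_lam R alpha)).
    exists 1 => p; rewrite ger0_norm ?expR_ge0//; exact: exp_lam_le1.
  have iqd : integ leb (fun z => q t z * dq n x z).
    apply: (integ_le _ (integZ (2 * n.+1%:R) (integ_q t))).
      apply: measurable_funM; first exact: integ_meas (integ_q t).
      apply: measurable_funM => //; apply: measurable_funB;
        by apply: bdm_meas; apply: bdm_cos; exact: measurable_funM.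
    move=> z; rewrite normrM (ger0_norm (q_ge0 t z)) mulrC ler_wpM2r ?q_ge0//.
    rewrite /dq normrM (ger0_norm (ler0n _ _)) ler_wpM2r//.
    apply: le_trans (ler_normB _ _) _; rewrite -[2%:R]/(1 + 1); apply: lerD; exact: cos_max.
  have -> : c1 * \int[U]_s (chi s * pt Z (quot t n) (c s) x) =
     \int[leb]_z (q t z * dq n x z * \int[U]_s F (z, s)).
    rewrite -(int_weight_swap U iqd bF) -RintZ; last by apply: bdm_integ; exact: bdmM.
    apply: eq_Rint => s; rewrite mulrCA pt_quot_rep// -RintZ.
      by apply: eq_Rint => z; rewrite /F/=; ring.
    apply: (integ_le _ (integ_abs iqd)).
      apply: measurable_funM; [exact: integ_meas iqd|exact: exp_lam_meas].
    move=> z; rewrite normrM ler_piMr// ger0_norm ?expR_ge0//; exact: exp_lam_le1.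
  have E : c1 * (B * Cpot t L) = \int[leb]_z (B * (`|1 - cos (t * z)| / z ^+ 2 * `|z| * Num.min 1 (`|z| * (L + 1)) / lam z)).
    rewrite RintZ; last by apply: (pot_integ alpha_gt1 alpha_le2 (mult2_one_cos t)); rewrite addr_ge0.
    by rewrite /Cpot mulrCA mulVKf// gt_eqF.
  rewrite E; apply: Rint_abs_le.
  - have bI : bdm (fun z : measurableTypeR R => \int[U]_s F (z, s)) by exact: (bdm_Rint2 U bF).
    have [mI [K hK]] := bI.
    apply: (integ_le _ (integZ K (integ_abs iqd))).
      by apply: measurable_funM => //; exact: integ_meas iqd.
    by move=> z; rewrite normrM mulrC ler_wpM2r.
  - by apply: integZ; apply: (pot_integ alpha_gt1 alpha_le2 (mult2_one_cos t)); rewrite addr_ge0.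
  move=> z; have [->|z0] := eqVneq z 0.
    by rewrite mulr0 cos0 subrr !mul0r normr0 !mul0r mulr0.
  rewrite normrM (normrM (q t z)) (ger0_norm (q_ge0 t z)).
  have h1 : `|\int[U]_s F (z, s)| <= B / lam z.
    apply: le_trans (cB z0); apply: Rint_abs_le.
    - by apply: bdm_integ; apply: (bdm_comp bF); exact: measurable_fun_pair.
    - apply: bdm_integ; split; last by exists 1 => s; rewrite ger0_norm ?expR_ge0// exp_lam_le1.
      apply: measurableT_comp => //; apply: measurable_funN; apply: measurable_funM => //.
      exact: measurableT_comp.
    - by move=> s; rewrite /F/= normrM (ger0_norm (expR_ge0 _)) ler_piMl ?expR_ge0.
  rewrite (ger0_norm (one_cos_ge0 _)).
  have -> : B * ((1 - cos (t * z)) / z ^+ 2 * `|z| * Num.min 1 (`|z| * (L + 1)) / lam z) =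
    (q t z * (`|z| * Num.min 1 (`|z| * (L + 1)))) * (B / lam z) by ring.
  apply: ler_pM => //; first by rewrite mulr_ge0 ?q_ge0.
  by apply: ler_wpM2l; [exact: q_ge0|exact: dq_le].
exact: (norm_lim_le lim bnd).
Qed.

End potential.

Lemma indic_set1 {R : realType} (a s : R) : \1_[set a] s = (s == a)%:R :> R.
Proof.
rewrite indicE; congr (nat_of_bool _)%:R; apply/idP/eqP => [/set_mem//|->].
by apply/mem_set.
Qed.

(** * Averages of exponentials over uniform times *)

Section uniform_time.
Context {R : realType} (T : R) (T0 : 0 < T).
Local Notation leb := (@lebesgue_measure R).
Local Notation U := (uniform_prob T0 : probability (measurableTypeR R) R).
Implicit Types f g : R -> R.

Lemma unif_atomless (a : R) : U [set a] = 0%E.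
Proof.
have /null_content_dominatesP := dominates_uniform_prob T0.
by apply; [exact: measurable_set1|exact: lebesgue_measure_set1].
Qed.

Let mI : measurable (`[0, T]%classic : set (measurableTypeR R)).
Proof. exact: measurable_itv. Qed.

Let lebI : (leb `[0%R, T] < +oo)%E.
Proof. by rewrite lebesgue_measure_itv/= lte_fin T0 -EFinB ltry. Qed.

Lemma bdm_integ_itv f : bdm f -> leb.-integrable `[0, T] (EFin \o f).
Proof.
move=> [mf [K hK]]; apply: (@le_integrable _ _ _ leb _ mI _ (fun=> K%:E)).
- by apply/measurable_EFinP; apply: measurable_funS mf.
- by move=> x _ /=; rewrite lee_fin (le_trans (hK x))// ler_norm.
- apply/integrableP; split => //; rewrite integral_cst//.
  by rewrite lte_mul_pinfty.
Qed.

Lemma unif_Rint_ge0 f : bdm f -> (forall x, 0 <= f x) ->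
  \int[U]_s f s = T^-1 * \int[leb]_(s in `[0, T]) f s.
Proof.
move=> bf f0; have ii := bdm_integ_itv bf.
rewrite /Rintegral; rewrite (integral_uniform T0 (f := EFin \o f)); last 2 first.
- by apply/measurable_EFinP; exact: bdm_meas bf.
- by move=> x /=; rewrite lee_fin.
by rewrite subr0 fineM//; exact: integrable_fin_num.
Qed.

Lemma unif_Rint f : bdm f -> \int[U]_s f s = T^-1 * \int[leb]_(s in `[0, T]) f s.
Proof.
move=> bf; have [mf [K hK]] := bf.
have K0 : 0 <= K by apply: le_trans (hK 0).
have b1 : bdm (fun s => f s + K) by apply: bdmD => //; exact: bdm_cst.
have h1 s : 0 <= f s + K by have := hK s; rewrite ler_norml => /andP[]; rewrite -subr_ge0 opprK.
have e : \int[U]_s f s = \int[U]_s (f s + K) - \int[U]_s K.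
  rewrite -RintB; [|exact: bdm_integ|exact: bdm_integ (bdm_cst _ _)].
  by apply: eq_Rint => s; rewrite addrK.
rewrite e unif_Rint_ge0// (@unif_Rint_ge0 (fun=> K))//; last exact: bdm_cst.
rewrite -mulrBr -RintegralB//; [|exact: bdm_integ_itv..|exact: bdm_integ_itv (bdm_cst _ _)].
by congr (_ * _); apply: eq_Rintegral => s _; rewrite addrK.
Qed.

Lemma unif_eq f g : bdm f -> bdm g -> (forall s, 0 <= s <= T -> f s = g s) ->
  \int[U]_s f s = \int[U]_s g s.
Proof.
move=> bf bg fg; rewrite !unif_Rint//; congr (_ * _); apply: eq_Rintegral => s.
by rewrite inE/= in_itv/=; exact: fg.
Qed.

Lemma unif_le f g : bdm f -> bdm g -> (forall s, 0 <= s <= T -> f s <= g s) ->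
  \int[U]_s f s <= \int[U]_s g s.
Proof.
move=> bf bg fg; rewrite !unif_Rint//; apply: ler_wpM2l; first by rewrite invr_ge0 ltW.
apply: le_Rintegral; [exact: mI|exact: bdm_integ_itv|exact: bdm_integ_itv|].
by move=> s; rewrite /= in_itv/=; exact: fg.
Qed.

Lemma unif_nn f : bdm f -> \int[U]_s ((0 <= s)%R%:R * f s) = \int[U]_s f s.
Proof.
move=> bf; apply: unif_eq => //; first by apply: bdmM => //; exact: bdm_le.
by move=> s /andP[-> _]; rewrite mul1r.
Qed.

Lemma bdm_exp_itv (mu u v : R) : bdm (fun s : R => (u <= s)%R%:R * (s <= v)%R%:R * expR (mu * s)).
Proof.
split.
  apply: measurable_funM; last by apply: measurableT_comp => //; exact: measurable_funM.
  by apply: bdm_meas; apply: bdmM; exact: bdm_le.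
exists (expR (`|mu| * (`|u| + `|v|))) => s; rewrite -natrM mulnb.
case: (boolP (_ && _)) => [/andP[us sv]|_]; last by rewrite mul0r normr0 expR_ge0.
rewrite mul1r ger0_norm ?expR_ge0// ler_expR; apply: le_trans (ler_norm _) _.
rewrite normrM ler_wpM2l// ler_norml; apply/andP; split.
  by apply: le_trans us; rewrite lerNl; apply: le_trans (ler_norm _) _; rewrite normrN lerDl.
by apply: le_trans sv _; apply: le_trans (ler_norm _) _; rewrite lerDr.
Qed.

Lemma unif_exp (mu u v : R) : mu != 0 -> 0 <= u -> u <= v -> v <= T ->
  \int[U]_s ((u <= s)%R%:R * (s <= v)%R%:R * expR (mu * s)) =
  (expR (mu * v) - expR (mu * u)) / (mu * T).
Proof.
move=> mu0 u0 uv vT; rewrite unif_Rint; last exact: bdm_exp_itv.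
(* The fundamental theorem needs u < v; for u = v the integrand lives on one point, which has mass
   0. *)
have [uve|uvn] := eqVneq u v.
  rewrite uve subrr mul0r; have := bdm_exp_itv mu v v => bb.
  have bi : bdm (\1_[set v] : measurableTypeR R -> R) by apply: bdm_indic; exact: measurable_set1.
  rewrite -unif_Rint//.
  transitivity (\int[U]_s (expR (mu * v) * \1_[set v] s)).
    apply: eq_Rint => s; rewrite -natrM mulnb -eq_le indic_set1 eq_sym mulrC.
    by have [->|] := eqVneq s v; rewrite ?mulr0.
  rewrite RintZ; last exact: bdm_integ.
  rewrite /Rintegral integral_indic ?setIT//=.
  by rewrite [X in fine X]unif_atomless mulr0.
have uv' : u < v by rewrite lt_neqAle uvn.
have E : \int[leb]_(s in `[0, T]) ((u <= s)%R%:R * (s <= v)%R%:R * expR (mu * s)) =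
  \int[leb]_(s in `[u, v]) expR (mu * s).
  rewrite /Rintegral; congr fine.
  rewrite integral_mkcond [RHS]integral_mkcond; apply: eq_integral => s _.
  rewrite !patchE !mem_setE !in_itv/=.
  have [us|us] := leP u s; have [sv|sv] := leP s v; rewrite /= ?(mulr0, mul0r, mul1r);
    first [by rewrite (le_trans u0 us) (le_trans sv vT)|by case: ifP => //; rewrite mul0r].
rewrite E /Rintegral (@continuous_FTC2 _ _ (fun s => expR (mu * s) / mu))//=.
- by field; rewrite mu0 gt_eqF.
- apply: continuous_subspaceT => x; apply: (@continuous_comp _ _ _ (fun s => mu * s) expR).
    exact: mulrl_continuous.
  exact: continuous_expR.
- split.
  + by move=> x _; exact: ex_derive.
  + apply: cvg_at_right_filter; apply: cvgM; last exact: cvg_cst.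
    apply: (@continuous_comp _ _ _ (fun s => mu * s) expR); [exact: mulrl_continuous|exact: continuous_expR].
  + apply: cvg_at_left_filter; apply: cvgM; last exact: cvg_cst.
    apply: (@continuous_comp _ _ _ (fun s => mu * s) expR); [exact: mulrl_continuous|exact: continuous_expR].
- move=> x _; rewrite derive1E.
  have D : is_derive x 1 (fun s => expR (mu * s) / mu) (mu * expR (mu * x) / mu).
    by apply: is_derive_eq; rewrite /GRing.scale/= ; ring.
  by rewrite derive_val; field.
Qed.

Lemma bdm_exp_dist l (a : R) : 0 <= l -> bdm (fun s : R => expR (- (`|a - s| * l))).
Proof.
move=> l0; split; last first.
  by exists 1 => s; rewrite ger0_norm ?expR_ge0// expR_le1 oppr_le0 mulr_ge0.
apply: measurableT_comp => //; apply: measurable_funN; apply: measurable_funM => //.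
by apply: measurableT_comp => //; exact: measurable_funB.
Qed.

Let left_part (l a : R) (s : R) : R := expR (- (l * a)) * ((0 <= s)%R%:R * (s <= a)%R%:R * expR (l * s)).
Let right_part (l a : R) (s : R) : R := expR (l * a) * ((a <= s)%R%:R * (s <= T)%R%:R * expR (- l * s)).

Let left_int l a : 0 < l -> 0 <= a -> a <= T -> \int[U]_s left_part l a s = (1 - expR (- (l * a))) / (l * T).
Proof.
move=> l0 a0 aT; rewrite /left_part RintZ; last by apply: bdm_integ; exact: bdm_exp_itv.
rewrite unif_exp ?gt_eqF// mulr0 expR0 mulrA mulrBr mulr1; congr (_ / _).
by rewrite -expRD addNr expR0.
Qed.

Let right_int l a : 0 < l -> 0 <= a -> a <= T -> \int[U]_s right_part l a s = (1 - expR (- (l * (T - a)))) / (l * T).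
Proof.
move=> l0 a0 aT; rewrite /right_part RintZ; last by apply: bdm_integ; exact: bdm_exp_itv.
rewrite unif_exp ?oppr_eq0 ?gt_eqF//.
have e1 : expR (l * a) * expR (- l * a) = 1 by rewrite -expRD mulNr subrr expR0.
have e2 : expR (l * a) * expR (- l * T) = expR (- (l * (T - a))).
  by rewrite -expRD; congr expR; ring.
by rewrite -e2 mulrA mulrBr e1 mulNr invrN mulrN -mulNr opprB.
Qed.

Lemma unif_exp_dist l (a : R) : 0 < l -> 0 <= a -> a <= T ->
  \int[U]_s expR (- (`|a - s| * l)) = (2 - expR (- (l * a)) - expR (- (l * (T - a)))) / (l * T).
Proof.
move=> l0 a0 aT.
have bL : bdm (left_part l a) by apply: bdmM; [exact: bdm_cst|exact: bdm_exp_itv].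
have bR : bdm (right_part l a) by apply: bdmM; [exact: bdm_cst|exact: bdm_exp_itv].
have bi : bdm (\1_[set a] : measurableTypeR R -> R) by apply: bdm_indic; exact: measurable_set1.
have be := bdm_exp_dist a (ltW l0).
(* The two parts overlap at [a], where both equal 1; the indicator removes the second count. *)
transitivity (\int[U]_s (left_part l a s + right_part l a s - \1_[set a] s)).
  apply: unif_eq => //; first by apply: bdmB => //; exact: bdmD.
  move=> s /andP[s0 sT]; rewrite /left_part /right_part s0 sT indic_set1.
  have [sa|as_] := ltP s a.
    rewrite (ltW sa) (lt_eqF sa) !mul0r mulr0 addr0 subr0 !mul1r.
    by rewrite gtr0_norm ?subr_gt0// -expRD; congr expR; ring.
  have [sa|sa] := eqVneq s a.
    rewrite sa lexx subrr normr0 mul0r oppr0 expR0 !mul1r.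
    by rewrite mulNr -!expRD addNr subrr expR0 addrK.
  have as2 : a < s by rewrite lt_neqAle eq_sym sa.
  rewrite (lt_geF as2) mulr0 mul0r mulr0 add0r subr0 !mul1r.
  by rewrite ltr0_norm ?subr_lt0// -expRD; congr expR; ring.
rewrite RintB; [|by apply: bdm_integ; exact: bdmD|exact: bdm_integ].
rewrite RintD; [|exact: bdm_integ..].
rewrite left_int// right_int//.
have -> : \int[U]_s \1_[set a] s = 0 :> R.
  rewrite /Rintegral integral_indic ?setIT//=.
  by rewrite [X in fine X]unif_atomless.
by rewrite subr0; ring.
Qed.

Lemma unif_exp_dist_le l (a : R) : 0 < l -> \int[U]_s expR (- (`|a - s| * l)) <= 2 / T / l.
Proof.
move=> l0.
(* The projection of [a] on [0, T] is no farther than [a] from any point of [0, T], which reduces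
   the bound to the explicit case. *)
pose a' := Num.max 0 (Num.min a T).
have a'0 : 0 <= a' by rewrite le_max lexx.
have a'T : a' <= T by rewrite ge_max (ltW T0) ge_min lexx orbT.
apply: (@le_trans _ _ (\int[U]_s expR (- (`|a' - s| * l)))).
  apply: unif_le; [exact: bdm_exp_dist (ltW l0)|exact: bdm_exp_dist (ltW l0)|].
  move=> s /andP[s0 sT]; rewrite ler_expR lerN2; apply: ler_wpM2r; first exact: ltW.
  rewrite /a'; have [aT|Ta] := leP a T.
    have [a0|a0] := leP 0 a; first by [].
    rewrite !ler0_norm; lra.
  rewrite max_r ?(ltW T0)//; rewrite !ger0_norm; lra.
rewrite unif_exp_dist//.
have -> : 2 / T / l = 2 / (l * T) by field; rewrite !gt_eqF.
rewrite ler_pM2r ?invr_gt0 ?mulr_gt0//.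
by have := expR_ge0 (- (l * a')); have := expR_ge0 (- (l * (T - a'))); lra.
Qed.

Lemma unif_exp_le l : 0 < l -> \int[U]_s expR (- (`|s| * l)) <= T^-1 / l.
Proof.
move=> l0.
rewrite (eq_Rint U (fun s => expR (- (`|0 - s| * l)))); last by move=> s; rewrite sub0r normrN.
rewrite unif_exp_dist; [|exact: l0|exact: lexx|exact: ltW].
rewrite mulr0 oppr0 expR0 -invfM [T * l]mulrC -[leRHS]mul1r ler_pM2r ?invr_gt0 ?mulr_gt0//.
Qed.

Lemma unif_exp_le1 l : 0 <= l -> \int[U]_s expR (- (`|s| * l)) <= 1.
Proof.
move=> l0.
have -> : (1 : R) = \int[U]_s 1 by rewrite Rintegral_cst// [X in fine X](probability_setT U) mulr1.
apply: le_Rint; [|exact: bdm_integ (bdm_cst _ _)|].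
  apply: bdm_integ; have := bdm_exp_dist 0 l0; congr bdm.
  by apply/funext => s; rewrite sub0r normrN.
by move=> s; rewrite expR_le1 oppr_le0 mulr_ge0.
Qed.

(** Laplace transform of |a - s| for two independent uniform times. *)
Definition kap2 (l : R) : R := \int[U]_a \int[U]_s expR (- (`|a - s| * l)).

Lemma bdm_exp_dist2 l : 0 <= l -> bdm (fun q : measurableTypeR R * measurableTypeR R => expR (- (`|q.1 - q.2| * l))).
Proof.
move=> l0; split; last first.
  by exists 1 => s; rewrite ger0_norm ?expR_ge0// expR_le1 oppr_le0 mulr_ge0.
apply: measurableT_comp => //; apply: measurable_funN; apply: measurable_funM => //.
by apply: measurableT_comp => //; exact: measurable_funB.
Qed.

Let bk l : 0 <= l -> bdm (fun a : R => \int[U]_s expR (- (`|a - s| * l))).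
Proof. by move=> l0; exact: (bdm_Rint2 U (bdm_exp_dist2 l0)). Qed.

Lemma kap2_ge0 l : 0 <= kap2 l.
Proof. by apply: Rintegral_ge0 => a _; apply: Rintegral_ge0 => s _; exact: expR_ge0. Qed.

Let Ecst (k : R) : \int[U]_s k = k.
Proof. by rewrite Rintegral_cst// [X in fine X](probability_setT U) mulr1. Qed.

Lemma kap2_le l : 0 < l -> kap2 l <= 2 / T / l.
Proof.
move=> l0; rewrite -[leRHS]Ecst; apply: le_Rint.
- by apply: bdm_integ; exact: bk (ltW l0).
- exact: bdm_integ (bdm_cst _ _).
- by move=> a; exact: unif_exp_dist_le.
Qed.

Lemma kap2_le1 l : 0 <= l -> kap2 l <= 1.
Proof.
move=> l0; rewrite -[leRHS]Ecst; apply: le_Rint.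
- by apply: bdm_integ; exact: bk.
- exact: bdm_integ (bdm_cst _ _).
- move=> a; rewrite -[leRHS]Ecst; apply: le_Rint.
  + by apply: bdm_integ; exact: bdm_exp_dist.
  + exact: bdm_integ (bdm_cst _ _).
  + by move=> s; rewrite expR_le1 oppr_le0 mulr_ge0.
Qed.

(** With [kap2_le] this shows that T kap2(l) tends to 2/l: a two-sided exponential has mass 2/l, and
    the parts cut off at 0 and at T cost at most 1/(l^2 T) each. *)
Lemma kap2_ge l : 0 < l -> 2 / l - 2 / (l ^+ 2 * T) <= T * kap2 l.
Proof.
move=> l0; have l0' := ltW l0.
have bE : bdm (fun a : R => expR (- (`|0 - a| * l))) := bdm_exp_dist 0 l0'.
have bE' : bdm (fun a : R => expR (- (`|T - a| * l))) := bdm_exp_dist T l0'.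
have lT : 0 < l * T by rewrite mulr_gt0.
have -> : kap2 l = \int[U]_a (2 / (l * T) - (l * T)^-1 * expR (- (`|0 - a| * l)) - (l * T)^-1 * expR (- (`|T - a| * l))).
  apply: unif_eq.
  - exact: bk l0'.
  - by apply: bdmB; [apply: bdmB|]; [exact: bdm_cst|apply: bdmM => //; exact: bdm_cst|apply: bdmM => //; exact: bdm_cst].
  - move=> a /andP[a0 aT]; rewrite unif_exp_dist// sub0r normrN (ger0_norm a0) (@ger0_norm _ (T - a)) ?subr_ge0//.
    by rewrite ![_ * l]mulrC; ring.
have b1 : bdm (fun a : R => (l * T)^-1 * expR (- (`|0 - a| * l))) by apply: bdmM => //; exact: bdm_cst.
have b2 : bdm (fun a : R => (l * T)^-1 * expR (- (`|T - a| * l))) by apply: bdmM => //; exact: bdm_cst.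
have b3 : bdm (fun a : R => 2 / (l * T) - (l * T)^-1 * expR (- (`|0 - a| * l))) by apply: bdmB => //; exact: bdm_cst.
rewrite RintB; [|exact: bdm_integ..]; rewrite RintB; [|exact: bdm_integ (bdm_cst _ _)|exact: bdm_integ].
rewrite Ecst !RintZ; [|exact: bdm_integ..].
have h c : c = 0 \/ c = T -> \int[U]_s expR (- (`|c - s| * l)) <= (l * T)^-1.
  move=> hc; have c0 : 0 <= c by case: hc => ->; rewrite // ltW.
  have cT : c <= T by case: hc => ->; rewrite // ltW.
  rewrite unif_exp_dist// ler_pdivrMr// mulVf ?gt_eqF//.
  have := expR_ge0 (- (l * T)).
  case: hc => ->; rewrite ?subr0 ?subrr ?mulr0 oppr0 expR0; lra.
have h0 := h 0 (or_introl erefl); have hT := h T (or_intror erefl).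
set A := \int[U]_s _ in h0 *; set B := \int[U]_s _ in hT *.
have -> : 2 / l - 2 / (l ^+ 2 * T) = T * (2 / (l * T) - (l * T)^-1 * (l * T)^-1 - (l * T)^-1 * (l * T)^-1).
  by field; rewrite !gt_eqF.
rewrite ler_pM2l// ?lerB// ler_pM2l ?invr_gt0//.
Qed.

End uniform_time.

(** * Asymptotics of the occupation moments *)

Section occ_moments.
Context {R : realType} (alpha : R).
Hypotheses (alpha_gt1 : 1 < alpha) (alpha_le2 : alpha <= 2).
Local Notation leb := (@lebesgue_measure R).
Local Notation lam := (lam alpha).
Local Notation q t := (fun z : R => (1 - cos (t * z)) / z ^+ 2).
Context d (Om : measurableType d) (P : probability Om R).
Variables X Z : R -> {RV P >-> R}.
Hypotheses (hX : std_symmetric_stable_levy alpha X) (hZ : std_symmetric_stable_levy alpha Z).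
Context (n : nat) (t b : 'I_n -> R).
Hypothesis t0 : forall i, 0 <= t i.
Context (T : R) (T0 : 0 < T).
Local Notation U := (uniform_prob T0 : probability (measurableTypeR R) R).
Local Notation phi := (phis t b).
Local Notation L := (Lphi t).
Local Notation M := (Mphi b).

Let bphi : bint phi := bint_phis t b.
Let c10 : 0 < @c1 R. Proof. by apply: (@c1_gt0 R 2); rewrite ?ltr1n. Qed.

Definition occT := occ U phi X.

Let at0 := unif_atomless T0.

Lemma occT_mean y : \int[P]_w occT y w = \int[U]_s pt Z phi s y.
Proof.
rewrite /occT (occ_mean hX hZ U bphi) unif_nn//.
by apply: (bdm_pt hZ) => //; exact: (proj1 bphi).
Qed.

(** [V] on [Q] is the displacement at an independent uniform time: the mean occupation is [phi]
    averaged over [V], so the lemmas on shifts by a random variable apply. *)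
Let Q : probability _ R := (U \x P)%E.
Let V (p : measurableTypeR R * Om) := Z `|p.1| p.2.
Let mV : measurable_fun setT V.
Proof.
have := jmZ hZ (@measurable_cst _ _ (measurableTypeR R * Om)%type R setT 0) measurable_fst measurable_snd.
by rewrite (_ : (fun _ => _) = V)//; apply/funext => p; rewrite add0r.
Qed.

Let meanQ y : \int[P]_w occT y w = \int[Q]_p phi (y + V p).
Proof.
rewrite occT_mean.
have bb : bdm (fun p : measurableTypeR R * Om => phi (y + V p)).
  by apply: (bdm_comp (proj1 bphi)); exact: measurable_funD.
by have /= <- := Rfubini1 (bdm_integ_prod U P bb).
Qed.

Let meanE : (fun y => \int[P]_w occT y w) = (fun y => \int[Q]_p phi (y + V p)).
Proof. by apply/funext => y; exact: meanQ. Qed.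

Lemma bint_occT_mean : bint (fun y => \int[P]_w occT y w).
Proof.
rewrite meanE; split; last exact: (integ_E_shift Q mV bphi).
apply: (@bdm_Rint2 _ _ _ _ _ Q (fun p : R * _ => phi (p.1 + V p.2))).
by apply: (bdm_comp (proj1 bphi)); apply: measurable_funD => //; exact: (measurableT_comp mV).
Qed.

Lemma phis_odd y : phi (- y) = - phi y.
Proof. by rewrite /phis -sumrN; apply: eq_bigr => i _; rewrite psi_odd mulrN. Qed.

Lemma int_phis0 : \int[leb]_x phi x = 0.
Proof. by apply: Rint_odd; [exact: (proj2 bphi)|exact: phis_odd]. Qed.

Lemma int_occT_mean : \int[leb]_y \int[P]_w occT y w = 0.
Proof. by rewrite meanE (int_E_shift Q mV (proj2 bphi)) int_phis0. Qed.

Let cosV z th : \int[Q]_p cos (z * V p + th) = cos th * \int[U]_s expR (- (`|s| * lam z)).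
Proof.
have bc : bdm (fun p : measurableTypeR R * Om => cos (z * V p + th)).
  by apply: bdm_cos; apply: measurable_funD => //; exact: measurable_funM.
have /= <- := Rfubini1 (bdm_integ_prod U P bc).
rewrite -RintZ.
  by apply: eq_Rint => s; rewrite /V/= (stable_cos z th hZ).
apply: bdm_integ; have := bdm_exp_dist 0 (lam_ge0 alpha z); congr bdm.
by apply/funext => s; rewrite sub0r normrN.
Qed.

(** One of the two means is moved to the other side by duality. The displacement becomes the
    difference of two independent copies of [V], and its transform the square of that of [V]. *)
Lemma occT_mean_sqr_rep : c1 * \int[leb]_y (\int[P]_w occT y w) ^+ 2 =
  \int[leb]_z (gker t b z * (\int[U]_s expR (- (`|s| * lam z))) ^+ 2).
Proof.
have bm := bint_occT_mean.
rewrite (eq_Rint leb (fun y => \int[P]_w occT y w * \int[Q]_p phi (y + V p))); last first.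
  by move=> y; rewrite expr2 {2}meanQ.
rewrite (int_shift_sym Q mV bm bphi).
pose Q2 : probability _ R := (Q \x Q)%E.
pose V2 (p : (measurableTypeR R * Om) * (measurableTypeR R * Om)) := V p.2 - V p.1.
have m1 : measurable_fun setT (fun p : (measurableTypeR R * Om) * (measurableTypeR R * Om) => V p.1).
  exact: (measurableT_comp mV measurable_fst).
have m2 : measurable_fun setT (fun p : (measurableTypeR R * Om) * (measurableTypeR R * Om) => V p.2).
  exact: (measurableT_comp mV measurable_snd).
have mV2 : measurable_fun setT V2 by exact: measurable_funB.
transitivity (c1 * \int[leb]_x (phi x * \int[Q2]_p phi (x + V2 p))).
  congr (_ * _); apply: eq_Rint => x; congr (_ * _).
  have bb : bdm (fun p : (measurableTypeR R * Om) * (measurableTypeR R * Om) => phi (x + V2 p)).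
    by apply: (bdm_comp (proj1 bphi)); exact: measurable_funD.
  have /= <- := Rfubini1 (bdm_integ_prod Q Q bb).
  apply: eq_Rint => p; rewrite meanQ; apply: eq_Rint => p'; rewrite /V2/=; congr phi; ring.
rewrite (phis_E_rep b t0 Q2 mV2); apply: eq_Rint => z; congr (_ * _).
have bb : bdm (fun p : (measurableTypeR R * Om) * (measurableTypeR R * Om) => cos (z * V2 p)).
  by apply: bdm_cos; exact: measurable_funM.
have /= <- := Rfubini1 (bdm_integ_prod Q Q bb).
set k := \int[U]_s _.
transitivity (\int[Q]_p (cos (z * V p + 0) * k)).
  apply: eq_Rint => p.
  rewrite (eq_Rint Q (fun p' => cos (z * V p' + (- (z * V p))))); last first.
    by move=> p'; rewrite /V2/= mulrBr.
  by rewrite cosV cosN addr0.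
rewrite RintZr; last first.
  by apply: bdm_integ; apply: bdm_cos; apply: measurable_funD => //; exact: measurable_funM.
by rewrite cosV cos0 mul1r expr2.
Qed.

Let exp2E z : kap2 T0 (lam z) = \int[(U \x U)%E]_q expR (- (`|q.1 - q.2| * lam z)).
Proof. by have /= <- := Rfubini1 (bdm_integ_prod U U (bdm_exp_dist2 (lam_ge0 alpha z))). Qed.

(** [V3] on [Q3] is the displacement over the lag between two independent uniform times; its
    transform is [kap2] at [lam z]. *)
Let Q3 : probability _ R := ((U \x U) \x P)%E.
Let V3 (p : (measurableTypeR R * measurableTypeR R) * Om) := Z `|p.1.2 - p.1.1| p.2.
Let mV3 : measurable_fun setT V3.
Proof.
have m1 : measurable_fun setT (fun p : (measurableTypeR R * measurableTypeR R) * Om => p.1.2 - p.1.1).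
  apply: measurable_funB; first exact: (measurableT_comp measurable_snd measurable_fst).
  exact: (measurableT_comp measurable_fst measurable_fst).
have := jmZ hZ (@measurable_cst _ _ ((measurableTypeR R * measurableTypeR R) * Om)%type R setT 0) m1 measurable_snd.
by rewrite (_ : (fun _ => _) = V3)//; apply/funext => p; rewrite add0r.
Qed.

Let cosV3 z : \int[Q3]_p cos (z * V3 p) = kap2 T0 (lam z).
Proof.
have bc : bdm (fun p : (measurableTypeR R * measurableTypeR R) * Om => cos (z * V3 p)).
  by apply: bdm_cos; exact: measurable_funM.
pose V2 : probability _ R := (U \x U)%E.
have /= <- := Rfubini1 (bdm_integ_prod V2 P bc).
rewrite exp2E; apply: eq_Rint => p; rewrite distrC /V3/=.
rewrite -[RHS]mul1r -[in RHS]cos0 -(stable_cos z 0 hZ (normr_ge0 _)).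
by apply: eq_Rint => w; rewrite addr0.
Qed.

Let ptQ3 f x : bdm f -> \int[(U \x U)%E]_q pt Z f (q.2 - q.1) x = \int[Q3]_p f (x + V3 p).
Proof.
move=> bf.
have bb : bdm (fun p : (measurableTypeR R * measurableTypeR R) * Om => f (x + V3 p)).
  by apply: (bdm_comp bf); exact: measurable_funD.
pose V2 : probability _ R := (U \x U)%E.
by have /= <- := Rfubini1 (bdm_integ_prod V2 P bb).
Qed.

Let nn2 (G : measurableTypeR R * measurableTypeR R -> R) : bdm G ->
  \int[(U \x U)%E]_q ((0 <= q.1)%R%:R * (0 <= q.2)%R%:R * G q) = \int[(U \x U)%E]_q G q.
Proof.
move=> bG.
have bnG : bdm (fun q : measurableTypeR R * measurableTypeR R => (0 <= q.1)%R%:R * (0 <= q.2)%R%:R * G q).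
  by apply: bdmM => //; apply: bdmM; apply: bdm_le.
have /= <- := Rfubini1 (bdm_integ_prod U U bnG).
have /= <- := Rfubini1 (bdm_integ_prod U U bG).
rewrite -[RHS]unif_nn; last exact: (bdm_Rint2 U bG).
apply: eq_Rint => s.
have bs : bdm (fun r => G (s, r)) by apply: (bdm_comp bG); exact: measurable_fun_pair.
rewrite -(unif_nn T0 bs) -RintZ; last by apply: bdm_integ; apply: bdmM => //; exact: bdm_le.
by apply: eq_Rint => r; rewrite mulrA.
Qed.

(** Since Lebesgue measure is invariant, only the lag between the two times matters, which is the
    displacement [V3]. *)
Lemma int_occT_sqr : integ leb (fun y => \int[P]_w occT y w ^+ 2) /\
  c1 * \int[leb]_y \int[P]_w occT y w ^+ 2 = \int[leb]_z (gker t b z * kap2 T0 (lam z)).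
Proof.
have [ii e] := int_occ_sqr hX hZ U bphi; split; first exact: ii.
rewrite /occT e.
pose V2 : probability _ R := (U \x U)%E.
have bpt : bdm (fun p : measurableTypeR R * (measurableTypeR R * measurableTypeR R) => pt Z phi (p.2.2 - p.2.1) p.1).
  apply: (bdm_pt hZ); [exact: (proj1 bphi)| |exact: measurable_fst].
  apply: measurable_funB; first exact: (measurableT_comp measurable_snd measurable_snd).
  exact: (measurableT_comp measurable_fst measurable_snd).
pose F (p : measurableTypeR R * (measurableTypeR R * measurableTypeR R)) : R :=
  ((0 <= p.2.1)%R%:R * (0 <= p.2.2)%R%:R) * pt Z phi (p.2.2 - p.2.1) p.1.
have bF : bdm F.
  apply: bdmM => //; apply: bdmM; apply: bdm_le => //.
    exact: (measurableT_comp measurable_fst measurable_snd).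
  exact: (measurableT_comp measurable_snd measurable_snd).
have -> : \int[(U \x U)%E]_q ((0 <= q.1)%R%:R * (0 <= q.2)%R%:R * \int[leb]_x (phi x * pt Z phi (q.2 - q.1) x)) =
    \int[V2]_q \int[leb]_x (phi x * F (x, q)).
  apply: eq_Rint => q; rewrite -RintZ.
    by apply: eq_Rint => x; rewrite /F/=; ring.
  have [mb [K hK]] : bdm (fun x => pt Z phi (q.2 - q.1) x).
    by apply: (bdm_pt hZ) => //; exact: (proj1 bphi).
  apply: (integ_le _ (integZ K (integ_abs (proj2 bphi)))).
    by apply: measurable_funM => //; exact: integ_meas (proj2 bphi).
  by move=> x; rewrite normrM mulrC ler_wpM2r.
rewrite (int_weight_swap V2 (proj2 bphi) bF).
transitivity (c1 * \int[leb]_x (phi x * \int[Q3]_p phi (x + V3 p))).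
  congr (_ * _); apply: eq_Rint => x; congr (_ * _).
  have bx : bdm (fun q : measurableTypeR R * measurableTypeR R => pt Z phi (q.2 - q.1) x).
    by apply: (bdm_comp bpt (g := fun q => (x, q))); exact: measurable_fun_pair.
  by rewrite -(ptQ3 x (proj1 bphi)) -(nn2 bx).
by rewrite (phis_E_rep b t0 Q3 mV3); apply: eq_Rint => z; rewrite cosV3.
Qed.

Definition Cphi : R := \sum_i `|b i| * Cpot alpha (t i) L.

Lemma Cphi_ge0 : 0 <= Cphi.
Proof.
by apply: sumr_ge0 => i _; rewrite mulr_ge0//; apply: Cpot_ge0; exact: Lphi_ge0.
Qed.

Lemma phis_potential (chi c : R -> R) x : bdm chi -> (forall s, `|chi s| <= 1) ->
  measurable_fun setT c -> U [set s | c s = 0] = 0%E ->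
  (forall z, z != 0 -> \int[U]_s expR (- (`|c s| * lam z)) <= 2 / T / lam z) ->
  phi x != 0 -> `|\int[U]_s (chi s * pt Z phi (c s) x)| <= 2 / T * Cphi.
Proof.
move=> bchi chi1 mc c0 cB px.
have xL : `|x| <= L by rewrite leNgt; apply/negP => h; move: px; rewrite (phis_supp b t0 h) eqxx.
have B0 : 0 <= 2 / T by rewrite divr_ge0// ltW.
have mc' : measurable_fun setT (c : measurableTypeR R -> R) := mc.
have bpsi i : bdm (fun s : measurableTypeR R => pt Z (psi (t i)) (c s) x).
  by apply: (bdm_pt hZ) => //; exact: (proj1 (bint_psi _)).
rewrite (eq_Rint U (fun s => \sum_i b i * (chi s * pt Z (psi (t i)) (c s) x))); last first.
  move=> s; rewrite /pt /phis Rint_sum.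
    rewrite mulr_sumr; apply: eq_bigr => i _; rewrite RintZ; first by ring.
    by apply: bdm_integ; apply: (bdm_comp (proj1 (bint_psi _))); exact: measurable_funD.
  move=> i; apply: integZ; apply: bdm_integ; apply: (bdm_comp (proj1 (bint_psi _))); exact: measurable_funD.
rewrite Rint_sum; last by move=> i; apply: integZ; apply: bdm_integ; exact: bdmM.
apply: le_trans (ler_norm_sum _ _ _) _; rewrite /Cphi mulr_sumr; apply: ler_sum => i _.
rewrite RintZ; last by apply: bdm_integ; exact: bdmM.
rewrite normrM mulrCA; apply: ler_wpM2l => //.
have h1 := @psi_potential _ _ alpha_gt1 alpha_le2 _ _ _ _ hZ U chi c (2 / T) bchi chi1 mc c0.
have h2 := h1 cB.
refine (h2 _ _ _ (t0 i) xL).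
Qed.

(** The outer potentials give the factor (2 Cphi / T)^2. In the rest, |phi| is bounded by [M] times
    the indicator of [-L, L], whose autocorrelation is [tent (2 * L)]; the tent is turned into a
    cosine integral. *)
Lemma int_occT_pow4 : integ leb (fun y => \int[P]_w occT y w ^+ 4) /\
  \int[leb]_y \int[P]_w occT y w ^+ 4 <=
  24 * ((2 / T * Cphi) ^+ 2 * (M ^+ 2 * (c1^-1 * \int[leb]_z (q (2 * L) z * kap2 T0 (lam z))))).
Proof.
have D0 : 0 <= 2 / T * Cphi by rewrite mulr_ge0 ?Cphi_ge0// divr_ge0// ltW.
have null_lin (a : R) (c : R -> R) : (forall s, c s = 0 -> s = a) -> c a = 0 -> U [set s | c s = 0] = 0%E.
  move=> h1 h2; rewrite (_ : [set s | _] = [set a]); first exact: at0.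
  by apply/seteqP; split=> s /=; [exact: h1|move=> ->].
have [||ii hle] := @int_occ_pow4 _ _ _ _ P X Z hX hZ U at0 phi bphi _ D0.
- move=> a x px.
  rewrite (eq_Rint U (fun s => ((s <= a)%R%:R * (0 <= s)%R%:R) * pt Z phi (a - s) x)); last by move=> s; rewrite mulrA.
  apply: (phis_potential (chi := fun s => (s <= a)%R%:R * (0 <= s)%R%:R) (c := fun s => a - s)) => //.
  + by apply: bdmM; exact: bdm_le.
  + by move=> s; rewrite -natrM mulnb normr_nat lern1 leq_b1.
  + exact: measurable_funB.
  + by apply: (null_lin a) => [s /eqP|]; rewrite ?subrr// subr_eq0 => /eqP.
  + by move=> z z0; apply: unif_exp_dist_le; exact: lam_gt0.
- move=> a x px.
  apply: (phis_potential (chi := fun s => (a <= s)%R%:R) (c := fun s => s - a)) => //.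
  + exact: bdm_le.
  + by move=> s; rewrite normr_nat lern1 leq_b1.
  + exact: measurable_funB.
  + by apply: (null_lin a) => [s /eqP|]; rewrite ?subrr// subr_eq0 => /eqP.
  + move=> z z0; rewrite (eq_Rint U (fun s => expR (- (`|a - s| * lam z)))); last by move=> s; rewrite distrC.
    by apply: unif_exp_dist_le; exact: lam_gt0.
split; first exact: ii.
apply: le_trans hle _; apply: ler_wpM2l => //; apply: ler_wpM2l; first exact: sqr_ge0.
have L0 : 0 <= L := Lphi_ge0 t0.
pose J : R -> R := \1_(`[- L, L]%classic).
have [bJ iJ] : bint J := bint_itv (- L) L.
have J0 x : 0 <= J x by rewrite /J indicE.
have phiJ x : `|phi x| <= M * J x.
  rewrite /J indicE; case: (boolP (x \in _)) => h; first by rewrite mulr1 phis_le.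
  rewrite mulr0 (phis_supp b t0) ?normr0//; move: h.
  by rewrite mem_setE in_itv/= -ler_norml -ltNge.
have bF f : bdm f -> bdm (fun p : measurableTypeR R * (measurableTypeR R * measurableTypeR R) => pt Z f (p.2.1 - p.2.2) p.1).
  move=> bf; apply: (bdm_pt hZ) => //; apply: measurable_funB.
    exact: (measurableT_comp measurable_fst measurable_snd).
  exact: (measurableT_comp measurable_snd measurable_snd).
pose V2 : probability _ R := (U \x U)%E.
have ba : bdm (fun x => `|phi x|) by exact: bdm_norm (proj1 bphi).
have bK f : bdm f -> bdm (fun x : measurableTypeR R => \int[V2]_q pt Z f (q.1 - q.2) x).
  by move=> bf; exact: (bdm_Rint2 V2 (bF f bf)).
have bint_mul (k l : R -> R) : integ leb k -> bdm l -> integ leb (fun x => k x * l x).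
  move=> ik [ml [K hK]].
  apply: (integ_le _ (integZ K (integ_abs ik))).
    by apply: measurable_funM => //; exact: integ_meas ik.
  by move=> x; rewrite normrM mulrC ler_wpM2r.
have Msq x : `|phi x| * \int[V2]_q pt Z (fun x => `|phi x|) (q.1 - q.2) x <=
    M ^+ 2 * (J x * \int[V2]_q pt Z J (q.1 - q.2) x).
  have M0 := Mphi_ge0 b.
  apply: (@le_trans _ _ ((M * J x) * (M * \int[V2]_q pt Z J (q.1 - q.2) x))); last by rewrite le_eqVlt; apply/orP; left; apply/eqP; ring.
  apply: ler_pM => //.
    by apply: Rintegral_ge0 => q _; apply: Rintegral_ge0.
  have bx f : bdm f -> bdm (fun q : measurableTypeR R * measurableTypeR R => pt Z f (q.1 - q.2) x).
    by move=> bf; apply: (bdm_comp (bF f bf) (g := fun q => (x, q))); exact: measurable_fun_pair.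
  rewrite -RintZ; last by apply: (bdm_integ V2); exact: bx.
  apply: le_Rint; [by apply: (bdm_integ V2); exact: bx|by apply: integZ; apply: (bdm_integ V2); exact: bx|].
  move=> q; rewrite /pt -RintZ; last by apply: bdm_integ; apply: (bdm_comp bJ); exact: measurable_funD.
  apply: le_Rint.
  - by apply: bdm_integ; apply: (bdm_comp ba); exact: measurable_funD.
  - by apply: integZ; apply: bdm_integ; apply: (bdm_comp bJ); exact: measurable_funD.
  - by move=> w; exact: phiJ.
have iJK : integ leb (fun x => J x * \int[V2]_q pt Z J (q.1 - q.2) x) by apply: bint_mul => //; exact: bK.
apply: (@le_trans _ _ (\int[leb]_x (M ^+ 2 * (J x * \int[V2]_q pt Z J (q.1 - q.2) x)))).
  apply: le_Rint => //; last exact: integZ.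
  by apply: bint_mul; [exact: integ_abs (proj2 bphi)|exact: bK].
rewrite RintZ//; apply: ler_wpM2l; first exact: sqr_ge0.
have bJV : bdm (fun p : measurableTypeR R * ((measurableTypeR R * measurableTypeR R) * Om) => J (p.1 + V3 p.2)).
  apply: (bdm_comp bJ); apply: measurable_funD; first exact: measurable_fst.
  exact: (measurableT_comp mV3 measurable_snd).
have -> : \int[leb]_x (J x * \int[V2]_q pt Z J (q.1 - q.2) x) = \int[leb]_x (J x * \int[Q3]_p J (x + V3 p)).
  apply: eq_Rint => x; congr (_ * _); rewrite -(ptQ3 x bJ); apply: eq_Rint => q.
  by rewrite /pt distrC.
rewrite -(int_weight_swap Q3 iJ bJV)/=.
have ov y : \int[leb]_x (J x * J (x + y)) = tent (2 * L) y.
  have NL : - L <= L by lra.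
  rewrite overlap// tentE ?mulr_ge0//.
  have -> : L - (- L - y) = y + 2 * L by ring.
  have -> : L - y - - L = - (y - 2 * L) by ring.
  have -> : - L - (- L - y) = y by ring.
  have -> : L - (L - y) = y by ring.
  by rewrite normrN; field.
rewrite (eq_Rint Q3 (fun p => tent (2 * L) (V3 p)))//.
rewrite -[leLHS](mulKf (lt0r_neq0 c10)) ler_pM2l ?invr_gt0//.
have L2 : 0 <= 2 * L by rewrite mulr_ge0.
have := @tent_fubini _ _ _ Q3 (fun=> 1) V3 (2 * L) L2 (bdm_cst _ 1) mV3.
rewrite (eq_Rint Q3 (fun p => tent (2 * L) (V3 p))); last by move=> p; rewrite mul1r.
move=> ->; rewrite le_eqVlt; apply/orP; left; apply/eqP; apply: eq_Rint => z.
rewrite mulrC; congr (_ * _); rewrite -cosV3; apply: eq_Rint => p; by rewrite mul1r.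
Qed.

End occ_moments.

Section occ_limits.
Context {R : realType} (alpha : R).
Hypotheses (alpha_gt1 : 1 < alpha) (alpha_le2 : alpha <= 2).
Local Notation leb := (@lebesgue_measure R).
Local Notation lam := (lam alpha).
Local Notation q t := (fun z : R => (1 - cos (t * z)) / z ^+ 2).
Context d (Om : measurableType d) (P : probability Om R).
Variable Z : R -> {RV P >-> R}.
Hypothesis hZ : std_symmetric_stable_levy alpha Z.
Context (n : nat) (t b : 'I_n -> R).
Hypothesis t0 : forall i, 0 <= t i.
Local Notation phi := (phis t b).
Variables (T : nat -> R) (T0 : forall k, 0 < T k).
Hypothesis Toy : T k @[k --> \oo] --> +oo.

Let c10 : 0 < @c1 R. Proof. by apply: (@c1_gt0 R 2); rewrite ?ltr1n. Qed.

Let TV : (T k)^-1 @[k --> \oo] --> 0.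
Proof. by apply/gtr0_cvgV0 => //; apply: nearW. Qed.

(** The limit of the variances: T kap2(l) tends to 2/l. *)
Definition sig2 : R := c1^-1 * \int[leb]_z (gker t b z * (2 / lam z)).

Lemma bdm_kap2 (S : R) (S0 : 0 < S) : bdm (fun z : R => kap2 S0 (lam z)).
Proof.
have bE : bdm (fun p : (R * measurableTypeR R) * measurableTypeR R => expR (- (`|p.1.2 - p.2| * lam p.1.1))).
  split; last by exists 1 => p; rewrite ger0_norm ?expR_ge0// expR_le1 oppr_le0 mulr_ge0// lam_ge0.
  apply: measurableT_comp => //; apply: measurable_funN; apply: measurable_funM.
    apply: measurableT_comp => //; apply: measurable_funB; last exact: measurable_snd.
    exact: (measurableT_comp measurable_snd measurable_fst).
  apply: (measurableT_comp (@meas_lam R alpha)).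
  exact: (measurableT_comp measurable_fst measurable_fst).
exact: (bdm_Rint2 (uniform_prob S0) (bdm_Rint2 (uniform_prob S0) bE)).
Qed.

Lemma bdm_kap1 (S : R) (S0 : 0 < S) : bdm (fun z : R => \int[uniform_prob S0]_s expR (- (`|s| * lam z))).
Proof.
have bE : bdm (fun p : R * measurableTypeR R => expR (- (`|p.2| * lam p.1))).
  split; last by exists 1 => p; rewrite ger0_norm ?expR_ge0// expR_le1 oppr_le0 mulr_ge0// lam_ge0.
  apply: measurableT_comp => //; apply: measurable_funN; apply: measurable_funM.
    by apply: measurableT_comp => //; exact: measurable_snd.
  by apply: (measurableT_comp (@meas_lam R alpha)); exact: measurable_fst.
exact: (bdm_Rint2 (uniform_prob S0) bE).
Qed.

Let gl_integ : integ leb (fun z => gker t b z * (2 / lam z)).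
Proof.
have m2 := mult2_mulp t b.
have := mult2_lam_integ alpha_gt1 alpha_le2 (mult2Z 2 m2) (mult2Z 2 m2).
congr (integrable _ _ _); apply/funext => z /=; congr EFin.
by rewrite /gker; ring.
Qed.

Let gker0 : gker t b 0 = 0.
Proof. by rewrite /gker expr0n invr0 mulr0. Qed.

Lemma var_cvg : T k * (c1^-1 * \int[leb]_z (gker t b z * kap2 (T0 k) (lam z))) @[k --> \oo] --> sig2.
Proof.
have mg := integ_meas (integ_gker t b).
rewrite (_ : (fun k => _) = (fun k => c1^-1 * \int[leb]_z (gker t b z * (T k * kap2 (T0 k) (lam z))))); last first.
  apply/funext => k; rewrite mulrCA; congr (_ * _); rewrite -RintZ.
    by apply: eq_Rint => z; ring.
  have [mk [K hK]] := bdm_kap2 (T0 k).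
  apply: (integ_le _ (integZ K (integ_abs (integ_gker t b)))).
    exact: measurable_funM.
  by move=> z; rewrite normrM mulrC ler_wpM2r.
apply: cvgMr; apply: (@dct_pt _ _ _ leb (fun k z => gker t b z * (T k * kap2 (T0 k) (lam z))) _ (fun z => gker t b z * (2 / lam z))).
- move=> k; apply: measurable_funM => //; apply: measurable_funM => //.
  exact: bdm_meas (bdm_kap2 (T0 k)).
- move=> z; have [->|z0] := eqVneq z 0.
    by rewrite gker0 !mul0r; under eq_fun do rewrite mul0r; exact: cvg_cst.
  apply: cvgMr; have l0 := lam_gt0 alpha z0; set l := lam z in l0 *.
  apply: (@squeeze_cvgr _ _ _ _ (fun k => 2 / l - 2 / l ^+ 2 * (T k)^-1) (fun=> 2 / l)).
  + apply: nearW => k; apply/andP; split.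
      apply: le_trans (kap2_ge (T0 k) l0); rewrite lerB// invfM mulrA//.
    rewrite -(ler_pM2l (_ : 0 < (T k)^-1)) ?invr_gt0// mulKf ?gt_eqF//.
    by apply: le_trans (kap2_le (T0 k) l0) _; rewrite mulrAC mulrC mulrA.
  + rewrite -[X in _ --> X]subr0 -[X in _ - X](mulr0 (2 / l ^+ 2)).
    by apply: cvgB; [exact: cvg_cst|apply: cvgMr; exact: TV].
  + exact: cvg_cst.
- exact: gl_integ.
- move=> k z; have [->|z0] := eqVneq z 0; first by rewrite gker0 !mul0r normr0.
  have l0 := lam_gt0 alpha z0.
  rewrite normrM (ger0_norm (gker_ge0 t b z)); apply: ler_wpM2l; first exact: gker_ge0.
  rewrite ger0_norm; last by rewrite mulr_ge0 ?kap2_ge0// ltW.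
  rewrite -(ler_pM2l (_ : 0 < (T k)^-1)) ?invr_gt0// mulKf ?gt_eqF//.
  by apply: le_trans (kap2_le (T0 k) l0) _; rewrite mulrAC mulrC mulrA.
Qed.

Lemma mean_cvg : T k * (c1^-1 * \int[leb]_z (gker t b z *
  (\int[uniform_prob (T0 k)]_s expR (- (`|s| * lam z))) ^+ 2)) @[k --> \oo] --> 0.
Proof.
have mg := integ_meas (integ_gker t b).
pose k1 k z := \int[uniform_prob (T0 k)]_s expR (- (`|s| * lam z)).
have k10 k z : 0 <= k1 k z by apply: Rintegral_ge0 => s _; exact: expR_ge0.
have k1V k z : z != 0 -> k1 k z <= (T k)^-1 / lam z by move=> z0; apply: unif_exp_le; exact: lam_gt0.
have k11 k z : k1 k z <= 1 by apply: unif_exp_le1; exact: lam_ge0.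
rewrite (_ : (fun k => _) = (fun k => c1^-1 * \int[leb]_z (gker t b z * (T k * (k1 k z) ^+ 2)))); last first.
  apply/funext => k; rewrite mulrCA; congr (_ * _); rewrite -RintZ.
    by apply: eq_Rint => z; rewrite -/(k1 k z); ring.
  have [mk [K hK]] := bdmX 2 (bdm_kap1 (T0 k)).
  apply: (integ_le _ (integZ K (integ_abs (integ_gker t b)))).
    exact: measurable_funM.
  by move=> z; rewrite normrM mulrC ler_wpM2r.
rewrite -[X in _ --> X](mulr0 c1^-1); apply: cvgMr.
have -> : 0 = \int[leb]_z (gker t b z * 0) :> R.
  by rewrite (eq_Rint leb (fun=> 0)) ?Rint0// => z; rewrite mulr0.
have bnd k z : z != 0 -> T k * k1 k z ^+ 2 <= (T k)^-1 * (lam z)^-2.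
  move=> z0; have l0 := lam_gt0 alpha z0.
  have -> : (T k)^-1 * (lam z)^-2 = T k * ((T k)^-1 / lam z) ^+ 2.
    by field; rewrite !gt_eqF// T0.
  by rewrite ler_pM2l// lerXn2r ?nnegrE ?k1V// divr_ge0 ?invr_ge0// ltW.
(* [bnd] cannot serve for domination: [gker] divided by the square of [lam] need not be integrable
   at 0 when alpha >= 3/2. One of the two factors [k1] is bounded by 1 instead. *)
have bnd1 k z : z != 0 -> T k * k1 k z ^+ 2 <= 2 / lam z.
  move=> z0; have l0 := lam_gt0 alpha z0.
  have h := k1V k z z0.
  apply: (@le_trans _ _ (T k * ((T k)^-1 / lam z * 1))).
    rewrite ler_pM2l// expr2; apply: ler_pM => //; exact: k11.
  rewrite mulr1 mulVKf ?gt_eqF// -[leLHS]mul1r ler_pM2r ?invr_gt0// ler1n//.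
apply: (@dct_pt _ _ _ leb (fun k z => gker t b z * (T k * k1 k z ^+ 2)) _ (fun z => gker t b z * (2 / lam z))).
- move=> k; apply: measurable_funM => //; apply: measurable_funM => //.
  exact: bdm_meas (bdmX 2 (bdm_kap1 (T0 k))).
- move=> z; have [->|z0] := eqVneq z 0.
    by rewrite gker0 !mul0r; under eq_fun do rewrite mul0r; exact: cvg_cst.
  apply: cvgMr; apply: (@squeeze_cvgr _ _ _ _ (fun=> 0) (fun k => (T k)^-1 * (lam z)^-2)).
  + apply: nearW => k; rewrite bnd// andbT mulr_ge0 ?sqr_ge0// ltW//.
  + exact: cvg_cst.
  + rewrite -[X in _ --> X](mul0r ((lam z)^-2)); apply: cvgMl; exact: TV.
- exact: gl_integ.
- move=> k z; have [->|z0] := eqVneq z 0; first by rewrite gker0 !mul0r normr0.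
  rewrite normrM (ger0_norm (gker_ge0 t b z)); apply: ler_wpM2l; first exact: gker_ge0.
  rewrite ger0_norm; last by rewrite mulr_ge0 ?sqr_ge0// ltW.
  exact: bnd1.
Qed.

(** Indicators, unlike [psi], have no cancellation at frequency 0: [q L] divided by [lam] is in
    general not integrable there and yields no rate. Domination comes from kap2 <= 1, the limit from
    the pointwise decay. *)
Lemma kap2_cvg0 L : \int[leb]_z (q L z * kap2 (T0 k) (lam z)) @[k --> \oo] --> 0.
Proof.
have mq := integ_meas (integ_q L).
have -> : 0 = \int[leb]_z (q L z * 0) :> R.
  by rewrite (eq_Rint leb (fun=> 0)) ?Rint0// => z; rewrite mulr0.
apply: (@dct_pt _ _ _ leb (fun k z => q L z * kap2 (T0 k) (lam z)) _ (q L)).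
- move=> k; apply: measurable_funM => //.
  exact: bdm_meas (bdm_kap2 (T0 k)).
- move=> z; have [->|z0] := eqVneq z 0.
    by rewrite expr0n invr0 mulr0 !mul0r; under eq_fun do rewrite mul0r; exact: cvg_cst.
  have l0 := lam_gt0 alpha z0.
  apply: cvgMr; apply: (@squeeze_cvgr _ _ _ _ (fun=> 0) (fun k => 2 * (T k)^-1 / lam z)).
  + by apply: nearW => k; rewrite kap2_ge0/= kap2_le.
  + exact: cvg_cst.
  + rewrite -[X in _ --> X](mul0r (lam z)^-1) -[X in X * _](mulr0 2); apply: cvgMl; apply: cvgMr; exact: TV.
- exact: integ_q.
- move=> k z; rewrite normrM (ger0_norm (q_ge0 L z)) ler_piMr ?q_ge0//.
  by rewrite ger0_norm ?kap2_ge0// kap2_le1// lam_ge0.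
Qed.

Local Notation occk k := (occT Z t b (T0 k)).

Lemma occ_var_cvg :
  T k * \int[leb]_y \int[P]_w occk k y w ^+ 2 @[k --> \oo] --> sig2.
Proof.
rewrite (_ : (fun k => _) = (fun k => T k * (c1^-1 * \int[leb]_z (gker t b z * kap2 (T0 k) (lam z))))).
  exact: var_cvg.
apply/funext => k; have [_ <-] := int_occT_sqr hZ hZ b t0 (T0 k).
by rewrite mulKf// gt_eqF.
Qed.

Lemma occ_mean_cvg :
  T k * \int[leb]_y (\int[P]_w occk k y w) ^+ 2 @[k --> \oo] --> 0.
Proof.
rewrite (_ : (fun k => _) = (fun k => T k * (c1^-1 * \int[leb]_z (gker t b z *
  (\int[uniform_prob (T0 k)]_s expR (- (`|s| * lam z))) ^+ 2)))).
  exact: mean_cvg.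
apply/funext => k; rewrite -(occT_mean_sqr_rep hZ hZ b t0 (T0 k)).
by rewrite mulKf// gt_eqF.
Qed.

(** The factor T^2 is exactly compensated by the two potentials; the decay comes from the middle gap
    alone. *)
Lemma occ_pow4_cvg :
  T k ^+ 2 * \int[leb]_y \int[P]_w occk k y w ^+ 4 @[k --> \oo] --> 0.
Proof.
pose C := 24 * ((2 * Cphi alpha t b) ^+ 2 * (Mphi b ^+ 2 * c1^-1)).
apply: (@squeeze_cvgr _ _ _ _ (fun=> 0) (fun k => C * \int[leb]_z (q (2 * Lphi t) z * kap2 (T0 k) (lam z)))).
- apply: nearW => k; apply/andP; split.
    rewrite mulr_ge0 ?sqr_ge0//; apply: Rintegral_ge0 => y _; apply: Rintegral_ge0 => w _.
    by rewrite -[4%N]/(2 * 2)%N exprM sqr_ge0.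
  have [_ h] := int_occT_pow4 alpha_gt1 alpha_le2 hZ hZ b t0 (T0 k).
  rewrite -(ler_pM2l (_ : 0 < (T k ^+ 2)^-1)) ?invr_gt0 ?exprn_gt0// mulKf ?gt_eqF ?exprn_gt0//.
  apply: le_trans h _; rewrite le_eqVlt; apply/orP; left; apply/eqP.
  by rewrite /C; have := T0 k => Tk; have c1k := c10; field; rewrite !gt_eqF.
- exact: cvg_cst.
- rewrite -[X in _ --> X](mulr0 C); apply: cvgMr; exact: kap2_cvg0.
Qed.

End occ_limits.

(** * Lindeberg's exchange *)

Section real_bounds.
Context {R : realType}.
Implicit Types x y d : R.

Lemma expRN_lip x y : 0 <= x -> 0 <= y -> `|expR (- x) - expR (- y)| <= `|x - y|.
Proof.
wlog xy : x y / x <= y => [hw|] x0 y0.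
  have [xy|/ltW yx] := leP x y; first exact: hw.
  by rewrite distrC [leRHS]distrC; exact: hw.
rewrite ger0_norm; last by rewrite subr_ge0 ler_expR lerN2.
rewrite distrC ger0_norm ?subr_ge0//.
have -> : - y = - x + (x - y) by ring.
rewrite expRD -[X in X - _]mulr1 -mulrBr.
have h := expR_ge1Dx (x - y).
have h1 : expR (- x) <= 1 by rewrite expR_le1 oppr_le0.
have h2 : 1 - expR (x - y) <= y - x by lra.
have h3 : 0 <= 1 - expR (x - y) by rewrite subr_ge0 expR_le1 subr_le0.
rewrite -[leRHS]mul1r; apply: ler_pM => //; exact: expR_ge0.
Qed.

Lemma expRN_taylor x : 0 <= x -> `|expR (- x) - (1 - x)| <= x ^+ 2.
Proof.
move=> x0; rewrite ger0_norm; last by have := expR_ge1Dx (- x); rewrite subr_ge0.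
have p : 0 < 1 + x by rewrite ltr_wpDr.
have h : expR (- x) <= (1 + x)^-1 by rewrite expRN lef_pV2 ?posrE ?expR_gt0// expR_ge1Dx.
have : (1 + x)^-1 <= 1 - x + x ^+ 2.
  rewrite -[leLHS]mul1r ler_pdivrMr//.
  have : 0 <= x ^+ 3 by rewrite exprn_ge0.
  have -> : (1 - x + x ^+ 2) * (1 + x) = 1 + x ^+ 3 by ring.
  by lra.
lra.
Qed.

(** Arithmetic-geometric inequality with a weight [d]: the third moment costs a small multiple of
    the second and a large multiple of the vanishing fourth. *)
Lemma norm_cube_le d x : 0 < d -> `|x| ^+ 3 <= (d * x ^+ 2 + x ^+ 4 / d) / 2.
Proof.
move=> d0; rewrite -(sqn x) (_ : x ^+ 4 = `|x| ^+ 4); last first.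
  by rewrite -[4%N]/(2 * 2)%N !exprM sqn.
have h : 0 <= (`|x| * (d - `|x|)) ^+ 2 / d by rewrite divr_ge0 ?sqr_ge0// ltW.
have -> : (d * `|x| ^+ 2 + `|x| ^+ 4 / d) / 2 = `|x| ^+ 3 + (`|x| * (d - `|x|)) ^+ 2 / d / 2.
  by field; rewrite gt_eqF.
by lra.
Qed.

Lemma norm_le_sqr d x : 0 < d -> `|x| <= (d + x ^+ 2 / d) / 2.
Proof.
move=> d0; have h : 0 <= (d - `|x|) ^+ 2 / d by rewrite divr_ge0 ?sqr_ge0// ltW.
have -> : (d + x ^+ 2 / d) / 2 = `|x| + (d - `|x|) ^+ 2 / d / 2.
  by rewrite -(sqn x); field; rewrite gt_eqF.
by lra.
Qed.

End real_bounds.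

Section one_step.
Context {R : realType} d (Om : measurableType d) (P : probability Om R).
Variables (h : Om -> R) (bh : bdm h).
Local Notation m := (\int[P]_w h w).
Local Notation v := (\int[P]_w h w ^+ 2).
Local Notation H4 := (\int[P]_w h w ^+ 4).

Lemma Rint_cst (c : R) : \int[P]_w c = c.
Proof.
rewrite /Rintegral integral_cst//= probability_setT mule1//.
Qed.

Let ii f : bdm f -> integ P f. Proof. exact: bdm_integ. Qed.

Lemma sqr_mean_le : m ^+ 2 <= v.
Proof.
have : 0 <= \int[P]_w (h w - m) ^+ 2 by apply: Rintegral_ge0 => w _; exact: sqr_ge0.
rewrite (eq_Rint P (fun w => h w ^+ 2 - (2 * m) * h w + m ^+ 2)); last by move=> w; ring.
rewrite RintD ?RintB ?Rint_cst ?RintZ.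
- by lra.
- exact: ii.
- by apply: ii; exact: bdmX.
- by apply: integZ; exact: ii.
- by apply: ii; apply: bdmB; [exact: bdmX|apply: bdmM => //; exact: bdm_cst].
- by apply: ii; exact: bdm_cst.
Qed.

Variables (dl : R) (dl0 : 0 < dl).
Hypothesis vH : v ^+ 2 <= H4.
(** Both terms are compared with the expansion cos a (1 - v/2) - m sin a. The exponent carries the
    second moment [v] and not the variance v - m^2; the difference is paid for by the term
    [m ^+ 2]. *)
Lemma one_step a :
  `|\int[P]_w cos (a + h w) - cos (a + m) * expR (- (v / 2))| <=
  (1 + (4 * dl)^-1) * H4 + dl / 4 * v + m ^+ 2.
Proof.
have v0 : 0 <= v by apply: Rintegral_ge0 => w _; exact: sqr_ge0.
have mv := sqr_mean_le.
have H40 : 0 <= H4 by apply: le_trans vH; exact: sqr_ge0.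
have m4 : m ^+ 4 <= H4.
  apply: le_trans vH; by rewrite -[4%N]/(2 * 2)%N exprM; apply: lerXn2r => //; rewrite nnegrE ?sqr_ge0.
have b1 : bdm (fun w => cos (a + h w)).
  by apply: bdm_cos; apply: measurable_funD => //; exact: bdm_meas.
pose L w := cos a * (1 - h w ^+ 2 / 2) - sin a * h w.
have bL : bdm L.
  apply: bdmB; apply: bdmM; rewrite ?bdm_cst//; try exact: bdm_cst; try exact: bh.
  apply: bdmB; first exact: bdm_cst.
  by apply: bdmM; [exact: bdmX|exact: bdm_cst].
have EL : \int[P]_w L w = cos a * (1 - v / 2) - sin a * m.
  transitivity (\int[P]_w (cos a + (- (cos a / 2)) * h w ^+ 2 + (- sin a) * h w)).
    by apply: eq_Rint => w; rewrite /L; ring.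
  rewrite RintD ?RintD ?RintZ ?Rint_cst.
  - by ring.
  - exact: ii.
  - exact: ii (bdmX _ _).
  - by apply: ii; exact: bdm_cst.
  - exact: integZ (ii (bdmX _ _)).
  - by apply: integD; [by apply: ii; exact: bdm_cst|exact: integZ (ii (bdmX _ _))].
  - by apply: integZ; exact: ii.
have s1 : `|\int[P]_w cos (a + h w) - (cos a * (1 - v / 2) - sin a * m)| <=
    H4 / 8 + (dl * v + H4 / dl) / 4.
  rewrite -EL -RintB; [|exact: ii|exact: ii].
  have -> : H4 / 8 + (dl * v + H4 / dl) / 4 = \int[P]_w ((8^-1 + dl^-1 / 4) * h w ^+ 4 + dl / 4 * h w ^+ 2).
    rewrite RintD ?RintZ; first by field; rewrite gt_eqF.
    + exact: ii (bdmX _ _).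
    + exact: ii (bdmX _ _).
    + exact: integZ (ii (bdmX _ _)).
    + exact: integZ (ii (bdmX _ _)).
  apply: Rint_abs_le.
  + by apply: ii; apply: bdmB.
  + by apply: integD; exact: integZ (ii (bdmX _ _)).
  + move=> w; apply: le_trans (cos_expand a (h w)) _.
    have := norm_cube_le (h w) dl0; set u := h w ^+ 4.
    have -> : (8^-1 + dl^-1 / 4) * u = u / 8 + u / dl / 4 by field; rewrite gt_eqF.
    by move: (u / dl) => u'; lra.
have s2 : `|cos (a + m) - (cos a * (1 - m ^+ 2 / 2) - sin a * m)| <= H4 / 8 + (m ^+ 2 + H4) / 4.
  apply: le_trans (cos_expand a m) _.
  by have := norm_cube_le m (@ltr01 R); rewrite divr1 mul1r; lra.
have s2' : `|cos a * (m ^+ 2 / 2)| <= m ^+ 2 / 2.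
  by rewrite normrM [X in _ * X <= _]ger0_norm ?divr_ge0 ?sqr_ge0// ler_piMl ?divr_ge0 ?sqr_ge0// ler_norml cos_le1 cos_geN1.
have s3 : `|cos (a + m) * (expR (- (v / 2)) - (1 - v / 2))| <= H4 / 4.
  rewrite normrM; apply: (@le_trans _ _ (1 * (v / 2) ^+ 2)).
    apply: ler_pM => //; first by rewrite ler_norml cos_le1 cos_geN1.
    by apply: expRN_taylor; rewrite divr_ge0.
  by have -> : 1 * (v / 2) ^+ 2 = v ^+ 2 / 4; [field|rewrite ler_pM2r].
have s4 : `|(v / 2) * (cos (a + m) - cos a)| <= (H4 + m ^+ 2) / 4.
  rewrite normrM ger0_norm ?divr_ge0//.
  apply: (@le_trans _ _ (v / 2 * `|m|)).
    by rewrite ler_wpM2l ?divr_ge0//; have := cos_lip (a + m) a; rewrite [a + m]addrC addrK.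
  have h2 := sqr_ge0 (v - `|m|).
  have -> : v / 2 * `|m| = (v ^+ 2 + `|m| ^+ 2 - (v - `|m|) ^+ 2) / 4 by field.
  by rewrite sqn ler_pM2r//; move: h2 vH; set V2 := v ^+ 2; set V3 := (_ - _) ^+ 2; lra.
(* Five errors: the expansions at [h] and at [m], the quadratic term of the latter, the expansion of
   the exponential, and the change from cos(a + m) to cos a in front of v/2. *)
have -> : \int[P]_w cos (a + h w) - cos (a + m) * expR (- (v / 2)) =
  (\int[P]_w cos (a + h w) - (cos a * (1 - v / 2) - sin a * m))
  - (cos (a + m) - (cos a * (1 - m ^+ 2 / 2) - sin a * m)) + cos a * (m ^+ 2 / 2)
  - cos (a + m) * (expR (- (v / 2)) - (1 - v / 2)) + (v / 2) * (cos (a + m) - cos a) by field.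
have -> : (1 + (4 * dl)^-1) * H4 = H4 + H4 / dl / 4 by field; rewrite gt_eqF.
move: s1 s2 s2' s3 s4; rewrite !ler_norml.
set X1 := _ - _; set X2 := _ - (_ - _); set X3 := cos a * _; set X4 := cos _ * _; set X5 := _ / 2 * _.
move=> /andP[s1 s1'] /andP[s2 s2'] /andP[s3 s3'] /andP[s4 s4'] /andP[s5 s5'].
have hd : 0 <= H4 / dl by rewrite divr_ge0// ltW.
have hdv : 0 <= dl * v by rewrite mulr_ge0// ltW.
apply/andP; split; lra.
Qed.

End one_step.

(* Lindeberg's exchange: given the positions, the contribution [h n] of particle [n] is
   traded for a Gaussian one with the same mean and second moment. Its trajectory is
   [G2 n]-measurable, and all that remains to be exchanged is [G1 n]-measurable. *)
Section swap.
Context {R : realType}.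
Local Notation leb := (@lebesgue_measure R).
Context d (Om : measurableType d) (P : probability Om R).
Variables (G1 G2 : nat -> set (set Om)).
Hypotheses (sG1 : forall n, G1 n `<=` measurable) (sG2 : forall n, G2 n `<=` measurable).
Hypothesis ind : forall n, indep2 P (id : Om -> g_sigma_algebraType (G1 n)) (id : Om -> g_sigma_algebraType (G2 n)).
Variables (x : nat -> Om -> R) (h : nat -> R -> Om -> R).
Hypothesis mx1 : forall j n, measurable_fun setT (x j : g_sigma_algebraType (G1 n) -> R).
Hypothesis bh1 : forall j n, (j < n)%N -> bdm (fun p : R * g_sigma_algebraType (G1 n) => h j p.1 p.2).
Hypothesis bh2 : forall n, bdm (fun p : R * g_sigma_algebraType (G2 n) => h n p.1 p.2).
Variables (m v H4 : R -> R).
Hypothesis hm : forall n y, \int[P]_w h n y w = m y.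
Hypothesis hv : forall n y, \int[P]_w h n y w ^+ 2 = v y.
Hypothesis hH : forall n y, \int[P]_w h n y w ^+ 4 = H4 y.
Variables (dl th : R) (dl0 : 0 < dl).

Let e y := (1 + (4 * dl)^-1) * H4 y + dl / 4 * v y + m y ^+ 2.

Let bh n : bdm (fun p : R * Om => h n p.1 p.2).
Proof.
apply: (bdm_comp (f := fun p : R * g_sigma_algebraType (G2 n) => h n p.1 p.2) (g := fun p : R * Om => (p.1, p.2))).
  exact: bh2.
apply: measurable_fun_pair; first exact: measurable_fst.
by apply: (measurableT_comp (measurable_fun_gen_id (@sG2 n))); exact: measurable_snd.
Qed.

Let bhy n y : bdm (h n y).
Proof. by apply: (bdm_comp (bh n) (g := fun w => (y, w))); apply: measurable_fun_pair. Qed.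

Let mx j : measurable_fun setT (x j).
Proof.
have h0 : measurable_fun [set: Om] ((x j : g_sigma_algebraType (G1 0) -> R) \o (id : Om -> g_sigma_algebraType (G1 0))).
  by apply: measurableT_comp; [exact: mx1|exact: measurable_fun_gen_id].
exact: h0.
Qed.

Let bm : bdm m.
Proof. by rewrite (_ : m = fun y => \int[P]_w h 0 y w); [exact: bdm_Rint2 (bh 0)|apply/funext => y; rewrite hm]. Qed.

Let bv : bdm v.
Proof. by rewrite (_ : v = fun y => \int[P]_w h 0 y w ^+ 2); [exact: bdm_Rint2 (bdmX 2 (bh 0))|apply/funext => y; rewrite hv]. Qed.

Let bH : bdm H4.
Proof. by rewrite (_ : H4 = fun y => \int[P]_w h 0 y w ^+ 4); [exact: bdm_Rint2 (bdmX 4 (bh 0))|apply/funext => y; rewrite hH]. Qed.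

Let mv y : m y ^+ 2 <= v y.
Proof. by rewrite -(hm 0) -(hv 0); exact: sqr_mean_le (bhy 0 y). Qed.

Let vH y : v y ^+ 2 <= H4 y.
Proof.
rewrite -(hv 0) -(hH 0); apply: le_trans (sqr_mean_le P (bdmX 2 (bhy 0 y))) _.
by rewrite le_eqVlt; apply/orP; left; apply/eqP; apply: eq_Rint => w; rewrite -exprM.
Qed.

Let v0 y : 0 <= v y. Proof. exact: le_trans (sqr_ge0 _) (mv y). Qed.

(** Interpolation: particles below [n] keep their trajectories, those from [n] to N - 1 are already
    exchanged. [W N N] is the original expectation and [W N 0] involves the positions only. *)
Let W N n := \int[P]_w (cos (th + \sum_(0 <= j < n) h j (x j w) w + \sum_(n <= j < N) m (x j w)) *
  expR (- (\sum_(n <= j < N) v (x j w) / 2))).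

Let bxs d' (E : measurableType d') (f : R -> R) (g : nat -> E -> R) (s : seq nat) :
  (forall j, measurable_fun setT (g j)) -> bdm f -> bdm (fun w => \sum_(j <- s) f (g j w)).
Proof. by move=> mg bf; apply: bdm_sum => j; exact: bdm_comp bf (mg j). Qed.

Let step N n : (n < N)%N -> `|W N n.+1 - W N n| <= \int[P]_w e (x n w).
Proof.
move=> nN.
pose E1 : measurableType _ := g_sigma_algebraType (G1 n).
pose E2 : measurableType _ := g_sigma_algebraType (G2 n).
pose A (w : E1) : R := th + \sum_(0 <= j < n) h j (x j w) w + \sum_(n.+1 <= j < N) m (x j w).
pose Q (w : E1) : R := \sum_(n.+1 <= j < N) v (x j w) / 2.
have bA : bdm A.
  apply: bdmD; last exact: bxs.
  apply: bdmD; first exact: bdm_cst.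
  (* [bh1] requires j < n, which holds inside the sum; the guard makes the summand measurable for
     every index. *)
  rewrite (_ : (fun w : E1 => _) = fun w : E1 => \sum_(0 <= j < n) (if (j < n)%N then h j (x j w) w else 0)); last first.
    by apply/funext => w; apply: eq_big_nat => j /andP[_ ->].
  have bj j : bdm (fun w : E1 => if (j < n)%N then h j (x j w) w else 0).
    have [jn|jn] := boolP (j < n)%N; last exact: bdm_cst.
    apply: (bdm_comp (bh1 jn) (g := fun w : E1 => (x j w, w))).
    by apply: measurable_fun_pair => //; exact: mx1.
  exact: bdm_sum _ bj.
have bQ : bdm Q.
  apply: (bxs _ _ (f := fun y => v y / 2)) => //.
  by apply: bdmM => //; exact: bdm_cst.
have Q0 w : 0 <= Q w by apply: sumr_ge0 => j _; rewrite divr_ge0.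
have bE : bdm (fun w => expR (- Q w)).
  split; first by apply: measurableT_comp => //; apply: measurable_funN; exact: bdm_meas.
  by exists 1 => w; rewrite ger0_norm ?expR_ge0// expR_le1 oppr_le0.
have mid := measurable_fun_gen_id (@sG1 n).
pose F (p : E1 * E2) := cos (A p.1 + h n (x n p.1) p.2) * expR (- Q p.1).
have bF : bdm F.
  apply: bdmM; last by apply: (bdm_comp bE); exact: measurable_fst.
  apply: bdm_cos; apply: measurable_funD.
    by apply: (measurableT_comp (bdm_meas bA)); exact: measurable_fst.
  apply: (bdm_meas (bdm_comp (bh2 n) (g := fun p : E1 * E2 => (x n p.1, p.2)) _)).
  apply: measurable_fun_pair; last exact: measurable_snd.
  by apply: measurableT_comp; [exact: mx1|exact: measurable_fst].
(* All but the trajectory of particle [n] is measurable for [G1 n], so this trajectory is integrated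
   first, with the rest frozen. *)
have -> : W N n.+1 = \int[P]_w1 (\int[P]_w2 cos (A w1 + h n (x n w1) w2) * expR (- Q w1)).
  transitivity (\int[P]_w F (id w, id w)).
    by apply: eq_Rint => w; rewrite /F /= /A /Q big_nat_recr//= [LHS]mulrC [RHS]mulrC; congr (_ * cos _); ring.
  rewrite (indep2_bdm mid (measurable_fun_gen_id (@sG2 n)) (@ind n) bF).
  apply: eq_Rint => w; rewrite /F /= RintZr//; apply: bdm_integ.
  apply: bdm_cos; apply: measurable_funD => //; exact: bdm_meas (bhy _ _).
have -> : W N n = \int[P]_w (cos (A w + m (x n w)) * expR (- (v (x n w) / 2)) * expR (- Q w)).
  apply: eq_Rint => w; rewrite /A /Q (big_ltn nN) [in X in expR (- X)](big_ltn nN) opprD expRD mulrA.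
  by congr (cos _ * _ * _); ring.
have be : bdm e.
  apply: bdmD; last exact: bdmX.
  by apply: bdmD; apply: bdmM => //; exact: bdm_cst.
have bcA : bdm (fun w : Om => \int[P]_w2 cos (A w + h n (x n w) w2) * expR (- Q w)).
  have bb : bdm (fun p : Om * Om => cos (A p.1 + h n (x n p.1) p.2)).
    apply: bdm_cos; apply: measurable_funD.
      by apply: (measurableT_comp (bdm_meas (bdm_comp bA mid))); exact: measurable_fst.
    apply: (bdm_meas (bdm_comp (bh n) (g := fun p : Om * Om => (x n p.1, p.2)) _)).
    apply: measurable_fun_pair; last exact: measurable_snd.
    by apply: measurableT_comp => //; exact: measurable_fst.
  by apply: bdmM; [exact: (bdm_Rint2 P bb)|exact: bdm_comp bE mid].
have bcB : bdm (fun w : Om => cos (A w + m (x n w)) * expR (- (v (x n w) / 2)) * expR (- Q w)).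
  apply: bdmM; last exact: bdm_comp bE mid.
  apply: bdmM.
    apply: bdm_cos; apply: measurable_funD; first exact: bdm_meas (bdm_comp bA mid).
    by apply: measurableT_comp => //; exact: bdm_meas.
  split; last by exists 1 => w; rewrite ger0_norm ?expR_ge0// expR_le1 oppr_le0 divr_ge0.
  apply: measurableT_comp => //; apply: measurable_funN; apply: measurable_funM => //.
  by apply: measurableT_comp => //; exact: bdm_meas.
rewrite -RintB; [|exact: bdm_integ|exact: bdm_integ].
apply: Rint_abs_le.
- by apply: bdm_integ; exact: bdmB.
- by apply: bdm_integ; exact: bdm_comp be _.
- move=> w; rewrite -mulrBl normrM (ger0_norm (expR_ge0 _)).
  rewrite -[leRHS]mulr1; apply: ler_pM; rewrite ?expR_ge0//; last by rewrite expR_le1 oppr_le0.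
  have hh : (\int[P]_w2 h n (x n w) w2 ^+ 2) ^+ 2 <= \int[P]_w2 h n (x n w) w2 ^+ 4 by rewrite hv hH.
  by have := one_step (bhy n (x n w)) dl0 hh (A w); rewrite hm hv hH.
Qed.

Hypothesis prm : poisson_random_measure P leb (fun w => mseries (fun i => \d_(x i w)) 0).
Hypotheses (im : integ leb m) (iv : integ leb v) (iH : integ leb H4).
Hypothesis m0 : \int[leb]_y m y = 0.
Local Notation V := (\int[leb]_y v y).
Local Notation HH := (\int[leb]_y H4 y).
Local Notation MM := (\int[leb]_y m y ^+ 2).

Let im2 : integ leb (fun y => m y ^+ 2).
Proof.
apply: integ_le _ iv _; first by apply: bdm_meas; exact: bdmX.
by move=> y; rewrite ger0_norm ?sqr_ge0.
Qed.

Let iv2 : integ leb (fun y => v y ^+ 2).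
Proof.
apply: integ_le _ iH _; first by apply: bdm_meas; exact: bdmX.
by move=> y; rewrite ger0_norm ?sqr_ge0.
Qed.

Let ie : integ leb e.
Proof. by apply: integD => //; apply: integD; exact: integZ. Qed.

Let Rie : \int[leb]_y e y = (1 + (4 * dl)^-1) * HH + dl / 4 * V + MM.
Proof. by rewrite RintD ?RintD ?RintZ//; [exact: integZ|exact: integZ|apply: integD; exact: integZ]. Qed.

Let V0 : 0 <= V. Proof. by apply: Rintegral_ge0 => y _. Qed.
Let HH0 : 0 <= HH. Proof. by apply: Rintegral_ge0 => y _; apply: le_trans (vH y); exact: sqr_ge0. Qed.
Let MM0 : 0 <= MM. Proof. by apply: Rintegral_ge0 => y _; exact: sqr_ge0. Qed.

Let steps N k : (k <= N)%N -> `|W N k - W N 0| <= \sum_(n < k) \int[P]_w e (x n w).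
Proof.
elim: k => [_|k IH kN]; first by rewrite subrr normr0 big_ord0.
rewrite big_ord_recr/= -[W N k.+1](subrK (W N k)) -addrA addrC.
by apply: le_trans (ler_normD _ _) _; apply: lerD; [apply: IH; exact: ltnW|exact: step].
Qed.

Let E2 (f : R -> R) c N := \int[P]_w (\sum_(i < N) f (x i w) - c) ^+ 2.

(** The random sums of [m] and of [v] are replaced by 0 and [V] in mean square; [norm_le_sqr] turns
    absolute values into squares at the price of [dl]. *)
Let final N : `|W N 0 - cos th * expR (- (V / 2))| <=
  (dl + E2 m 0 N / dl) / 2 + (dl + E2 v V N / dl) / 4.
Proof.
have bS (f : R -> R) : bdm f -> bdm (fun w => \sum_(i < N) f (x i w)).
  by move=> bf; apply: bdm_sum => i; exact: bdm_comp bf _.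
have bW : bdm (fun w => cos (th + \sum_(i < N) m (x i w)) * expR (- (\sum_(i < N) v (x i w) / 2))).
  apply: bdmM.
    by apply: bdm_cos; apply: measurable_funD => //; exact: bdm_meas (bS _ bm).
  have b2 : bdm (fun w => \sum_(i < N) v (x i w) / 2).
    by apply: bdm_sum => i; apply: (bdm_comp (f := fun y => v y / 2)) => //; apply: bdmM => //; exact: bdm_cst.
  split; first by apply: measurableT_comp => //; apply: measurable_funN; exact: bdm_meas.
  exists 1 => w; rewrite ger0_norm ?expR_ge0// expR_le1 oppr_le0; apply: sumr_ge0 => i _.
  by rewrite divr_ge0.
rewrite -(Rint_cst P (cos th * _)).
have -> : W N 0 = \int[P]_w (cos (th + \sum_(i < N) m (x i w)) * expR (- (\sum_(i < N) v (x i w) / 2))).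
  by apply: eq_Rint => w; rewrite big_geq// addr0 !big_mkord.
rewrite -RintB; [|exact: bdm_integ|by apply: bdm_integ; exact: bdm_cst].
have b1 : bdm (fun w => (\sum_(i < N) m (x i w) - 0) ^+ 2).
  by apply: bdmX; apply: bdmB; [exact: bS|exact: bdm_cst].
have b2 : bdm (fun w => (\sum_(i < N) v (x i w) - V) ^+ 2).
  by apply: bdmX; apply: bdmB; [exact: bS|exact: bdm_cst].
have -> : (dl + E2 m 0 N / dl) / 2 + (dl + E2 v V N / dl) / 4 =
  \int[P]_w (dl * 3 / 4 + ((2 * dl)^-1 * (\sum_(i < N) m (x i w) - 0) ^+ 2 + (4 * dl)^-1 * (\sum_(i < N) v (x i w) - V) ^+ 2)).
  rewrite RintD ?Rint_cst ?RintD ?RintZ.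
  - by rewrite -/(E2 m 0 N) -/(E2 v V N); field; rewrite gt_eqF.
  - exact: bdm_integ.
  - exact: bdm_integ.
  - by apply: integZ; exact: bdm_integ.
  - by apply: integZ; exact: bdm_integ.
  - by apply: bdm_integ; exact: bdm_cst.
  - by apply: integD; apply: integZ; exact: bdm_integ.
apply: Rint_abs_le.
- by apply: bdm_integ; apply: bdmB => //; exact: bdm_cst.
- apply: integD; first by apply: bdm_integ; exact: bdm_cst.
  by apply: integD; apply: integZ; exact: bdm_integ.
- move=> w; set S := \sum_(i < N) m _; rewrite -mulr_suml; set S2 := \sum_(i < N) v _.
  have S20 : 0 <= S2 by apply: sumr_ge0.
  have -> : cos (th + S) * expR (- (S2 / 2)) - cos th * expR (- (V / 2)) =
    (cos (th + S) - cos th) * expR (- (S2 / 2)) + cos th * (expR (- (S2 / 2)) - expR (- (V / 2))) by ring.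
  apply: le_trans (ler_normD _ _) _; rewrite !normrM.
  have c1 : `|cos (th + S) - cos th| <= `|S - 0| by rewrite subr0; have := cos_lip (th + S) th; rewrite [th + S]addrC addrK.
  have c2 : `|expR (- (S2 / 2))| <= 1 by rewrite ger0_norm ?expR_ge0// expR_le1 oppr_le0 divr_ge0.
  have c3 : `|cos th| <= 1 by rewrite ler_norml cos_le1 cos_geN1.
  have c4 : `|expR (- (S2 / 2)) - expR (- (V / 2))| <= `|S2 - V| / 2.
    apply: le_trans (expRN_lip _ _) _; rewrite ?divr_ge0// -mulrBl normrM [X in _ * X]ger0_norm//.
  have d1 := norm_le_sqr (S - 0) dl0; have d2 := norm_le_sqr (S2 - V) dl0.
  apply: (@le_trans _ _ (`|S - 0| * 1 + 1 * (`|S2 - V| / 2))).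
    by apply: lerD; apply: ler_pM.
  rewrite mulr1 mul1r; apply: (@le_trans _ _ ((dl + (S - 0) ^+ 2 / dl) / 2 + (dl + (S2 - V) ^+ 2 / dl) / 2 / 2)).
    by apply: lerD => //; rewrite ler_pM2r.
  by rewrite le_eqVlt; apply/orP; left; apply/eqP; field; rewrite gt_eqF.
Qed.

(** The exchange is made for [N] particles; as N grows, Campbell's formulas turn sums over particles
    into Lebesgue integrals. The parameter [dl] stays free, to be fixed before the horizon tends to
    infinity. *)
Lemma swap_bound (Y : Om -> R) :
  \int[P]_w cos (th + \sum_(j < N) h j (x j w) w) @[N --> \oo] --> \int[P]_w cos (th + Y w) ->
  `|\int[P]_w cos (th + Y w) - cos th * expR (- (V / 2))| <= (1 + dl^-1) * (HH + MM) + dl * (1 + V).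
Proof.
move=> cY.
have [_ ce] := campbell_cvg mx prm ie.
have [_ cm] := campbell_var mx prm im im2.
have [_ cv] := campbell_var mx prm iv iv2.
rewrite m0 in cm.
have WN N : W N N = \int[P]_w cos (th + \sum_(j < N) h j (x j w) w).
  by apply: eq_Rint => w; rewrite big_mkord !(@big_geq _ _ _ N N)// oppr0 expR0 mulr1 addr0.
pose B N := \sum_(n < N) \int[P]_w e (x n w) + ((dl + E2 m 0 N / dl) / 2 + (dl + E2 v V N / dl) / 4).
have cB : B N @[N --> \oo] --> \int[leb]_y e y + ((dl + MM / dl) / 2 + (dl + (\int[leb]_y v y ^+ 2) / dl) / 4).
  apply: cvgD => //; apply: cvgD; apply: cvgMl; apply: cvgD; first exact: cvg_cst.
  + by apply: cvgMl; exact: cm.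
  + exact: cvg_cst.
  + by apply: cvgMl; exact: cv.
apply: (@le_trans _ _ (\int[leb]_y e y + ((dl + MM / dl) / 2 + (dl + (\int[leb]_y v y ^+ 2) / dl) / 4))).
  have cD : `|\int[P]_w cos (th + \sum_(j < N) h j (x j w) w) - cos th * expR (- (V / 2))| @[N --> \oo] -->
      `|\int[P]_w cos (th + Y w) - cos th * expR (- (V / 2))|.
    by apply: cvg_norm; apply: cvgB; [exact: cY|exact: cvg_cst].
  apply: (ler_cvg_to cD cB).
  apply: nearW => N; rewrite -WN -[W N N](subrK (W N 0)) -addrA.
  by apply: le_trans (ler_normD _ _) _; apply: lerD; [exact: steps|exact: final].
have vHH : \int[leb]_y v y ^+ 2 <= HH by exact: le_Rint.
have dV : 0 <= dl^-1 by rewrite invr_ge0 ltW.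
rewrite Rie invfM; have h1 := mulr_ge0 dV HH0; have h2 := mulr_ge0 dV MM0.
have h3 : dl^-1 * (\int[leb]_y v y ^+ 2) <= dl^-1 * HH by rewrite ler_wpM2l.
have h4 := mulr_ge0 (ltW dl0) V0.
rewrite [X in (dl + X) / 2]mulrC [X in (dl + X) / 4]mulrC.
rewrite !mulrDl !mul1r !mulrDr mulr1 -[4^-1 / dl * _]mulrA.
rewrite (_ : dl / 4 * V = dl * V / 4); last by ring.
move: h1 h2 h3 h4 dl0 HH0 MM0; move: (dl^-1 * HH) (dl^-1 * MM) (dl^-1 * _) (dl * V) => a1 a2 a3 a4.
move: HH MM => hh mm; lra.
Qed.

End swap.

(** * The particle system *)

Section signed_series.
Context {R : realType} d (T : measurableType d).
Variables (mu : {measure set T -> \bar R}) (D : set T) (mD : measurable D).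
Variable g : nat -> T -> R.
Hypothesis mg : forall j, measurable_fun setT (g j).

(* The difference of the two sums equals the integral against the point configuration
   unconditionally, junk values of [fine] included. *)
Definition signed_sum (x : T) : R :=
  fine (\sum_(j <oo) (EFin \o g j)^\+ x - \sum_(j <oo) (EFin \o g j)^\- x)%E.

Let mEg j : measurable_fun setT (EFin \o g j). Proof. exact/measurable_EFinP. Qed.

Lemma meas_signed_sum : measurable_fun setT signed_sum.
Proof.
apply: (measurableT_comp (fine_measurable measurableT)); apply: emeasurable_funB.
- by apply: ge0_emeasurable_sum => j // _; apply: measurable_funepos.
- by apply: ge0_emeasurable_sum => j // _; apply: measurable_funeneg.
Qed.

Let S x : \bar R := (\sum_(j <oo) `|g j x|%:E)%E.

Let S0 x : (0 <= S x)%E. Proof. by apply: nneseries_ge0 => j _ _; rewrite lee_fin. Qed.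

Let mS : measurable_fun setT S.
Proof.
apply: ge0_emeasurable_sum => [j x _ _|j _]; first by rewrite lee_fin.
by apply/measurable_EFinP; apply: measurableT_comp.
Qed.

Lemma signed_sum_cvg x : S x \is a fin_num -> \sum_(j < N) g j x @[N --> \oo] --> signed_sum x.
Proof.
move=> Sx.
have le (h : nat -> \bar R) : (forall j, (0 <= h j <= `|g j x|%:E)%E) -> (\sum_(j <oo) h j)%E \is a fin_num.
  move=> h0; have h1 : (\sum_(j <oo) h j <= S x)%E by apply: lee_nneseries => j _; have /andP[] := h0 j.
  rewrite ge0_fin_numE; last by apply: nneseries_ge0 => j _ _; have /andP[] := h0 j.
  by apply: le_lt_trans h1 _; rewrite -ge0_fin_numE.
have p0 j : (0 <= (EFin \o g j)^\+ x <= `|g j x|%:E)%E.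
  by rewrite funepos_ge0/= funeposE/= ge_max lee_fin ler_norm lee_fin normr_ge0.
have n0 j : (0 <= (EFin \o g j)^\- x <= `|g j x|%:E)%E.
  by rewrite funeneg_ge0/= funenegE/= ge_max lee_fin -normrN ler_norm lee_fin normr_ge0.
have fp := le _ p0; have fn := le _ n0.
have c : ((\sum_(j < N) (EFin \o g j)^\+ x - \sum_(j < N) (EFin \o g j)^\- x)%E @[N --> \oo] -->
   (\sum_(j <oo) (EFin \o g j)^\+ x - \sum_(j <oo) (EFin \o g j)^\- x)%E).
  apply: cvgeB.
  - by rewrite fin_num_adde_defl// fin_numN.
  - by apply: nneseries_cvg => j; have /andP[] := p0 j.
  - by apply: nneseries_cvg => j; have /andP[] := n0 j.
apply: (@fine_cvg _ _ _ _ (fun N => (\sum_(j < N) g j x)%:E)); rewrite /signed_sum fineK; last by rewrite fin_numB fp fn.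
apply: cvg_trans c; apply: near_eq_cvg; apply: nearW => N.
have pf j : ((EFin \o g j)^\+ x)%E \is a fin_num.
  by have /andP[h1 h2] := p0 j; rewrite ge0_fin_numE//; apply: le_lt_trans h2 _; rewrite ltry.
have nf j : ((EFin \o g j)^\- x)%E \is a fin_num.
  by have /andP[h1 h2] := n0 j; rewrite ge0_fin_numE//; apply: le_lt_trans h2 _; rewrite ltry.
elim: N => [|N IH]; first by rewrite !big_ord0 sube0.
rewrite !big_ord_recr/= EFinD -IH.
have -> : (g N x)%:E = ((EFin \o g N)^\+ x - (EFin \o g N)^\- x)%E.
  by rewrite -[LHS]/((EFin \o g N) x) [in LHS](funeposneg (EFin \o g N)).
have f1 : (\sum_(j < N) (EFin \o g j)^\+ x)%E \is a fin_num by apply/sum_fin_numP.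
have f2 : (\sum_(j < N) (EFin \o g j)^\- x)%E \is a fin_num by apply/sum_fin_numP.
have [f3 f4] := (pf N, nf N).
rewrite -(fineK f1) -(fineK f2) -(fineK f3) -(fineK f4).
set u := fine _; set u1 := fine _; set u2 := fine _; set u3 := fine _.
by rewrite -[LHS]/((u + u1 - (u2 + u3))%:E) -[RHS]/((u - u2 + (u1 - u3))%:E); congr EFin; ring.
Qed.

Hypothesis fin : (\sum_(j <oo) \int[mu]_(x in D) `|g j x|%:E < +oo)%E.

Let iS : mu.-integrable D S.
Proof.
apply/integrableP; split; first exact: (measurable_funS measurableT).
under eq_integral do rewrite gee0_abs//.
rewrite integral_nneseries//.
by move=> j; apply/measurable_EFinP; apply: (measurable_funS measurableT) => //; apply: measurableT_comp.
Qed.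

Lemma signed_sum_ae : {ae mu, forall x, D x -> \sum_(j < N) g j x @[N --> \oo] --> signed_sum x}.
Proof.
by apply: filterS (integrable_ae mD iS) => x fx Dx; apply: signed_sum_cvg; exact: fx.
Qed.

Lemma int_signed_sum : 
  \int[mu]_(x in D) \sum_(j < N) g j x @[N --> \oo] --> \int[mu]_(x in D) signed_sum x.
Proof.
have [|||||i1 _ i2] := @dominated_convergence _ _ _ mu D mD
  (fun N x => (\sum_(j < N) g j x)%:E) (EFin \o signed_sum) S.
- by move=> n; apply/measurable_EFinP; apply: (measurable_funS measurableT) => //; exact: measurable_sum.
- by apply/measurable_EFinP; apply: (measurable_funS measurableT) => //; exact: meas_signed_sum.
- by apply: filterS signed_sum_ae => x fx Dx; apply: cvg_EFin; [exact: nearW|exact: fx].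
- exact: iS.
- apply: aeW => x n _ /=; apply: le_trans (sum_le_nneseries n _); last by move=> j; rewrite lee_fin.
  by rewrite sumEFin lee_fin ler_norm_sum.
apply: fine_cvg; rewrite /Rintegral fineK//; exact: integrable_fin_num.
Qed.

End signed_series.

Lemma bracket_mseries {R : realType} d (T : measurableType d) (y : nat -> R) (f : R -> R)
    (g : nat -> T -> R) w : measurable_fun setT f -> (forall j, g j w = f (y j)) ->
  bracket (mseries (fun j => \d_(y j)) 0) f = signed_sum g w.
Proof.
move=> mf gE; rewrite /bracket /Rintegral integralE /signed_sum; congr (fine (_ - _)%E).
- rewrite ge0_integral_measure_series//; last by apply: measurable_funepos; exact/measurable_EFinP.
  apply: eq_eseriesr => j _; rewrite integral_dirac// ?diracT ?mul1e//; first by rewrite !funeposE/= gE.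
  by apply: measurable_funepos; exact/measurable_EFinP.
- rewrite ge0_integral_measure_series//; last by apply: measurable_funeneg; exact/measurable_EFinP.
  apply: eq_eseriesr => j _; rewrite integral_dirac// ?diracT ?mul1e//; first by rewrite !funenegE/= gE.
  by apply: measurable_funeneg; exact/measurable_EFinP.
Qed.

Section particles.
Context {R : realType} (alpha : R).
Local Notation leb := (@lebesgue_measure R).
Context d (Om : measurableType d) (P : probability Om R).
Variables (x : nat -> {RV P >-> R}) (xi : nat -> R -> {RV P >-> R}).
Hypothesis sys : stable_particle_system alpha x xi.

Let prm : poisson_random_measure P leb (fun w => mseries (fun i => \d_(x i w)) 0).
Proof. by case: sys. Qed.
Let hxi i : std_symmetric_stable_levy alpha (xi i). Proof. by case: sys. Qed.
Let mx j : measurable_fun setT (x j). Proof. exact: measurable_funP. Qed.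

Let F (o : option nat) : set (set Om) :=
  match o with
  | None => sigma_gen setT (fun i => x i : Om -> R)
  | Some i => sigma_gen [set t : R | 0 <= t] (fun t => xi i t : Om -> R)
  end.

(** Generators of all that is kept fixed in the n-th exchange: the initial positions of all
    particles and the trajectories of index below [n]. *)
Definition past (n : nat) : set (set Om) :=
  \bigcup_(o in [set o : option nat | if o is Some i then (i < n)%N else true]) F o.

Definition trajectory (n : nat) : set (set Om) :=
  \bigcup_(t in [set t : R | 0 <= t]) preimage_set_system setT (xi n t : Om -> R) measurable.

Let mF o : F o `<=` measurable.
Proof. by case: o => [i|] /=; apply: sigma_gen_meas => t _; exact: measurable_funP. Qed.

Lemma past_meas n : past n `<=` measurable.
Proof. by move=> A [a _ FA]; exact: (mF (o := a)). Qed.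

Lemma trajectory_meas n : trajectory n `<=` measurable.
Proof.
move=> A [t _ [B mB <-]]; rewrite setTI; have := measurable_funP (xi n t) measurableT _ mB.
by rewrite setTI.
Qed.

Lemma indep_past_trajectory n :
  indep2 P (id : Om -> g_sigma_algebraType (past n)) (id : Om -> g_sigma_algebraType (trajectory n)).
Proof.
have [_ _ mi] := sys.
apply: (@indep2_sigma _ _ _ P _ F mF _ _ mi [set o : option nat | if o is Some i then (i < n)%N else true] (Some n)) => //.
- by case=> [i|]; exact: sigma_genT.
- by case=> [i|]; exact: sigma_genI.
- by rewrite /= ltnn.
Qed.

Lemma x_past j n : measurable_fun setT (x j : g_sigma_algebraType (past n) -> R).
Proof.
apply: (@measurable_fun_coarser _ _ _ _ (\bigcup_(i in setT) preimage_set_system setT (x i : Om -> R) measurable)).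
  move=> A hA; apply: sub_sigma_algebra; exists None => //; exact: sub_sigma_algebra.
exact: (@sigma_gen_measurable_fun _ _ nat _ _ setT (fun i => x i : Om -> R) j).
Qed.

Lemma xi_trajectory n t : 0 <= t -> measurable_fun setT (xi n t : g_sigma_algebraType (trajectory n) -> R).
Proof.
move=> t0; exact: (@sigma_gen_measurable_fun _ _ R _ _ [set t : R | 0 <= t] (fun t => xi n t : Om -> R) t).
Qed.

Lemma xi_past j n t : (j < n)%N -> 0 <= t -> measurable_fun setT (xi j t : g_sigma_algebraType (past n) -> R).
Proof.
move=> jn t0.
apply: (@measurable_fun_coarser _ _ _ _ (trajectory j)); last exact: xi_trajectory.
by move=> A hA; apply: sub_sigma_algebra; exists (Some j) => //; exact: sub_sigma_algebra.
Qed.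

(** Joint measurability uses only the values at nonnegative times and right-continuity, so it holds
    relative to any [G] for which these values are measurable. *)
Lemma jm_xi j (G : set (set Om)) : 
  (forall t, 0 <= t -> measurable_fun setT (xi j t : g_sigma_algebraType G -> R)) ->
  measurable_fun setT (fun p : R * g_sigma_algebraType G => xi j `|p.1| p.2).
Proof.
move=> mG; have h := @joint_meas R _ (g_sigma_algebraType G) (fun t w => xi j t w) mG.
apply: h => w t t0; by have [[_ _ _ cad] _] := hxi j; have [] := cad w t t0.
Qed.

Lemma bdm_occ_gen j (G : set (set Om)) (U : probability (measurableTypeR R) R) (f : R -> R) : bdm f ->
  (forall t, 0 <= t -> measurable_fun setT (xi j t : g_sigma_algebraType G -> R)) ->
  bdm (fun p : R * g_sigma_algebraType G => occ U f (xi j) p.1 p.2).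
Proof.
move=> bf mG.
apply: (@bdm_Rint2 _ _ _ _ _ U (fun q : (R * g_sigma_algebraType G) * measurableTypeR R =>
  (0 <= q.2)%R%:R * f (q.1.1 + xi j `|q.2| q.1.2))).
apply: bdmM; first by apply: bdm_le => //; exact: measurable_snd.
apply: (bdm_comp bf); apply: measurable_funD.
  exact: (measurableT_comp measurable_fst measurable_fst).
have m2 : measurable_fun setT (fun q : (R * g_sigma_algebraType G) * measurableTypeR R => (q.2 : R, q.1.2)).
  by apply: measurable_fun_pair; [exact: measurable_snd|exact: (measurableT_comp measurable_snd measurable_fst)].
have h := measurableT_comp (jm_xi mG) m2; exact: h.
Qed.

Lemma move_mean j (k : R -> Om -> R) :
  bdm (fun p : R * g_sigma_algebraType (trajectory j) => k p.1 p.2) ->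
  \int[P]_w k (x j w) w = \int[P]_w1 \int[P]_w2 k (x j w1) w2.
Proof.
move=> bk.
have bF : bdm (fun p : g_sigma_algebraType (past j) * g_sigma_algebraType (trajectory j) => k (x j p.1) p.2).
  apply: (bdm_comp bk (g := fun p : g_sigma_algebraType (past j) * g_sigma_algebraType (trajectory j) => (x j p.1, p.2))).
  apply: measurable_fun_pair; last exact: measurable_snd.
  by have h := measurableT_comp (@x_past j j) (@measurable_fst _ _ _ (g_sigma_algebraType (trajectory j))); exact: h.
exact: (indep2_bdm (measurable_fun_gen_id (@past_meas j)) (measurable_fun_gen_id (@trajectory_meas j)) (@indep_past_trajectory j) bF).
Qed.

Lemma bdm_move j (k : R -> Om -> R) :
  bdm (fun p : R * g_sigma_algebraType (trajectory j) => k p.1 p.2) -> bdm (fun w => k (x j w) w).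
Proof.
move=> bk.
have m2 : measurable_fun setT (fun w : Om => (x j w, w : g_sigma_algebraType (trajectory j))).
  by apply: measurable_fun_pair => //; exact: measurable_fun_gen_id (@trajectory_meas j).
by have h := bdm_comp bk m2; exact: h.
Qed.

(** Campbell's formula for marked points: the trajectory, independent of the starting point, is
    averaged out first. *)
Lemma move_series (k : nat -> R -> Om -> R) (f : R -> R) : integ leb f ->
  (forall j y w, 0 <= k j y w) ->
  (forall j, bdm (fun p : R * g_sigma_algebraType (trajectory j) => k j p.1 p.2)) ->
  (forall j y, \int[P]_w k j y w = f y) ->
  (\sum_(j <oo) \int[P]_w (k j (x j w) w)%:E = (\int[leb]_y f y)%:E)%E.
Proof.
move=> if_ k0 bk kf.
have f0 y : 0 <= f y by rewrite -(kf 0); apply: Rintegral_ge0 => w _.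
have mf : measurable_fun setT (EFin \o f) by apply/measurable_EFinP; exact: integ_meas if_.
have C := campbell1 mx prm mf (fun y => f0 y).
rewrite -(Rint_EFin if_) -C; apply: eq_eseriesr => j _.
have ik : integ P (fun w => k j (x j w) w) by apply: bdm_integ; exact: bdm_move.
rewrite (Rint_EFin ik) move_mean//.
have [ifx _] := campbell_cvg mx prm if_.
transitivity ((\int[P]_w f (x j w))%:E); last by rewrite -(Rint_EFin (ifx j)).
by congr EFin; apply: eq_Rint => w; rewrite kf.
Qed.

End particles.

Lemma meas_Rint_section {R : realType} d (W : measurableType d) (D : set R) (G : W * measurableTypeR R -> R) :
  measurable D -> measurable_fun setT G ->
  measurable_fun setT (fun w => \int[@lebesgue_measure R]_(s in D) G (w, s)).
Proof.
move=> mD mG.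
have h (g : W * measurableTypeR R -> \bar R) : measurable_fun setT g -> (forall p, (0 <= g p)%E) ->
    measurable_fun setT (fun w => (\int[@lebesgue_measure R]_(s in D) g (w, s))%E).
  move=> mg g0.
  have mg1 : measurable_fun setT (fun p : W * measurableTypeR R => (g p * (\1_D p.2 : R)%:E)%E).
    apply: emeasurable_funM => //; apply/measurable_EFinP.
    exact: (measurableT_comp (measurable_indic mD) measurable_snd).
  have := measurable_fun_fubini_tonelli_F (m2 := @lebesgue_measure R) _ mg1.
  rewrite (_ : fubini_F _ _ = (fun w => (\int[@lebesgue_measure R]_(s in D) g (w, s))%E)); last first.
    by apply/funext => w; rewrite /fubini_F/= [RHS]integral_mkcond epatch_indic.
  by apply => p; rewrite mule_ge0// lee_fin.
rewrite (_ : (fun w => _) = (fun w => fine (\int[@lebesgue_measure R]_(s in D) (EFin \o G)^\+ (w, s) -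
  \int[@lebesgue_measure R]_(s in D) (EFin \o G)^\- (w, s))%E)); last first.
  apply/funext => w; rewrite /Rintegral integralE; congr (fine (_ - _)%E).
    by apply: eq_integral => s _; rewrite !funeposE.
  by apply: eq_integral => s _; rewrite !funenegE.
have mEG : measurable_fun setT (EFin \o G) by exact/measurable_EFinP.
apply: (measurableT_comp (fine_measurable measurableT)); apply: emeasurable_funB; apply: h.
- exact: measurable_funepos.
- by move=> p; exact: funepos_ge0.
- exact: measurable_funeneg.
- by move=> p; exact: funeneg_ge0.
Qed.

Lemma Rint_psi {R : realType} (u : R) : \int[@lebesgue_measure R]_y psi u y = 0.
Proof.
have [b1 i1] := bint_itv 0 u; have [b2 i2] := bint_itv (- u) 0.
by rewrite RintB// !Rint_itv oppr_lt0 sub0r opprK subr0 subrr.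
Qed.

Section fluctuation.
Context {R : realType} (alpha : R).
Local Notation leb := (@lebesgue_measure R).
Context d (Om : measurableType d) (P : probability Om R).
Variables (x : nat -> {RV P >-> R}) (xi : nat -> R -> {RV P >-> R}).
Hypothesis sys : stable_particle_system alpha x xi.
Local Notation N := (empirical_process x xi).

Let prm : poisson_random_measure P leb (fun w => mseries (fun i => \d_(x i w)) 0).
Proof. by case: sys. Qed.
Let hxi i : std_symmetric_stable_levy alpha (xi i). Proof. by case: sys. Qed.
Let mx j : measurable_fun setT (x j). Proof. exact: measurable_funP. Qed.
Let mxi j s : measurable_fun setT (xi j s). Proof. exact: measurable_funP. Qed.
Let hZ : std_symmetric_stable_levy alpha (xi 0). Proof. exact: hxi. Qed.

Let bpsi u : bdm (psi u : R -> R). Proof. by have [] := bint_psi u. Qed.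
Let ipsi u : integ leb (psi u : R -> R). Proof. by have [] := bint_psi u. Qed.
Let mpsi u : measurable_fun setT (psi u : R -> R). Proof. exact: bdm_meas. Qed.

Lemma bracket_sum s u w :
  bracket (N s w) (psi u) = signed_sum (fun j w => psi u (x j w + xi j s w)) w.
Proof. by rewrite /empirical_process (@bracket_mseries _ _ _ _ _ (fun j w => psi u (x j w + xi j s w)) w). Qed.

Let bmove (f : R -> R) j s : bdm f -> 0 <= s ->
  bdm (fun p : R * g_sigma_algebraType (trajectory xi j) => f (p.1 + xi j s p.2)).
Proof.
move=> bf s0; apply: (bdm_comp bf); apply: measurable_funD => //.
have h := measurableT_comp (@xi_trajectory _ _ _ _ xi j s s0) (@measurable_snd _ _ R _); exact: h.
Qed.

Let ptE (f : R -> R) j s y : bdm f -> 0 <= s ->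
  \int[P]_w f (y + xi j s w) = \int[P]_w f (y + xi 0 s w).
Proof.
move=> bf s0.
apply: (same_law_bdm (mxi j s) (mxi 0 s) (stable_same_law (hxi j) (hxi 0) s0) (f := fun v => f (y + v))).
by apply: (bdm_comp bf); exact: measurable_funD.
Qed.

(** Campbell's formula and translation invariance reduce the expectation to the integral of [psi u],
    which is 0: the centring in [occupation_fluctuation] vanishes. *)
Lemma mean_bracket s u : 0 <= s ->
  fine 'E_P[fun w => bracket (N s w) (psi u)] = 0.
Proof.
move=> s0.
pose g j w := psi u (x j w + xi j s w).
have mg j : measurable_fun setT (g j) by apply: (measurableT_comp (mpsi u)); exact: measurable_funD.
have -> : fine 'E_P[fun w => bracket (N s w) (psi u)] = \int[P]_w signed_sum g w.
  by rewrite unlock /Rintegral; congr fine; apply: eq_integral => w _; rewrite bracket_sum.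
have bapsi : bdm (fun y : R => `|psi u y|) by exact: bdm_norm.
have iapsi : integ leb (fun y : R => `|psi u y|) by exact: integ_abs.
have fin : (\sum_(j <oo) \int[P]_(w in setT) `|g j w|%:E < +oo)%E.
  rewrite (move_series sys (k := fun j y w => `|psi u (y + xi j s w)|) (f := fun y => \int[P]_w `|psi u (y + xi 0 s w)|)).
  - exact: ltry.
  - exact: (integ_E_shift P (mxi 0 s) (conj bapsi iapsi)).
  - by [].
  - by move=> j; exact: (bmove j bapsi s0).
  - by move=> j y; exact: (ptE j y bapsi s0).
have c1 := int_signed_sum measurableT mg fin.
have ipt : integ leb (fun y => \int[P]_w psi u (y + xi 0 s w)).
  exact: (integ_E_shift P (mxi 0 s) (bint_psi u)).
have [_ c2] := campbell_cvg mx prm ipt.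
rewrite (int_E_shift P (mxi 0 s) (ipsi u)) Rint_psi in c2.
suff e : (fun n => \int[P]_w \sum_(j < n) g j w) = (fun n => \sum_(j < n) \int[P]_w \int[P]_w' psi u (x j w + xi 0 s w')).
  rewrite e in c1; by rewrite -(cvg_lim _ c1)// (cvg_lim _ c2).
apply/funext => n; rewrite Rint_sum; last first.
  move=> j; apply: bdm_integ; apply: (bdm_comp (bpsi u)); exact: measurable_funD.
apply: eq_bigr => j _.
rewrite (move_mean sys (k := fun y w => psi u (y + xi j s w)) (bmove j (bpsi u) s0)).
by apply: eq_Rint => w; exact: ptE.
Qed.

Context (n : nat) (t b : 'I_n -> R) (T : R) (T0 : 0 < T).
Hypothesis t0 : forall i, 0 <= t i.
Local Notation U := (uniform_prob T0 : probability (measurableTypeR R) R).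
Local Notation Y i := (fun w => occupation_fluctuation P N T (psi (t i)) w).

Lemma fluctE u w : occupation_fluctuation P N T (psi u) w =
  (Num.sqrt T)^-1 * \int[leb]_(s in `[0, T]) signed_sum (fun j (s : measurableTypeR R) => psi u (x j w + xi j `|s| w)) s.
Proof.
rewrite /occupation_fluctuation; congr (_ * _).
rewrite (_ : \int[leb]_(s in `[0, T]) fine 'E_P[fun w' => bracket (N s w') (psi u)] = 0); last first.
  transitivity (\int[leb]_(s in `[0, T]) (0 : R)); last by rewrite Rintegral_cst//= mul0r.
  apply: eq_Rintegral => s; rewrite inE/= in_itv/= => /andP[s0 _]; exact: mean_bracket.
rewrite subr0; apply: eq_Rintegral => s; rewrite inE/= in_itv/= => /andP[s0 _].
by apply: bracket_mseries => // j; rewrite ger0_norm.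
Qed.

Let jxi j : measurable_fun setT (fun p : R * Om => xi j `|p.1| p.2).
Proof.
have h := @joint_meas R _ Om (fun t w => xi j t w) (fun t _ => mxi j t).
apply: h => w v v0; by have [[_ _ _ cad] _] := hxi j; have [] := cad w v v0.
Qed.

Lemma meas_fluct u : measurable_fun setT (occupation_fluctuation P N T (psi u)).
Proof.
rewrite (_ : occupation_fluctuation _ _ _ _ = fun w => (Num.sqrt T)^-1 * \int[leb]_(s in `[0, T])
   signed_sum (fun j (p : Om * measurableTypeR R) => psi u (x j p.1 + xi j `|p.2| p.1)) (w, s)); last first.
  apply/funext => w; rewrite fluctE; congr (_ * _); apply: eq_Rintegral => s _.
  rewrite /signed_sum; congr (fine (_ - _)%E).
    by apply: eq_eseriesr => j _; rewrite !funeposE.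
  by apply: eq_eseriesr => j _; rewrite !funenegE.
apply: measurable_funM => //; apply: meas_Rint_section => //; apply: meas_signed_sum => j.
apply: (measurableT_comp (mpsi u)); apply: measurable_funD.
  exact: (measurableT_comp (mx j) measurable_fst).
have m2 : measurable_fun setT (fun p : Om * measurableTypeR R => (p.2 : R, p.1)).
  by apply: measurable_fun_pair; [exact: measurable_snd|exact: measurable_fst].
exact: (measurableT_comp (jxi j) m2).
Qed.

Let f (y : R) := \sum_i `|psi (t i) y|.
Let bf : bdm f. Proof. by apply: bdm_sum => i; exact: bdm_norm. Qed.
Let if_ : integ leb f. Proof. by apply: integ_sum => i; exact: integ_abs. Qed.
Let f0 y : 0 <= f y. Proof. by apply: sumr_ge0. Qed.

Let bsec (h : R -> R) j w : bdm h -> bdm (fun s : measurableTypeR R => h (x j w + xi j `|s| w)).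
Proof.
move=> bh; apply: (bdm_comp bh); apply: measurable_funD => //.
exact: (measurableT_comp (jxi j) (measurable_pair2 w)).
Qed.

Let occE (h : R -> R) j w : bdm h ->
  occ U h (xi j) (x j w) w = T^-1 * \int[leb]_(s in `[0, T]) h (x j w + xi j `|s| w).
Proof. by move=> bh; rewrite /occ unif_nn ?unif_Rint//; exact: bsec. Qed.

(** Almost surely all particles together spend a finite time in the supports of the test functions;
    this justifies exchanging the sum over particles with the integral over time. *)
Let fin_ae : {ae P, forall w, (\sum_(j <oo) (occ U f (xi j) (x j w) w)%:E < +oo)%E}.
Proof.
have o0 j y w : 0 <= occ U f (xi j) y w.
  by apply: Rintegral_ge0 => s _; rewrite mulr_ge0.
have bo j := bdm_occ_gen sys U bf (fun v v0 => @xi_trajectory _ _ _ _ xi j v v0).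
have bw j := bdm_move x (bo j).
pose m y := \int[P]_w occ U f (xi 0) y w.
have im : integ leb m.
  pose Q : probability _ R := (U \x P)%E.
  have mV : measurable_fun setT (fun p : measurableTypeR R * Om => xi 0 `|p.1| p.2) by exact: jxi.
  have := integ_E_shift Q mV (conj bf if_).
  rewrite (_ : (fun y => _) = m); first by [].
  apply/funext => y; rewrite /m (occ_mean hZ hZ _ (conj bf if_)) unif_nn; last first.
    by apply: (bdm_pt hZ) => //; exact: measurable_cst.
  have bb : bdm (fun p : measurableTypeR R * Om => f (y + xi 0 `|p.1| p.2)).
    by apply: (bdm_comp bf); exact: measurable_funD.
  by have /= <- := Rfubini1 (bdm_integ_prod U P bb).
have om j y : \int[P]_w occ U f (xi j) y w = m y.
  by rewrite /m (occ_mean (hxi j) hZ U (conj bf if_)) (occ_mean hZ hZ U (conj bf if_)).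
have E := move_series sys (k := fun j y w => occ U f (xi j) y w) im o0 bo om.
have fin : (\sum_(j <oo) \int[P]_w (occ U f (xi j) (x j w) w)%:E < +oo)%E by rewrite E ltry.
have mo j : measurable_fun setT (fun w => (occ U f (xi j) (x j w) w)%:E).
  by apply/measurable_EFinP; exact: bdm_meas (bw j).
have iS : P.-integrable setT (fun w => \sum_(j <oo) (occ U f (xi j) (x j w) w)%:E)%E.
  apply/integrableP; split.
    by apply: ge0_emeasurable_sum => [j w _ _|j _]; [rewrite lee_fin|exact: mo].
  have S0 w : (0 <= \sum_(j <oo) (occ U f (xi j) (x j w) w)%:E)%E.
    by apply: nneseries_ge0 => j _ _; rewrite lee_fin.
  under eq_integral do rewrite gee0_abs//.
  by rewrite integral_nneseries// => j w _; rewrite lee_fin.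
apply: filterS (integrable_ae measurableT iS) => w /(_ I).
by rewrite ge0_fin_numE// nneseries_ge0// => j _ _; rewrite lee_fin.
Qed.

Lemma fluct_ae : {ae P, forall w,
  \sum_(j < k) Num.sqrt T * occT (xi j) t b T0 (x j w) w @[k --> \oo] --> \sum_i b i * Y i w}.
Proof.
apply: filterS fin_ae => w fw.
have c i : \int[leb]_(s in `[0, T]) \sum_(j < k) psi (t i) (x j w + xi j `|s| w) @[k --> \oo] -->
    \int[leb]_(s in `[0, T]) signed_sum (fun j (s : measurableTypeR R) => psi (t i) (x j w + xi j `|s| w)) s.
  apply: int_signed_sum => //.
    by move=> j; exact: bdm_meas (bsec j w (bpsi (t i))).
  apply: (@le_lt_trans _ _ (\sum_(j <oo) (T * occ U f (xi j) (x j w) w)%:E)%E).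
    apply: lee_nneseries => [j *|j *]; first by apply: integral_ge0 => s _; rewrite lee_fin.
    rewrite occE// mulVKf ?gt_eqF//.
    rewrite /Rintegral fineK; last exact: integrable_fin_num (bdm_integ_itv T0 (bsec j w bf)).
    apply: ge0_le_integral => //.
    + apply/measurable_EFinP; apply: measurable_funS (bdm_meas (bdm_norm (bsec j w (bpsi (t i))))) => //.
    + apply/measurable_EFinP; apply: measurable_funS (bdm_meas (bsec j w bf)) => //.
    + move=> s _; rewrite lee_fin /f (bigD1 i)//= lerDl; exact: sumr_ge0.
  under eq_eseriesr do rewrite EFinM.
  rewrite nneseriesZl//; last by move=> j _; rewrite lee_fin; apply: Rintegral_ge0 => s _; rewrite mulr_ge0.
  by rewrite lte_mul_pinfty// lee_fin ltW.
have e k : \sum_(j < k) Num.sqrt T * occT (xi j) t b T0 (x j w) w =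
   \sum_i b i * ((Num.sqrt T)^-1 * \int[leb]_(s in `[0, T]) \sum_(j < k) psi (t i) (x j w + xi j `|s| w)).
  (* [occT] is a time average; the factor sqrt T in front of it restores the normalisation of the
     time integral by 1 / sqrt T. *)
  have sT : (Num.sqrt T)^-1 = Num.sqrt T / T.
    by rewrite -[T in _ / T]sqr_sqrtr ?ltW// expr2 invfM mulVKf// gt_eqF// sqrtr_gt0.
  have occI i j : integ U (fun s => psi (t i) (x j w + xi j `|s| w)).
    by apply: bdm_integ; exact: bsec.
  transitivity (\sum_(j < k) \sum_i b i * (Num.sqrt T * \int[U]_s psi (t i) (x j w + xi j `|s| w))).
    apply: eq_bigr => j _; rewrite /occT /occ unif_nn; last exact: (bsec j w (proj1 (bint_phis t b))).
    rewrite /phis Rint_sum; last by move=> i; exact: integZ.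
    by rewrite mulr_sumr; apply: eq_bigr => i _; rewrite RintZ// mulrCA.
  rewrite exchange_big/=; apply: eq_bigr => i _; rewrite -mulr_sumr -mulr_sumr; congr (_ * _).
  rewrite sT -mulrA -(unif_Rint T0); last by apply: bdm_sum => j; exact: bsec.
  by rewrite Rint_sum.
rewrite (_ : (fun k => _) = (fun k => \sum_i b i * ((Num.sqrt T)^-1 * \int[leb]_(s in `[0, T]) \sum_(j < k) psi (t i) (x j w + xi j `|s| w)))); last by apply/funext.
apply: cvg_big => [|i _]; first exact: add_continuous.
rewrite fluctE; apply: cvgMr; apply: cvgMr; exact: c.
Qed.

End fluctuation.

Section fluctuation_limit.
Context {R : realType} (alpha : R).
Hypotheses (alpha_gt1 : 1 < alpha) (alpha_le2 : alpha <= 2).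
Local Notation leb := (@lebesgue_measure R).
Context d (Om : measurableType d) (P : probability Om R).
Variables (x : nat -> {RV P >-> R}) (xi : nat -> R -> {RV P >-> R}).
Hypothesis sys : stable_particle_system alpha x xi.
Local Notation N := (empirical_process x xi).
Context (n : nat) (t b : 'I_n -> R).
Hypothesis t0 : forall i, 0 <= t i.
Local Notation Y T := (fun w => \sum_i b i * occupation_fluctuation P N T (psi (t i)) w).

Let prm : poisson_random_measure P leb (fun w => mseries (fun i => \d_(x i w)) 0).
Proof. by case: sys. Qed.
Let hxi i : std_symmetric_stable_levy alpha (xi i). Proof. by case: sys. Qed.

Section fixed_horizon.
Context (T : R) (T0 : 0 < T).
Local Notation U := (uniform_prob T0 : probability (measurableTypeR R) R).
Local Notation occj j := (occT (xi j) t b T0).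

Let h j y w := Num.sqrt T * occj j y w.
Let bocc j G (mG : forall s, 0 <= s -> measurable_fun setT (xi j s : g_sigma_algebraType G -> R)) :
  bdm (fun p : R * g_sigma_algebraType G => h j p.1 p.2).
Proof.
apply: bdmM; first exact: bdm_cst.
exact: (bdm_occ_gen sys U (proj1 (bint_phis t b)) mG).
Qed.

Let bh2 j : bdm (fun p : R * g_sigma_algebraType (trajectory xi j) => h j p.1 p.2).
Proof. by apply: bocc => s s0; exact: xi_trajectory. Qed.

Let bho j y : bdm (occj j y).
Proof.
have b2 : bdm (fun p : R * g_sigma_algebraType (trajectory xi j) => occj j p.1 p.2).
  apply: (bdm_occ_gen sys U (proj1 (bint_phis t b))) => s s0; exact: xi_trajectory.
have m2 : measurable_fun setT (fun w : Om => (y, w : g_sigma_algebraType (trajectory xi j))).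
  by apply: measurable_fun_pair => //; exact: measurable_fun_gen_id (@trajectory_meas _ _ _ _ xi j).
by have e := bdm_comp b2 m2; exact: e.
Qed.

Let sT : Num.sqrt T ^+ 2 = T. Proof. by rewrite sqr_sqrtr// ltW. Qed.
Let sT4 : Num.sqrt T ^+ 4 = T ^+ 2. Proof. by rewrite -[4%N]/(2 * 2)%N exprM sT. Qed.

(** Particle 0 serves as reference: the moments of all particles agree with its own. *)
Let m y := Num.sqrt T * \int[P]_w occj 0 y w.
Let v y := T * \int[P]_w occj 0 y w ^+ 2.
Let H4 y := T ^+ 2 * \int[P]_w occj 0 y w ^+ 4.

Let hm j y : \int[P]_w h j y w = m y.
Proof.
rewrite /h RintZ; last exact: bdm_integ.
by rewrite (occT_mean (hxi j) (hxi 0) t b T0) -(occT_mean (hxi 0) (hxi 0) t b T0).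
Qed.

Let hv j y : \int[P]_w h j y w ^+ 2 = v y.
Proof.
rewrite (eq_Rint P (fun w => T * occj j y w ^+ 2)); last by move=> w; rewrite exprMn sT.
rewrite RintZ; last by apply: bdm_integ; exact: bdmX.
have bp := bint_phis t b.
have e1 := @occ_sqr_law R alpha d Om P (xi j) (xi 0) (hxi j) (hxi 0) U (phis t b) bp y.
have e2 := @occ_sqr_law R alpha d Om P (xi 0) (xi 0) (hxi 0) (hxi 0) U (phis t b) bp y.
by rewrite /v /occT e1 e2.
Qed.

Let hH j y : \int[P]_w h j y w ^+ 4 = H4 y.
Proof.
rewrite (eq_Rint P (fun w => T ^+ 2 * occj j y w ^+ 4)); last by move=> w; rewrite exprMn sT4.
rewrite RintZ; last by apply: bdm_integ; exact: bdmX.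
have bp := bint_phis t b; have at0 := unif_atomless T0.
have e1 := @occ_pow4_law R alpha d Om P (xi j) (xi 0) (hxi j) (hxi 0) U at0 (phis t b) bp y.
have e2 := @occ_pow4_law R alpha d Om P (xi 0) (xi 0) (hxi 0) (hxi 0) U at0 (phis t b) bp y.
by rewrite /H4 /occT e1 e2.
Qed.

Let im : integ leb m.
Proof. by apply: integZ; have [] := bint_occT_mean (hxi 0) (hxi 0) t b T0. Qed.
Let iv : integ leb v.
Proof. by apply: integZ; have [] := int_occT_sqr (hxi 0) (hxi 0) b t0 T0. Qed.
Let iH : integ leb H4.
Proof. by apply: integZ; have [] := int_occT_pow4 alpha_gt1 alpha_le2 (hxi 0) (hxi 0) b t0 T0. Qed.

Let m0 : \int[leb]_y m y = 0.
Proof.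
rewrite RintZ; first by rewrite (int_occT_mean (hxi 0) (hxi 0) t b T0) mulr0.
by have [] := bint_occT_mean (hxi 0) (hxi 0) t b T0.
Qed.

Let cY th : \int[P]_w cos (th + \sum_(j < k) h j (x j w) w) @[k --> \oo] --> \int[P]_w cos (th + Y T w).
Proof.
apply: (@dct _ _ _ P (fun k w => cos (th + \sum_(j < k) h j (x j w) w)) _ (fun=> 1)).
- move=> k; apply: bdm_meas; apply: bdm_cos; apply: measurable_funD => //.
  apply: bdm_meas; apply: bdm_sum => j; exact: (bdm_move x (bh2 j)).
- apply: bdm_meas; apply: bdm_cos; apply: measurable_funD => //; apply: measurable_sum => i.
  by apply: measurable_funM => //; exact: (meas_fluct sys).
- apply: filterS (fluct_ae sys t b T0) => w hw.
  have c : th + \sum_(j < k) h j (x j w) w @[k --> \oo] --> th + Y T w.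
    by apply: cvgD; [exact: cvg_cst|exact: hw].
  exact: (cvg_comp _ _ c (@continuous_cos R _)).
- by apply: bdm_integ; exact: bdm_cst.
- by move=> k w; rewrite ler_norml cos_le1 cos_geN1.
Qed.

Lemma fluct_cos_bound dl th : 0 < dl ->
  `|\int[P]_w cos (th + Y T w) -
     cos th * expR (- ((T * \int[leb]_y \int[P]_w occj 0 y w ^+ 2) / 2))| <=
  (1 + dl^-1) * (T ^+ 2 * \int[leb]_y \int[P]_w occj 0 y w ^+ 4 +
                 T * \int[leb]_y (\int[P]_w occj 0 y w) ^+ 2) +
  dl * (1 + T * \int[leb]_y \int[P]_w occj 0 y w ^+ 2).
Proof.
move=> dl0.
have H := @swap_bound R _ Om P (past x xi) (trajectory xi) (@past_meas _ _ _ _ x xi) (@trajectory_meas _ _ _ _ xi)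
  (indep_past_trajectory sys) (fun j => x j) h (@x_past _ _ _ _ x xi)
  (fun j k jk => bocc (fun s s0 => xi_past jk s0)) bh2 m v H4 hm hv hH dl th dl0 prm im iv iH m0 _ (@cY th).
have e1 : \int[leb]_y v y = T * \int[leb]_y \int[P]_w occj 0 y w ^+ 2.
  by rewrite RintZ//; have [] := int_occT_sqr (hxi 0) (hxi 0) b t0 T0.
have e2 : \int[leb]_y H4 y = T ^+ 2 * \int[leb]_y \int[P]_w occj 0 y w ^+ 4.
  by rewrite RintZ//; have [] := int_occT_pow4 alpha_gt1 alpha_le2 (hxi 0) (hxi 0) b t0 T0.
have e3 : \int[leb]_y m y ^+ 2 = T * \int[leb]_y (\int[P]_w occj 0 y w) ^+ 2.
  transitivity (\int[leb]_y (T * (\int[P]_w occj 0 y w) ^+ 2)).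
    by apply: eq_Rint => y; rewrite /m exprMn sT.
  have [[mb [M hM]] ib] := bint_occT_mean (hxi 0) (hxi 0) t b T0.
  rewrite RintZ//; apply: (integ_le _ (integZ M (integ_abs ib))).
    exact: measurable_funX.
  by move=> y; rewrite expr2 normrM ler_wpM2r.
by rewrite -e1 -e2 -e3.
Qed.

End fixed_horizon.

Variables (T : nat -> R) (T0 : forall k, 0 < T k).
Hypothesis Toy : T k @[k --> \oo] --> +oo.

Lemma fluct_cos_cvg th :
  \int[P]_w cos (th + Y (T k) w) @[k --> \oo] --> cos th * expR (- (sig2 alpha t b / 2)).
Proof.
set s := sig2 alpha t b.
pose V k := T k * \int[leb]_y \int[P]_w occT (xi 0) t b (T0 k) y w ^+ 2.
pose A k := T k ^+ 2 * \int[leb]_y \int[P]_w occT (xi 0) t b (T0 k) y w ^+ 4.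
pose B k := T k * \int[leb]_y (\int[P]_w occT (xi 0) t b (T0 k) y w) ^+ 2.
have cV : V k @[k --> \oo] --> s := @occ_var_cvg R alpha alpha_gt1 alpha_le2 _ _ P (xi 0) (hxi 0) n t b t0 T T0 Toy.
have cA : A k @[k --> \oo] --> 0 := @occ_pow4_cvg R alpha alpha_gt1 alpha_le2 _ _ P (xi 0) (hxi 0) n t b t0 T T0 Toy.
have cB : B k @[k --> \oo] --> 0 := @occ_mean_cvg R alpha alpha_gt1 alpha_le2 _ _ P (xi 0) (hxi 0) n t b t0 T T0 Toy.
have cE : cos th * expR (- (V k / 2)) @[k --> \oo] --> cos th * expR (- (s / 2)).
  have c : - (V k / 2) @[k --> \oo] --> - (s / 2) by apply: cvgN; apply: cvgMl.
  by apply: cvgMr; exact: (cvg_comp _ _ c (@continuous_expR R _)).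
apply/cvgrPdist_le => e e0.
(* [dl] is fixed first, so that dl (1 + s) is small; the terms multiplied by 1/dl then vanish as [k]
   grows. *)
pose dl := e / (4 * (1 + `|s|)).
have s1 : 0 < 1 + `|s| by rewrite ltr_pwDl.
have dl0 : 0 < dl by rewrite divr_gt0// mulr_gt0.
have dls : dl * (1 + s) <= e / 4.
  have -> : e / 4 = dl * (1 + `|s|) by rewrite /dl; field; rewrite gt_eqF.
  by rewrite ler_wpM2l ?(ltW dl0)// lerD2l ler_norm.
have cD : (1 + dl^-1) * (A k + B k) + dl * (1 + V k) @[k --> \oo] --> dl * (1 + s).
  rewrite (_ : dl * (1 + s) = (1 + dl^-1) * (0 + 0) + dl * (1 + s)); last by ring.
  apply: cvgD; apply: cvgMr; apply: cvgD => //; exact: cvg_cst.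
have e4 : 0 < e / 4 by rewrite divr_gt0.
move/cvgrPdist_le : cD => /(_ _ e4); move/cvgrPdist_le : cE => /(_ _ e4).
apply: filterS2 => k h1 h2.
have h3 := fluct_cos_bound (T0 k) th dl0.
rewrite -/(V k) -/(A k) -/(B k) in h3.
move: h1 h2 h3 dls; set X := cos th * _; set X' := cos th * expR (- (V k / 2)).
set Q := (1 + dl^-1) * _ + _; set I := \int[P]_w _; set q := dl * (1 + s).
rewrite !ler_norml => /andP[a1 a2] /andP[b1 b2] /andP[c1 c2] q1.
by apply/andP; split; lra.
Qed.

End fluctuation_limit.

(** * Gaussian laws *)

Lemma Rint_lin3 {R : realType} d (T : measurableType d) (mu : {measure set T -> \bar R})
    (f g h : T -> R) (a b c : R) : integ mu f -> integ mu g -> integ mu h ->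
  \int[mu]_x (a * f x + (b * g x + c * h x)) =
  a * \int[mu]_x f x + (b * \int[mu]_x g x + c * \int[mu]_x h x).
Proof.
move=> i1 i2 i3; rewrite -(RintZ a i1) -(RintZ b i2) -(RintZ c i3).
rewrite -(RintD (integZ b i2) (integZ c i3)) -RintD //; first exact: integZ.
by apply: integD; exact: integZ.
Qed.

Section gaussian_weight.
Context {R : realType}.
Local Notation leb := (@lebesgue_measure R).

(* The second moment of [gw] need not be computed: it cancels in [gaussian_cos],
   which only involves the second moment of the variable. *)
Definition gw (y : R) : R := (Num.sqrt pi)^-1 * gauss_fun y.

Let sp0 : 0 < Num.sqrt (pi : R). Proof. by rewrite sqrtr_gt0 pi_gt0. Qed.

Lemma gw_ge0 y : 0 <= gw y. Proof. by rewrite mulr_ge0 ?gauss_fun_ge0// invr_ge0 ltW. Qed.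

Lemma integ_gauss : integ leb (@gauss_fun R). Proof. exact: integrableT_gauss. Qed.

Lemma Rint_gauss : \int[leb]_y gauss_fun y = Num.sqrt pi.
Proof. by rewrite /Rintegral integralT_gauss. Qed.

Lemma integ_gw : integ leb gw. Proof. exact: integZ integ_gauss. Qed.

Lemma Rint_gw : \int[leb]_y gw y = 1.
Proof. by rewrite RintZ ?Rint_gauss ?mulVf ?gt_eqF//; exact: integ_gauss. Qed.

Let mgw : measurable_fun setT gw. Proof. exact: integ_meas integ_gw. Qed.

Lemma gwN y : gw (- y) = gw y. Proof. by rewrite /gw /gauss_fun sqrrN. Qed.

(** By y^2 <= 2 exp(y^2 / 2), half of the Gaussian exponent absorbs the polynomial. *)
Lemma integ_gw2 : integ leb (fun y => y ^+ 2 * gw y).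
Proof.
have ig : integ leb (fun y => 2 * ((Num.sqrt pi)^-1 * gauss_fun ((Num.sqrt 2)^-1 * y + 0))).
  apply: integZ; apply: integZ; apply: (integ_affine 0 _ integ_gauss).
  by rewrite invr_eq0 gt_eqF// sqrtr_gt0.
apply: (integ_le _ ig); first exact: measurable_funM.
move=> y; have y0 : 0 <= y ^+ 2 * gw y by apply: mulr_ge0; [exact: sqr_ge0|exact: gw_ge0].
rewrite (ger0_norm y0) /gw mulrCA [leRHS]mulrCA; apply: ler_wpM2l.
  by rewrite invr_ge0 ltW.
  rewrite addr0 /gauss_fun exprMn exprVn sqr_sqrtr//.
  have -> : expR (- y ^+ 2) = expR (- (y ^+ 2 / 2)) * expR (- (2^-1 * y ^+ 2)) by rewrite -expRD; congr expR; field.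
  rewrite mulrA ler_wpM2r ?expR_ge0// expRN ler_pdivrMr ?expR_gt0//.
  by have := expR_ge1Dx (y ^+ 2 / 2); lra.
Qed.

Lemma integ_gw1 : integ leb (fun y => y * gw y).
Proof.
apply: (integ_le _ (integD integ_gw integ_gw2)); first exact: measurable_funM.
move=> y; rewrite normrM (ger0_norm (gw_ge0 y)) -[X in _ <= X + _]mul1r -mulrDl ler_wpM2r ?gw_ge0//.
by have := norm_le_sqr y (@ltr01 R); rewrite divr1; have := sqr_ge0 y; lra.
Qed.

Lemma Rint_gw1 : \int[leb]_y (y * gw y) = 0.
Proof. by apply: Rint_odd => [|y]; [exact: integ_gw1|rewrite gwN mulNr]. Qed.

Let mu2 : R := \int[leb]_y (y ^+ 2 * gw y).

Definition gphi (z : R) : R := \int[leb]_y (cos (z * y) * gw y).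

Let mz (z : R) : measurable_fun setT (fun y : R => z * y).
Proof. exact: measurable_funM. Qed.

Lemma integ_bdm_gw (f : R -> R) : bdm f -> integ leb (fun y => f y * gw y).
Proof. by move=> [mf [M hM]]; have h := @integM _ _ _ leb f gw M mf hM integ_gw; exact: h. Qed.

Let icos z : integ leb (fun y => cos (z * y) * gw y).
Proof. by apply: integ_bdm_gw; apply: bdm_cos. Qed.
Let isin z : integ leb (fun y => sin (z * y) * gw y).
Proof. by apply: integ_bdm_gw; apply: bdm_sin. Qed.

Lemma Rint_sin_gw z : \int[leb]_y (sin (z * y) * gw y) = 0.
Proof. by apply: Rint_odd => [|y]; [exact: isin|rewrite gwN mulrN sinN mulNr]. Qed.

Lemma gphi_cos z th : \int[leb]_y (cos (z * y + th) * gw y) = cos th * gphi z.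
Proof.
transitivity (\int[leb]_y (cos th * (cos (z * y) * gw y) - sin th * (sin (z * y) * gw y))).
  by apply: eq_Rint => y; rewrite cosD; ring.
by rewrite RintB ?RintZ ?Rint_sin_gw ?mulr0 ?subr0//; exact: integZ.
Qed.

Lemma gphi_le1 z : `|gphi z| <= 1.
Proof.
rewrite -Rint_gw; apply: Rint_abs_le; [exact: icos|exact: integ_gw|].
move=> y; rewrite normrM (ger0_norm (gw_ge0 y)) ler_piMl ?gw_ge0//.
by rewrite ler_norml cos_le1 cos_geN1.
Qed.

Let s2 : R := Num.sqrt 2.
Let s20 : 0 < s2. Proof. by rewrite sqrtr_gt0. Qed.
Let s22 : s2 ^+ 2 = 2. Proof. by rewrite sqr_sqrtr. Qed.

(* The rotation by 45 degrees preserves the product weight gw x * gw y. *)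
Lemma gphi_sqr z : gphi z ^+ 2 = gphi (s2 * z).
Proof.
pose F (p : measurableTypeR R * measurableTypeR R) := cos (z * p.2) * (gw p.1 * gw (p.2 - p.1)).
have mF : measurable_fun setT F.
  apply: measurable_funM.
    by apply: bdm_meas; apply: bdm_cos; exact: (measurableT_comp (mz z) measurable_snd).
  apply: measurable_funM; first exact: (measurableT_comp mgw measurable_fst).
  by apply: (measurableT_comp mgw); apply: measurable_funB; [exact: measurable_snd|exact: measurable_fst].
have ig2 : integ leb (fun y => (Num.sqrt pi)^-1 * gauss_fun (2^-1 * y + 0)).
  by apply: integZ; apply: (integ_affine 0 _ integ_gauss); rewrite invr_eq0.
have iF : integ (leb \x leb)%E F.
  apply: (integ_prod_le mF ig2 ig2) => x u; rewrite /F /=.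
  have gg : 0 <= gw x * gw (u - x) by apply: mulr_ge0; exact: gw_ge0.
  rewrite normrM (ger0_norm gg).
  apply: (@le_trans _ _ (1 * (gw x * gw (u - x)))).
    by apply: ler_wpM2r => //; rewrite ler_norml cos_le1 cos_geN1.
  rewrite mul1r /gw !addr0 [leLHS]mulrACA [leRHS]mulrACA ler_wpM2l ?mulr_ge0 ?invr_ge0 ?(ltW sp0)//.
  rewrite /gauss_fun -!expRD ler_expR -subr_ge0.
  (* The difference of the exponents is a positive definite quadratic form, written by completing
     the square. *)
  have -> : - (2^-1 * x) ^+ 2 - (2^-1 * u) ^+ 2 - (- x ^+ 2 - (u - x) ^+ 2) =
    (x * 7 / 4 - u) ^+ 2 * 4 / 7 + u ^+ 2 * 5 / 28 by field.
  have := sqr_ge0 (x * 7 / 4 - u); have := sqr_ge0 u.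
  by move: (u ^+ 2) ((_ - _) ^+ 2) => a c; lra.
have E1 : gphi z ^+ 2 = \int[leb]_x \int[leb]_u F (x, u).
  transitivity (\int[leb]_x (cos (z * x) * gw x * gphi z)).
    by rewrite RintZr// -expr2.
  apply: eq_Rint => x; rewrite mulrAC -[cos _ * gphi _]gphi_cos -RintZr; last first.
    by apply: integ_bdm_gw; apply: bdm_cos; exact: measurable_funD.
  pose k (u : R) := cos (z * u) * (gw x * gw (u - x)).
  have ik : integ leb k.
    have h := @integ_shift R (fun y => gw x * gw y) (- x) (integZ (gw x) integ_gw).
    by apply: (integM (M := 1) _ _ h); [by apply: bdm_meas; exact: bdm_cos|move=> u; rewrite ler_norml cos_le1 cos_geN1].
  transitivity (\int[leb]_y k (y + x)); last exact: Rint_shift.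
  by apply: eq_Rint => y; rewrite /k addrK mulrDr; ring.
rewrite E1 (Rfubini iF).
pose k (v : R) := cos (s2 * z * v) * gw v.
have E2 u : \int[leb]_x F (x, u) = s2^-1 * k (s2^-1 * u + 0).
  transitivity (cos (z * u) * ((Num.sqrt pi)^-1 ^+ 2 * gauss_fun (s2^-1 * u)) *
     \int[leb]_x gauss_fun (s2 * x + (- (s2^-1 * u)))).
    rewrite -RintZ; last by apply: (integ_affine _ _ integ_gauss); rewrite gt_eqF.
    apply: eq_Rint => x; rewrite /F /gw /=.
    have e : gauss_fun x * gauss_fun (u - x) = gauss_fun (s2^-1 * u) * gauss_fun (s2 * x - s2^-1 * u).
      rewrite /gauss_fun -!expRD; congr expR.
      have -> : (s2 * x - s2^-1 * u) ^+ 2 = s2 ^+ 2 * x ^+ 2 - 2 * x * u + u ^+ 2 / s2 ^+ 2 by field; rewrite gt_eqF.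
      by rewrite exprMn exprVn s22; field.
    transitivity (cos (z * u) * ((Num.sqrt pi)^-1 ^+ 2 * (gauss_fun x * gauss_fun (u - x)))); first by ring.
    by rewrite e; ring.
  rewrite (Rint_affine _ _ integ_gauss) ?gt_eqF// Rint_gauss (gtr0_norm s20) /k /gw addr0.
  have -> : s2 * z * (s2^-1 * u) = z * u by field; rewrite gt_eqF.
  by field; rewrite !gt_eqF.
rewrite (eq_Rint leb (fun u => s2^-1 * k (s2^-1 * u + 0))); last exact: E2.
have s2V : s2^-1 != 0 by rewrite invr_eq0 gt_eqF.
rewrite RintZ; last exact: (integ_affine 0 s2V (icos (s2 * z))).
by rewrite (Rint_affine 0 s2V (icos (s2 * z))) ger0_norm ?invr_ge0 ?(ltW s20)// invrK mulKf// gt_eqF.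
Qed.

Lemma pow_diff_le (a b : R) n : `|a| <= 1 -> `|b| <= 1 -> `|a ^+ n - b ^+ n| <= n%:R * `|a - b|.
Proof.
move=> a1 b1; elim: n => [|n IH]; first by rewrite !expr0 subrr normr0 mul0r.
have -> : a ^+ n.+1 - b ^+ n.+1 = a * (a ^+ n - b ^+ n) + (a - b) * b ^+ n by rewrite !exprS; ring.
apply: le_trans (ler_normD _ _) _; rewrite !normrM -natr1 mulrDl mul1r; apply: lerD.
  by apply: le_trans IH; rewrite ler_piMl.
by rewrite ler_piMr// normrX exprn_ile1.
Qed.

Lemma gphi_iter z k : gphi z = gphi (z / s2 ^+ k) ^+ (2 ^ k).
Proof.
elim: k => [|k IH]; first by rewrite expr0 divr1 expn0 expr1.
rewrite IH expnS exprM gphi_sqr; congr (gphi _ ^+ _).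
by rewrite exprS; field; rewrite expf_neq0 gt_eqF.
Qed.

(** By [gphi_sqr], gphi(z) is the 2^k-th power of gphi(z / 2^(k/2)); a second-order expansion at 0
    identifies the limit, as in the central limit theorem. *)
Lemma gphiE z : gphi z = expR (- (z ^+ 2 * mu2 / 2)).
Proof.
have mu20 : 0 <= mu2 by apply: Rintegral_ge0 => y _; rewrite mulr_ge0 ?sqr_ge0 ?gw_ge0.
pose h k := z / s2 ^+ k.
have hsq k : h k ^+ 2 = z ^+ 2 / 2 ^+ k by rewrite /h expr_div_n exprAC s22.
(* 2^k times the weighted Taylor remainder: dominated by an integrable function independent of [k],
   and of order 2^(-k) pointwise. *)
pose G k y := 2 ^+ k * (cos (h k * y) - 1 + (h k * y) ^+ 2 / 2) * gw y.
have p2 k : 0 < 2 ^+ k :> R by rewrite exprn_gt0.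
have G0 k y : 0 <= G k y by rewrite mulr_ge0 ?gw_ge0// mulr_ge0 ?cos_taylor_ge0// ltW.
have half : (2 ^+ k)^-1 @[k --> \oo] --> (0 : R).
  have := @cvg_geometric R 1 2^-1; rewrite ger0_norm// => /(_ _).
  rewrite invf_lt1// ltr1n => /(_ isT).
  by rewrite (_ : geometric 1 2^-1 = fun k => (2 ^+ k)^-1)//; apply/funext => k; rewrite /= mul1r exprVn.
have mG k : measurable_fun setT (G k).
  apply: measurable_funM => //; apply: measurable_funM => //.
  apply: measurable_funD; last by apply: measurable_funM => //; exact: measurable_funX.
  by apply: measurable_funB => //; apply: bdm_meas; exact: bdm_cos.
have Gle k y : `|G k y| <= z ^+ 2 / 2 * (y ^+ 2 * gw y).
  rewrite ger0_norm// mulrA ler_wpM2r ?gw_ge0//.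
  apply: le_trans (ler_wpM2l (ltW (p2 k)) (cos_taylor_le2 (h k * y))) _.
  by rewrite exprMn hsq le_eqVlt; apply/orP; left; apply/eqP; field; rewrite gt_eqF.
have cG : \int[leb]_y G k y @[k --> \oo] --> 0.
  have -> : 0 = \int[leb]_y (0 : R) by rewrite Rint0.
  apply: (@dct_pt _ _ _ leb G _ (fun y => z ^+ 2 / 2 * (y ^+ 2 * gw y))) => //.
  - move=> y; apply: (@squeeze_cvgr _ _ _ _ (fun=> 0) (fun k => (z ^+ 4 * y ^+ 4 / 8 * gw y) * (2 ^+ k)^-1)).
    + apply: nearW => k; rewrite G0/= /G.
      rewrite [leRHS]mulrAC ler_wpM2r ?gw_ge0//.
      apply: le_trans (ler_wpM2l (ltW (p2 k)) (cos_taylor_le4 (h k * y))) _.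
      have -> : (h k * y) ^+ 4 = (z ^+ 2 / 2 ^+ k) ^+ 2 * y ^+ 4 by rewrite -hsq; ring.
      rewrite le_eqVlt; apply/orP; left; apply/eqP.
      by field; rewrite gt_eqF.
    + exact: cvg_cst.
    + by rewrite -[X in _ --> X](mulr0 (z ^+ 4 * y ^+ 4 / 8 * gw y)); apply: cvgMr.
  - exact: integZ integ_gw2.
have EG k : \int[leb]_y G k y = 2 ^+ k * (gphi (h k) - (1 - h k ^+ 2 * mu2 / 2)).
  transitivity (\int[leb]_y (2 ^+ k * (cos (h k * y) * gw y) + ((- 2 ^+ k) * gw y + 2 ^+ k * h k ^+ 2 / 2 * (y ^+ 2 * gw y)))).
    by apply: eq_Rint => y; rewrite /G; field.
  by rewrite (Rint_lin3 _ _ _ (icos (h k)) integ_gw integ_gw2) Rint_gw -/mu2 -/(gphi (h k)); field.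
have bnd k : `|gphi z - expR (- (z ^+ 2 * mu2 / 2))| <= \int[leb]_y G k y + (z ^+ 2 * mu2 / 2) ^+ 2 * (2 ^+ k)^-1.
  rewrite (gphi_iter z k) -/(h k).
  have -> : expR (- (z ^+ 2 * mu2 / 2)) = expR (- (h k ^+ 2 * mu2 / 2)) ^+ (2 ^ k).
    by rewrite -expRM_natl hsq natrX; congr expR; field; rewrite gt_eqF.
  have hm0 : 0 <= h k ^+ 2 * mu2 / 2 by rewrite divr_ge0// mulr_ge0// sqr_ge0.
  apply: le_trans (pow_diff_le _ _ _) _.
  - exact: gphi_le1.
  - by rewrite ger0_norm ?expR_ge0// expR_le1 oppr_le0.
  rewrite natrX.
  have e1 : `|gphi (h k) - (1 - h k ^+ 2 * mu2 / 2)| = (2 ^+ k)^-1 * \int[leb]_y G k y.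
    rewrite EG mulKf ?gt_eqF// ger0_norm//.
    by rewrite -(pmulr_rge0 _ (p2 k)) -EG; apply: Rintegral_ge0 => y _.
  have e2 := expRN_taylor hm0.
  have e3 : `|gphi (h k) - expR (- (h k ^+ 2 * mu2 / 2))| <= (2 ^+ k)^-1 * \int[leb]_y G k y + (h k ^+ 2 * mu2 / 2) ^+ 2.
    rewrite -e1; move: e2; rewrite distrC; set E := expR _; set X := gphi _; set Y := 1 - _ => e2.
    have -> : X - E = (X - Y) + (Y - E) by ring.
    by apply: le_trans (ler_normD _ _) _; rewrite lerD2l.
  apply: le_trans (ler_wpM2l (ltW (p2 k)) e3) _.
  by rewrite hsq le_eqVlt; apply/orP; left; apply/eqP; field; rewrite gt_eqF.
have c0 : \int[leb]_y G k y + (z ^+ 2 * mu2 / 2) ^+ 2 * (2 ^+ k)^-1 @[k --> \oo] --> (0 : R).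
  rewrite -[X in _ --> X]addr0; apply: cvgD => //.
  by rewrite -[X in _ --> X](mulr0 ((z ^+ 2 * mu2 / 2) ^+ 2)); apply: cvgMr.
apply/eqP; rewrite -subr_eq0 -normr_le0.
apply: (ler_cvg_to (@cvg_cst _ _ _ _ _) c0); exact: nearW.
Qed.

End gaussian_weight.

(** The Radon-Nikodym derivative of [normal_prob m s] agrees almost everywhere with
    [normal_pdf m s], since both have the same integrals over measurable sets. *)
Lemma normal_int_ge0 {R : realType} (m s : R) (f : R -> R) : measurable_fun setT f -> (forall y, 0 <= f y) ->
  (\int[normal_prob m s]_x (f x)%:E = \int[@lebesgue_measure R]_x (f x * normal_pdf m s x)%:E)%E.
Proof.
move=> mf f0.
have numu := @normal_prob_dominates R m s.
have mEf : measurable_fun setT (EFin \o f) by exact/measurable_EFinP.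
rewrite -[LHS](@Radon_Nikodym_SigmaFinite.change_of_variables _ _ R (normal_prob m s) (@lebesgue_measure R) numu (EFin \o f) setT)//.
have iN := Radon_Nikodym_SigmaFinite.f_integrable numu.
have mpdf : measurable_fun setT (fun x => (normal_pdf m s x)%:E).
  by apply/measurable_EFinP; exact: measurable_normal_pdf.
transitivity (\int[@lebesgue_measure R]_x ((EFin \o f) x * (normal_pdf m s x)%:E))%E; last first.
  by apply: eq_integral => x _; rewrite /= EFinM.
apply: ae_eq_integral => //.
- by apply: emeasurable_funM => //; exact: measurable_int iN.
- exact: emeasurable_funM.
- apply: ae_eqe_mul2l => /=; apply: integral_ae_eq => //.
  by move=> E _ mE; rewrite -Radon_Nikodym_SigmaFinite.f_integral.
Qed.

Section gaussian_variable.
Context {R : realType}.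
Local Notation leb := (@lebesgue_measure R).
Context d (Om : measurableType d) (P : probability Om R) (X : Om -> R) (mX : measurable_fun setT X).
Variables (m s : R).
Hypothesis lawX : forall A : set R, measurable A -> P [set w | A (X w)] = gaussian_law m s A.

(** [X] has the law of c G + m with G of density [gw]. As [gw] has exponent -y^2, c is sqrt(2 s^2);
    the degenerate law is the case c = 0, so that the distinction is made only here. *)
Let gaussian_rep_ge0 : exists c : R, forall f : R -> R, measurable_fun setT f -> (forall y, 0 <= f y) ->
  (\int[P]_w (f (X w))%:E = \int[leb]_y (f (c * y + m) * gw y)%:E)%E.
Proof.
have [s0|s0] := eqVneq s 0.
  exists 0 => f mf f0.
  have sl : same_law P P X (cst m).
    move=> A mA; rewrite [LHS]lawX// /gaussian_law s0 eqxx /dirac indicE preimage_cst.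
    by case: ifP => Am; rewrite ?probability_setT ?measure0.
  rewrite (same_law_ge0 mX (@measurable_cst _ _ _ _ _ m) sl (f := EFin \o f))//; last first.
    exact/measurable_EFinP.
  rewrite (_ : (fun w => _) = cst (f m)%:E)//.
  rewrite integral_cst//= probability_setT mule1.
  transitivity ((f m)%:E * \int[leb]_y (gw y)%:E)%E.
    by rewrite (Rint_EFin integ_gw) Rint_gw mule1.
  rewrite -ge0_integralZl//; last 3 first.
  - by apply/measurable_EFinP; exact: integ_meas integ_gw.
  - by move=> y _; rewrite lee_fin gw_ge0.
  - by rewrite lee_fin.
  by apply: eq_integral => y _; rewrite mul0r add0r EFinM.
pose c := Num.sqrt (s ^+ 2 *+ 2).
have c0 : 0 < c by rewrite sqrtr_gt0 pmulrn_lgt0// exprn_even_gt0.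
exists c => f mf f0.
pose N : probability (measurableTypeR R) R := normal_prob m s.
have sl : same_law P N X (id : measurableTypeR R -> R).
  by move=> A mA; rewrite [LHS]lawX// /gaussian_law (negbTE s0).
have mid : measurable_fun setT (id : measurableTypeR R -> R) by exact: measurable_id.
have mEf : measurable_fun setT (EFin \o f) by exact/measurable_EFinP.
rewrite (same_law_ge0 mX mid sl mEf (fun y => f0 y)).
transitivity (\int[normal_prob m s]_x (f x)%:E)%E; first by [].
rewrite normal_int_ge0//.
pose F x := (f x * normal_pdf m s x)%:E.
have mF : measurable_fun setT F.
  by apply/measurable_EFinP; apply: measurable_funM => //; exact: measurable_normal_pdf.
have F0 x : (0 <= F x)%E by rewrite lee_fin mulr_ge0// normal_pdf_ge0.
have e := @ge0_leb_affine R c m F (lt0r_neq0 c0) mF F0.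
have -> : (\int[leb]_x F x = c%:E * \int[leb]_x F (c * x + m)%R)%E.
  by rewrite e muleA -EFinM (gtr0_norm c0) divff ?mul1e// gt_eqF.
rewrite -ge0_integralZl//; last 2 first.
- have h : measurable_fun setT (F \o (fun x => c * x + m)) by apply: measurableT_comp => //; exact: meas_affine.
  exact: h.
- by rewrite lee_fin ltW.
apply: eq_integral => y _; rewrite /F -EFinM; congr EFin.
rewrite normal_pdfE// mulrCA; congr (_ * _); rewrite mulrA /gw; congr (_ * _).
  rewrite /normal_peak /c -[_ ^+ 2 * pi *+ 2]mulrnAl.
  by rewrite sqrtrM ?mulrn_wge0 ?sqr_ge0// invfM mulrA divff ?mul1r// gt_eqF.
rewrite /normal_fun /gauss_fun addrK; congr expR.
rewrite exprMn /c sqr_sqrtr ?mulrn_wge0 ?sqr_ge0// mulNr mulrAC divff ?mul1r//.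
by rewrite mulrn_eq0/= sqrf_eq0.
Qed.

Lemma gaussian_cos th : integ P X -> integ P (fun w => X w ^+ 2) -> \int[P]_w X w = 0 ->
  \int[P]_w cos (th + X w) = cos th * expR (- ((\int[P]_w X w ^+ 2) / 2)).
Proof.
move=> iX iX2 X0; have [c rep0] := gaussian_rep_ge0.
have rep (f : R -> R) : measurable_fun setT f -> (forall y, 0 <= f y) ->
    \int[P]_w f (X w) = \int[leb]_y (f (c * y + m) * gw y).
  by move=> mf f0; rewrite /Rintegral rep0.
pose mu2 := \int[leb]_y (y ^+ 2 * gw y).
have i1 : integ P (fun=> 1) by apply: bdm_integ; exact: bdm_cst.
have sq a : \int[P]_w (X w + a) ^+ 2 = c ^+ 2 * mu2 + (m + a) ^+ 2.
  rewrite (rep (fun y => (y + a) ^+ 2)); last 2 first.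
  - by apply: measurable_funX; exact: measurable_funD.
  - by move=> y; exact: sqr_ge0.
  transitivity (\int[leb]_y (c ^+ 2 * (y ^+ 2 * gw y) + (2 * c * (m + a) * (y * gw y) + (m + a) ^+ 2 * gw y))).
    by apply: eq_Rint => y; ring.
  by rewrite (Rint_lin3 _ _ _ integ_gw2 integ_gw1 integ_gw) Rint_gw Rint_gw1 -/mu2; ring.
(* The representation covers nonnegative functions only, so the mean is read off from the second
   moments of X and X + 1. *)
have m0 : m = 0.
  have e1 := sq 1; have e0 := sq 0.
  have : \int[P]_w (X w + 1) ^+ 2 = \int[P]_w (X w + 0) ^+ 2 + 1.
    transitivity (\int[P]_w (1 * X w ^+ 2 + (2 * X w + 1 * (fun=> 1) w))).
      by apply: eq_Rint => w; ring.
    rewrite (Rint_lin3 1 2 1 iX2 iX i1) X0 Rint_cst mulr0 add0r !mul1r; congr (_ + _).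
    by apply: eq_Rint => w; rewrite addr0.
  by rewrite e1 e0; lra.
have V : \int[P]_w X w ^+ 2 = c ^+ 2 * mu2.
  by have := sq 0; rewrite m0 addr0 expr0n/= addr0 => <-; apply: eq_Rint => w; rewrite addr0.
have bc : bdm (fun w => cos (th + X w)) by apply: bdm_cos; exact: measurable_funD.
have bcy : bdm (fun y : R => cos (th + (c * y + m))).
  by apply: bdm_cos; apply: measurable_funD => //; exact: meas_affine.
(* The cosine is raised by 1 to be nonnegative. *)
have : \int[P]_w (cos (th + X w) + 1) = \int[leb]_y ((cos (th + (c * y + m)) + 1) * gw y).
  apply: (rep (fun y => cos (th + y) + 1)).
  - by apply: measurable_funD => //; apply: bdm_meas; apply: bdm_cos; exact: measurable_funD.
  - by move=> y; have := cos_geN1 (th + y); lra.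
rewrite RintD//; last exact: bdm_integ.
rewrite Rint_cst.
have -> : \int[leb]_y ((cos (th + (c * y + m)) + 1) * gw y) = cos th * gphi c + 1.
  transitivity (\int[leb]_y (cos (c * y + th) * gw y + gw y)).
    by apply: eq_Rint => y; rewrite m0 addr0 [th + _]addrC; ring.
  rewrite RintD ?gphi_cos ?Rint_gw//; last exact: integ_gw.
  by apply: integ_bdm_gw; apply: bdm_cos; exact: meas_affine.
by rewrite V gphiE -/mu2 => /addIr.
Qed.

End gaussian_variable.

(** * Conclusion *)

Section limit_variance.
Context {R : realType} (alpha : R).
Hypotheses (alpha_gt1 : 1 < alpha) (alpha_le2 : alpha <= 2).
Local Notation leb := (@lebesgue_measure R).
Local Notation lam := (lam alpha).
Local Notation H := ((1 + alpha) / 2).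

(** The factor 4 combines the 2 in [gker] with the 2 in [2 / lam z]. The division by H - 1 answers
    the factor 1 - H of [sub_fbm_cov], which is negative here. *)
Definition limK : R := Num.sqrt (4 * (@c1 R)^-1 * Calpha alpha / (H - 1)).

Let c10 : 0 < @c1 R. Proof. by apply: (@c1_gt0 R 2); rewrite ?ltr1n. Qed.
Let H1 : 0 < H - 1. Proof. by have := alpha_gt1; lra. Qed.

Lemma limK_sqr : limK ^+ 2 = 4 * (@c1 R)^-1 * Calpha alpha / (H - 1).
Proof.
by rewrite sqr_sqrtr// divr_ge0 ?(ltW H1)// mulr_ge0 ?Calpha_ge0// mulr_ge0// invr_ge0 ltW.
Qed.

Let T a (z : R) := (cos (a * z) - 1 + (a * z) ^+ 2 / 2) / z ^+ 2 / lam z.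

(* Each 1 - cos (a z) alone is not integrable against 1 / (z^2 |z|^alpha); the quadratic
   Taylor terms added in [T] cancel in the combination below. *)
Lemma cov_rep s t : 0 <= s -> 0 <= t ->
  \int[leb]_z ((1 - cos (s * z)) * (1 - cos (t * z)) / z ^+ 2 / lam z) =
  Calpha alpha / (H - 1) * sub_fbm_cov H s t.
Proof.
move=> s0 t0.
have iT a : integ leb (T a) by exact: cos_taylor_integ.
transitivity (\int[leb]_z (2^-1 * T (s + t) z + (2^-1 * T (t - s) z + (-1) * (T s z + T t z)))).
  apply: eq_Rint => z; rewrite /T.
  have -> : cos ((s + t) * z) = cos (s * z) * cos (t * z) - sin (s * z) * sin (t * z).
    by rewrite mulrDl cosD.
  have -> : cos ((t - s) * z) = cos (s * z) * cos (t * z) + sin (s * z) * sin (t * z).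
    by rewrite mulrBl cosB; ring.
  by move: (z ^- 2) (lam z)^-1 => a c; field.
apply: etrans (Rint_lin3 _ _ _ (iT _) (iT _) (integD (iT s) (iT t))) _.
rewrite RintD// !Calpha_rep//.
rewrite /sub_fbm_cov (_ : 2 * H = 1 + alpha); last by field.
rewrite (ger0_norm s0) (ger0_norm t0) (@ger0_norm _ (s + t)) ?addr_ge0//.
rewrite -[1 - H]opprB; move: (_ `^ _) (_ `^ _) (_ `^ _) (_ `^ _) H1 => p1 p2 p3 p4; move: (H - 1) => q q0.
by field; rewrite gt_eqF.
Qed.

Lemma sub_fbm_covC (h s t : R) : sub_fbm_cov h s t = sub_fbm_cov h t s.
Proof. by rewrite /sub_fbm_cov distrC [s + t]addrC [s `^ _ + _]addrC. Qed.

Lemma sig2E n (t b : 'I_n -> R) : (forall i, 0 <= t i) ->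
  sig2 alpha t b = \sum_i \sum_j (limK * b i) * (limK * b j) * sub_fbm_cov H (t i) (t j).
Proof.
move=> t0.
have ii i j : integ leb (fun z => (1 - cos (t i * z)) * (1 - cos (t j * z)) / z ^+ 2 / lam z).
  by apply: mult2_lam_integ => //; exact: mult2_one_cos.
rewrite /sig2 (eq_Rint leb (fun z => 4 * \sum_i \sum_j (b i * b j) *
    ((1 - cos (t i * z)) * (1 - cos (t j * z)) / z ^+ 2 / lam z))); last first.
  move=> z; transitivity (4 * (mulp t b z * mulp t b z / z ^+ 2 / lam z)).
    by rewrite /gker; ring.
  congr (4 * _); rewrite /mulp !mulr_suml; apply: eq_bigr => i _.
  by rewrite mulr_sumr !mulr_suml; apply: eq_bigr => j _; ring.
rewrite RintZ; last by apply: integ_sum => i; apply: integ_sum => j; exact: integZ.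
rewrite Rint_sum; last by move=> i; apply: integ_sum => j; exact: integZ.
rewrite mulrA mulr_sumr; apply: eq_bigr => i _.
rewrite Rint_sum; last by move=> j; exact: integZ.
rewrite mulr_sumr; apply: eq_bigr => j _.
rewrite RintZ// cov_rep//.
transitivity (limK ^+ 2 * (b i * b j * sub_fbm_cov H (t i) (t j))); last by ring.
rewrite limK_sqr; move: (sub_fbm_cov _ _ _) H1 => sc; move: (H - 1) => q q0.
by field; rewrite !gt_eqF.
Qed.

End limit_variance.

(** * Cosine transforms of the limit process *)

Section gaussian_side.
Context {R : realType} (h : R) d (Om : measurableType d) (P : probability Om R).
Variable zeta : R -> {RV P >-> R}.
Hypothesis hz : negative_sub_fbm h zeta.

Let mz t : measurable_fun setT (zeta t). Proof. exact: measurable_funP. Qed.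

(** Square integrability is contained in the finiteness of the covariance at (t, t). *)
Let i2 t : 0 <= t -> integ P (fun w => zeta t w ^+ 2).
Proof.
move=> t0; have [_ _ cov _] := hz; have e := cov t t t0 (lexx _).
rewrite unlock in e.
apply: integ_ge0P; [exact: measurable_funX|by move=> w; exact: sqr_ge0|].
by under eq_integral do rewrite expr2; rewrite e ltry.
Qed.

Let i1 t : 0 <= t -> integ P (fun w => zeta t w).
Proof.
move=> t0; have ic : integ P (fun=> 1) by apply: bdm_integ; exact: bdm_cst.
apply: (integ_le _ (integD ic (i2 t0))) => [|w]; first exact: mz.
by have := norm_le_sqr (zeta t w) (@ltr01 R); rewrite divr1; have := sqr_ge0 (zeta t w); lra.
Qed.

Let mean t : 0 <= t -> \int[P]_w zeta t w = 0.
Proof.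
move=> t0; have [_ m0 _ _] := hz; have := m0 t t0; rewrite unlock => e.
by rewrite /Rintegral e.
Qed.

Let i11 s t : 0 <= s -> 0 <= t -> integ P (fun w => zeta s w * zeta t w).
Proof.
move=> s0 t0; apply: (integ_le _ (integD (i2 s0) (i2 t0))) => [|w]; first exact: measurable_funM.
rewrite normrM -(sqn (zeta s w)) -(sqn (zeta t w)).
have := sqr_ge0 (`|zeta s w| - `|zeta t w|); have := normr_ge0 (zeta s w); have := normr_ge0 (zeta t w).
by move: `|_| `|_| => a c; nra.
Qed.

Let cov s t : 0 <= s -> 0 <= t -> \int[P]_w (zeta s w * zeta t w) = sub_fbm_cov h s t.
Proof.
have le u v : 0 <= u -> u <= v -> \int[P]_w (zeta u w * zeta v w) = sub_fbm_cov h u v.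
  move=> u0 uv; have [_ _ c _] := hz; have := c u v u0 uv; rewrite unlock => e.
  by rewrite /Rintegral e.
move=> s0 t0; have [st|/ltW ts] := leP s t; first exact: le.
rewrite sub_fbm_covC -le//; apply: eq_Rint => w; exact: mulrC.
Qed.

Lemma zeta_cos n (t a : 'I_n -> R) th : (forall i, 0 <= t i) ->
  \int[P]_w cos (th + \sum_i a i * zeta (t i) w) =
  cos th * expR (- ((\sum_i \sum_j a i * a j * sub_fbm_cov h (t i) (t j)) / 2)).
Proof.
move=> t0; have [gp _ _ _] := hz; have [m [s law]] := gp n t a t0.
pose X w := \sum_i a i * zeta (t i) w.
have mX : measurable_fun setT X by apply: measurable_sum => i; exact: measurable_funM.
have sqE w : X w ^+ 2 = \sum_i \sum_j (a i * a j) * (zeta (t i) w * zeta (t j) w).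
  rewrite expr2 mulr_suml; apply: eq_bigr => i _; rewrite mulr_sumr; apply: eq_bigr => j _; ring.
have iX : integ P X by apply: integ_sum => i; apply: integZ; exact: i1.
have iX2 : integ P (fun w => X w ^+ 2).
  rewrite (_ : (fun w => _) = fun w => \sum_i \sum_j (a i * a j) * (zeta (t i) w * zeta (t j) w)); last exact/funext.
  by apply: integ_sum => i; apply: integ_sum => j; apply: integZ; exact: i11.
have X0 : \int[P]_w X w = 0.
  rewrite Rint_sum; last by move=> i; apply: integZ; exact: i1.
  by apply: big1 => i _; rewrite RintZ ?mean ?mulr0//; exact: i1.
rewrite (gaussian_cos mX law th iX iX2 X0); congr (_ * expR (- (_ / 2))).
rewrite (eq_Rint P (fun w => \sum_i \sum_j (a i * a j) * (zeta (t i) w * zeta (t j) w))); last exact: sqE.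
rewrite Rint_sum; last by move=> i; apply: integ_sum => j; apply: integZ; exact: i11.
apply: eq_bigr => i _; rewrite Rint_sum; last by move=> j; apply: integZ; exact: i11.
by apply: eq_bigr => j _; rewrite RintZ ?cov//; exact: i11.
Qed.

End gaussian_side.

Theorem proposition2p14 (R : realType) (alpha : R) (alpha_gt1 : 1 < alpha)
    (alpha_le2 : alpha <= 2) (H : R) (HE : H = (1 + alpha) / 2) :
  1 < H <= 3 / 2 /\
  exists K : R,
    forall (d : measure_display) (Omega : measurableType d)
      (P : probability Omega R)
      (x : nat -> {RV P >-> R}) (xi : nat -> R -> {RV P >-> R}),
    stable_particle_system alpha x xi ->
    forall (d' : measure_display) (Omega' : measurableType d')
      (P' : probability Omega' R) (zeta : R -> {RV P' >-> R}),
    negative_sub_fbm H zeta ->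
    fdd_cvg P P'
      (fun (T t : R) (w : Omega) =>
         occupation_fluctuation P (empirical_process x xi) T (psi t) w)
      (fun (t : R) (w : Omega') => K * zeta t w).
Proof.
split; first by apply/andP; split; rewrite HE; lra.
exists (limK alpha) => d Om P x xi sys d' Om' P' zeta hz n t t0 f cf fb.
have mY T i : measurable_fun setT (occupation_fluctuation P (empirical_process x xi) T (psi (t i))).
  exact: (meas_fluct sys).
have mZ i : measurable_fun setT (fun w => limK alpha * zeta (t i) w).
  by apply: measurable_funM => //; exact: measurable_funP.
have E dd (O : measurableType dd) (Q : probability O R) (V : 'I_n -> O -> R) :
    (forall i, measurable_fun setT (V i)) ->
    ('E_Q[fun w => f (\row_i V i w)] = (\int[Q]_w f (\row_i V i w))%:E)%E.
  move=> mV; rewrite unlock; apply: Rint_EFin; apply: bdm_integ; split; first exact: meas_row_comp.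
  by have [M hM] := fb; exists M => w.
(* The limit at infinity is tested along sequences, for which dominated convergence is available. *)
rewrite E//; apply/cvge_pinftyP => u uoo.
(* The uniform law needs a positive horizon; the early terms that are not positive are replaced by
   1. *)
pose T k := if 0 < u k then u k else 1.
have T0 k : 0 < T k by rewrite /T; case: ifP.
have uT : \forall k \near \oo, u k = T k.
  have : \forall k \near \oo, 0 < u k by move/cvgryPgt : uoo; exact.
  by apply: filterS => k uk; rewrite /T uk.
have Too : T k @[k --> \oo] --> +oo.
  by apply: cvg_trans uoo; apply: near_eq_cvg; apply: filterS uT.
suff c : \int[P]_w f (\row_i occupation_fluctuation P (empirical_process x xi) (T k) (psi (t i)) w) @[k --> \oo] -->
    \int[P']_w f (\row_i (limK alpha * zeta (t i) w)).
  have c' : (\int[P]_w f (\row_i occupation_fluctuation P (empirical_process x xi) (T k) (psi (t i)) w))%:E @[k --> \oo] -->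
    (\int[P']_w f (\row_i (limK alpha * zeta (t i) w)))%:E by apply: cvg_EFin => //; exact: nearW.
  apply: cvg_trans c'; apply: near_eq_cvg; apply: filterS uT => k ->.
  by rewrite E.
apply: (weak_cvg (Y := fun k i w => occupation_fluctuation P (empirical_process x xi) (T k) (psi (t i)) w)
  (Z := fun i w => limK alpha * zeta (t i) w)) => // b th.
have c := @fluct_cos_cvg R alpha alpha_gt1 alpha_le2 _ _ P x xi sys n t b t0 T T0 Too th.
have e : \int[P']_w cos (\sum_i b i * (limK alpha * zeta (t i) w) + th) =
    cos th * expR (- (sig2 alpha t b / 2)).
  rewrite (sig2E alpha_gt1 alpha_le2 b t0) -HE -(zeta_cos hz (fun i => limK alpha * b i) th t0).
  by apply: eq_Rint => w; rewrite addrC; congr (cos (_ + _)); apply: eq_bigr => i _; ring.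
rewrite e; apply: cvg_trans c; apply: near_eq_cvg; apply: nearW => k.
by apply: eq_Rint => w; rewrite addrC.
Qed.
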